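(* Let $(X_i)_{i\in\mathbb N}$ be an $\mathbb R^d$-valued causal function of an i.i.d. sequence. Assume: (i) the distribution function $F$ of $X_0$ is $\theta$-Hölder for some $\theta\in(0,1]$; (ii) there are $r\in[1,\infty)$, $s\in(1,\infty]$ with $\frac1r+\frac1s=1$, an integer $p>rd$ and $\alpha\in(0,1]$ such that $\frac\theta\alpha>\frac{rp}{p-rd}$ and $\sum_{i=1}^\infty i^{2p-2}(\delta_{i,s})^\alpha<\infty$. Then there is a centered Gaussian process $(W(t))_{t\in[-\infty,\infty]^d}$ with almost surely continuous sample paths such that $U_n\to W$ in distribution in $\mathbb D([-\infty,\infty]^d)$.
   Context: Causal function: $(\xi_j)_{j\in\mathbb Z}$ is an i.i.d. process with values in a Banach space $\mathcal X$, $G:\mathcal X^{\mathbb N}\to\mathbb R^d$ is measurable, and $X_i=G(\xi_i,\xi_{i-1},\dots)$. Let $(\xi'_j)$ be an independent copy of $(\xi_j)$ and $\dot X_i=G(\xi_i,\dots,\xi_1,\xi'_0,\xi'_{-1},\dots)$; $\delta_{i,s}=\big({\rm E}\|X_i-\dot X_i\|^s_{\mathbb R^d}\big)^{1/s}$. $F$ $\theta$-Hölder means $|F(s)-F(t)|\le c\|s-t\|^\theta$ for some $c<\infty$. Inequalities between vectors are componentwise, $F(t)=P(X_0\le t)$; $U_n(t)=\frac1{\sqrt n}\sum_{i=1}^n(\mathbf 1\{X_i\le t\}-F(t))$, $t\in[-\infty,\infty]^d$, a random element of $\mathbb D([-\infty,\infty]^d)$ (multidimensional càdlàg functions with the multidimensional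 Skorokhod metric). *)

(* Defs.v *)
From mathcomp Require Import all_boot all_order all_algebra.
From mathcomp Require Import all_classical all_reals all_analysis.
Set Implicit Arguments. Unset Strict Implicit. Unset Printing Implicit Defensive.
Import Order.TTheory GRing.Theory Num.Theory numFieldNormedType.Exports.
Local Open Scope classical_set_scope.
Local Open Scope ring_scope.

Section Defs.
Variable R : realType.

Section Banach.
Variable V : completeNormedModType R.

Definition borelV : set (set V) := <<s [set A : set V | open A] >>.

Definition prodV : set (set (nat -> V)) :=
  <<s [set A | exists (k : nat) (B : set V),
          borelV B /\ A = (fun x : nat -> V => x k) @^-1` B] >>.

(* measurability of G : V^N -> R^d (R^d carries the Borel sigma-algebra,
   i.e. the product of the Borel sigma-algebras of the coordinates) *)
Definition measurable_G (d : nat) (G : (nat -> V) -> ('I_d -> R)) :=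
  forall (k : 'I_d) (B : set R), measurable B ->
    prodV ((fun x => G x k) @^-1` B).

Section OnSpace.
Context (dT : measure_display) (T : measurableType dT) (P : probability T R).

Definition rv_V (Z : T -> V) := forall B, borelV B -> measurable (Z @^-1` B).

Definition mutually_independent (I : eqType) (Z : I -> T -> V) :=
  forall (J : seq I) (B : I -> set V), uniq J ->
    (forall j, j \in J -> borelV (B j)) ->
    P (\bigcap_(j in [set j | j \in J]) (Z j @^-1` B j)) =
    (\prod_(j <- J) P (Z j @^-1` B j))%E.

Definition iid (I : eqType) (Z : I -> T -> V) :=
  (forall j, rv_V (Z j)) /\
  (forall i j B, borelV B -> P (Z i @^-1` B) = P (Z j @^-1` B)) /\
  mutually_independent Z.
End OnSpace.

Definition causal (d : nat) (G : (nat -> V) -> ('I_d -> R)) (T : Type)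
  (xi : int -> T -> V) (i : int) : T -> ('I_d -> R) :=
  fun w => G (fun k : nat => xi (i - k%:Z) w).

Definition causal_coupled (d : nat) (G : (nat -> V) -> ('I_d -> R)) (T : Type)
  (xi xi' : int -> T -> V) (i : int) : T -> ('I_d -> R) :=
  fun w => G (fun k : nat => if (0 < i - k%:Z)%R then xi (i - k%:Z) w
                             else xi' (i - k%:Z) w).
End Banach.

Definition enorm (d : nat) (x : 'I_d -> R) : R := Num.sqrt (\sum_k x k ^+ 2).

Section Gauss.
Context (dT : measure_display) (T : measurableType dT) (Q : probability T R).

Definition centered_gaussian (Y : T -> R) :=
  measurable_fun setT Y /\
  exists sigma : R, 0 <= sigma /\
    forall B : set R, measurable B ->
      Q (Y @^-1` B) = if sigma == 0 then \d_(0 : R) B else normal_prob 0 sigma B.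

Definition centered_gaussian_process (S : Type) (W : T -> S -> R) :=
  forall (m : nat) (t : 'I_m -> S) (a : 'I_m -> R),
    centered_gaussian (fun w => \sum_(k < m) a k * W w (t k)).
End Gauss.

(* homeomorphism [-oo,oo] -> [-1,1], used to metrize [-oo,oo] *)
Definition hcomp (x : \bar R) : R :=
  match x with
  | EFin r => r / (1 + `|r|)
  | +oo%E => 1
  | -oo%E => -1
  end.

(* sequential continuity on [-oo,oo]^d (product topology; metrizable) *)
Definition continuous_ext (d : nat) (x : ('I_d -> \bar R) -> R) :=
  forall (t : 'I_d -> \bar R) (u : nat -> 'I_d -> \bar R),
    (forall k, (fun n => u n k) @ \oo --> t k) ->
    (fun n => x (u n)) @ \oo --> x t.

(* multiparameter cadlag space D([-oo,oo]^d) (Neuhaus / Bickel-Wichura):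
   at every point t, the limit of x(s) exists as s -> t within each of the
   2^d quadrants {s | s_k >= t_k if b k, s_k < t_k otherwise}; taking b = all
   true (the quadrant contains t) this forces continuity from above. *)
Definition Dspace (d : nat) (x : ('I_d -> \bar R) -> R) :=
  forall (t : 'I_d -> \bar R) (b : 'I_d -> bool), exists l : R,
    forall e : R, 0 < e -> exists eta : R, 0 < eta /\
      forall s : 'I_d -> \bar R,
        (forall k, if b k then (t k <= s k)%E else (s k < t k)%E) ->
        (forall k, `|hcomp (s k) - hcomp (t k)| < eta) ->
        `|x s - l| < e.

Definition time_change (d : nat) (lam : 'I_d -> \bar R -> \bar R) :=
  forall k, {mono lam k : a b / (a < b)%E} /\ bijective (lam k).

Definition skor_close (d : nat) (x y : ('I_d -> \bar R) -> R) (e : R) :=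
  exists2 lam, time_change lam &
    exists2 e' : R, e' < e &
      (forall k a, `|hcomp (lam k a) - hcomp a| <= e') /\
      (forall t, `|x t - y (fun k => lam k (t k))| <= e').

Definition bcont_skor (d : nat) (f : (('I_d -> \bar R) -> R) -> R) :=
  (exists M : R, forall x, `|f x| <= M) /\
  forall x, Dspace x -> forall e : R, 0 < e -> exists2 eta : R, 0 < eta &
    forall y, Dspace y -> skor_close x y eta -> `|f x - f y| < e.

Section Emp.
Context (dT : measure_display) (T : measurableType dT) (P : probability T R).
Variable d : nat.
Variable X : int -> T -> ('I_d -> R).

Definition Fdist (t : 'I_d -> \bar R) : R :=
  fine (P [set w | forall k, ((X 0 w k)%:E <= t k)%E]).

Definition Un (n : nat) (w : T) (t : 'I_d -> \bar R) : R :=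
  (Num.sqrt n%:R)^-1 *
  \sum_(1 <= i < n.+1)
     ((\1_[set w' | forall k, ((X i%:Z w' k)%:E <= t k)%E] w : R) - Fdist t).
End Emp.

End Defs.

(* Main.v *)
(* The indicator of an orthant difference A of measure m satisfies a coupling bound
   E |1_A(X_i) - 1_A(X'_i)| <= C m^g delta_i^alpha with g > d/p, by interpolating between the
   trivial bound 2m and the Hoelder modulus of F at the best radius. Splitting partial sums
   into an early block and a late block decoupled from it, and doubling the length, gives
   E S_n^(2p) <= C ((n m^g)^p + lower order); blocks also give the central limit theorem as
   convergence of E cos(u S_n + c), hence of the finite-dimensional laws.
   Chaining the moment bound along grids whose nodes are quantiles of the margins gives
   asymptotic equicontinuity of U_n; below the scale n^(-1/2) monotonicity of the orthants
   takes over. A Gaussian sequence with the limit covariance, indexed by the nodes and built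
   from one uniform variable, inherits the moment bounds in the limit, so the same chaining
   extends it to a process that is uniformly continuous in the metric of the margins.
   Finally f(U_n), which need not be measurable, lies between Lipschitz sup- and
   inf-convolutions of f evaluated at U_n projected on a grid. *)
Require Import Defs.
From mathcomp Require Import all_boot all_order all_algebra.
From mathcomp Require Import all_classical all_reals all_analysis.
From mathcomp Require Import measurable_realfun zify ring lra.
Import Order.TTheory GRing.Theory Num.Theory numFieldNormedType.Exports.
Local Open Scope classical_set_scope.
Local Open Scope ring_scope.
Set Implicit Arguments.
Unset Strict Implicit.
Unset Printing Implicit Defensive.

(** * Expectations of bounded functions *)

(** Write p = [q] + 2. The error between a late block and its decoupled copy is a sum of coupling
    distances D_i. A power mean with weights 1/i bounds its 2p-th moment: the sum of the weights
    costs a power of k, one factor i is traded for the block length 2^k, and i^(2p-2) is left for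
    the summability hypothesis. The resulting lower-order term 2^k k^(2p-1) m^g is absorbed into 3^k
    m^g. After division by n^p it reads (3/2^p)^k m^g, which is only linear in m^g, so refining the
    grid forever would make it explode; this is why chaining stops at mesh about n^(-1/2). At level
    j there are about 2^(jd) increments with m <= 2^-j: the main term is summable in j because g p >
    d, and the lower-order term is harmless down to a level K with 4^K of order n because 9 *
    2^(d-g) < 4^p. The coupled innovations live on a probability space unrelated to that of the
    observations, so the two are compared through laws only. Characteristic functions are replaced
    by cosines with arbitrary phase, which keeps every expectation real and bounded. *)

Section BoundedMeasurable.
Context (R : realType) (dT : measure_display) (T : measurableType dT).
Implicit Types f g : T -> R.

(* bmf: bounded measurable function *)
Definition bmf f := measurable_fun setT f /\ exists M : R, forall x, `|f x| <= M.

Lemma bmf_meas f : bmf f -> measurable_fun setT f. Proof. by case. Qed.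

Lemma bmf_bound f : bmf f -> exists2 M, 0 < M & forall x, `|f x| <= M.
Proof.
case=> _ [M fM]; exists (`|M| + 1); first by rewrite ltr_wpDl.
by move=> x; rewrite (le_trans (fM x))// (le_trans (ler_norm M))// lerDl.
Qed.

Lemma bmf_cst c : bmf (fun=> c).
Proof. by split; [exact: measurable_cst|exists `|c|]. Qed.

Lemma bmfN f : bmf f -> bmf (fun x => - f x).
Proof.
case=> mf [M fM]; split; first exact: measurable_funN.
by exists M => x; rewrite normrN.
Qed.

Lemma bmfD f g : bmf f -> bmf g -> bmf (fun x => f x + g x).
Proof.
case=> mf [M fM] [mg [N gN]]; split; first exact: measurable_funD.
by exists (M + N) => x; rewrite (le_trans (ler_normD _ _))// lerD.
Qed.

Lemma bmfB f g : bmf f -> bmf g -> bmf (fun x => f x - g x).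
Proof. by move=> bf bg; apply: bmfD => //; exact: bmfN. Qed.

Lemma bmfM f g : bmf f -> bmf g -> bmf (fun x => f x * g x).
Proof.
case=> mf [M fM] [mg [N gN]]; split; first exact: measurable_funM.
by exists (M * N) => x; rewrite normrM ler_pM.
Qed.

Lemma bmfX f n : bmf f -> bmf (fun x => f x ^+ n).
Proof.
move=> bf; elim: n => [|n IH]; first by under eq_fun do rewrite expr0; exact: bmf_cst.
by under eq_fun do rewrite exprS; exact: bmfM.
Qed.

Lemma bmf_sum (I : Type) (s : seq I) (F : I -> T -> R) :
  (forall i, bmf (F i)) -> bmf (fun x => \sum_(i <- s) F i x).
Proof.
move=> bF; elim: s => [|i s IH].
  by under eq_fun do rewrite big_nil; exact: bmf_cst.
by under eq_fun do rewrite big_cons; exact: bmfD.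
Qed.

Lemma bmf_prod (I : Type) (s : seq I) (F : I -> T -> R) :
  (forall i, bmf (F i)) -> bmf (fun x => \prod_(i <- s) F i x).
Proof.
move=> bF; elim: s => [|i s IH].
  by under eq_fun do rewrite big_nil; exact: bmf_cst.
by under eq_fun do rewrite big_cons; exact: bmfM.
Qed.

Lemma bmf_norm f : bmf f -> bmf (fun x => `|f x|).
Proof.
case=> mf [M fM]; split; first exact: measurableT_comp.
by exists M => x; rewrite normr_id.
Qed.

Lemma bmf_indic (A : set T) : measurable A -> bmf (\1_A : T -> R).
Proof.
move=> mA; split; first exact: measurable_indic.
by exists 1 => x; rewrite indicE; case: (_ \in _); rewrite ?normr1 ?normr0.
Qed.

Lemma bmf_comp (phi : R -> R) f : measurable_fun setT phi ->
  (exists M, forall x, `|phi x| <= M) -> measurable_fun setT f ->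
  bmf (fun x => phi (f x)).
Proof.
move=> mphi [M pM] mf; split; first exact: (measurableT_comp mphi).
by exists M => x.
Qed.

Lemma bmf_cos f : measurable_fun setT f -> bmf (fun x => cos (f x)).
Proof.
apply: bmf_comp; last by exists 1 => x; rewrite ler_norml cos_geN1 cos_le1.
by apply: continuous_measurable_fun; exact: continuous_cos.
Qed.

Lemma bmf_sin f : measurable_fun setT f -> bmf (fun x => sin (f x)).
Proof.
apply: bmf_comp; last by exists 1 => x; rewrite ler_norml sin_geN1 sin_le1.
by apply: continuous_measurable_fun; exact: continuous_sin.
Qed.

End BoundedMeasurable.

Section Expectation.
Context (R : realType) (dT : measure_display) (T : measurableType dT).
Variable P : probability T R.
Implicit Types f g : T -> R.

(** Real-valued, so that linearity is rewriting in R; boundedness ([bmf]) is what makes the value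
    the true integral. *)
Definition Ex f : R := \int[P]_x f x.

Lemma bmf_integrable f : bmf f -> P.-integrable setT (EFin \o f).
Proof.
case=> mf [M fM]; apply: measurable_bounded_integrable => //.
  by rewrite [X in (X < _)%E](_ : _ = 1%E) ?ltry//; exact: probability_setT.
exists `|M|; split; first exact: num_real.
by move=> N MN x _ /=; apply: (le_trans (fM x)); apply: (le_trans (ler_norm M)); exact: ltW.
Qed.

Lemma Ex_cst c : Ex (fun=> c) = c.
Proof. by rewrite /Ex Rintegral_cst// (_ : fine _ = 1) ?mulr1//;
   by rewrite [X in fine X](_ : _ = 1%E)//; exact: probability_setT. Qed.

Lemma eq_Ex f g : f =1 g -> Ex f = Ex g.
Proof. by move=> fg; congr Ex; apply/funext. Qed.

Lemma ExD f g : bmf f -> bmf g -> Ex (fun x => f x + g x) = Ex f + Ex g.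
Proof. by move=> bf bg; rewrite /Ex RintegralD//; exact: bmf_integrable. Qed.

Lemma ExB f g : bmf f -> bmf g -> Ex (fun x => f x - g x) = Ex f - Ex g.
Proof. by move=> bf bg; rewrite /Ex RintegralB//; exact: bmf_integrable. Qed.

Lemma ExZ c f : bmf f -> Ex (fun x => c * f x) = c * Ex f.
Proof. by move=> bf; rewrite /Ex RintegralZl//; exact: bmf_integrable. Qed.

Lemma ExZr c f : bmf f -> Ex (fun x => f x * c) = Ex f * c.
Proof. by move=> bf; rewrite /Ex RintegralZr//; exact: bmf_integrable. Qed.

Lemma ExN f : bmf f -> Ex (fun x => - f x) = - Ex f.
Proof.
move=> bf; rewrite -mulN1r -ExZ//; by apply: eq_Ex => x; rewrite mulN1r.
Qed.

Lemma Ex_sum (I : Type) (s : seq I) (F : I -> T -> R) :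
  (forall i, bmf (F i)) ->
  Ex (fun x => \sum_(i <- s) F i x) = \sum_(i <- s) Ex (F i).
Proof.
move=> bF; elim: s => [|i s IH].
  by rewrite big_nil -[RHS](Ex_cst 0); apply: eq_Ex => x; rewrite big_nil.
rewrite big_cons -IH -ExD//; last exact: bmf_sum.
by apply: eq_Ex => x; rewrite big_cons.
Qed.

Lemma le_Ex f g : bmf f -> bmf g -> (forall x, f x <= g x) -> Ex f <= Ex g.
Proof.
by move=> bf bg fg; rewrite /Ex le_Rintegral//; exact: bmf_integrable.
Qed.

Lemma Ex_ge0 f : (forall x, 0 <= f x) -> 0 <= Ex f.
Proof. by move=> f0; exact: Rintegral_ge0. Qed.

Lemma le_Ex_cst f c : bmf f -> (forall x, f x <= c) -> Ex f <= c.
Proof. by move=> bf fc; rewrite -(Ex_cst c); apply: le_Ex => //; exact: bmf_cst. Qed.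

Lemma Ex_norm f : bmf f -> `|Ex f| <= Ex (fun x => `|f x|).
Proof. by move=> bf; apply: le_normr_Rintegral => //; exact: bmf_integrable. Qed.

Lemma Ex_le_norm f c : bmf f -> (forall x, `|f x| <= c) -> `|Ex f| <= c.
Proof.
by move=> bf fc; rewrite (le_trans (Ex_norm bf))// le_Ex_cst//; exact: bmf_norm.
Qed.

Lemma Ex_dist f g h : bmf f -> bmf g -> bmf h ->
  (forall x, `|f x - g x| <= h x) -> `|Ex f - Ex g| <= Ex h.
Proof.
move=> bf bg bh fgh; rewrite -ExB// (le_trans (Ex_norm _))//; first exact: bmfB.
by apply: le_Ex => //; apply/bmf_norm/bmfB.
Qed.

Lemma Ex_indic (A : set T) : measurable A -> Ex (\1_A : T -> R) = fine (P A).
Proof. by move=> mA; rewrite /Ex /Rintegral integral_indic// setIT. Qed.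

Lemma Ex_EFin f : bmf f -> (\int[P]_x (f x)%:E)%E = (Ex f)%:E.
Proof.
move=> bf; rewrite /Ex /Rintegral fineK//; apply: integrable_fin_num => //.
exact: bmf_integrable.
Qed.

Lemma markov_Ex f (e : R) : 0 < e -> bmf f -> (forall x, 0 <= f x) ->
  fine (P [set x | e <= f x]) <= Ex f / e.
Proof.
move=> e0 bf f0.
have mA : measurable [set x | e <= f x].
  rewrite [X in measurable X](_ : _ = [set: T] `&` f @^-1` `[e, +oo[).
    by apply: (bmf_meas bf).
  by apply/seteqP; split => x /=; rewrite in_itv/= andbT; [move=> ?; split|case].
rewrite -Ex_indic// ler_pdivlMr// -ExZr; last exact: bmf_indic.
apply: le_Ex => // [|x]; first by apply: bmfM; [exact: bmf_indic|exact: bmf_cst].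
rewrite indicE; case: (boolP (x \in _)) => [/set_mem//= ?|_]; first by rewrite mul1r.
by rewrite mul0r.
Qed.

Lemma cvg_Ex (f_ : nat -> T -> R) f (M : R) :
  (forall n, measurable_fun setT (f_ n)) -> measurable_fun setT f ->
  (forall n x, `|f_ n x| <= M) ->
  {ae P, forall x, f_ ^~ x @ \oo --> f x} ->
  Ex (f_ n) @[n --> \oo] --> Ex f.
Proof.
move=> mf_ mf fM fcvg.
have bf_ n : bmf (f_ n) by split => //; exists M.
have [] := @dominated_convergence _ T R P setT measurableT
  (fun n => EFin \o f_ n) (EFin \o f) (fun=> M%:E).
- by move=> n; exact/measurable_EFinP.
- exact/measurable_EFinP.
- by apply: filterS fcvg => x fx _; apply/fine_cvgP; split => //; exact: nearW.
- exact: finite_measure_integrable_cst.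
- by apply: aeW => x n _ /=; rewrite lee_fin.
- move=> intf _ /= cv.
  have fin : (\int[P]_x (f x)%:E)%E \is a fin_num by exact: integrable_fin_num.
  by rewrite /Ex /Rintegral; apply: fine_cvg; rewrite fineK.
Qed.

End Expectation.

(** The bridge between different probability spaces: both sides are integrals of [phi] against the
    common image law. *)
Lemma Ex_transfer (R : realType) d1 d2 d (T1 : measurableType d1)
    (T2 : measurableType d2) (U : measurableType d)
    (P1 : probability T1 R) (P2 : probability T2 R) (X1 : T1 -> U) (X2 : T2 -> U)
    (phi : U -> R) :
  measurable_fun setT X1 -> measurable_fun setT X2 ->
  (forall A, measurable A -> P1 (X1 @^-1` A) = P2 (X2 @^-1` A)) ->
  bmf phi -> Ex P1 (phi \o X1) = Ex P2 (phi \o X2).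
Proof.
move=> mX1 mX2 eqP bphi; rewrite /Ex /Rintegral; congr fine.
have bc (dd : measure_display) (TT : measurableType dd) (X : TT -> U) :
    measurable_fun setT X -> bmf (phi \o X).
  case: bphi => mphi [M pM] mX; split; first exact: measurableT_comp.
  by exists M => x /=.
have H d0 (T0 : measurableType d0) (P0 : probability T0 R) (X0 : T0 -> U) :
    measurable_fun setT X0 ->
    (\int[P0]_x ((phi \o X0) x)%:E = \int[pushforward P0 X0]_y (phi y)%:E)%E.
  move=> mX0.
  rewrite (@integral_pushforward _ _ _ _ _ X0 mX0 P0 setT (EFin \o phi))//.
    by apply/measurable_EFinP; exact: bmf_meas bphi.
  by rewrite preimage_setT; apply: bmf_integrable; exact: bc.
rewrite (H _ _ P1 X1)// (H _ _ P2 X2)//.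
apply: eq_measure_integral => A mA _; exact: eqP.
Qed.

Lemma Ex_prod (R : realType) d1 d2 (T1 : measurableType d1)
    (T2 : measurableType d2) (P1 : probability T1 R) (P2 : probability T2 R)
    (f : T1 * T2 -> R) : bmf f ->
  Ex (P1 \x P2)%E f = Ex P1 (fun x => Ex P2 (fun y => f (x, y))).
Proof.
move=> bf; rewrite /Ex /Rintegral; congr fine.
rewrite -(@integral12_prod_meas1 _ _ _ _ _ P1 P2 (EFin \o f)); last exact: bmf_integrable.
apply: eq_integral => x _; rewrite /fubini_F fineK//; apply: integrable_fin_num => //.
apply: bmf_integrable; case: bf => mf [M fM]; split; last by exists M.
exact: measurable_fun_pair2.
Qed.

(** * Laws of independent families *)

(** Powers are unbounded on R, but [f] takes its values in a compact interval, on which [psi] is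
    bounded. *)
Lemma bmf_continuous (R : realType) d (T : measurableType d) (psi : R -> R)
    (f : T -> R) : continuous psi -> bmf f -> bmf (fun x => psi (f x)).
Proof.
move=> cpsi bf; have [M M0 fM] := bmf_bound bf; case: bf => mf _.
split; first exact: (measurableT_comp (continuous_measurable_fun cpsi)).
have : bounded_set (psi @` `[- M, M]).
  apply: compact_bounded; apply: continuous_compact; last exact: segment_compact.
  exact: continuous_subspaceT.
case=> N [_ bN]; exists (`|N| + 1) => x; apply: bN.
  by rewrite (le_lt_trans (ler_norm N))// ltrDl.
by exists (f x) => //=; rewrite in_itv/= -ler_norml.
Qed.

Section Laws.
Context (R : realType) (V : completeNormedModType R).

(** For [I] = nat this is the generator of [prodV], so [measurable_G] is measurability on
    [paths V nat] by conversion. *)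
Definition cylinders (I : Type) : set (set (I -> V)) :=
  [set A | exists (k : I) (B : set V),
      borelV B /\ A = (fun x : I -> V => x k) @^-1` B].

Definition paths (I : Type) := g_sigma_algebraType (@cylinders I).

Lemma measurable_paths (I : Type) d (T : measurableType d) (Z : I -> T -> V) :
  (forall i, rv_V (Z i)) -> measurable_fun setT (fun w => (fun i => Z i w) : paths I).
Proof.
move=> mZ; apply: (@measurability _ _ T (paths I) _ _ (@cylinders I)) => //.
move=> _ [_ [k [B [mB ->]]] <-]; rewrite setTI; exact: mZ.
Qed.

Lemma measurable_reindex (I J : Type) (h : I -> J) :
  measurable_fun setT (fun x : paths J => (fun i => x (h i)) : paths I).
Proof.
apply: (@measurable_paths I _ (paths J) (fun i x => x (h i))) => i B mB.
by apply: sub_sigma_algebra; exists (h i), B.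
Qed.

Lemma borelVT : borelV [set: V].
Proof. by apply: sub_sigma_algebra; exact: openT. Qed.

Lemma borelVI (A B : set V) : borelV A -> borelV B -> borelV (A `&` B).
Proof.
move=> mA mB.
exact: (@measurableI _ (g_sigma_algebraType [set A : set V | open A]) A B).
Qed.

(** The pi-system on which mutual independence determines the joint law. *)
Definition rects (I : eqType) : set (set (I -> V)) :=
  [set A | exists (J : seq I) (B : I -> set V),
      [/\ uniq J, forall j, borelV (B j) &
      A = \bigcap_(j in [set j | j \in J]) ((fun x : I -> V => x j) @^-1` B j)]].

Lemma measurable_rects (I : eqType) (A : set (I -> V)) :
  rects A -> measurable (A : set (paths I)).
Proof.
case=> J [B [uJ mB ->]].
apply: fin_bigcap_measurable; first exact: finite_seq.
by move=> j _; apply: sub_sigma_algebra; exists j, (B j).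
Qed.

Lemma setI_closed_rects (I : eqType) : setI_closed (@rects I).
Proof.
move=> _ _ [J [B [uJ mB ->]]] [J' [B' [uJ' mB' ->]]].
exists (undup (J ++ J')).
exists (fun j => (if j \in J then B j else setT) `&` (if j \in J' then B' j else setT)).
split.
- exact: undup_uniq.
- by move=> j; apply: borelVI; case: ifP => _ //; exact: borelVT.
- apply/seteqP; split => x /=.
  + move=> [H1 H2] j /=; rewrite mem_undup mem_cat => _; split.
      by case: ifP => // jJ; exact: H1.
    by case: ifP => // jJ; exact: H2.
  + move=> H; split=> j /= jJ; have := H j; rewrite /= mem_undup mem_cat jJ ?orbT => -[]//.
Qed.

Lemma rects_generate (I : eqType) : @measurable _ (paths I) = <<s @rects I >>.
Proof.
apply/seteqP; split.
- apply: smallest_sub; first exact: smallest_sigma_algebra.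
  move=> _ [k [B [mB ->]]]; apply: sub_sigma_algebra.
  exists [:: k], (fun=> B); split => //.
  apply/seteqP; split => [x /= xB j|x /=]; first by rewrite /= inE => /eqP->.
  by apply; rewrite /= inE.
- apply: smallest_sub; first exact: sigma_algebra_measurable.
  exact: measurable_rects.
Qed.

Section SameLaw.
Context d1 (T1 : measurableType d1) (P1 : probability T1 R).
Context d2 (T2 : measurableType d2) (P2 : probability T2 R).

(** Independence reduces a rectangle to its marginal probabilities, and rectangles generate;
    Dynkin's theorem does the rest. *)
Lemma iid_same_law (I : eqType) (Z1 : I -> T1 -> V) (Z2 : I -> T2 -> V) :
  iid P1 Z1 -> iid P2 Z2 ->
  (forall i B, borelV B -> P1 (Z1 i @^-1` B) = P2 (Z2 i @^-1` B)) ->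
  forall A : set (paths I), measurable A ->
    P1 ((fun w => (fun i => Z1 i w) : paths I) @^-1` A) =
    P2 ((fun w => (fun i => Z2 i w) : paths I) @^-1` A).
Proof.
move=> [mZ1 [_ ind1]] [mZ2 [_ ind2]] eqm A.
pose X1 w : paths I := fun i => Z1 i w; pose X2 w : paths I := fun i => Z2 i w.
change (measurable A -> P1 (X1 @^-1` A) = P2 (X2 @^-1` A)).
have mX1 : measurable_fun setT X1 by exact: measurable_paths.
have mX2 : measurable_fun setT X2 by exact: measurable_paths.
have mP1 S : measurable S -> measurable (X1 @^-1` S).
  by move=> mS; rewrite -[X in measurable X]setTI; exact: mX1.
have mP2 S : measurable S -> measurable (X2 @^-1` S).
  by move=> mS; rewrite -[X in measurable X]setTI; exact: mX2.
rewrite rects_generate; move: A.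
apply: (@dynkin_induction _ (paths I) (@rects I)
  (fun S => P1 (X1 @^-1` S) = P2 (X2 @^-1` S))).
- exact: rects_generate.
- exact: setI_closed_rects.
- by rewrite !preimage_setT [LHS]probability_setT; apply/esym; exact: probability_setT.
- move=> _ [J [B [uJ mB ->]]].
  have := ind1 J B uJ (fun j _ => mB j); have := ind2 J B uJ (fun j _ => mB j).
  rewrite !preimage_bigcap => e2 e1; rewrite [LHS]e1 [RHS]e2.
  by apply: eq_bigr => j _; exact: eqm.
- move=> S mS eqS.
  have E1 : (P1 (~` (X1 @^-1` S)) = 1 - P1 (X1 @^-1` S))%E by apply: probability_setC; exact: mP1.
  have E2 : (P2 (~` (X2 @^-1` S)) = 1 - P2 (X2 @^-1` S))%E by apply: probability_setC; exact: mP2.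
  by transitivity (1 - P1 (X1 @^-1` S))%E => //; rewrite eqS.
- move=> F mF tF eqF; rewrite !preimage_bigcup.
  have tr (T : Type) (X : T -> paths I) : trivIset setT (fun i => X @^-1` F i).
    by apply/trivIsetP => i j _ _ ij; rewrite -preimage_setI (_ : F i `&` F j = set0)//; move/trivIsetP : tF => ->.
  have E1 : (P1 (\bigcup_i (X1 @^-1` F i)) = \sum_(0 <= i <oo | i \in setT) P1 (X1 @^-1` F i))%E.
    by apply: measure_bigcup => // i _; exact: mP1.
  have E2 : (P2 (\bigcup_i (X2 @^-1` F i)) = \sum_(0 <= i <oo | i \in setT) P2 (X2 @^-1` F i))%E.
    by apply: measure_bigcup => // i _; exact: mP2.
  rewrite [LHS]E1 [RHS]E2; apply: eq_eseriesr => i _; exact: eqF.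
Qed.

Lemma iid_reindex (I J : eqType) (h : I -> J) (Z : J -> T1 -> V) :
  injective h -> iid P1 Z -> iid P1 (fun i => Z (h i)).
Proof.
move=> injh [mZ [eqZ ind]]; split; [by move=> j; exact: mZ|split].
  by move=> i j B mB; exact: eqZ.
move=> K B uK mB.
(* A partial inverse of [h] on the finite list [K], used to carry the sets [B] over to the indices
   [h i]. *)
have [g gP] : exists g : J -> option I, forall i, i \in K -> g (h i) = Some i.
  exists (fun j => ohead [seq i <- K | h i == j]) => i iK.
  have : i \in [seq i' <- K | h i' == h i] by rewrite mem_filter eqxx.
  have : all (fun i' => h i' == h i) [seq i' <- K | h i' == h i] by exact: filter_all.
  by case: [seq _ <- _ | _] => //= a l /andP[/eqP/injh -> _].
pose B' j := if g j is Some i then B i else setT.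
have := ind (map h K) B'; rewrite map_inj_uniq// big_map => /(_ uK).
move=> H; transitivity (P1 (\bigcap_(j in [set j | j \in map h K]) (Z j @^-1` B' j))).
  congr (P1 _); apply/seteqP; split => x /= xB j /=.
    by move=> /mapP[i iK ->]; rewrite /B' gP//; exact: xB.
  by move=> jK; have := xB (h j); rewrite /= /B' gP//; apply; apply: map_f.
rewrite H.
  by rewrite big_seq [RHS]big_seq; apply: eq_bigr => i iK; rewrite /B' gP.
by move=> _ /mapP[i iK ->]; rewrite /B' gP//; exact: mB.
Qed.

(** The reference model of independence: joint laws are identified with a product measure, where
    Fubini factorizes expectations. *)
Lemma iid_prod (I J : eqType) (X : I -> T1 -> V) (Y : J -> T2 -> V) :
  iid P1 X -> iid P2 Y ->
  (forall i j B, borelV B -> P1 (X i @^-1` B) = P2 (Y j @^-1` B)) ->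
  iid (P1 \x P2)%E (fun (k : I + J) (w : T1 * T2) =>
    match k with inl i => X i w.1 | inr j => Y j w.2 end).
Proof.
move=> [mX [eqX indX]] [mY [eqY indY]] eqXY.
pose Z (k : I + J) (w : T1 * T2) := match k with inl i => X i w.1 | inr j => Y j w.2 end.
have EX i B : borelV B -> (P1 \x P2)%E (Z (inl i) @^-1` B) = P1 (X i @^-1` B).
  move=> mB; rewrite (_ : Z (inl i) @^-1` B = (X i @^-1` B) `*` setT); last first.
    by apply/seteqP; split => -[x y] //= [].
  rewrite [LHS]product_measure1E//; last exact: mX.
  by rewrite [X in (_ * X)%E](_ : _ = 1%E) ?mule1//; exact: probability_setT.
have EY j B : borelV B -> (P1 \x P2)%E (Z (inr j) @^-1` B) = P2 (Y j @^-1` B).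
  move=> mB; rewrite (_ : Z (inr j) @^-1` B = setT `*` (Y j @^-1` B)); last first.
    by apply/seteqP; split => -[x y] //= [].
  rewrite [LHS]product_measure1E//; last exact: mY.
  by rewrite [X in (X * _)%E](_ : _ = 1%E) ?mul1e//; exact: probability_setT.
split; [|split].
- move=> [i|j] B mB.
  + rewrite [X in measurable X](_ : _ = (X i @^-1` B) `*` setT); last first.
      by apply/seteqP; split => -[x y] //= [].
    by apply: measurableX => //; exact: mX.
  + rewrite [X in measurable X](_ : _ = setT `*` (Y j @^-1` B)); last first.
      by apply/seteqP; split => -[x y] //= [].
    by apply: measurableX => //; exact: mY.
- move=> [i|j] [i'|j'] B mB.
  + by rewrite [LHS]EX// [RHS]EX//; exact: eqX.
  + by rewrite [LHS]EX// [RHS]EY//; exact: eqXY.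
  + by rewrite [LHS]EY// [RHS]EX//; apply/esym; exact: eqXY.
  + by rewrite [LHS]EY// [RHS]EY//; exact: eqY.
- move=> K B uK mB.
  pose fI (k : I + J) := if k is inl i then Some i else None.
  pose fJ (k : I + J) := if k is inr j then Some j else None.
  pose KI := pmap fI K; pose KJ := pmap fJ K.
  have inI i : (i \in KI) = (inl i \in K).
    rewrite /KI; elim: (K) => //= -[i'|j'] l IH /=; rewrite !inE ?IH//.
  have inJ j : (j \in KJ) = (inr j \in K).
    rewrite /KJ; elim: (K) => //= -[i'|j'] l IH /=; rewrite !inE ?IH//.
  have uKI : uniq KI by apply: (pmap_uniq (g := inl)) uK => -[].
  have uKJ : uniq KJ by apply: (pmap_uniq (g := inr)) uK => -[].
  have prodK (F : I + J -> \bar R) : (\prod_(k <- K) F k =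
      (\prod_(i <- KI) F (inl i)) * (\prod_(j <- KJ) F (inr j)))%E.
    rewrite /KI /KJ; elim: (K) => [|[i|j] l IH]; first by rewrite !big_nil mule1.
      by rewrite /= !big_cons IH muleA.
    by rewrite /= !big_cons IH muleCA.
  rewrite prodK.
  rewrite (_ : \bigcap_(j in _) _ = (\bigcap_(i in [set i | i \in KI]) (X i @^-1` B (inl i)))
     `*` (\bigcap_(j in [set j | j \in KJ]) (Y j @^-1` B (inr j)))); last first.
    apply/seteqP; split => -[x y] /=.
      move=> H; split => k /=; rewrite (inI, inJ) => kK; exact: (H _ kK).
    by move=> [H1 H2] [i|j] /= kK; [apply: H1; rewrite /= inI|apply: H2; rewrite /= inJ].
  rewrite [LHS]product_measure1E.
  + congr (_ * _)%E.
      rewrite [LHS](indX KI (fun i => B (inl i)))//; last by move=> i; rewrite inI; exact: mB.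
      rewrite big_seq [RHS]big_seq; apply: eq_bigr => k.
      by rewrite inI => kK; rewrite [RHS]EX//; exact: mB.
    rewrite [LHS](indY KJ (fun i => B (inr i)))//; last by move=> i; rewrite inJ; exact: mB.
    rewrite big_seq [RHS]big_seq; apply: eq_bigr => k.
    by rewrite inJ => kK; rewrite [RHS]EY//; exact: mB.
  + apply: fin_bigcap_measurable => [|i]; first exact: finite_seq.
    by rewrite /= inI => kK; apply: mX; exact: mB.
  + apply: fin_bigcap_measurable => [|i]; first exact: finite_seq.
    by rewrite /= inJ => kK; apply: mY; exact: mB.
Qed.
End SameLaw.
End Laws.

(** * Coupling of partial sums *)

Section Coupling.
Context (R : realType) (V : completeNormedModType R).
Context dT (T : measurableType dT) (P : probability T R).
Context d2 (T2 : measurableType d2) (P2 : probability T2 R).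
Context (xi : int -> T -> V) (zeta zeta' : int -> T2 -> V).
Hypothesis iid_xi : iid P xi.
Hypothesis iid_zeta : iid P2 (fun j : int + int =>
  match j with inl j => zeta j | inr j => zeta' j end).
Hypothesis law_zeta : forall B, borelV B -> P2 (zeta 0 @^-1` B) = P (xi 0 @^-1` B).

Definition past (I : Type) (Z : int -> I -> V) (i : int) (w : I) : paths V nat :=
  fun k => Z (i - k%:Z) w.

Definition coupled_past (Z Z' : int -> T2 -> V) (i : int) (w : T2) : paths V nat :=
  fun k => if 0 < i - k%:Z then Z (i - k%:Z) w else Z' (i - k%:Z) w.

Let Z (j : int + int) : T2 -> V := match j with inl j => zeta j | inr j => zeta' j end.

Let law_Z (i : int) (j : int + int) B : borelV B -> P (xi i @^-1` B) = P2 (Z j @^-1` B).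
Proof.
move=> mB; case: iid_xi => _ [eqxi _]; case: iid_zeta => _ [eqZ _].
by rewrite (eqxi i 0)// -law_zeta// (eqZ j (inl 0)).
Qed.

(** Lists the innovations behind the pair (past at 0, coupled sequence): the former uses [zeta] at
    times at most 0, the latter [zeta] at positive times and [zeta'] at the others. Injectivity says
    that none is shared. *)
Let split_index (k : nat + int) : int + int :=
  match k with
  | inl k => inl (- k%:Z)
  | inr j => if 0 < j then inl j else inr j
  end.

Let split_index_inj : injective split_index.
Proof.
move=> [k|j] [k'|j'] /=.
- by move=> [/oppr_inj[->]].
- case: ltP => // j0 [] e; move: j0; rewrite -e; lia.
- case: ltP => // j0 [] e; move: j0; rewrite e; lia.
- by case: ltP => // _; case: ltP => // _ [->].
Qed.

Lemma bmf_past (a : paths V nat -> R) dI (I : measurableType dI) (X : int -> I -> V) i :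
  (forall j, rv_V (X j)) -> bmf a -> bmf (fun w => a (past X i w)).
Proof.
move=> mX [ma [M aM]]; split; last by exists M => w.
by apply: (measurableT_comp ma); exact: measurable_paths.
Qed.

Lemma bmf_coupled_past (a : paths V nat -> R) i :
  bmf a -> bmf (fun w => a (coupled_past zeta zeta' i w)).
Proof.
move=> [ma [M aM]]; split; last by exists M => w.
apply: (measurableT_comp ma); apply: measurable_paths => k; case: iid_zeta => mZ _.
by case: (0 < _); [exact: (mZ (inl _))|exact: (mZ (inr _))].
Qed.

Lemma Ex_stationary (b : paths V int -> R) (m : int) : bmf b ->
  Ex P (fun w => b (fun j => xi (j + m) w)) = Ex P2 (fun w => b (fun j => zeta j w)).
Proof.
move=> bb.
have iid1 : iid P (fun j => xi (j + m)) by exact: (iid_reindex (@addIr _ m)).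
have iid2 : iid P2 (fun j => zeta j).
  by apply: (@iid_reindex _ _ _ _ _ _ _ inl Z) iid_zeta => i j [].
apply: (@Ex_transfer _ _ _ _ _ _ (paths V int) P P2
  (fun w j => xi (j + m) w) (fun w j => zeta j w) b) => //.
- by apply: measurable_paths => j; case: iid1.
- by apply: measurable_paths => j; case: iid2.
- apply: iid_same_law => // i B mB; exact: (law_Z _ (inl i)).
Qed.

(** The past at 0 and the coupled sequence are built from disjoint innovations, hence exactly
    independent. Stationarity allows reading the first factor at any time [m]. *)
Lemma Ex_independent (a : paths V nat -> R) (b : paths V int -> R) (m : int) :
  bmf a -> bmf b ->
  Ex P2 (fun w => a (past zeta 0 w) *
    b (fun j => if 0 < j then zeta j w else zeta' j w)) =
  Ex P (fun w => a (past xi m w)) * Ex P (fun w => b (fun j => xi j w)).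
Proof.
move=> ba bb.
have mxi j : rv_V (xi j) by case: iid_xi.
have iidx : iid P (fun k : nat => xi (m - k%:Z)).
  by apply: iid_reindex iid_xi => k k' /addrI/oppr_inj[].
have iid1 := iid_prod iidx iid_xi (fun i j B mB =>
   let: conj _ (conj eqxi _) := iid_xi in eqxi _ _ B mB).
have iid2 := iid_reindex split_index_inj iid_zeta.
pose phi (x : paths V (nat + int)) := a (fun k => x (inl k)) * b (fun j => x (inr j)).
have bphi : bmf phi.
  apply: bmfM.
    case: ba => ma [M aM]; split; last by exists M => w.
    by apply: (measurableT_comp ma); exact: measurable_reindex.
  case: bb => mb [M bM]; split; last by exists M => w.
  by apply: (measurableT_comp mb); exact: measurable_reindex.
have := @Ex_transfer _ _ _ _ _ _ (paths V (nat + int)%type) P2 (P \x P)%E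
  (fun w k => Z (split_index k) w)
  (fun w k => match k with inl k => xi (m - k%:Z) w.1 | inr j => xi j w.2 end) phi.
have E1 : (phi \o (fun w k => Z (split_index k) w)) =1 (fun w => a (past zeta 0 w) *
    b (fun j => if 0 < j then zeta j w else zeta' j w)).
  move=> w; rewrite /phi /=; congr (a _ * b _); apply/funext => j.
    by rewrite /past sub0r.
  by case: ifP.
rewrite (eq_Ex _ E1) => ->//.
- rewrite Ex_prod; last first.
    case: bphi => mphi [M pM]; split; last by exists M => w /=.
    apply: (measurableT_comp mphi); apply: measurable_paths => k; case: iid1 => mk _; exact: mk.
  rewrite -ExZr; last exact: bmf_past.
  apply: eq_Ex => x; rewrite /phi /= -ExZ//.
  case: bb => mb [M bM]; split; last by exists M => w.
  by apply: (measurableT_comp mb); exact: measurable_paths.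
- by apply: (@measurable_paths _ _ _ _ _ (fun k => Z (split_index k))) => k; case: iid2 => mk _; exact: mk.
- by apply: measurable_paths => k; case: iid1 => mk _; exact: mk.
- apply: iid_same_law => // k B mB.
  transitivity (P (xi 0 @^-1` B)); first by rewrite (law_Z 0 (split_index k)).
  case: iid1 => _ [eq1 _]; rewrite (eq1 k (inr 0))//=; apply/esym.
  rewrite [X in (P \x P)%E X](_ : _ = setT `*` (xi 0 @^-1` B)); last first.
    by apply/seteqP; split => -[x y] //= [].
  rewrite [LHS]product_measure1E//; last exact: mxi.
  by rewrite [X in (X * _)%E](_ : _ = 1%E) ?mul1e//; exact: probability_setT.
Qed.

Lemma Ex_stationary_pasts (b : paths V nat -> paths V nat -> R) (i h : nat) :
  bmf (fun x : paths V int => b (fun k => x (- k%:Z)) (fun k => x (h%:Z - k%:Z))) ->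
  Ex P (fun w => b (past xi i w) (past xi (i + h)%N w)) =
  Ex P2 (fun w => b (past zeta 0 w) (past zeta h w)).
Proof.
move=> bb; have := Ex_stationary i bb => H.
transitivity (Ex P (fun w => b (fun k => xi (- k%:Z + i) w) (fun k => xi (h%:Z - k%:Z + i) w))).
  apply: eq_Ex => w; congr (b _ _); apply/funext => k; rewrite /past.
    by rewrite addrC.
  by rewrite PoszD [i%:Z + _]addrC addrAC.
rewrite H; apply: eq_Ex => w; congr (b _ _); apply/funext => k; rewrite /past.
by rewrite sub0r.
Qed.

Variable a : paths V nat -> R.
Hypothesis bmf_a : bmf a.

Let bmf_read (I : Type) (f : nat -> I) : bmf (fun x : paths V I => a (fun k => x (f k))).
Proof.
case: bmf_a => ma [M aM]; split; last by exists M.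
by apply: (measurableT_comp ma); exact: measurable_reindex.
Qed.

Let mxi j : rv_V (xi j). Proof. by case: iid_xi. Qed.
Let mzeta j : rv_V (zeta j). Proof. by case: iid_zeta => mZ _; exact: (mZ (inl j)). Qed.

Definition psum (n : nat) (w : T) : R := \sum_(i < n) a (past xi i.+1 w).

Definition coupling_dist (i : nat) (w : T2) : R :=
  `|a (past zeta i.+1 w) - a (coupled_past zeta zeta' i.+1 w)|.

Lemma bmf_psum n : bmf (psum n).
Proof. by apply: bmf_sum => i; exact: bmf_past. Qed.

Lemma bmf_coupling_dist i : bmf (coupling_dist i).
Proof.
by apply/bmf_norm/bmfB; [exact: bmf_past|exact: bmf_coupled_past].
Qed.

(* S (m + b) has the law of A + B, and the late block B is close to a block B'
   independent of A. *)
Definition splits (S : nat -> T -> R) (D : nat -> T2 -> R) :=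
  forall m b, exists A B B' : T2 -> R,
  [/\ bmf A, bmf B, bmf B', forall w, `|B w - B' w| <= \sum_(i < b) D i w &
   (forall psi : R -> R, continuous psi ->
     Ex P (fun w => psi (S (m + b)%N w)) = Ex P2 (fun w => psi (A w + B w))) /\
   (forall phi psi : R -> R, continuous phi -> continuous psi ->
     Ex P2 (fun w => phi (A w) * psi (B' w)) =
     Ex P (fun w => phi (S m w)) * Ex P (fun w => psi (S b w)))].

Lemma psum_splits : splits psum coupling_dist.
Proof.
move=> m b.
(* Time is shifted by -m: the first block occupies the times -m+1, ..., 0 and is a function of the
   past at 0, listed backwards; the second block occupies 1, ..., b. *)
exists (fun w => \sum_(i < m) a (fun k => past zeta 0 w (i + k)%N)).
exists (fun w => \sum_(i < b) a (past zeta i.+1 w)).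
exists (fun w => \sum_(i < b) a (coupled_past zeta zeta' i.+1 w)).
split.
- apply: bmf_sum => i; apply: (@bmf_past (fun x => a (fun k => x (i + k)%N))) => //.
- by apply: bmf_sum => i; exact: bmf_past.
- by apply: bmf_sum => i; exact: bmf_coupled_past.
- by move=> w; rewrite -sumrB; exact: ler_norm_sum.
- split; last first.
  {
  move=> phi psi cphi cpsi.
  pose aa (x : paths V nat) := phi (\sum_(i < m) a (fun k => x (i + k)%N)).
  pose bb (x : paths V int) := psi (\sum_(i < b) a (fun k => x (i.+1%:Z - k%:Z))).
  have baa : bmf aa by apply: bmf_continuous => //; apply: bmf_sum => i; exact: bmf_read.
  have bbb : bmf bb by apply: bmf_continuous => //; apply: bmf_sum => i; exact: bmf_read.
  have := Ex_independent m baa bbb; rewrite /aa /bb => H.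
  transitivity (Ex P (fun w => phi (\sum_(i < m) a (fun k => past xi m w (i + k)%N))) *
     Ex P (fun w => psi (\sum_(i < b) a (fun k => xi (i.+1%:Z - k%:Z) w)))).
    by rewrite -H; apply: eq_Ex => w.
  congr (_ * _); apply: eq_Ex => w; congr phi.
  rewrite /psum (reindex_inj rev_ord_inj) /=; apply: eq_bigr => i _; congr a.
  by apply/funext => k; rewrite /past; congr (xi _ w); have := ltn_ord i; lia.
  }
  move=> psi cpsi.
  pose bb (x : paths V int) := psi (\sum_(i < m + b) a (fun k => x (i.+1%:Z - m%:Z - k%:Z))).
  have bbb : bmf bb.
    by apply: bmf_continuous => //; apply: bmf_sum => i; exact: bmf_read.
  transitivity (Ex P2 (fun w => bb (fun j => zeta j w))); last first.
    apply: eq_Ex => w; rewrite /bb; congr psi.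
    rewrite big_split_ord /=; congr (_ + _).
      rewrite (reindex_inj rev_ord_inj) /=; apply: eq_bigr => i _; congr a.
      apply/funext => k; rewrite /past; congr (zeta _ w); have := ltn_ord i; lia.
    apply: eq_bigr => i _; congr a; apply/funext => k; rewrite /past; congr (zeta _ w); lia.
  rewrite -(Ex_stationary m%:Z bbb); apply: eq_Ex => w; rewrite /bb /psum; congr psi.
  by apply: eq_bigr => i _; congr a; apply/funext => k; rewrite /past; congr (xi _ w); lia.
Qed.

Hypothesis Ea0 : Ex P (fun w => a (past xi 0 w)) = 0.
Hypothesis a_le1 : forall x, `|a x| <= 1.

Definition autocov (h : nat) := Ex P2 (fun w => a (past zeta 0 w) * a (past zeta h w)).

Lemma Ex_past (i : nat) : Ex P (fun w => a (past xi i w)) = 0.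
Proof.
rewrite -Ea0; have := @Ex_stationary_pasts (fun x _ => a x).
move=> H; rewrite (H i 0%N) ?(H 0%N 0%N)//; exact: bmf_read.
Qed.

Lemma Ex_psum n : Ex P (psum n) = 0.
Proof. by rewrite Ex_sum => [|i]; [rewrite big1// => i _; exact: Ex_past|exact: bmf_past]. Qed.

Lemma autocov0 : autocov 0 = Ex P (fun w => a (past xi 0 w) ^+ 2).
Proof.
have := @Ex_stationary_pasts (fun x y => a x * a y) 0 0; rewrite /autocov => <-.
  by apply: eq_Ex => w; rewrite expr2.
by apply: bmfM; exact: bmf_read.
Qed.

(** Replacing the late factor by its decoupled copy turns the covariance into a product of two zero
    means. *)
Lemma autocov_le h : `|autocov h.+1| <= Ex P2 (coupling_dist h).
Proof.
have -> : autocov h.+1 = Ex P2 (fun w => a (past zeta 0 w) *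
    (a (past zeta h.+1 w) - a (coupled_past zeta zeta' h.+1 w))).
  have b1 := bmf_past 0 mzeta bmf_a; have b2 := bmf_past h.+1 mzeta bmf_a.
  have b3 := bmf_coupled_past h.+1 bmf_a.
  transitivity (autocov h.+1 - 0); first by rewrite subr0.
  rewrite [RHS](_ : _ = Ex P2 (fun w => a (past zeta 0 w) * a (past zeta h.+1 w) -
    a (past zeta 0 w) * a (coupled_past zeta zeta' h.+1 w))); last first.
    by apply: eq_Ex => w; rewrite mulrBr.
  rewrite ExB; [|exact: bmfM|exact: bmfM].
  congr (_ - _); have := Ex_independent 0 bmf_a (bmf_read (fun k => h.+1%:Z - k%:Z)).
  by rewrite Ea0 mul0r => <-.
apply: (le_trans (Ex_norm _ _)).
  by apply: bmfM; [exact: bmf_past|apply: bmfB; [exact: bmf_past|exact: bmf_coupled_past]].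
apply: le_Ex; last by move=> w; rewrite normrM ler_piMl.
  apply/bmf_norm/bmfM; first exact: bmf_past.
  by apply: bmfB; [exact: bmf_past|exact: bmf_coupled_past].
exact: bmf_coupling_dist.
Qed.

(** The variance is built one term at a time, because its increments show both that it grows
    linearly and that variance / n converges. *)
Lemma Ex_psum_sqS n : Ex P (fun w => psum n.+1 w ^+ 2) =
  Ex P (fun w => psum n w ^+ 2) + (autocov 0 + 2 * \sum_(h < n) autocov h.+1).
Proof.
have bY i : bmf (fun w => a (past xi i w)) by exact: bmf_past.
have stat (i h : nat) : Ex P (fun w => a (past xi i w) * a (past xi (i + h)%N w)) = autocov h.
  apply: (@Ex_stationary_pasts (fun x y => a x * a y) i h).
  by apply: bmfM; exact: bmf_read.
have -> : Ex P (fun w => psum n.+1 w ^+ 2) = Ex P (fun w => psum n w ^+ 2 +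
   (a (past xi n.+1 w) * a (past xi (n.+1 + 0)%N w) +
    2 * (\sum_(i < n) a (past xi i.+1 w) * a (past xi (i.+1 + (n - i))%N w)))).
  apply: eq_Ex => w; rewrite /psum big_ord_recr /= addn0.
  rewrite [X in _ + (_ + 2 * X)](eq_bigr (fun i : 'I_n => a (past xi i.+1 w) * a (past xi n.+1 w))); last first.
    by move=> i _; congr (_ * a (past xi _ w)); have := ltn_ord i; lia.
  by rewrite -mulr_suml; ring.
have b1 : bmf (fun w => 2 * (\sum_(i < n) a (past xi i.+1 w) * a (past xi (i.+1 + (n - i))%N w))).
  by apply: bmfM; [exact: bmf_cst|apply: bmf_sum => i; exact: bmfM].
have b2 : bmf (fun w => a (past xi n.+1 w) * a (past xi (n.+1 + 0)%N w)) by exact: bmfM.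
rewrite ExD//; [|by apply: bmfX; exact: bmf_psum|exact: bmfD].
congr (_ + _); rewrite ExD//.
rewrite stat; congr (_ + _); rewrite ExZ; last by apply: bmf_sum => i; exact: bmfM.
congr (_ * _); rewrite Ex_sum; last by move=> i; exact: bmfM.
rewrite (reindex_inj rev_ord_inj) /=; apply: eq_bigr => i _; rewrite stat; congr autocov.
by have := ltn_ord i; lia.
Qed.

Section VarianceBound.
Variables (kappa K : R) (beta : nat -> R).
Hypothesis kappa0 : 0 <= kappa.
Hypothesis dep_le : forall i, Ex P2 (coupling_dist i) <= kappa * beta i.
Hypothesis sum_beta : forall n, \sum_(i < n) beta i <= K.

Lemma sum_autocov_le n : \sum_(h < n) `|autocov h.+1| <= kappa * K.
Proof.
apply: le_trans (_ : \sum_(h < n) kappa * beta h <= _).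
  by apply: ler_sum => h _; exact: le_trans (autocov_le h) (dep_le h).
by rewrite -mulr_sumr ler_wpM2l.
Qed.

Lemma variance_bound n : Ex P (fun w => a (past xi 0 w) ^+ 2) <= kappa ->
  Ex P (fun w => psum n w ^+ 2) <= n%:R * (kappa * (1 + 2 * K)).
Proof.
rewrite -autocov0 => c0; elim: n => [|n IH].
  rewrite mul0r (_ : Ex _ _ = 0)// -[RHS](Ex_cst P 0).
  by apply: eq_Ex => w; rewrite /psum big_ord0 expr0n.
rewrite Ex_psum_sqS -[n.+1%:R]natr1 [(n%:R + 1) * _]mulrDl mul1r.
apply: lerD => //.
rewrite mulrDr mulr1; apply: lerD => //.
rewrite mulrCA ler_pM2l//; apply: le_trans (sum_autocov_le n).
by apply: ler_sum => h _; exact: ler_norm.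
Qed.

Lemma variance_cvg : exists2 s2 : R, 0 <= s2 &
  Ex P (fun w => psum n w ^+ 2) / n%:R @[n --> \oo] --> s2.
Proof.
pose u n := autocov 0 + 2 * \sum_(h < n) autocov h.+1.
have [l ul] : exists l : R, u n @[n --> \oo] --> l.
  have : cvgn (series (fun h => autocov h.+1)).
    apply: normed_cvg; apply: nondecreasing_is_cvgn.
      move=> m n mn.
 change (\sum_(0 <= k < m) `|autocov k.+1| <= \sum_(0 <= k < n) `|autocov k.+1|).
 by rewrite [leRHS](big_cat_nat (n := m))//= lerDl sumr_ge0.
    exists (kappa * K) => _ [n _ <-].
    change (\sum_(0 <= k < n) `|autocov k.+1| <= kappa * K).
    by rewrite big_mkord; exact: sum_autocov_le.
  move=> /cvg_ex[l cl]; exists (autocov 0 + 2 * l).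
  apply: cvgD; first exact: cvg_cst.
  apply: cvgM; first exact: cvg_cst.
  by move: cl; rewrite /series /=; under eq_fun do rewrite big_mkord.
have Ev n : Ex P (fun w => psum n w ^+ 2) = series u n.
  elim: n => [|n IH]; last by rewrite Ex_psum_sqS /series /= big_nat_recr//= IH.
  rewrite /series /= big_geq// -[RHS](Ex_cst P 0).
  by apply: eq_Ex => w; rewrite /psum big_ord0 expr0n.
(* The variance is the sum of the increments [u], so variance / n is a Cesaro mean of a convergent
   sequence. *)
have cv : Ex P (fun w => psum n w ^+ 2) / n%:R @[n --> \oo] --> l.
  rewrite -cvg_shiftS; apply: cvg_trans (cesaro ul); apply: near_eq_cvg; apply: nearW => n.
  by rewrite /arithmetic_mean /= Ev mulrC.
exists l => //; apply: cvgr_to_ge cv _; apply: nearW => n; rewrite divr_ge0//.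
by apply: Ex_ge0 => w; exact: sqr_ge0.
Qed.
End VarianceBound.

End Coupling.

(** * Moment bounds *)

Ltac nneg := repeat match goal with
  | |- is_true (0 <= _ * _) => apply: mulr_ge0
  | |- is_true (0 <= _ ^+ _) => apply: exprn_ge0
  | |- is_true (0 <= _ + _) => apply: addr_ge0
  | |- is_true (0 <= _^-1) => rewrite invr_ge0
  | |- is_true (0 <= _) => first [done | by apply: ltW]
  end.

Section PowerInequalities.
Context {R : realType}.
Implicit Types x y c e v : R.

Lemma exprD1_le (e : R) N : 0 <= e <= 1 -> (1 + e) ^+ N <= 1 + (2 ^ N)%:R * e.
Proof.
move=> /andP[e0 e1]; apply: (@le_trans _ _ (1 + ((2 ^ N)%:R - 1) * e)); last first.
  by rewrite lerD2l ler_wpM2r// gerBl.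
elim: N => [|N IH]; first by rewrite expr0 expn0 subrr mul0r addr0.
rewrite exprS; apply: (le_trans (ler_wpM2l _ IH)); first by rewrite addr_ge0.
rewrite expnS natrM; have p1 : (1:R) <= (2 ^ N)%:R by rewrite ler1n expn_gt0.
set p := (2 ^ N)%:R in p1 *.
have h : 0 <= (p - 1) * (e * (1 - e)) by rewrite !mulr_ge0// subr_ge0.
nra.
Qed.

Lemma normr_powD x y (e : R) N : 0 < e ->
  `|x + y| ^+ N <= (1 + e) ^+ N * `|x| ^+ N + (1 + e^-1) ^+ N * `|y| ^+ N.
Proof.
move=> e0; have [yx|xy] := leP `|y| (e * `|x|).
  apply: le_trans (_ : (1 + e) ^+ N * `|x| ^+ N <= _); last first.
    by rewrite lerDl mulr_ge0 ?exprn_ge0// addr_ge0// invr_ge0 ltW.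
  rewrite -exprMn lerXn2r ?nnegrE ?mulr_ge0 ?addr_ge0 ?(ltW e0)//.
  by rewrite (le_trans (ler_normD _ _))// mulrDl mul1r lerD.
apply: le_trans (_ : (1 + e^-1) ^+ N * `|y| ^+ N <= _); last first.
  by rewrite lerDr mulr_ge0 ?exprn_ge0// addr_ge0// ltW.
rewrite -exprMn lerXn2r ?nnegrE ?mulr_ge0 ?addr_ge0 ?invr_ge0 ?(ltW e0)//.
rewrite (le_trans (ler_normD _ _))// mulrDl mul1r addrC lerD//.
by rewrite ler_pdivlMl// ltW.
Qed.

(** The factor of |x|^N must stay near 1, because the doubling recursion iterates it; the price is a
    large constant on the small term. *)
Lemma normr_powD_eps (e : R) N : 0 < e -> exists2 C : R, 0 <= C &
  forall x y, `|x + y| ^+ N <= (1 + e) * `|x| ^+ N + C * `|y| ^+ N.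
Proof.
move=> e0; pose h : R := Num.min 1 (e / (2 ^ N)%:R).
have p0 : (0:R) < (2 ^ N)%:R by rewrite ltr0n expn_gt0.
have h0 : 0 < h by rewrite lt_min ltr01 divr_gt0.
exists ((1 + h^-1) ^+ N); first by rewrite exprn_ge0// addr_ge0// invr_ge0 ltW.
move=> x y; apply: le_trans (normr_powD x y N h0) _.
rewrite lerD2r ler_wpM2r ?exprn_ge0//; apply: le_trans (@exprD1_le h N _) _.
  by rewrite (ltW h0) ge_min lexx.
by rewrite lerD2l mulrC -ler_pdivlMr// ge_min lexx orbT.
Qed.

(** Absorbs variance times a moment of order two less into a small multiple of the top moment plus a
    pure power of the variance. *)
Lemma young_pow (v s e : R) q : 0 <= v -> 0 < e ->
  v * s ^+ (2 * q) <= e * s ^+ (2 * q.+1) + e^-1 ^+ q * v ^+ q.+1.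
Proof.
move=> v0 e0; rewrite mulnS exprD !exprM.
have s20 : 0 <= s ^+ 2 by exact: sqr_ge0.
have [vs|sv] := leP v (e * s ^+ 2).
  rewrite -[leLHS]addr0; apply: lerD.
    rewrite [leRHS]mulrA; apply: ler_wpM2r => //; exact: exprn_ge0.
  by rewrite mulr_ge0 ?exprn_ge0// invr_ge0 ltW.
rewrite -[leLHS]add0r; apply: lerD; first by apply: mulr_ge0; [exact: ltW|exact: (mulr_ge0 s20 (exprn_ge0 q s20))].
rewrite [v ^+ _]exprSr mulrA -exprMn [leLHS]mulrC ler_wpM2r//.
apply: lerXn2r; rewrite ?nnegrE//; last by rewrite ler_pdivlMl// ltW.
by apply: mulr_ge0 => //; rewrite invr_ge0 ltW.
Qed.

(** The middle terms of a binomial expansion are dominated by its two extreme mixed terms, those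
    with exponent 2 on one side. *)
Lemma mixed_pow_le x y i j : 0 <= x -> 0 <= y ->
  x ^+ i.+2 * y ^+ j.+2 <= x ^+ 2 * y ^+ (i + j).+2 + x ^+ (i + j).+2 * y ^+ 2.
Proof.
move=> x0 y0; have [xy|yx] := leP x y.
  apply: le_trans (_ : x ^+ 2 * y ^+ (i + j).+2 <= _); last first.
    by rewrite lerDl mulr_ge0 ?exprn_ge0.
  rewrite -addn2 exprD -mulrA mulrCA ler_wpM2l ?exprn_ge0//.
  by rewrite -addnS -addnS exprD ler_wpM2r ?exprn_ge0// lerXn2r.
apply: le_trans (_ : x ^+ (i + j).+2 * y ^+ 2 <= _); last first.
  by rewrite lerDr mulr_ge0 ?exprn_ge0.
rewrite -[j.+2]addn2 exprD mulrA ler_wpM2r ?exprn_ge0//.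
by rewrite -addSn -addSn exprD ler_wpM2l ?exprn_ge0// lerXn2r ?nnegrE// ltW.
Qed.

(** The terms linear in x or in y are kept exact, since they vanish in expectation for independent
    centered factors; an absolute bound would lose this cancellation. *)
Lemma exprD_le x y M : ~~ odd M ->
  (x + y) ^+ M.+4 <= x ^+ M.+4 + y ^+ M.+4 +
   (M.+4)%:R * (x * y ^+ M.+3) + (M.+4)%:R * (x ^+ M.+3 * y) +
   (2 ^ M.+4)%:R * (x ^+ 2 * y ^+ M.+2 + x ^+ M.+2 * y ^+ 2).
Proof.
move=> oM; rewrite exprDn big_ord_recl big_ord_recl big_ord_recr big_ord_recr /=.
rewrite /bump /= !add1n !subn0 expr0 mulr1 bin0 mulr1n bin1 subn1 /=.
rewrite (_ : (M.+4 - M.+3 = 1)%N); last by lia.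
rewrite subnn expr0 mul1r binn mulr1n !expr1 (_ : 'C(M.+4, M.+3) = M.+4); last first.
  by rewrite -bin_sub// (_ : (M.+4 - M.+3 = 1)%N) ?bin1//; lia.
rewrite -[(x * y ^+ M.+3) *+ _]mulr_natl -[(x ^+ M.+3 * y) *+ _]mulr_natl.
set S := (\sum_(i < M.+1) _).
suff : S <= (2 ^ M.+4)%:R * (x ^+ 2 * y ^+ M.+2 + x ^+ M.+2 * y ^+ 2).
  move=> h; set Z := (2 ^ _)%:R * _ in h *; rewrite [leLHS](_ : _ = x ^+ M.+4 + y ^+ M.+4 +
   (M.+4)%:R * (x * y ^+ M.+3) + (M.+4)%:R * (x ^+ M.+3 * y) + S); last by ring.
  by rewrite lerD2l.
have key : x ^+ 2 * y ^+ M.+2 + x ^+ M.+2 * y ^+ 2 = `|x| ^+ 2 * `|y| ^+ M.+2 + `|x| ^+ M.+2 * `|y| ^+ 2.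
  rewrite -![`|_| ^+ _]normrX; congr (_ * _ + _ * _); rewrite ger0_norm// ?sqr_ge0//.
    by rewrite exprn_even_ge0//= oM.
  by rewrite exprn_even_ge0//= oM.
rewrite key; set Q := _ + _.
have Q0 : 0 <= Q by apply: addr_ge0; apply: mulr_ge0; apply: exprn_ge0; exact: normr_ge0.
apply: (@le_trans _ _ (\sum_(i < M.+1) 'C(M.+4, i.+2)%:R * Q)).
  apply: ler_sum => i _; rewrite -[_ *+ _]mulr_natl ler_wpM2l//.
  apply: le_trans (ler_norm _) _; rewrite normrM !normrX.
  have iM := ltn_ord i; rewrite (_ : (M.+4 - i.+2 = (M - i).+2)%N); last by lia.
  have := @mixed_pow_le `|x| `|y| (M - i)%N i (normr_ge0 _) (normr_ge0 _).
  by rewrite subnK// -ltnS.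
rewrite -mulr_suml ler_wpM2r// -natr_sum ler_nat.
have -> : (2 ^ M.+4 = \sum_(i < M.+4.+1) 'C(M.+4, i))%N.
  rewrite -(addn1 1) Pascal.
  by apply: eq_bigr => i _; rewrite !exp1n !muln1.
rewrite 2!big_ord_recl /= addnA; apply: leq_trans (leq_addl _ _).
rewrite [leqRHS]big_ord_recr /= [X in (_ <= X + _)%N]big_ord_recr /= -addnA /bump /=.
by apply: leq_trans (leq_addr _ _); apply: leq_sum => i _; rewrite !add1n.
Qed.

Lemma pow_tangent x c N : 0 <= x -> 0 <= c ->
  c ^+ N.+1 + N.+1%:R * c ^+ N * (x - c) <= x ^+ N.+1.
Proof.
move=> x0 c0; elim: N => [|N IH]; first by rewrite !expr1 expr0; lra.
rewrite [x ^+ _]exprS; apply: le_trans (ler_wpM2l x0 IH).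
rewrite -subr_ge0 (_ : _ - _ = N.+1%:R * c ^+ N * (x - c) ^+ 2); last first.
  by rewrite -[N.+2%:R]natr1 !exprS; ring.
by rewrite mulr_ge0 ?sqr_ge0// mulr_ge0 ?exprn_ge0.
Qed.

(** Jensen's inequality with unnormalized weights, from the tangent of the power function at the
    weighted mean. *)
Lemma power_mean n (w x : nat -> R) N : (forall i, 0 <= w i) -> (forall i, 0 <= x i) ->
  (\sum_(i < n) w i * x i) ^+ N.+1 <=
  (\sum_(i < n) w i) ^+ N * \sum_(i < n) w i * x i ^+ N.+1.
Proof.
move=> w0 x0; set W := \sum_(i < n) w i; set X := \sum_(i < n) w i * x i.
have W0 : 0 <= W by exact: sumr_ge0.
have X0 : 0 <= X by apply: sumr_ge0 => i _; exact: mulr_ge0.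
have [We|Wn] := eqVneq W 0.
  have wi (i : 'I_n) : w i = 0.
    by move/eqP : We; rewrite psumr_eq0// => /allP/(_ i); rewrite mem_index_enum => /(_ isT)/eqP.
  rewrite [X](_ : _ = 0) ?expr0n; last by rewrite /X big1// => i _; rewrite wi mul0r.
  by rewrite mulr_ge0 ?exprn_ge0// sumr_ge0// => i _; rewrite mulr_ge0 ?exprn_ge0.
have Wp : 0 < W by rewrite lt_neqAle eq_sym Wn.
pose c := X / W; have c0 : 0 <= c by rewrite divr_ge0.
have : \sum_(i < n) w i * (c ^+ N.+1 + N.+1%:R * c ^+ N * (x i - c)) <=
    \sum_(i < n) w i * x i ^+ N.+1.
  by apply: ler_sum => i _; rewrite ler_wpM2l// pow_tangent.
rewrite [leLHS](_ : _ = W * c ^+ N.+1); last first.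
  transitivity (W * c ^+ N.+1 + N.+1%:R * c ^+ N * (X - W * c)).
    rewrite /W /X mulr_suml [in RHS]mulr_suml -sumrB mulr_sumr -big_split /=.
    by apply: eq_bigr => i _; ring.
  by rewrite /c mulrCA divff// mulr1 subrr mulr0 addr0.
move=> h; apply: le_trans (ler_wpM2l (exprn_ge0 N W0) h).
rewrite /c expr_div_n mulrA -exprSr mulrCA divff ?mulr1// expf_neq0//.
Qed.

(** From exp(y) >= y at y = (k+1) ln r / M, raised to the power M. *)
Lemma poly_exp_bound (r : R) M : 1 < r ->
  exists2 C : R, 0 <= C & forall k, k.+1%:R ^+ M <= C * r ^+ k.
Proof.
move=> r1; have r0 : 0 < r by exact: lt_trans r1.
pose L := ln r; have L0 : 0 < L by rewrite ln_gt0.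
have [->|M0] := posnP M.
  by exists 1 => // k; rewrite expr0 mul1r exprn_ege1// ltW.
have Mp : (0 : R) < M%:R by rewrite ltr0n.
exists (r * (M%:R / L) ^+ M).
  by rewrite mulr_ge0 ?exprn_ge0 ?divr_ge0 ?(ltW L0)// ltW.
move=> k; have : (k.+1%:R * L / M%:R) ^+ M <= r ^+ k.+1.
  have -> : r ^+ k.+1 = expR (k.+1%:R * L / M%:R) ^+ M.
    by rewrite -expRM_natr mulfVK ?gt_eqF// mulrC expRM_natr lnK// posrE.
  rewrite lerXn2r ?nnegrE ?expR_ge0// ?mulr_ge0 ?invr_ge0 ?(ltW L0) ?(ltW Mp)//.
  by apply: le_trans (expR_ge1Dx _); rewrite lerDr.
rewrite !exprMn => h.
have h2 : 0 <= (M%:R / L) ^+ M by rewrite exprn_ge0 ?divr_ge0 ?(ltW L0).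
have := ler_wpM2l h2 h; rewrite [leLHS](_ : _ = k.+1%:R ^+ M).
  by move/le_trans; apply; rewrite exprS -exprMn le_eqVlt; apply/orP; left; apply/eqP; ring.
by rewrite mulrC -!exprMn; congr (_ ^+ _); field; rewrite !gt_eqF.
Qed.

End PowerInequalities.

(** Each dyadic block of indices contributes at most 1. *)
Lemma harmonic_sum_le {R : realType} (b k : nat) : (b <= 2 ^ k)%N ->
  \sum_(i < b) (i.+1%:R : R)^-1 <= k.+1%:R.
Proof.
move=> bk; apply: (@le_trans _ _ (\sum_(0 <= i < 2 ^ k) (i.+1%:R : R)^-1)).
  rewrite -(big_mkord xpredT (fun i => (i.+1%:R : R)^-1)).
  by rewrite [leRHS](big_cat_nat (n := b))//= lerDl sumr_ge0.
elim: k {b bk} => [|k IH]; first by rewrite expn0 big_nat1 invr1.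
rewrite (big_cat_nat (n := 2 ^ k))//=; last by rewrite leq_exp2l.
rewrite -[k.+2%:R]natr1; apply: lerD => //.
apply: (@le_trans _ _ (\sum_(2 ^ k <= i < 2 ^ k.+1) (2 ^ k)%:R^-1)).
  rewrite big_nat_cond [leRHS]big_nat_cond; apply: ler_sum => i /andP[/andP[ki _] _].
  by rewrite lef_pV2 ?posrE ?ltr0n ?expn_gt0// ler_nat ltnW.
rewrite sumr_const_nat expnS mul2n -addnn addnK -[_ *+ _]mulr_natl divff//.
Qed.

(** * Even moments of partial sums by doubling *)

Section MomentBound.
Context (R : realType) dT (T : measurableType dT) (P : probability T R).
Context d2 (T2 : measurableType d2) (P2 : probability T2 R).
Variables (q : nat) (Cv K : R).
Hypotheses (Cv0 : 0 <= Cv) (K0 : 0 <= K).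
Let N := (2 * q).+4.
Let NE : N = (2 * q.+2)%N. Proof. by rewrite /N; lia. Qed.

(** [kappa] carries the size of the summands, while [Cv] and [K] are common to all of them; this is
    what makes the moment constant below uniform over orthant differences. *)
Definition short_range (S : nat -> T -> R) (D : nat -> T2 -> R) (kappa : R)
    (beta : nat -> R) :=
  [/\ splits P P2 S D, forall n, bmf (S n) /\ forall i, bmf (D i),
    forall n w, `|S n w| <= n%:R, forall i w, 0 <= D i w <= 2 &
    [/\ forall n, Ex P (S n) = 0,
     forall n, Ex P (fun w => S n w ^+ 2) <= n%:R * (kappa * Cv),
     forall i, Ex P2 (D i) <= kappa * beta i, forall i, 0 <= beta i &
     forall n, \sum_(i < n) i.+1%:R ^+ (2 * q).+2 * beta i <= K]].

Lemma dependence_moment (S : nat -> T -> R) D (kappa : R) beta k b (Delta : T2 -> R) :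
  0 <= kappa -> short_range S D kappa beta -> (b <= 2 ^ k)%N ->
  bmf Delta -> (forall w, `|Delta w| <= \sum_(i < b) D i w) ->
  Ex P2 (fun w => `|Delta w| ^+ N) <=
   k.+1%:R ^+ N.-1 * ((2 ^ k)%:R * (2 ^+ N.-1 * (kappa * K))).
Proof.
move=> k0 [_ bSD _ D2 [_ _ ED b0 sb]] bk bDelta leD.
have bD i : bmf (D i) by case: (bSD 0%N).
pose W : R := \sum_(i < b) i.+1%:R^-1.
have pw w : `|Delta w| ^+ N <= k.+1%:R ^+ N.-1 *
    \sum_(i < b) ((2 ^ k)%:R * (2 ^+ N.-1 * i.+1%:R ^+ (2 * q).+2)) * D i w.
  apply: (@le_trans _ _ ((\sum_(i < b) D i w) ^+ N)).
    by rewrite lerXn2r ?nnegrE//; apply: sumr_ge0 => i _; case/andP: (D2 i w).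
  (* Weights 1/(i+1) on the values (i+1) D_i: the total weight is a harmonic sum, at most k + 1. *)
  have := @power_mean R b (fun i => i.+1%:R^-1) (fun i => i.+1%:R * D i w) N.-1.
  rewrite (eq_bigr (fun i : 'I_b => D i w)); last by move=> i _; rewrite mulKf// pnatr_eq0.
  move=> /(_ (fun i => _) (fun i => _))/le_trans; apply; first by move=> i; rewrite invr_ge0.
    by move=> i; rewrite mulr_ge0//; case/andP: (D2 i w).
  have s0 : 0 <= \sum_(i < b) (i.+1%:R : R)^-1 by apply: sumr_ge0.
  apply: ler_pM; [exact: exprn_ge0| |by rewrite lerXn2r ?nnegrE//; exact: harmonic_sum_le|].
    by apply: sumr_ge0 => i _; rewrite mulr_ge0// exprn_ge0// mulr_ge0//; case/andP: (D2 i w).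
  apply: ler_sum => i _; have /andP[D0 D2i] := D2 i w.
  rewrite exprMn /= [leLHS]mulrA.
  have -> : (i.+1%:R : R)^-1 * i.+1%:R ^+ (2 * q).+4 = i.+1%:R * i.+1%:R ^+ (2 * q).+2.
    by rewrite exprS mulKf ?pnatr_eq0// exprS.
  (* One factor i + 1 is paid by the block length and D_i <= 2 reduces the power of D_i to one; the
     exponent 2q + 2 that remains is the one controlled by [K]. *)
  have h1 : (i.+1%:R : R) <= (2 ^ k)%:R by rewrite ler_nat; apply: leq_trans bk; exact: ltn_ord.
  have h2 : D i w ^+ (2 * q).+4 <= 2 ^+ (2 * q).+3 * D i w.
    by rewrite exprSr ler_wpM2r// lerXn2r// nnegrE.
  apply: le_trans (ler_wpM2l _ h2) _; first by rewrite mulr_ge0 ?exprn_ge0.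
  rewrite [leLHS]mulrA ler_wpM2r// -mulrA [_ * 2 ^+ _]mulrC ler_wpM2r//.
have bsum : bmf (fun w => \sum_(i < b) ((2 ^ k)%:R * (2 ^+ N.-1 * i.+1%:R ^+ (2 * q).+2)) * D i w).
  by apply: bmf_sum => i; apply: bmfM => //; exact: bmf_cst.
apply: le_trans (le_Ex _ _ _ pw) _; first by apply: bmfX; exact: bmf_norm.
  by apply: bmfM => //; exact: bmf_cst.
rewrite ExZ// ler_wpM2l ?exprn_ge0// Ex_sum; last by move=> i; apply: bmfM => //; exact: bmf_cst.
apply: (@le_trans _ _ (\sum_(i < b) ((2 ^ k)%:R * (2 ^+ N.-1 * kappa)) * (i.+1%:R ^+ (2 * q).+2 * beta i))).
  apply: ler_sum => i _; rewrite ExZ//.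
  apply: le_trans (ler_wpM2l _ (ED i)) _; first by nneg.
  by rewrite le_eqVlt; apply/orP; left; apply/eqP; ring.
rewrite -mulr_sumr -mulrA ler_wpM2l// -mulrA ler_wpM2l ?exprn_ge0//.
by rewrite ler_wpM2l.
Qed.

Lemma moment_step : exists2 C : R, 0 <= C &
  forall S D (kappa : R) beta, 0 <= kappa -> short_range S D kappa beta ->
  forall k m b, (m <= 2 ^ k)%N -> (b <= 2 ^ k)%N ->
  Ex P (fun w => S (m + b)%N w ^+ N) <=
   5%:R / 4%:R * (Ex P (fun w => S m w ^+ N) + Ex P (fun w => S b w ^+ N)) +
   C * ((2 ^ k)%:R * kappa) ^+ q.+2 + C * (k.+1%:R ^+ N.-1 * (2 ^ k)%:R * kappa).
Proof.
(* The factor 1 + e occurs twice, for absorbing the mixed terms and for replacing B' by B; with e =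
   1/10 the product 121/100 is below 5/4. *)
pose e : R := 10%:R^-1.
have e0 : 0 < e by rewrite invr_gt0.
have e0' : 0 <= e by exact: ltW.
have [Ce Ce0 HCe] := @normr_powD_eps R e N e0.
pose C1 : R := (2 ^ N)%:R * Cv.
have C10 : 0 <= C1 by rewrite mulr_ge0.
pose C2 := (1 + e) * (2 * (e^-1 ^+ q.+1 * C1 ^+ q.+2)).
pose C3 := Ce * (2 ^+ N.-1 * K).
have C20 : 0 <= C2.
  apply: mulr_ge0; first exact: addr_ge0.
  by apply: mulr_ge0 => //; apply: mulr_ge0; apply: exprn_ge0 => //; rewrite invr_ge0.
have C30 : 0 <= C3 by apply: mulr_ge0 => //; apply: mulr_ge0 => //; exact: exprn_ge0.
exists (C2 + C3); first exact: addr_ge0.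
move=> S D kappa beta k0 SR k m b mk bk.
have dm := @dependence_moment S D kappa beta k b _ k0 SR bk.
case: SR => sp bSD S1 D2 [ES vS ED b0 sb].
have bS n : bmf (S n) by case: (bSD n).
have [A [B [B' [bA bB bB' BB' [Hs Hi]]]]] := sp m b.
have cX n : continuous (fun x : R => x ^+ n) by exact: exprn_continuous.
have evN x : `|x| ^+ N = x ^+ N :> R by rewrite NE !exprM real_normK// num_real.
set Mm := Ex P (fun w => S m w ^+ N); set Mb := Ex P (fun w => S b w ^+ N).
set v := (2 ^ k)%:R * kappa.
have v0 : 0 <= v by rewrite mulr_ge0.
have vle n : (n <= 2 ^ k)%N -> Ex P (fun w => S n w ^+ 2) <= v * Cv.
  move=> nk; apply: le_trans (vS n) _; rewrite /v -mulrA ler_wpM2r ?mulr_ge0//.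
  by rewrite ler_nat.
have Hprod i j : Ex P2 (fun w => A w ^+ i * B' w ^+ j) =
    Ex P (fun w => S m w ^+ i) * Ex P (fun w => S b w ^+ j).
  exact: (Hi _ _ (@cX i) (@cX j)).
have bsq n i : bmf (fun w => S n w ^+ i) by exact: bmfX.
have young n : (n <= 2 ^ k)%N -> C1 * v * Ex P (fun w => S n w ^+ (2 * q).+2) <=
    e * Ex P (fun w => S n w ^+ N) + e^-1 ^+ q.+1 * (C1 ^+ q.+2 * v ^+ q.+2).
  move=> nk; have b1 c i : bmf (fun w => c * S n w ^+ i) by apply: bmfM => //; exact: bmf_cst.
  have b2 c : bmf (fun w => e * S n w ^+ N + c) by apply: bmfD => //; exact: bmf_cst.
  rewrite -ExZ//; apply: (@le_trans _ _ (Ex P (fun w => e * S n w ^+ N + e^-1 ^+ q.+1 * (C1 ^+ q.+2 * v ^+ q.+2)))); last first.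
    by rewrite ExD// ?ExZ// ?Ex_cst//; exact: bmf_cst.
  apply: le_Ex => //.
  move=> w; have := @young_pow R (C1 * v) (S n w) e q.+1; rewrite exprMn NE.
  by rewrite (_ : (2 * q.+1 = (2 * q).+2)%N); [apply => //; exact: mulr_ge0|lia].
have bAB : bmf (fun w => (A w + B' w) ^+ N) by apply: bmfX; exact: bmfD.
have EAB : Ex P2 (fun w => (A w + B' w) ^+ N) <= (1 + e) * (Mm + Mb) +
    2 * (e^-1 ^+ q.+1 * (C1 ^+ q.+2 * v ^+ q.+2)).
  have bm i j : bmf (fun w => A w ^+ i * B' w ^+ j) by apply: bmfM; exact: bmfX.
  have bc c i j : bmf (fun w => c * (A w ^+ i * B' w ^+ j)) by apply: bmfM => //; exact: bmf_cst.
  pose rhs w := (A w ^+ N * B' w ^+ 0 + A w ^+ 0 * B' w ^+ N) +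
    (N%:R * (A w ^+ 1 * B' w ^+ N.-1) + N%:R * (A w ^+ N.-1 * B' w ^+ 1)) +
    ((2 ^ N)%:R * (A w ^+ 2 * B' w ^+ (2 * q).+2) + (2 ^ N)%:R * (A w ^+ (2 * q).+2 * B' w ^+ 2)).
  have brhs : bmf rhs by do !apply: bmfD.
  apply: (@le_trans _ _ (Ex P2 rhs)).
    apply: le_Ex => // w; have := @exprD_le R (A w) (B' w) (2 * q)%N.
    rewrite oddM /= => /(_ isT)/le_trans; apply; rewrite /rhs !expr0 !expr1 mulr1 mul1r.
    by rewrite -!addrA -mulrDr.
  have b1 : bmf (fun w => A w ^+ N * B' w ^+ 0 + A w ^+ 0 * B' w ^+ N) by exact: bmfD.
  have b2 : bmf (fun w => N%:R * (A w ^+ 1 * B' w ^+ N.-1) + N%:R * (A w ^+ N.-1 * B' w ^+ 1)) by exact: bmfD.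
  have b3 : bmf (fun w => (2 ^ N)%:R * (A w ^+ 2 * B' w ^+ (2 * q).+2) + (2 ^ N)%:R * (A w ^+ (2 * q).+2 * B' w ^+ 2)) by exact: bmfD.
  rewrite /rhs ExD//; last exact: bmfD.
  rewrite ExD// [X in X + _ + _]ExD// [X in _ + X + _]ExD// [X in _ + _ + X]ExD//.
  rewrite !(ExZ _ _ (bm _ _)) !Hprod.
  have E0 n : Ex P (fun w => S n w ^+ 0) = 1.
    by rewrite -[RHS](Ex_cst P 1); apply: eq_Ex => w; rewrite expr0.
  have E1 n : Ex P (fun w => S n w ^+ 1) = 0.
    by rewrite -[RHS](ES n); apply: eq_Ex => w; rewrite expr1.
  rewrite !E0 !E1 mulr1 mul1r mulr0 mul0r !mulr0 !addr0 -/Mm -/Mb.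
  have q0 n : 0 <= Ex P (fun w => S n w ^+ (2 * q).+2).
    by apply: Ex_ge0 => w; rewrite exprn_even_ge0//= oddM.
  have t1 : (2 ^ N)%:R * (Ex P (fun w => S m w ^+ 2) * Ex P (fun w => S b w ^+ (2 * q).+2)) <=
     e * Mb + e^-1 ^+ q.+1 * (C1 ^+ q.+2 * v ^+ q.+2).
    apply: le_trans (young b bk); rewrite mulrA ler_wpM2r// /C1 -mulrA ler_wpM2l//.
    by rewrite mulrC; exact: vle.
  have t2 : (2 ^ N)%:R * (Ex P (fun w => S m w ^+ (2 * q).+2) * Ex P (fun w => S b w ^+ 2)) <=
     e * Mm + e^-1 ^+ q.+1 * (C1 ^+ q.+2 * v ^+ q.+2).
    apply: le_trans (young m mk); rewrite [X in _ * X]mulrC mulrA ler_wpM2r// /C1 -mulrA ler_wpM2l//.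
    by rewrite mulrC; exact: vle.
  move: t1 t2; set x := e^-1 ^+ _ * _; set y1 := _%:R * _; set y2 := _%:R * _.
  by move=> t1 t2; nra.
rewrite (Hs _ (@cX N)).
have bDel : bmf (fun w => B w - B' w) by exact: bmfB.
apply: (@le_trans _ _ ((1 + e) * Ex P2 (fun w => (A w + B' w) ^+ N) +
    Ce * Ex P2 (fun w => `|B w - B' w| ^+ N))).
  have bN : bmf (fun w => `|B w - B' w| ^+ N) by apply: bmfX; exact: bmf_norm.
  rewrite -!ExZ// -ExD//; [|by apply: bmfM => //; exact: bmf_cst|by apply: bmfM => //; exact: bmf_cst].
  apply: le_Ex; first by apply: bmfX; exact: bmfD.
    by apply: bmfD; apply: bmfM => //; exact: bmf_cst.
  move=> w; have := HCe (A w + B' w) (B w - B' w); rewrite !evN.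
  by rewrite (_ : A w + B' w + (B w - B' w) = A w + B w)//; ring.
apply: le_trans (lerD (ler_wpM2l _ EAB) (ler_wpM2l Ce0 (dm _ bDel BB'))) _.
  by rewrite addr_ge0// ltW.
have M0 n : 0 <= Ex P (fun w => S n w ^+ N).
  by apply: Ex_ge0 => w; rewrite NE exprM exprn_ge0// sqr_ge0.
have Mm0 : 0 <= Mm := M0 m; have Mb0 : 0 <= Mb := M0 b.
have v2 : 0 <= v ^+ q.+2 by rewrite exprn_ge0.
pose z := k.+1%:R ^+ N.-1 * (2 ^ k)%:R * kappa.
have z0 : 0 <= z by rewrite /z; nneg.
rewrite -/z mulrDr (_ : (1 + e) * (2 * _) = C2 * v ^+ q.+2); last by rewrite /C2; ring.
rewrite [X in _ + X](_ : _ = C3 * z); last by rewrite /C3 /z; ring.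
have h1 : (1 + e) * ((1 + e) * (Mm + Mb)) <= 5 / 4 * (Mm + Mb).
  by rewrite mulrA ler_wpM2r ?addr_ge0// /e; lra.
have h2 : C2 * v ^+ q.+2 <= (C2 + C3) * v ^+ q.+2 by rewrite ler_wpM2r// lerDl.
have h3 : C3 * z <= (C2 + C3) * z by rewrite ler_wpM2r// lerDr.
by rewrite !lerD.
Qed.

(** The recursion closes because one doubling multiplies both terms by 2 * 5/4 = 5/2, while the
    claimed bound gains a factor of at least 4 on the first and of 3 on the second. The slack
    absorbs the additive errors, which determines the size of [C]. *)
Lemma moment_bound : exists2 C : R, 0 <= C &
  forall S D (kappa : R) beta, 0 <= kappa -> short_range S D kappa beta ->
  forall k n, (n <= 2 ^ k)%N ->
  Ex P (fun w => S n w ^+ (2 * q.+2)) <=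
   C * (((2 ^ k)%:R * kappa) ^+ q.+2 + 3 ^+ k * kappa).
Proof.
have [C1 C10 step] := moment_step.
(* Any power of k + 1 is beaten by (3/2)^k, so 2^k times that power is O(3^k). *)
have [C2 C20 pe] := @poly_exp_bound R (3 / 2) N.-1 ltac:(lra).
pose C := Num.max Cv (2 * C1 + 2 * C1 * C2).
have CCv : Cv <= C by rewrite le_max lexx.
have C12 : 2 * C1 + 2 * C1 * C2 <= C by rewrite le_max lexx orbT.
have CC1 : 0 <= C1 * C2 by rewrite mulr_ge0.
have C0 : 0 <= C by apply: le_trans CCv.
exists C => // S D kappa beta k0 SR; rewrite -NE; elim => [|k IH] n nk.
  case: SR => _ bSD S1 _ [_ vS _ _ _]; have bS : bmf (S n) by case: (bSD n).
  (* For n <= 1 the sum is at most 1 in absolute value, so its top moment is below its variance. *)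
  rewrite expn0 in nk; apply: (@le_trans _ _ (Ex P (fun w => S n w ^+ 2))).
    apply: le_Ex; [exact: bmfX|exact: bmfX|] => w.
    rewrite NE mulnS exprD exprM; apply: ler_piMr; first exact: sqr_ge0.
    rewrite exprn_ile1 ?sqr_ge0// -real_normK ?num_real// exprn_ile1//.
    by rewrite (le_trans (S1 n w))// lern1.
  apply: le_trans (vS n) _; have -> : (2 ^ 0)%:R * kappa = kappa by rewrite expn0 mul1r.
  apply: (@le_trans _ _ (kappa * Cv)); first by rewrite ler_piMl ?mulr_ge0// lern1.
  by rewrite mulrC; apply: ler_pM => //; rewrite lerDr exprn_ge0.
have [m [b [-> mk bk]]] : exists m b, [/\ n = (m + b)%N, (m <= 2 ^ k)%N & (b <= 2 ^ k)%N].
  exists (minn n (2 ^ k)), (n - minn n (2 ^ k))%N; rewrite expnS in nk.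
  by split; [lia|exact: geq_minr|lia].
apply: le_trans (step S D kappa beta k0 SR k m b mk bk) _.
have := IH m mk; have := IH b bk.
set Mm := Ex P _; set Mb := Ex P _ => IHb IHm.
set x := ((2 ^ k)%:R * kappa) ^+ q.+2; pose y : R := 3 ^+ k * kappa.
have x0 : 0 <= x by rewrite exprn_ge0// mulr_ge0.
have y0 : 0 <= y by rewrite mulr_ge0 ?exprn_ge0.
have hx : 4 * x <= ((2 ^ k.+1)%:R * kappa) ^+ q.+2.
  rewrite expnS natrM -mulrA exprMn -/x ler_wpM2r//.
  by rewrite -natrX ler_nat; exact: (@leq_pexp2l 2 2 q.+2).
have hz : k.+1%:R ^+ N.-1 * (2 ^ k)%:R * kappa <= C2 * y.
  rewrite /y mulrA ler_wpM2r//; apply: le_trans (ler_wpM2r _ (pe k)) _ => //.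
  rewrite -mulrA ler_wpM2l// natrX -exprMn lerXn2r ?nnegrE//.
  by rewrite -mulrA mulVf ?mulr1// pnatr_eq0.
rewrite (_ : 3 ^+ k.+1 * kappa = 3 * y); last by rewrite /y exprS mulrA.
have hz' := ler_wpM2l C10 hz.
have cx : 0 <= (C - 2 * C1 - 2 * C1 * C2) * x by rewrite mulr_ge0//; lra.
have cy : 0 <= (C - 2 * C1 - 2 * C1 * C2) * y by rewrite mulr_ge0//; lra.
have hC := ler_wpM2l C0 hx.
rewrite -/x -/y in IHb IHm.
have p1 : 0 <= C1 * x by rewrite mulr_ge0. 
have p2 : 0 <= C1 * y by rewrite mulr_ge0. 
have p3 : 0 <= C1 * C2 * x by rewrite mulr_ge0. 
have p4 : 0 <= C1 * C2 * y by rewrite mulr_ge0. 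
have p5 : 0 <= C * y by rewrite mulr_ge0. 
have p6 : 0 <= C * x by rewrite mulr_ge0. 
have e1 : C * (x + y) = C * x + C * y by rewrite mulrDr.
rewrite !e1 in IHb IHm.
set X' := (_ ^+ _) in hx hC *; set Z := C1 * (k.+1%:R ^+ _ * _ * _) in hz' *.
have e2 : C * (X' + 3 * y) = C * X' + 3 * (C * y) by ring.
rewrite e2.
have e3 : (C - 2 * C1 - 2 * C1 * C2) * x = C * x - 2 * (C1 * x) - 2 * (C1 * C2 * x) by ring.
have e4 : (C - 2 * C1 - 2 * C1 * C2) * y = C * y - 2 * (C1 * y) - 2 * (C1 * C2 * y) by ring.
have e5 : C * (4 * x) = 4 * (C * x) by ring.
have e6 : C1 * (C2 * y) = C1 * C2 * y by ring.
rewrite e3 in cx; rewrite e4 in cy; rewrite e5 in hC; rewrite e6 in hz'.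
by clearbody Z X' Mm Mb x y; lra.
Qed.
End MomentBound.

(** * Central limit theorem *)

Section TrigBounds.
Context {R : realType}.
Implicit Types x y : R.

Lemma mvt_le (f df : R -> R) (M x : R) : (forall z : R, is_derive z (1 : R) f (df z)) ->
  0 <= x -> (forall z, 0 <= z <= x -> `|df z| <= M) -> `|f x - f 0| <= M * x.
Proof.
move=> fd; rewrite le_eqVlt => /predU1P[<- _|x0 dM].
  by rewrite subrr normr0 mulr0.
have der z : z \in `]0, x[%R -> is_derive z 1 f (df z) by move=> _; exact: fd.
have con : {within `[0, x], continuous f}.
  by apply: derivable_within_continuous => z _; case: (fd z).
have [c + ->] := MVT x0 der con; rewrite in_itv/= => /andP[c0 cx].
by rewrite subr0 normrM (gtr0_norm x0) ler_wpM2r ?(ltW x0)// dM// !ltW.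
Qed.

Lemma normr_sin_le x : `|sin x| <= `|x|.
Proof.
wlog x0 : x / 0 <= x.
  move=> H; have [/H//|/ltW x0] := leP 0 x.
  by have := H (- x); rewrite oppr_ge0 sinN !normrN; exact.
have := @mvt_le sin cos 1 x (fun z => is_derive_sin z) x0.
rewrite sin0 subr0 mul1r (ger0_norm x0); apply => z _.
by rewrite ler_norml cos_geN1 cos_le1.
Qed.

Lemma onem_cosE x : 1 - cos x = 2 * sin (x / 2) ^+ 2.
Proof.
rewrite {1}(_ : x = (x / 2) + (x / 2)); last by field.
rewrite cosD -!expr2; have := cos2Dsin2 (x / 2); lra.
Qed.

Lemma onem_cos_le x : 0 <= 1 - cos x <= x ^+ 2 / 2.
Proof.
rewrite onem_cosE mulr_ge0 ?sqr_ge0//=.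
have : sin (x / 2) ^+ 2 <= (x / 2) ^+ 2.
  by rewrite -real_normK ?num_real// -[leRHS]real_normK ?num_real// lerXn2r ?nnegrE// normr_sin_le.
by rewrite expr_div_n; lra.
Qed.

Lemma sin_approx x : `|x - sin x| <= `|x| ^+ 3 / 2.
Proof.
wlog x0 : x / 0 <= x.
  move=> H; have [/H//|/ltW x0] := leP 0 x.
  by have := H (- x); rewrite oppr_ge0 sinN opprK -opprB !normrN addrC; exact.
have := @mvt_le (fun z => z - sin z) (fun z => 1 - cos z) (x ^+ 2 / 2) x
  (fun z => is_deriveB (is_derive_id z 1) (is_derive_sin z)) x0.
rewrite sin0 !subr0 (ger0_norm x0) => H; apply: le_trans (H _) _ => [z /andP[z0 zx]|].
  have /andP[h0 h1] := onem_cos_le z; rewrite ger0_norm//; apply: le_trans h1 _.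
  by rewrite ler_pM2r// lerXn2r// nnegrE.
by rewrite le_eqVlt; apply/orP; left; apply/eqP; field.
Qed.

(** By 1 - cos x = 2 sin(x/2)^2 the error is 2 (z - sin z)(z + sin z) with z = x/2, which reduces
    the fourth-order bound to the cubic one for the sine. *)
Lemma cos_approx x : `|cos x - 1 + x ^+ 2 / 2| <= x ^+ 4 / 8.
Proof.
set z := x / 2.
rewrite (_ : cos x - 1 + x ^+ 2 / 2 = 2 * ((z - sin z) * (z + sin z))); last first.
  have := onem_cosE x; rewrite -/z => h.
  transitivity (x ^+ 2 / 2 - 2 * sin z ^+ 2); first by rewrite -h; ring.
  by rewrite /z; field.
rewrite normrM normrM ger0_norm//.
have h1 := sin_approx z; have h2 : `|z + sin z| <= 2 * `|z|.
  by apply: le_trans (ler_normD _ _) _; have := normr_sin_le z; lra.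
apply: (@le_trans _ _ (2 * ((`|z| ^+ 3 / 2) * (2 * `|z|)))).
  by rewrite ler_pM2l// ler_pM.
rewrite [leLHS](_ : _ = 2 * (`|z| ^+ 4)); last by field.
have -> : `|z| ^+ 4 = z ^+ 4 by rewrite !(exprM _ 2 2) real_normK// num_real.
by rewrite /z le_eqVlt; apply/orP; left; apply/eqP; field.
Qed.

Lemma cos_dist x y : `|cos x - cos y| <= `|x - y|.
Proof.
set a := (x + y) / 2; set b := (x - y) / 2.
rewrite (_ : cos x = cos (a + b)); last by congr cos; rewrite /a /b; field.
rewrite (_ : cos y = cos (a - b)); last by congr cos; rewrite /a /b; field.
rewrite cosD cosB (_ : _ - _ = - (2 * (sin a * sin b))); last by ring.
rewrite normrN normrM ger0_norm// normrM.
have h : `|sin b| <= `|b| by exact: normr_sin_le.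
have sa : `|sin a| <= 1 by rewrite ler_norml sin_geN1 sin_le1.
apply: (@le_trans _ _ (2 * (1 * `|b|))); first by rewrite ler_pM2l// ler_pM.
by rewrite mul1r /b normrM normfV [`|2|]ger0_norm// mulrC divfK.
Qed.

Lemma expRN_approx x : 0 <= x -> `|expR (- x) - 1 + x| <= x ^+ 2.
Proof.
move=> x0; have := expR_ge1Dx (- x) => h1; rewrite ger0_norm; last by lra.
have h2 : (1 + x) * expR (- x) <= 1.
  apply: (@le_trans _ _ (expR x * expR (- x))); last by rewrite expRxMexpNx_1.
  by rewrite ler_wpM2r ?expR_ge0// expR_ge1Dx.
have h3 := expR_ge0 (- x).
have h4 : 0 <= x * (expR (- x) - 1 + x) by rewrite mulr_ge0//; lra.
by nra.
Qed.

End TrigBounds.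

Lemma cvg_divn {R : realType} (k : nat) : (0 < k)%N ->
  ((n %/ k)%:R / n%:R : R) @[n --> \oo] --> (k%:R^-1 : R).
Proof.
move=> k0; apply/cvgrPdist_le => e e0; near=> n.
have n0 : (0 < n)%N by near: n; exists 1%N.
have n0' : (0 : R) < n%:R by rewrite ltr0n.
have k0' : (0 : R) < k%:R by rewrite ltr0n.
have en : e^-1 <= n%:R by near: n; exact: nbhs_infty_ger.
apply: (@le_trans _ _ (n%:R^-1)); last by rewrite -[e]invrK lef_pV2 ?posrE ?invr_gt0.
have h : `|n%:R - (n %/ k)%:R * k%:R| <= k%:R :> R.
  rewrite {1}(divn_eq n k) natrD natrM addrAC subrr add0r ger0_norm//.
  by rewrite ler_nat ltnW// ltn_mod.
rewrite (_ : k%:R^-1 - _ = (n%:R - (n %/ k)%:R * k%:R) / (n%:R * k%:R)); last first.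
  by field; rewrite !gt_eqF.
rewrite normrM normfV [`|n%:R * _|]gtr0_norm ?mulr_gt0// ler_pdivrMr ?mulr_gt0//.
by rewrite mulrA mulVf ?gt_eqF// mul1r.
Unshelve. all: by end_near. Qed.

(** * Central limit theorem by blocks, for cosines with a phase *)

Section CentralLimit.
Context (R : realType) dT (T : measurableType dT) (P : probability T R).
Context d2 (T2 : measurableType d2) (P2 : probability T2 R).
Variables (Cv K : R) (S : nat -> T -> R) (D : nat -> T2 -> R) (kappa : R) (beta : nat -> R).
Hypotheses (Cv0 : 0 <= Cv) (K0 : 0 <= K) (kappa0 : 0 <= kappa).
Hypothesis SR : short_range P P2 0 Cv K S D kappa beta.

Let L := kappa * K.
Let L0 : 0 <= L. Proof. exact: mulr_ge0. Qed.
Let bS n : bmf (S n). Proof. by case: SR => _ h _ _ _; case: (h n). Qed.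
Let bD i : bmf (D i). Proof. by case: SR => _ h _ _ _; case: (h 0%N). Qed.

Let sum_D b : Ex P2 (fun w => \sum_(i < b) D i w) <= L.
Proof.
case: SR => _ _ _ _ [_ _ ED b0 sb]; rewrite Ex_sum//.
apply: (@le_trans _ _ (\sum_(i < b) kappa * beta i)); first by apply: ler_sum.
rewrite -mulr_sumr ler_wpM2l//; apply: le_trans (sb b).
by apply: ler_sum => i _; rewrite ler_peMl// exprn_ege1// ler1n.
Qed.

(** Once the late block is decoupled, the addition formula factorizes: the cosine of the block is
    replaced by a number [x], and its sine is small because the block is centered. [u * L] is the
    cost of decoupling. *)
Lemma cos_split (m b : nat) (c u x : R) : 0 <= u ->
  `|Ex P (fun w => cos (u * S (m + b)%N w + c)) - x * Ex P (fun w => cos (u * S m w + c))| <=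
  u * L + `|Ex P (fun w => cos (u * S b w)) - x| + `|Ex P (fun w => sin (u * S b w))|.
Proof.
move=> u0; case: SR => sp _ _ _ _.
have [A [B [B' [bA bB bB' BB' [Hs Hi]]]]] := sp m b.
have lin (c' : R) : continuous (fun y : R => u * y + c').
  by move=> y; apply: cvgD; [apply: cvgMr; exact: cvg_id|exact: cvg_cst].
have ccos (c' : R) : continuous (fun y : R => cos (u * y + c')).
  by move=> y; apply: continuous_comp; [exact: lin|exact: continuous_cos].
have csin (c' : R) : continuous (fun y : R => sin (u * y + c')).
  by move=> y; apply: continuous_comp; [exact: lin|exact: continuous_sin].
have ccos0 : continuous (fun y : R => cos (u * y)).
  by move=> y; apply: continuous_comp; [apply: cvgMr; exact: cvg_id|exact: continuous_cos].
have csin0 : continuous (fun y : R => sin (u * y)).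
  by move=> y; apply: continuous_comp; [apply: cvgMr; exact: cvg_id|exact: continuous_sin].
rewrite (Hs _ (ccos c)).
have mlin (d : measure_display) (U : measurableType d) (f : U -> R) c' :
    bmf f -> measurable_fun setT (fun w => u * f w + c').
  by move=> bf; apply: bmf_meas; apply: bmfD; [apply: bmfM => //|]; exact: bmf_cst.
have mlin0 (d : measure_display) (U : measurableType d) (f : U -> R) :
    bmf f -> measurable_fun setT (fun w => u * f w).
  by move=> bf; apply: bmf_meas; apply: bmfM => //; exact: bmf_cst.
have e1 : Ex P2 (fun w => cos (u * (A w + B' w) + c)) =
    Ex P (fun w => cos (u * S m w + c)) * Ex P (fun w => cos (u * S b w)) -
    Ex P (fun w => sin (u * S m w + c)) * Ex P (fun w => sin (u * S b w)).
  rewrite -(Hi _ _ (ccos c) ccos0) -(Hi _ _ (csin c) csin0) -ExB; [|by apply: bmfM; apply: bmf_cos; [exact: mlin|exact: mlin0]|by apply: bmfM; apply: bmf_sin; [exact: mlin|exact: mlin0]].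
  by apply: eq_Ex => w; rewrite -cosD; congr cos; ring.
have e2 : `|Ex P2 (fun w => cos (u * (A w + B w) + c)) - Ex P2 (fun w => cos (u * (A w + B' w) + c))| <= u * L.
{  apply: le_trans (_ : Ex P2 (fun w => u * \sum_(i < b) D i w) <= _); last first.
    by rewrite ExZ ?ler_wpM2l//; exact: bmf_sum.
  apply: Ex_dist.
  - by apply: bmf_cos; apply: mlin; exact: bmfD.
  - by apply: bmf_cos; apply: mlin; exact: bmfD.
  - by apply: bmfM; [exact: bmf_cst|exact: bmf_sum].
  - move=> w; apply: le_trans (cos_dist _ _) _.
    rewrite (_ : _ - _ = u * (B w - B' w)); last by ring.
    by rewrite normrM (ger0_norm u0) ler_wpM2l. }
have n1 : `|Ex P (fun w => cos (u * S m w + c))| <= 1.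
  apply: Ex_le_norm; first by apply: bmf_cos; exact: mlin.
  by move=> w; rewrite ler_norml cos_geN1 cos_le1.
have n2 : `|Ex P (fun w => sin (u * S m w + c))| <= 1.
  apply: Ex_le_norm; first by apply: bmf_sin; exact: mlin.
  by move=> w; rewrite ler_norml sin_geN1 sin_le1.
rewrite e1 in e2; move: e2 n1 n2.
set a := Ex P2 _; set p := Ex P _; set r := Ex P _; set p' := Ex P _; set r' := Ex P _.
move=> e2 n1 n2.
rewrite (_ : a - x * p = (a - (p * r - p' * r')) + (r - x) * p - p' * r'); last by ring.
apply: le_trans (ler_normB _ _) _; apply: lerD; last first.
  by rewrite normrM ler_piMl.
apply: le_trans (ler_normD _ _) _; apply: lerD => //.
by rewrite normrM ler_piMr.
Qed.

Variable s2 : R.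
Hypothesis s20 : 0 <= s2.
Hypothesis var_cvg : Ex P (fun w => S n w ^+ 2) / n%:R @[n --> \oo] --> s2.

(** The moment bound at [q] = 0, where 3^k is below (2^k)^2, so both terms are of order n^2. *)
Lemma fourth_moment : exists2 C : R, 0 <= C &
  forall n, Ex P (fun w => S n w ^+ 4) <= C * n%:R ^+ 2.
Proof.
have [C C0 H] := moment_bound P P2 0 Cv0 K0.
exists (C * (4 * kappa ^+ 2 + 4 * kappa)); first by nneg.
move=> [|n].
  case: SR => _ _ S1 _ _; rewrite (_ : Ex _ _ = 0) ?expr0n ?mulr0//.
  rewrite -[RHS](Ex_cst P 0); apply: eq_Ex => w; have := S1 0%N w.
  by rewrite normr_le0 => /eqP ->; rewrite expr0n.
pose k := up_log 2 n.+1.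
have nk : (n.+1 <= 2 ^ k)%N by exact: up_logP.
have kn : (2 ^ k <= 2 * n.+1)%N.
  rewrite /k; case: n {k nk} => [|n]; first by rewrite up_log1.
  have := @up_log_bounds 2 n.+2 isT isT => /andP[h _].
  have k0 : (0 < up_log 2 n.+2)%N by rewrite up_log_gt0.
  by rewrite -(prednK k0) expnS leq_mul2l/= ltnW.
apply: le_trans (H S D kappa beta kappa0 SR k n.+1 nk) _.
rewrite -mulrA ler_wpM2l//; have kn' : ((2 ^ k)%:R : R) <= 2 * n.+1%:R by rewrite -natrM ler_nat.
have h4 : ((2 ^ k)%:R : R) ^+ 2 <= 4 * n.+1%:R ^+ 2.
  apply: (@le_trans _ _ ((2 * n.+1%:R) ^+ 2)); first by apply: lerXn2r => //; rewrite nnegrE; nneg.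
  by rewrite le_eqVlt; apply/orP; left; apply/eqP; ring.
have h3 : (3 : R) ^+ k <= (2 ^ k)%:R ^+ 2.
  rewrite natrX exprAC; apply: lerXn2r; rewrite ?nnegrE//.
  by rewrite -natrX ler_nat.
have h5 := ler_wpM2r (sqr_ge0 kappa) h4; have h6 := ler_wpM2r kappa0 (le_trans h3 h4).
by rewrite exprMn; lra.
Qed.

(** Blocks so short that u^2 b <= 1/j^2 have an error of order j^-3. The number of blocks will be of
    order j^2, so the total error is O(1/j). *)
Lemma block_estimate (C4 : R) (b : nat) (u : R) (j : nat) : (0 < j)%N ->
  0 <= u -> (forall n, Ex P (fun w => S n w ^+ 4) <= C4 * n%:R ^+ 2) ->
  0 <= C4 -> u ^+ 2 * b%:R <= (j ^ 2)%:R^-1 ->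
  `|Ex P (fun w => cos (u * S b w)) - (1 - u ^+ 2 * Ex P (fun w => S b w ^+ 2) / 2)|
   + `|Ex P (fun w => sin (u * S b w))| <= (C4 + kappa * Cv + C4) / (j ^ 3)%:R.
Proof.
move=> j0 u0 m4 C40 ub.
case: SR => _ _ _ _ [ES vS _ _ _].
have jp : (0 : R) < j%:R by rewrite ltr0n.
have bc : bmf (fun w => cos (u * S b w)) by apply: bmf_cos; apply: (bmf_meas (bmfM (bmf_cst _ u) (bS b))).
have bs : bmf (fun w => sin (u * S b w)) by apply: bmf_sin; apply: (bmf_meas (bmfM (bmf_cst _ u) (bS b))).
have bX i : bmf (fun w => S b w ^+ i) by exact: bmfX.
have bZ c i : bmf (fun w => c * S b w ^+ i) by apply: bmfM => //; exact: bmf_cst.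
have bq c : bmf (fun w => 1 - c * S b w ^+ 2) by apply: bmfB => //; exact: bmf_cst.
have E4 : u ^+ 4 * Ex P (fun w => S b w ^+ 4) <= C4 / (j ^ 4)%:R.
  apply: (@le_trans _ _ (C4 * (u ^+ 2 * b%:R) ^+ 2)).
    rewrite exprMn -exprM mulrCA; apply: ler_wpM2l (m4 b); exact: exprn_ge0.
  rewrite ler_wpM2l// (_ : (j ^ 4)%:R^-1 = ((j ^ 2)%:R^-1) ^+ 2 :> R); last first.
    by rewrite exprVn -natrX -expnM.
  by apply: lerXn2r; rewrite ?nnegrE//; nneg.
have E2 : u ^+ 2 * Ex P (fun w => S b w ^+ 2) <= kappa * Cv / (j ^ 2)%:R.
  apply: (@le_trans _ _ (kappa * Cv * (u ^+ 2 * b%:R))).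
    rewrite mulrCA; apply: ler_wpM2l; first exact: exprn_ge0.
    by rewrite mulrC; exact: vS.
  by apply: ler_wpM2l => //; exact: mulr_ge0.
have t1 : `|Ex P (fun w => cos (u * S b w)) - (1 - u ^+ 2 * Ex P (fun w => S b w ^+ 2) / 2)| <= C4 / (j ^ 4)%:R.
  apply: le_trans E4; rewrite (_ : 1 - _ = Ex P (fun w => 1 - (u ^+ 2 / 2) * S b w ^+ 2)); last first.
    by rewrite ExB//; [rewrite Ex_cst ExZ//; ring|exact: bmf_cst].
  rewrite -ExZ//; apply: Ex_dist => // w.
  have := cos_approx (u * S b w); rewrite !exprMn => h.
  rewrite (_ : _ - _ = cos (u * S b w) - 1 + u ^+ 2 * S b w ^+ 2 / 2); last by ring.
  apply: le_trans h _.
  have : 0 <= u ^+ 4 * S b w ^+ 4 by rewrite mulr_ge0 ?(exprM _ 2 2) ?sqr_ge0.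
  by lra.
(* The cubic error of the sine is split between second and fourth moments with weight 1/j: 2 |y|^3
   <= y^2 / j + j y^4. *)
have t2 : `|Ex P (fun w => sin (u * S b w))| <= (kappa * Cv / (j ^ 2)%:R) / j%:R + (C4 / (j ^ 4)%:R) * j%:R.
  have -> : Ex P (fun w => sin (u * S b w)) = Ex P (fun w => sin (u * S b w)) - Ex P (fun w => u * S b w ^+ 1).
    by rewrite ExZ// (_ : Ex P (fun w => S b w ^+ 1) = 0) ?mulr0 ?subr0// -(ES b); apply: eq_Ex => w; rewrite expr1.
  apply: (@le_trans _ _ (Ex P (fun w => (u ^+ 2 / j%:R) * S b w ^+ 2 + (u ^+ 4 * j%:R) * S b w ^+ 4))); last first.
    rewrite ExD// !ExZ// mulrAC [X in _ + X]mulrAC; apply: lerD.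
      by rewrite ler_pM2r ?invr_gt0.
    by rewrite ler_pM2r.
  apply: Ex_dist => //; first exact: bmfD.
  move=> w; set y := u * S b w.
  rewrite (_ : u ^+ 2 / j%:R * S b w ^+ 2 + u ^+ 4 * j%:R * S b w ^+ 4 = y ^+ 2 / j%:R + y ^+ 4 * j%:R); last first.
    by rewrite /y; ring.
  rewrite distrC; apply: le_trans (sin_approx y) _.
  have y4 : y ^+ 4 = `|y| ^+ 4 by rewrite !(exprM _ 2 2) real_normK// num_real.
  have y2 : y ^+ 2 = `|y| ^+ 2 by rewrite real_normK// num_real.
  rewrite y4 y2; have : 0 <= (`|y| / j%:R - `|y| ^+ 2) ^+ 2 by exact: sqr_ge0.
  have a0 : 0 <= `|y| ^+ 3 by exact: exprn_ge0.
  have h : (`|y| / j%:R - `|y| ^+ 2) ^+ 2 * j%:R = `|y| ^+ 2 / j%:R + `|y| ^+ 4 * j%:R - 2 * `|y| ^+ 3.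
    by field; rewrite gt_eqF.
  move=> h0; have : 0 <= (`|y| / j%:R - `|y| ^+ 2) ^+ 2 * j%:R by exact: mulr_ge0.
  by rewrite h; lra.
apply: le_trans (lerD t1 t2) _.
have j1 : (1 : R) <= j%:R by rewrite ler1n.
have e4 : C4 / (j ^ 4)%:R <= C4 / (j ^ 3)%:R.
  by rewrite ler_wpM2l// lef_pV2 ?posrE ?ltr0n ?expn_gt0 ?j0// ler_nat leq_pexp2l.
rewrite !mulrDl -!addrA; apply: lerD => //; rewrite !natrX.
by rewrite le_eqVlt; apply/orP; left; apply/eqP; field; rewrite gt_eqF.
Qed.

Let mean_cos (n : nat) (u c : R) := Ex P (fun w => cos (u * S n w + c)).

(** The errors of the successive blocks add up without amplification because 0 <= x <= 1. *)
Lemma cos_blocks (b : nat) (u c x err : R) (k : nat) : 0 <= u -> 0 <= x <= 1 ->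
  (forall m, `|mean_cos (m + b) u c - x * mean_cos m u c| <= err) ->
  `|mean_cos (k * b) u c - x ^+ k * cos c| <= k%:R * err.
Proof.
move=> u0 /andP[x0 x1] H; elim: k => [|k IH].
  rewrite mul0n expr0 !mul1r mul0r (_ : mean_cos 0 u c = cos c) ?subrr ?normr0//.
  rewrite -[RHS](Ex_cst P); apply: eq_Ex => w; case: SR => _ _ S1 _ _; have := S1 0%N w.
  by rewrite normr_le0 => /eqP ->; rewrite mulr0 add0r.
rewrite mulSn addnC -natr1 mulrDl mul1r.
rewrite (_ : _ - _ = (mean_cos (k * b + b) u c - x * mean_cos (k * b) u c) +
  x * (mean_cos (k * b) u c - x ^+ k * cos c)); last by rewrite exprS; ring.
apply: le_trans (ler_normD _ _) _; rewrite addrC; apply: lerD => //.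
by rewrite normrM (ger0_norm x0); apply: le_trans IH; rewrite ler_piMl.
Qed.

Lemma cos_clt (lam c : R) : 0 <= lam ->
  Ex P (fun w => cos (lam / Num.sqrt n%:R * S n w + c)) @[n --> \oo] --> expR (- (lam ^+ 2 * s2 / 2)) * cos c.
Proof.
move=> lam0; pose l2 := lam ^+ 2 * s2; have l20 : 0 <= l2 by rewrite mulr_ge0// sqr_ge0.
pose A := (Num.truncn (lam ^+ 2)).+1; have lamA : lam ^+ 2 <= A%:R by apply/ltW; exact: truncnS_gt.
have A1 : (1 : R) <= A%:R by rewrite ler1n.
have [C4 C40 m4] := fourth_moment.
pose C := 2 + l2 ^+ 2 + A%:R * (C4 + kappa * Cv + C4) + 1.
have C0 : 0 < C by rewrite /C ltr_wpDl//; nneg.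
apply/cvgrPdist_le => e e0.
pose j := (Num.truncn (C / e)).+1.
have j0 : (0 < j)%N by [].
have jp : (0 : R) < j%:R by rewrite ltr0n.
have Cj : C / j%:R <= e.
  rewrite ler_pdivrMr// mulrC -ler_pdivrMr//; apply/ltW; exact: truncnS_gt.
(* The number of blocks; since A >= lam^2, blocks of length n / k satisfy u^2 b <= 1/j^2. *)
pose k := (A * j ^ 2)%N; have k0 : (0 < k)%N by rewrite muln_gt0 expn_gt0.
have kp : (0 : R) < k%:R by rewrite ltr0n.
pose v n : R := (Num.sqrt n%:R)^-1; pose u n := lam * v n.
have v_cvg : v n @[n --> \oo] --> (0 : R).
  apply/cvgr0Pnorm_le => h h0; near=> n.
  rewrite ger0_norm ?invr_ge0 ?sqrtr_ge0// /v -[h]invrK.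
  have n0 : (0 < n)%N by near: n; exists 1%N.
  rewrite lef_pV2 ?posrE ?invr_gt0 ?sqrtr_gt0 ?ltr0n//.
  rewrite -[leLHS]ger0_norm ?invr_ge0 ?(ltW h0)// -sqrtr_sqr ler_wsqrtr//.
  by near: n; exact: nbhs_infty_ger.
have u_cvg : u n @[n --> \oo] --> (0 : R) by rewrite -(mulr0 lam); exact: cvgMr.
have bn : (n %/ k)%N @[n --> \oo] --> \oo.
  apply/cvgnyPge => a; near=> n; rewrite leq_divRL//.
  by near: n; exists (a * k)%N.
have var_b : u n ^+ 2 * Ex P (fun w => S (n %/ k)%N w ^+ 2) @[n --> \oo] --> l2 / k%:R.
  rewrite /l2 -mulrA; apply: cvg_trans (cvgM (cvg_cst (lam ^+ 2)) (cvgM (cvg_comp _ _ bn var_cvg) (cvg_divn k0))).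
  apply: near_eq_cvg; near=> n => /=.
  have n0 : (0 < n)%N by near: n; exists 1%N.
  have kn : (0 < n %/ k)%N by rewrite divn_gt0//; near: n; exists k.
  rewrite /u /v exprMn exprVn sqr_sqrtr//; field.
  by rewrite !pnatr_eq0 -!lt0n n0 kn.
have ul : u n * L @[n --> \oo] --> 0 * L by apply: cvgM => //; exact: cvg_cst.
have ul' : u n * (L + 2 * k%:R) @[n --> \oo] --> 0 * (L + 2 * k%:R) by apply: cvgM => //; exact: cvg_cst.
rewrite !mul0r in ul ul'.
have kk2 : (0 : R) < k%:R ^- 2 by rewrite invr_gt0 exprn_gt0.
near=> n.
have n0 : (0 < n)%N by near: n; exists 1%N.
have un0 : 0 <= u n by rewrite mulr_ge0// invr_ge0 sqrtr_ge0.
have un2 : u n ^+ 2 = lam ^+ 2 * n%:R^-1 by rewrite exprMn exprVn sqr_sqrtr.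
have h1 : `|0 - u n * L| <= k%:R ^- 2 by near: n; move: ul => /cvgrPdist_le; apply.
have h2 : `|0 - u n * (L + 2 * k%:R)| <= k%:R^-1.
  by near: n; move: ul' => /cvgrPdist_le; apply; rewrite invr_gt0.
have h3 : `|l2 / k%:R - u n ^+ 2 * Ex P (fun w => S (n %/ k)%N w ^+ 2)| <= k%:R ^- 2.
  by near: n; move: var_b => /cvgrPdist_le; apply.
set b := (n %/ k)%N in h3.
have ub : u n ^+ 2 * b%:R <= (j ^ 2)%:R^-1.
  rewrite un2 -mulrA [n%:R^-1 * _]mulrC mulrA ler_pdivrMr ?ltr0n// [leRHS]mulrC ler_pdivlMr ?ltr0n ?expn_gt0 ?j0//.
  apply: (@le_trans _ _ (A%:R * b%:R * (j ^ 2)%:R)).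
    by rewrite ler_wpM2r// ler_wpM2r.
  rewrite -!natrM ler_nat mulnAC -/k mulnC; exact: leq_trunc_div.
(* [x] is the k-th root of exp(-l2/2), so k blocks produce the Gaussian factor exactly. *)
pose y := l2 / 2 / k%:R; have y0 : 0 <= y by rewrite /y; nneg.
pose x := expR (- y).
have x01 : 0 <= x <= 1 by rewrite expR_ge0/= -expR0 ler_expR oppr_le0.
have xa : `|x - (1 - y)| <= l2 ^+ 2 / k%:R ^+ 2.
  rewrite (_ : x - (1 - y) = x - 1 + y); last by ring.
  apply: le_trans (expRN_approx y0) _; rewrite /y !expr_div_n -mulrA.
  rewrite ler_wpM2l ?sqr_ge0// ler_piMl ?invr_ge0 ?exprn_ge0//.
  by rewrite invf_le1 ?exprn_gt0// -natrX ler1n.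
pose err := (2 + l2 ^+ 2) / k%:R ^+ 2 + (C4 + kappa * Cv + C4) / (j ^ 3)%:R.
have step m : `|mean_cos (m + b) (u n) c - x * mean_cos m (u n) c| <= err.
  apply: le_trans (cos_split m b c x un0) _.
  have := block_estimate j0 un0 m4 C40 ub.
  set E1 := Ex P _ in h3 *; set E2 := Ex P _; set E3 := Ex P _ => hb.
  have hx : `|E2 - x| <= `|E2 - (1 - u n ^+ 2 * E1 / 2)| + `|l2 / k%:R - u n ^+ 2 * E1| / 2 + `|x - (1 - y)|.
    rewrite (_ : E2 - x = (E2 - (1 - u n ^+ 2 * E1 / 2)) + (l2 / k%:R - u n ^+ 2 * E1) / 2 - (x - (1 - y))); last first.
      by rewrite /y; field; rewrite gt_eqF.
    apply: le_trans (ler_normB _ _) _; apply: lerD => //.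
    by apply: le_trans (ler_normD _ _) _; rewrite [`|_ / 2|]normrM normfV [`|2|]ger0_norm.
  have h1' : u n * L <= k%:R ^- 2 by move: h1; rewrite sub0r normrN ger0_norm// mulr_ge0.
  have e1 : err = k%:R ^- 2 + k%:R ^- 2 + l2 ^+ 2 / k%:R ^+ 2 + (C4 + kappa * Cv + C4) / (j ^ 3)%:R.
    by rewrite /err; ring.
  by rewrite e1; have := kk2; move: hb hx h1' h3 xa; lra.
have blocks := cos_blocks k un0 x01 step.
(* The n mod k leftover terms are fewer than the fixed number k, hence negligible as u n tends to
   0. *)
have rem : `|mean_cos n (u n) c - 1 * mean_cos (k * b) (u n) c| <= k%:R^-1.
  have nE : n = (k * b + n %% k)%N by rewrite mulnC -divn_eq.
  rewrite {1}nE; apply: le_trans (cos_split _ _ _ _ un0) _.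
  have h2' : u n * (L + 2 * k%:R) <= k%:R^-1.
    by move: h2; rewrite sub0r normrN ger0_norm//; nneg.
  apply: le_trans h2'; rewrite mulrDr -addrA lerD2l.
  have rk : (n %% k)%:R <= k%:R :> R by rewrite ler_nat ltnW// ltn_mod.
  have Sr w : `|u n * S (n %% k)%N w| <= u n * k%:R.
    rewrite normrM (ger0_norm un0) ler_wpM2l//; case: SR => _ _ S1 _ _.
    exact: le_trans (S1 _ w) rk.
  have bl : measurable_fun setT (fun w => u n * S (n %% k)%N w).
    by apply: bmf_meas; apply: bmfM => //; exact: bmf_cst.
  have t1 : `|Ex P (fun w => cos (u n * S (n %% k)%N w)) - 1| <= u n * k%:R.
{    rewrite -(Ex_cst P (u n * k%:R)) -{1}(Ex_cst P 1); apply: Ex_dist.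
    - exact: bmf_cos.
    - exact: bmf_cst.
    - exact: bmf_cst.
    - by move=> w; rewrite -{1}cos0; apply: le_trans (cos_dist _ _) _; rewrite subr0. }
  have t2 : `|Ex P (fun w => sin (u n * S (n %% k)%N w))| <= u n * k%:R.
    apply: Ex_le_norm; first exact: bmf_sin.
    by move=> w; apply: le_trans (normr_sin_le _) _.
  by rewrite mulrCA mulrDl mul1r; apply: lerD.
have xk : x ^+ k = expR (- (l2 / 2)).
  by rewrite /x -expRM_natl; congr expR; rewrite /y /l2; field; rewrite gt_eqF.
rewrite xk in blocks; rewrite mul1r in rem.
rewrite distrC; apply: le_trans Cj.
rewrite -/(mean_cos n (u n) c).
rewrite (_ : _ - _ = (mean_cos n (u n) c - mean_cos (k * b) (u n) c) +
  (mean_cos (k * b) (u n) c - expR (- (l2 / 2)) * cos c)); last by ring.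
apply: le_trans (ler_normD _ _) _; apply: le_trans (lerD rem blocks) _.
have j1 : (1 : R) <= j%:R by rewrite ler1n.
have kj : k%:R^-1 <= j%:R^-1 :> R by rewrite lef_pV2 ?posrE// ler_nat /k (leq_trans (_ : _ <= j ^ 2)%N)// ?leq_pmull// -[leqLHS]expn1 leq_pexp2l.
have -> : k%:R * err = (2 + l2 ^+ 2) / k%:R + A%:R * (C4 + kappa * Cv + C4) / j%:R.
  have Ap : A%:R != 0 :> R by rewrite pnatr_eq0.
  by rewrite /err /k natrM !natrX; field; rewrite Ap gt_eqF.
have : (2 + l2 ^+ 2) / k%:R <= (2 + l2 ^+ 2) / j%:R by rewrite ler_wpM2l//; nneg.
by move: kj; rewrite /C !mulrDl mul1r; lra.
Unshelve. all: by end_near.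
Qed.

End CentralLimit.

(** * Convergence of finite-dimensional laws *)

Section PeriodicPartition.
Context {R : realType}.
Implicit Types x y t : R.

Inductive trig_span : nat -> (R -> R) -> Prop :=
| trig_span_cos n l c : (l <= n)%N -> trig_span n (fun x => cos (l%:R * x + c))
| trig_span_add n f g : trig_span n f -> trig_span n g -> trig_span n (fun x => f x + g x)
| trig_span_scale n a f : trig_span n f -> trig_span n (fun x => a * f x).

Let natS (l : nat) : (l.+1%:R : R) = l%:R + 1. Proof. by rewrite natr1. Qed.

Lemma trig_span_cosM n f : trig_span n f -> trig_span n.+1 (fun x => cos x * f x).
Proof.
elim=> {n f} [n l c ln|n f g _ IHf _ IHg|n a f _ IH].
- rewrite (_ : (fun _ => _) = fun x => 2^-1 * (cos (l.+1%:R * x + c) +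
     (if l is l'.+1 then cos (l'%:R * x + c) else cos (1%:R * x + - c)))).
    apply: trig_span_scale; apply: trig_span_add; first exact: trig_span_cos.
    by case: l ln => [|l] ln; apply: trig_span_cos => //; lia.
  apply/funext => x; rewrite natS mulrDl mul1r addrAC [cos (_ + _ + x)]cosD.
  case: l ln => [|l] ln.
    rewrite mul0r add0r (_ : x + - c = - (c - x)); last by ring.
    by rewrite cosN cosB; field.
  rewrite (_ : l%:R * x + c = (l.+1%:R * x + c) - x); last by rewrite natS; ring.
  by rewrite cosB; field.
- rewrite (_ : (fun _ => _) = fun x => cos x * f x + cos x * g x); first exact: trig_span_add.
  by apply/funext => x; rewrite mulrDr.
- rewrite (_ : (fun _ => _) = fun x => a * (cos x * f x)); first exact: trig_span_scale.
  by apply/funext => x; rewrite mulrCA.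
Qed.

Lemma trig_spanS n f : trig_span n f -> trig_span n.+1 f.
Proof.
elim=> {n f} [n l c ln|n f g _ IHf _ IHg|n a f _ IH].
- by apply: trig_span_cos; exact: leqW.
- exact: trig_span_add.
- exact: trig_span_scale.
Qed.

(* Translates of the kernel over m > n equispaced nodes sum to a constant, since it has no
   frequency above n: a partition of unity by nonnegative trigonometric polynomials. *)
Definition bump_kernel n t : R := ((1 + cos t) / 2) ^+ n.

Lemma bump_kernel_span n : trig_span n (bump_kernel n).
Proof.
elim: n => [|n IH].
  rewrite (_ : bump_kernel 0 = fun x => cos (0%:R * x + 0)); first exact: trig_span_cos.
  by apply/funext => x; rewrite /bump_kernel expr0 mul0r add0r cos0.
rewrite (_ : bump_kernel n.+1 = fun x => 2^-1 * (bump_kernel n x + cos x * bump_kernel n x)).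
  by apply: trig_span_scale; apply: trig_span_add; [exact: trig_spanS|exact: trig_span_cosM].
by apply/funext => x; rewrite /bump_kernel exprS; field.
Qed.

Lemma bump_kernel_ge0 n t : 0 <= bump_kernel n t.
Proof. by rewrite exprn_ge0// divr_ge0//; have := cos_geN1 t; lra. Qed.

Definition trig_node (m : nat) (j : nat) : R := 2 * pi * j%:R / m%:R.

(** Multiplication by 2 sin(pi l / m), which is positive for 0 < l < m, makes the sum telescope over
    whole periods. *)
Lemma sum_cos_nodes (m l : nat) (c : R) : (0 < l < m)%N ->
  \sum_(j < m) cos (c - l%:R * trig_node m j) = 0.
Proof.
move=> /andP[l0 lm]; have m0 : (0 < m)%N by exact: leq_trans lm.
have m0' : (m%:R : R) != 0 by rewrite pnatr_eq0 -lt0n.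
pose b : R := pi * l%:R / m%:R.
have sb : 0 < sin b.
  apply: sin_gt0_pi; apply/andP; split; first by rewrite /b !mulr_gt0 ?pi_gt0 ?invr_gt0 ?ltr0n.
  by rewrite /b ltr_pdivrMr ?ltr0n// ltr_pM2l ?pi_gt0// ltr_nat.
suff : 2 * sin b * (\sum_(j < m) cos (c - l%:R * trig_node m j)) = 0.
  by move/eqP; rewrite mulf_eq0 (gt_eqF (mulr_gt0 _ sb))// => /eqP.
rewrite mulr_sumr; pose g (j : nat) := - sin (c + b - 2 * b * j%:R).
rewrite (eq_bigr (fun j : 'I_m => g j.+1 - g j)); last first.
  move=> j _; have -> : c - l%:R * trig_node m j = c - 2 * b * j%:R by rewrite /trig_node /b; field.
  rewrite /g (natS j) (_ : c + b - 2 * b * (j%:R + 1) = (c - 2 * b * j%:R) - b); last by ring.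
  rewrite (_ : c + b - 2 * b * j%:R = (c - 2 * b * j%:R) + b); last by ring.
  by set u := c - _; rewrite (sinB u b) (sinD u b); ring.
rewrite -(big_mkord xpredT (fun j => g j.+1 - g j)) telescope_sumr// /g mulr0 subr0.
rewrite (_ : c + b - 2 * b * m%:R = (c + b) - (l%:R * 2) * pi); last by rewrite /b; field.
have per k y : sin (y - k%:R * 2 * pi) = sin y.
  elim: k => [|k IH]; first by rewrite !mul0r subr0.
  rewrite -[RHS]IH -natr1 (_ : y - k%:R * 2 * pi = (y - (k%:R + 1) * 2 * pi) + pi *+ 2).
    by rewrite sinD2pi.
  by rewrite mulr2n; ring.
by rewrite per; ring.
Qed.

Lemma sum_nodes_cst n f m : trig_span n f -> (n < m)%N ->
  exists C, forall t, \sum_(j < m) f (t - trig_node m j) = C.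
Proof.
move=> sf; elim: sf m => {n f} [n l c ln|n f g _ IHf _ IHg|n a f _ IH] m nm.
- have [l0|l0] := posnP l.
    exists (m%:R * cos c) => t; rewrite l0 (eq_bigr (fun=> cos c)) ?sumr_const ?card_ord ?mulr_natl//.
    by move=> j _; rewrite mul0r add0r.
  exists 0 => t; have := @sum_cos_nodes m l (l%:R * t + c); rewrite l0 (leq_ltn_trans ln nm).
  by move=> /(_ isT) h; rewrite -[RHS]h; apply: eq_bigr => j _; congr cos; ring.
- have [C1 h1] := IHf m nm; have [C2 h2] := IHg m nm.
  by exists (C1 + C2) => t; rewrite big_split /= h1 h2.
- have [C h] := IH m nm.
  by exists (a * C) => t; rewrite -mulr_sumr h.
Qed.

Lemma ler_cos x y : 0 <= x -> x <= y -> y <= pi -> cos y <= cos x.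
Proof.
move=> x0; rewrite le_eqVlt => /predU1P[->//|xy] ypi.
have y0 : 0 <= y by rewrite (le_trans x0)// ltW.
have xpi : x <= pi by rewrite (le_trans _ ypi)// ltW.
by apply/ltW; rewrite ltr_cos// in_itv/= ?x0 ?y0.
Qed.

Lemma cos_le_away (e t : R) : 0 < e <= pi -> e <= `|t| <= 2 * pi - e -> cos t <= cos e.
Proof.
move=> /andP[e0 ep] /andP[et te]; have p0 := pi_gt0 R.
rewrite -cos_norm; have [tp|pt] := leP `|t| pi; first exact: ler_cos (ltW e0) et tp.
rewrite -(cosN `|t|) -cosD2pi mulr2n.
by apply: ler_cos; [exact: ltW|lra|lra].
Qed.

(** At distance at least e the kernel is at most ((1 + cos e)/2)^n, which beats the n + 1 nodes. The
    restriction |t - pi| <= 1 keeps every node within 2 pi - e of t, so that periodicity cannot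
    bring a distant node close. *)
Lemma partition_of_unity (e : R) (eta : R) : 0 < e <= 1 -> 0 < eta ->
  exists (m : nat) (w : nat -> R -> R),
  [/\ (forall j t, 0 <= w j t), (forall t, \sum_(j < m) w j t = 1),
   (forall j, exists n, trig_span n (w j)) &
   forall t, `|t - pi| <= 1 -> \sum_(j < m | e <= `|t - trig_node m j|) w j t <= eta].
Proof.
move=> /andP[e0 e1] eta0.
have p2 : (2 : R) <= pi by exact: pi_ge2.
pose rho : R := (1 + cos e) / 2.
have ce1 : cos e < 1.
  by rewrite -[ltRHS]cos0 ltr_cos// in_itv/= ?lexx ?pi_ge0 ?(ltW e0)//=; lra.
have ceN : 0 <= rho by have := cos_geN1 e; rewrite /rho; lra.
have rho1 : rho < 1 by rewrite /rho; lra.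
have [n hn] : exists n : nat, n.+1%:R * rho ^+ n <= eta.
  pose r := (Num.max rho 2^-1)^-1.
  have r0 : 0 < Num.max rho 2^-1 by rewrite lt_max invr_gt0 ltr0n orbT.
  have r1 : 1 < r by rewrite invf_gt1// gt_max rho1; lra.
  have [C C0 hC] := @poly_exp_bound R r 2 r1.
  pose n := Num.truncn (C / eta); exists n.
  have hn : C / n.+1%:R <= eta.
    by rewrite ler_pdivrMr ?ltr0n// mulrC -ler_pdivrMr//; apply/ltW; exact: truncnS_gt.
  apply: le_trans hn; rewrite ler_pdivlMr ?ltr0n// mulrAC -expr2.
  apply: (@le_trans _ _ (n.+1%:R ^+ 2 * r ^- n)).
    rewrite ler_wpM2l ?sqr_ge0// /r exprVn invrK lerXn2r ?nnegrE//; first exact: ltW.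
    by rewrite le_max lexx.
  by rewrite ler_pdivrMr// exprn_gt0// (lt_trans _ r1).
have [C hC] := sum_nodes_cst (bump_kernel_span n) (ltnSn n).
(* At t = 0 the node 0 alone contributes 1. *)
have C1 : 1 <= C.
  rewrite -(hC 0) big_ord_recl /= {1}/bump_kernel /trig_node mulr0 mul0r subrr cos0.
  rewrite (_ : (1 + 1) / 2 = 1 :> R) ?expr1n; last by field.
  by rewrite lerDl sumr_ge0// => i _; exact: bump_kernel_ge0.
have C0 : 0 < C by exact: lt_le_trans C1.
exists n.+1, (fun j t => C^-1 * bump_kernel n (t - trig_node n.+1 j)); split.
- by move=> j t; rewrite mulr_ge0 ?bump_kernel_ge0// invr_ge0 ltW.
- by move=> t; rewrite -mulr_sumr hC mulVf// gt_eqF.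
- move=> j; exists n; apply: trig_span_scale.
  elim: (bump_kernel_span n) => {hC hn n} [n l c ln|n f g _ IHf _ IHg|n a f _ IH].
  + rewrite (_ : (fun _ => _) = fun x => cos (l%:R * x + (c - l%:R * trig_node n.+1 j))).
      exact: trig_span_cos.
    by apply/funext => x; congr cos; ring.
  + exact: (trig_span_add IHf IHg).
  + exact: (trig_span_scale a IH).
- move=> t tp; apply: le_trans hn.
  apply: (@le_trans _ _ (\sum_(j < n.+1) rho ^+ n)); last by rewrite sumr_const card_ord mulr_natl.
  rewrite [leRHS](bigID (fun j : 'I_n.+1 => e <= `|t - trig_node n.+1 j|)) /=.
  apply: ler_wpDr; first by apply: sumr_ge0 => i _; exact: exprn_ge0.
  apply: ler_sum => j ej.
  apply: (@le_trans _ _ (bump_kernel n (t - trig_node n.+1 j))).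
    by rewrite ler_piMl ?bump_kernel_ge0// invf_le1.
  have h0 : 0 <= (1 + cos (t - trig_node n.+1 j)) / 2 by have := cos_geN1 (t - trig_node n.+1 j); lra.
  rewrite /bump_kernel lerXn2r ?nnegrE//.
  rewrite /rho ler_pM2r// lerD2l; apply: cos_le_away; first by rewrite e0/=; lra.
  rewrite ej /=.
  have n0 : 0 <= trig_node n.+1 j by rewrite /trig_node !mulr_ge0 ?pi_ge0 ?invr_ge0.
  have n2 : trig_node n.+1 j <= 2 * pi.
    rewrite /trig_node -mulrA ler_piMr ?mulr_ge0 ?pi_ge0// ler_pdivrMr ?ltr0n// mul1r ler_nat ltnW//.
  have : `|t - trig_node n.+1 j| <= 1 + pi.
    by move: tp; rewrite !ler_norml => /andP[t1 t2]; apply/andP; split; lra.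
  by move=> h; apply: le_trans h _; lra.
Qed.

End PeriodicPartition.

(** * Continuity theorem for vectors of fixed dimension *)

Section Levy.
Context {R : realType} (N : nat).
Local Notation vec := ('I_N -> R).

Inductive trigpoly : (vec -> R) -> Prop :=
| trigpoly_cos (a : vec) c : trigpoly (fun x => cos (\sum_k a k * x k + c))
| trigpoly_add f g : trigpoly f -> trigpoly g -> trigpoly (fun x => f x + g x)
| trigpoly_scale a f : trigpoly f -> trigpoly (fun x => a * f x).

Lemma trigpoly_mul f g : trigpoly f -> trigpoly g -> trigpoly (fun x => f x * g x).
Proof.
move=> tf; elim: tf g => {f} [a c|f1 f2 _ IH1 _ IH2|a f _ IH] g.
- elim=> {g} [a' c'|g1 g2 _ IH1 _ IH2|a' g _ IH].
  + rewrite (_ : (fun _ => _) = fun x => 2^-1 * (cos (\sum_k (a k + a' k) * x k + (c + c')) +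
      cos (\sum_k (a k - a' k) * x k + (c - c')))).
      by apply: trigpoly_scale; apply: trigpoly_add; [exact: (trigpoly_cos (fun k => a k + a' k))|exact: (trigpoly_cos (fun k => a k - a' k))].
    apply/funext => x.
    rewrite (_ : \sum_k (a k + a' k) * x k + (c + c') = (\sum_k a k * x k + c) + (\sum_k a' k * x k + c')).
      rewrite (_ : \sum_k (a k - a' k) * x k + (c - c') = (\sum_k a k * x k + c) - (\sum_k a' k * x k + c')).
        by set u := _ + c; set v := _ + c'; rewrite (cosD u v) (cosB u v); field.
      by under eq_bigr do rewrite mulrBl; rewrite sumrB; ring.
    by under eq_bigr do rewrite mulrDl; rewrite big_split /=; ring.
  + rewrite (_ : (fun _ => _) = fun x => cos (\sum_k a k * x k + c) * g1 x + cos (\sum_k a k * x k + c) * g2 x).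
      exact: trigpoly_add.
    by apply/funext => x; rewrite mulrDr.
  + rewrite (_ : (fun _ => _) = fun x => a' * (cos (\sum_k a k * x k + c) * g x)).
      exact: trigpoly_scale.
    by apply/funext => x; rewrite mulrCA.
- move=> tg; rewrite (_ : (fun _ => _) = fun x => f1 x * g x + f2 x * g x).
    by apply: trigpoly_add; [exact: IH1|exact: IH2].
  by apply/funext => x; rewrite mulrDl.
- move=> tg; rewrite (_ : (fun _ => _) = fun x => a * (f x * g x)).
    by apply: trigpoly_scale; exact: IH.
  by apply/funext => x; rewrite mulrA.
Qed.

Lemma trigpoly_cst c : trigpoly (fun=> c).
Proof.
rewrite (_ : (fun _ => _) = fun x : vec => c * cos (\sum_k 0 * x k + 0)).
  by apply: trigpoly_scale; exact: (trigpoly_cos (fun=> 0)).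
apply/funext => x; rewrite big1 ?addr0 ?cos0 ?mulr1// => k _; exact: mul0r.
Qed.

Lemma trigpoly_sum (I : Type) (s : seq I) (F : I -> vec -> R) :
  (forall i, trigpoly (F i)) -> trigpoly (fun x => \sum_(i <- s) F i x).
Proof.
move=> tF; elim: s => [|i s IH].
  by under eq_fun do rewrite big_nil; exact: trigpoly_cst.
by under eq_fun do rewrite big_cons; exact: trigpoly_add.
Qed.

Lemma trigpoly_prod (I : Type) (s : seq I) (F : I -> vec -> R) :
  (forall i, trigpoly (F i)) -> trigpoly (fun x => \prod_(i <- s) F i x).
Proof.
move=> tF; elim: s => [|i s IH].
  by under eq_fun do rewrite big_nil; exact: trigpoly_cst.
by under eq_fun do rewrite big_cons; exact: trigpoly_mul.
Qed.

Lemma trigpoly_coord n (f : R -> R) (k : 'I_N) (u v : R) :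
  trig_span n f -> trigpoly (fun x => f (u * x k + v)).
Proof.
elim=> {n f} [n l c _|n f g _ IHf _ IHg|n a f _ IH].
- rewrite (_ : (fun _ => _) = fun x : vec => cos (\sum_j (if j == k then l%:R * u else 0) * x j + (l%:R * v + c))).
    exact: (trigpoly_cos (fun j => if j == k then l%:R * u else 0)).
  apply/funext => x; rewrite (bigD1 k)//= eqxx big1 ?addr0; first by congr cos; ring.
  by move=> j /negbTE ->; rewrite mul0r.
- exact: trigpoly_add.
- exact: trigpoly_scale.
Qed.

(** Averaging values of [H] with weights of total mass one keeps the bound [M] on the whole space,
    beyond the cube where the approximation holds; the tightness argument relies on this. *)
Lemma trigpoly_approx (H : vec -> R) (M L A eps : R) : 0 < A -> 0 < eps ->
  (forall x, `|H x| <= M) -> 0 <= L ->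
  (forall x y e, (forall k, `|x k - y k| <= e) -> `|H x - H y| <= L * e) ->
  exists2 f, trigpoly f & (forall x, `|f x| <= M) /\
    (forall x, (forall k, `|x k| <= A) -> `|f x - H x| <= eps).
Proof.
move=> A0 eps0 HM L0 HL.
have M0 : 0 <= M by apply: le_trans (HM (fun=> 0)).
pose e : R := Num.min 1 (eps / 2 / (L * A + 1)).
have LA : 0 < L * A + 1 by rewrite ltr_wpDl// mulr_ge0// ltW.
have e01 : 0 < e <= 1.
  by rewrite lt_min ltr01 ge_min lexx /= !divr_gt0.
have eL : L * (A * e) <= eps / 2.
  apply: (@le_trans _ _ ((L * A + 1) * e)); first by rewrite mulrA ler_wpM2r ?lerDl//; case/andP: e01 => /ltW.
  by rewrite mulrC -ler_pdivlMr// ge_min lexx orbT.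
pose NM := 2 * M * N%:R + 1; have NM0 : 0 < NM by rewrite ltr_wpDl// !mulr_ge0.
pose eta := eps / 2 / NM; have eta0 : 0 < eta by rewrite !divr_gt0.
have [m [w [w0 w1 wt wf]]] := partition_of_unity e01 eta0.
(* The map x -> x / A + pi sends the cube into |t - pi| <= 1; [nd] pulls the nodes back by its
   inverse. *)
pose nd (j : {ffun 'I_N -> 'I_m}) : vec := fun k => A * (trig_node m (j k) - pi).
pose W (x : vec) (j : {ffun 'I_N -> 'I_m}) := \prod_k w (j k) (A^-1 * x k + pi).
have W0 x j : 0 <= W x j by apply: prodr_ge0.
have W1 x : \sum_j W x j = 1.
  rewrite /W -(bigA_distr_bigA (fun (k : 'I_N) (j : 'I_m) => w j (A^-1 * x k + pi))) /=.
  by rewrite big1.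
exists (fun x => \sum_j H (nd j) * W x j).
  apply: trigpoly_sum => j; apply: trigpoly_scale; apply: trigpoly_prod => k.
  by have [n sn] := wt (j k); exact: (trigpoly_coord k A^-1 pi sn).
split.
  move=> x; apply: le_trans (ler_norm_sum _ _ _) _.
  rewrite -[leRHS]mulr1 -(W1 x) mulr_sumr; apply: ler_sum => j _.
  by rewrite normrM (ger0_norm (W0 x j)) ler_wpM2r.
move=> x xA.
pose far k (j : 'I_m) := e <= `|A^-1 * x k + pi - trig_node m j|.
have -> : \sum_j H (nd j) * W x j - H x = \sum_j (H (nd j) - H x) * W x j.
  by under [RHS]eq_bigr do rewrite mulrBl; rewrite sumrB -mulr_sumr W1 mulr1.
apply: le_trans (ler_norm_sum _ _ _) _.
apply: (@le_trans _ _ (\sum_j (eps / 2 * W x j + 2 * M * \sum_k (far k (j k))%:R * W x j))).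
  apply: ler_sum => j _; rewrite normrM (ger0_norm (W0 x j)).
  rewrite -mulr_suml mulrA -mulrDl ler_wpM2r//.
  have [/existsP[k fk]|/existsPn nf] := boolP [exists k, far k (j k)].
    apply: (@le_trans _ _ (2 * M)).
      by apply: le_trans (ler_normB _ _) _; have := HM (nd j); have := HM x; lra.
    apply: ler_wpDl; first by nneg.
    rewrite -[leLHS]mulr1 ler_wpM2l//; first by nneg.
    by rewrite (bigD1 k)//= fk lerDl sumr_ge0.
  have -> : \sum_i ((far i (j i))%:R : R) = 0 by apply: big1 => k _; rewrite (negbTE (nf k)).
  rewrite mulr0 addr0.
  apply: le_trans eL; apply: HL => k; have := nf k; rewrite /far -ltNge => h.
  rewrite /nd (_ : _ - _ = - (A * (A^-1 * x k + pi - trig_node m (j k)))); last by field; rewrite gt_eqF.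
  by rewrite normrN normrM (gtr0_norm A0) ler_pM2l// ltW.
rewrite big_split /= -mulr_sumr W1 mulr1 -mulr_sumr exchange_big /=.
have farE k : \sum_(j : {ffun 'I_N -> 'I_m}) (far k (j k))%:R * W x j <= eta.
  pose F i (l : 'I_m) := (if i == k then (far k l)%:R else 1) * w l (A^-1 * x i + pi).
  rewrite (eq_bigr (fun j : {ffun 'I_N -> 'I_m} => \prod_i F i (j i))); last first.
    move=> j _; rewrite /F big_split /= (bigD1 k)//= eqxx; congr (_ * _).
    by rewrite big1 ?mulr1// => i /negbTE ->.
  rewrite -(bigA_distr_bigA F) (bigD1 k)//= [X in _ * X]big1 ?mulr1; last first.
    move=> i /negbTE ik; rewrite /F ik -[RHS](w1 (A^-1 * x i + pi)).
    by apply: eq_bigr => l _; rewrite mul1r.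
  apply: le_trans (wf (A^-1 * x k + pi) _); last first.
    rewrite addrK normrM (gtr0_norm (_ : 0 < A^-1)) ?invr_gt0// mulrC ler_pdivrMr// mul1r; exact: xA.
  rewrite [leRHS]big_mkcond /=; apply: ler_sum => l _; rewrite /F eqxx /far.
  by case: ifP; rewrite ?mul1r ?mul0r.
apply: (@le_trans _ _ (eps / 2 + 2 * M * \sum_(k < N) eta)).
  by rewrite lerD2l ler_wpM2l ?ler_sum//; nneg.
have -> : 2 * M * (\sum_(k < N) eta) = 2 * M * N%:R * eta.
  by rewrite sumr_const card_ord -[eta *+ N]mulr_natl; ring.
suff : 2 * M * N%:R * eta <= eps / 2 by lra.
rewrite /eta mulrA ler_pdivrMr// mulrC ler_wpM2l//; first by nneg.
by rewrite /NM lerDl.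
Qed.

Context dT (T : measurableType dT) (P : probability T R).
Context d2 (T2 : measurableType d2) (Q : probability T2 R).
Variables (Y : nat -> T -> vec) (Z : T2 -> vec).
Hypothesis mY : forall n k, measurable_fun setT (fun w => Y n w k).
Hypothesis mZ : forall k, measurable_fun setT (fun w => Z w k).
Hypothesis cos_cvg : forall (a : vec) c,
  Ex P (fun w => cos (\sum_k a k * Y n w k + c)) @[n --> \oo] -->
  Ex Q (fun w => cos (\sum_k a k * Z w k + c)).

Let m_lin d0 (T0 : measurableType d0) (X : T0 -> vec) (a : vec) c :
  (forall k, measurable_fun setT (fun w => X w k)) ->
  measurable_fun setT (fun w => \sum_k a k * X w k + c).
Proof.
move=> mX; apply: measurable_funD; last exact: measurable_cst.
by apply: measurable_sum => k; apply: measurable_funM => //; exact: measurable_cst.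
Qed.

Let bmf_trig d0 (T0 : measurableType d0) (X : T0 -> vec) f :
  (forall k, measurable_fun setT (fun w => X w k)) -> trigpoly f -> bmf (fun w => f (X w)).
Proof.
move=> mX; elim=> {f} [a c|f g _ bf _ bg|a f _ bf].
- exact/bmf_cos/m_lin.
- exact: bmfD.
- by apply: bmfM => //; exact: bmf_cst.
Qed.

Lemma trigpoly_cvg f : trigpoly f ->
  Ex P (fun w => f (Y n w)) @[n --> \oo] --> Ex Q (fun w => f (Z w)).
Proof.
elim=> {f} [a c|f g tf cf tg cg|a f tf cf]; first exact: cos_cvg.
- rewrite ExD; [|exact: bmf_trig|exact: bmf_trig].
  under eq_fun do rewrite (ExD P (bmf_trig (mY _) tf) (bmf_trig (mY _) tg)).
  exact: cvgD.
- rewrite ExZ; last exact: bmf_trig.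
  under eq_fun do rewrite (ExZ P _ (bmf_trig (mY _) tf)).
  by apply: cvgMr.
Qed.

Hypothesis tight : forall e, 0 < e -> exists2 A : R, 0 < A &
  (forall n k, fine (P [set w | A < `|Y n w k|]) <= e) /\
  (forall k, fine (Q [set w | A < `|Z w k|]) <= e).

(** Outside a large cube [H] and its trigonometric approximant are both bounded by [M], so tightness
    controls their difference uniformly in n. *)
Lemma levy_continuity (H : vec -> R) (M L : R) :
  (forall x, `|H x| <= M) -> 0 <= L ->
  (forall x y e, (forall k, `|x k - y k| <= e) -> `|H x - H y| <= L * e) ->
  (forall n, measurable_fun setT (fun w => H (Y n w))) ->
  measurable_fun setT (fun w => H (Z w)) ->
  Ex P (fun w => H (Y n w)) @[n --> \oo] --> Ex Q (fun w => H (Z w)).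
Proof.
move=> HM L0 HL mHY mHZ; have M0 : 0 <= M by apply: le_trans (HM (fun=> 0)).
apply/cvgrPdist_le => eps eps0.
pose NM := 2 * M * N%:R + 1; have NM0 : 0 < NM by rewrite ltr_wpDl// !mulr_ge0.
have [A A0 [tY tZ]] : exists2 A : R, 0 < A &
    (forall n k, fine (P [set w | A < `|Y n w k|]) <= eps / 5 / NM) /\
    (forall k, fine (Q [set w | A < `|Z w k|]) <= eps / 5 / NM).
  by apply: tight; rewrite !divr_gt0.
have e5 : 0 < eps / 5 by rewrite divr_gt0.
have [f tf [fM fH]] := trigpoly_approx A0 e5 HM L0 HL.
have close d0 (T0 : measurableType d0) (P0 : probability T0 R) (X : T0 -> vec) :
    (forall k, measurable_fun setT (fun w => X w k)) ->
    measurable_fun setT (fun w => H (X w)) ->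
    (forall k, fine (P0 [set w | A < `|X w k|]) <= eps / 5 / NM) ->
    `|Ex P0 (fun w => f (X w)) - Ex P0 (fun w => H (X w))| <= 2 * (eps / 5).
  move=> mX mHX tX.
  have mA k : measurable [set w | A < `|X w k|].
    rewrite (_ : [set w | _] = [set: T0] `&` (fun w => `|X w k|) @^-1` `]A, +oo[).
      by apply: measurableT_comp.
    by apply/seteqP; split => w /=; rewrite in_itv/= andbT; [move=> ?; split|case].
  apply: (@le_trans _ _ (Ex P0 (fun w => eps / 5 + 2 * M * \sum_k (\1_[set w | A < `|X w k|] w : R)))).
  { apply: Ex_dist.
    - exact: bmf_trig.
    - by split => //; exists M.
    - apply: bmfD; first exact: bmf_cst.
      by apply: bmfM; [exact: bmf_cst|apply: bmf_sum => k; exact: bmf_indic].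
    - move=> w; have [/existsP[k fk]|/existsPn nf] := boolP [exists k, A < `|X w k|].
        apply: (@le_trans _ _ (2 * M)).
          by apply: le_trans (ler_normB _ _) _; have := HM (X w); have := fM (X w); lra.
        apply: ler_wpDl; first by nneg.
        rewrite -[leLHS]mulr1 ler_wpM2l//; first by nneg.
        by rewrite (bigD1 k)//= indicE mem_set// lerDl sumr_ge0.
      apply: ler_wpDr; last by apply: fH => k; have := nf k; rewrite -leNgt.
      apply: mulr_ge0; [nneg|by apply: sumr_ge0 => k _; rewrite indicE; case: (_ \in _)]. }
  rewrite ExD; [|exact: bmf_cst|by apply: bmfM; [exact: bmf_cst|apply: bmf_sum => k; exact: bmf_indic]].
  rewrite Ex_cst ExZ; last by apply: bmf_sum => k; exact: bmf_indic.
  rewrite Ex_sum; last by move=> k; exact: bmf_indic.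
  rewrite (_ : 2 * (eps / 5) = eps / 5 + eps / 5) ?lerD2l; last by ring.
  apply: (@le_trans _ _ (2 * M * \sum_(k < N) (eps / 5 / NM))).
    by rewrite ler_wpM2l ?ler_sum//; [nneg|move=> k _; rewrite Ex_indic].
  have -> : 2 * M * (\sum_(k < N) eps / 5 / NM) = (eps / 5) * (2 * M * N%:R) / NM.
    by rewrite sumr_const card_ord -[_ *+ N]mulr_natl; ring.
  by rewrite ler_pdivrMr// ler_wpM2l ?(ltW e5)// /NM lerDl.
have := trigpoly_cvg tf => /cvgrPdist_le/(_ _ e5).
apply: filterS => n; have := close _ _ P (Y n) (mY n) (mHY n) (tY n); have := close _ _ Q Z mZ mHZ tZ.
set a := Ex Q _; set b := Ex Q _; set c := Ex P _; set e := Ex P _ => h1 h2 h3.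
rewrite (_ : b - e = (c - e) - (a - b) + (a - c)); last by ring.
apply: le_trans (ler_normD _ _) _; apply: le_trans (lerD (ler_normB _ _) h3) _; lra.
Qed.

End Levy.

(** * Gaussian sequences on the unit interval *)

Section NormalCos.
Context {R : realType}.
Variable s : R.
Hypothesis s0 : s != 0.
Local Notation mu := (@lebesgue_measure R).
Local Notation N := (normal_prob 0 s).

Let p : R -> R := normal_pdf 0 s.

Let p_ge0 x : 0 <= p x. Proof. exact: normal_pdf_ge0. Qed.

Let pE x : p x = normal_peak s * expR (- (x ^+ 2 / (s ^+ 2 *+ 2))).
Proof. by rewrite /p normal_pdfE// /normal_fun subr0 mulNr. Qed.

Let mp : measurable_fun setT p. Proof. exact: measurable_normal_pdf. Qed.

Let int_p : mu.-integrable setT (EFin \o p).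
Proof. exact: integrable_normal_pdf. Qed.

Lemma Ex_normal_prob (f : R -> R) : bmf f ->
  Ex N f = \int[mu]_x (f x * p x).
Proof.
move=> bf; rewrite /Ex /Rintegral; congr fine.
have mf : measurable_fun setT (EFin \o f) by apply/measurable_EFinP; exact: bmf_meas bf.
rewrite -(Radon_Nikodym_change_of_variables (normal_prob_dominates 0 s))//=; last exact: bmf_integrable.
apply: ae_eq_integral => //.
- apply: emeasurable_funM => //; apply: (measurable_int mu).
  by apply: Radon_Nikodym_integrable; exact: normal_prob_dominates.
- by apply/measurable_EFinP; apply: measurable_funM => //; exact: bmf_meas bf.
- under [X in ae_eq _ _ _ X]eq_fun do rewrite EFinM.
  apply: ae_eqe_mul2l => /=.
  rewrite Radon_NikodymE//=; first exact: normal_prob_dominates.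
  move=> dom; case: cid => /= h [h1 h2 h3].
  apply: integral_ae_eq => //=; first exact/measurable_EFinP.
  by move=> E _ mE; rewrite -h3.
Qed.

Let is_derive_p (x : R) : is_derive x (1 : R) p (- (x / s ^+ 2) * p x).
Proof.
rewrite (_ : p = fun x => normal_peak s * expR (- (x ^+ 2 / (s ^+ 2 *+ 2)))); last exact/funext.
apply: is_derive_eq; rewrite -mulr_natr !scaler1 /GRing.scale /= mulr2n.
by field.
Qed.

(** A Gaussian density of doubled variance dominates x times the density: this yields the integrable
    majorant for differentiating under the integral. *)
Let abs_p_le (x : R) : `|x * p x| <= `|s| * normal_peak s * normal_fun 0 (Num.sqrt 2 * s) x.
Proof.
rewrite normrM (ger0_norm (p_ge0 x)) pE /normal_fun subr0 mulrCA [leRHS]mulrAC [leRHS]mulrC.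
rewrite ler_wpM2l ?normal_peak_ge0//.
have s2 : 0 < s ^+ 2 by rewrite exprn_even_gt0.
pose t := x ^+ 2 / (s ^+ 2 *+ 2 *+ 2).
have -> : - x ^+ 2 / ((Num.sqrt 2 * s) ^+ 2 *+ 2) = - t.
  by rewrite exprMn sqr_sqrtr// /t mulNr mulr_natl.
have -> : - (x ^+ 2 / (s ^+ 2 *+ 2)) = - t - t by rewrite /t; field.
rewrite expRD mulrA ler_wpM2r ?expR_ge0// expRN ler_pdivrMr ?expR_gt0//.
apply: le_trans (_ : `|s| * (1 + t) <= _); last by rewrite ler_wpM2l// expR_ge1Dx.
have s1 : 0 < `|s| by rewrite normr_gt0.
have h0 : 0 <= (2 * `|s| - `|x|) ^+ 2 by exact: sqr_ge0.
have ht : `|s| ^+ 2 * t = `|x| ^+ 2 / 4 by rewrite !real_normK ?num_real// /t; field.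
rewrite -(ler_pM2l s1) (_ : `|s| * (`|s| * (1 + t)) = `|s| ^+ 2 + `|s| ^+ 2 * t); last by ring.
by rewrite ht; lra.
Qed.

Let int_xp : mu.-integrable setT (EFin \o (fun x => `|x * p x|)).
Proof.
have sq : Num.sqrt 2 * s != 0 by rewrite mulf_neq0// gt_eqF// sqrtr_gt0.
apply: (@le_integrable _ _ _ mu setT measurableT _
  (EFin \o (fun x => `|s| * normal_peak s * (normal_peak (Num.sqrt 2 * s))^-1 * normal_pdf 0 (Num.sqrt 2 * s) x))).
- by apply/measurable_EFinP; apply: measurableT_comp => //; apply: measurable_funM.
- move=> x _ /=; rewrite lee_fin normr_id; apply: le_trans (abs_p_le x) _.
  rewrite normal_pdfE// mulrA -[_ * _ * normal_peak (_ * _)]mulrA mulVf ?mulr1; first exact: ler_norm.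
  by rewrite gt_eqF// normal_peak_gt0.
- rewrite (_ : EFin \o _ = fun x => ((`|s| * normal_peak s * (normal_peak (Num.sqrt 2 * s))^-1)%:E * (normal_pdf 0 (Num.sqrt 2 * s) x)%:E)%E).
    by apply: integrableZl => //; exact: integrable_normal_pdf.
  by apply/funext => x /=; rewrite EFinM.
Qed.

Let int_bound (K L : R) (u : R -> R) : measurable_fun setT u ->
  (forall x, `|u x| <= K * p x + L * `|x * p x|) -> mu.-integrable setT (EFin \o u).
Proof.
move=> mu' uK.
apply: (@le_integrable _ _ _ mu setT measurableT _ (EFin \o (fun x => K * p x + L * `|x * p x|))).
- exact/measurable_EFinP.
- move=> x _ /=; rewrite lee_fin; apply: le_trans (uK x) _; exact: ler_norm.
- rewrite (_ : EFin \o _ = (fun x => K%:E * (p x)%:E) \+ (fun x => L%:E * (`|x * p x|)%:E))%E.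
    by apply: integrableD => //; apply: integrableZl.
  by apply/funext => x /=; rewrite EFinD !EFinM.
Qed.

Let m_lin (a c : R) : measurable_fun setT (fun x : R => a * x + c).
Proof. by apply: measurable_funD => //; apply: measurable_funM. Qed.

Let m_cos (a c : R) : measurable_fun setT (fun x : R => cos (a * x + c)).
Proof. by apply: bmf_meas; apply: bmf_cos; exact: m_lin. Qed.

Let m_sin (a c : R) : measurable_fun setT (fun x : R => sin (a * x + c)).
Proof. by apply: bmf_meas; apply: bmf_sin; exact: m_lin. Qed.

Let cos1 (t : R) : `|cos t| <= 1. Proof. exact: cos_max. Qed.
Let sin1 (t : R) : `|sin t| <= 1. Proof. by rewrite ler_norml sin_geN1 sin_le1. Qed.

Let int_cos a c : mu.-integrable setT (EFin \o (fun x => cos (a * x + c) * p x)).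
Proof.
apply: (@int_bound 1 0); first exact: measurable_funM.
by move=> x; rewrite mul0r addr0 mul1r normrM (ger0_norm (p_ge0 x)) ler_piMl.
Qed.

Let int_xsin a c : mu.-integrable setT (EFin \o (fun x => x * p x * sin (a * x + c))).
Proof.
apply: (@int_bound 0 1); first by apply: measurable_funM => //; apply: measurable_funM.
by move=> x; rewrite mul0r add0r mul1r normrM ler_piMr.
Qed.

Let h (a c x : R) := sin (a * x + c) * p x.
Let g (a c x : R) := a * (cos (a * x + c) * p x) - (s ^+ 2)^-1 * (x * p x * sin (a * x + c)).

Let is_derive_h a c (x : R) : is_derive x (1 : R) (h a c) (g a c x).
Proof.
have dl : is_derive x (1 : R) (fun x => a * x + c) a.
  by apply: is_derive_eq; rewrite /GRing.scale /=; ring.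
have ds := @is_derive1_comp R sin (fun x => a * x + c) x _ _ (is_derive_sin (a * x + c)) dl.
have dh := is_deriveM ds (is_derive_p x).
by apply: is_derive_eq dh _; rewrite /GRing.scale /= /g; field.
Qed.

Let cont_p : continuous p. Proof. exact: continuous_normal_pdf. Qed.

Let cont_lin a c : continuous (fun x : R => a * x + c).
Proof. by move=> y; apply: cvgD; [apply: cvgMr; exact: cvg_id|exact: cvg_cst]. Qed.

Let cont_g a c : continuous (g a c).
Proof.
move=> x; apply: cvgB; apply: cvgMr; apply: cvgM.
- by apply: (continuous_comp (@cont_lin a c x)); exact: continuous_cos.
- exact: cont_p.
- by apply: cvgM; [exact: cvg_id|exact: cont_p].
- by apply: (continuous_comp (@cont_lin a c x)); exact: continuous_sin.
Qed.

Let int_g a c : mu.-integrable setT (EFin \o (g a c)).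
Proof.
rewrite (_ : EFin \o _ = (fun x => a%:E * (cos (a * x + c) * p x)%:E) \-
  (fun x => ((s ^+ 2)^-1)%:E * (x * p x * sin (a * x + c))%:E))%E.
  by apply: integrableB => //; apply: integrableZl => //; [exact: int_cos|exact: int_xsin].
by apply/funext => x /=; rewrite /g EFinB !EFinM.
Qed.

Let p_decay (n : nat) (x : R) : (0 < n)%N -> x ^+ 2 = n%:R ^+ 2 -> p x <= normal_peak s * (s ^+ 2 *+ 2) / n%:R.
Proof.
move=> n0 xn; have s2 : 0 < s ^+ 2 *+ 2 by rewrite pmulrn_lgt0// exprn_even_gt0.
rewrite pE -mulrA ler_wpM2l ?normal_peak_ge0// xn expRN.
have np : (0 : R) < n%:R by rewrite ltr0n.
rewrite -[leRHS]invrK lef_pV2 ?posrE ?expR_gt0 ?invr_gt0 ?divr_gt0// invf_div.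
apply: le_trans (expR_ge1Dx _); rewrite ler_wpDl// ler_pM2r ?invr_gt0//.
by rewrite expr2 ler_peMl// ler1n.
Qed.

(** [g] is the derivative of [h], which vanishes at both infinities. *)
Let int_g0 a c : \int[mu]_x g a c x = 0.
Proof.
pose C := normal_peak s * (s ^+ 2 *+ 2).
pose I (n : nat) : set R := `[(- n%:R : R), (n%:R : R)]%classic.
have FTC n : (0 < n)%N -> (\int[mu]_(x in I n) (g a c x)%:E = (h a c n%:R)%:E - (h a c (- n%:R))%:E)%E.
  { move=> n0; apply: continuous_FTC2.
  - by rewrite -subr_gt0 opprK addr_gt0// ltr0n.
  - exact: continuous_subspaceT.
  - have ch : continuous (h a c).
      move=> x; apply: differentiable_continuous; apply/derivable1_diffP.
      by case: (is_derive_h a c x).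
    split.
    + by move=> x _; case: (is_derive_h a c x).
    + by apply: cvg_at_right_filter; exact: ch.
    + by apply: cvg_at_left_filter; exact: ch.
  - by move=> x _; rewrite derive1E; exact: derive_val. }
have lim1 : (\int[mu]_(x in I n) (g a c x)%:E)%E @[n --> \oo] --> (\int[mu]_x (g a c x)%:E)%E.
  { under eq_fun do rewrite integral_mkcond.
  have [] := @dominated_convergence _ _ R mu setT measurableT
    (fun n => (EFin \o g a c) \_ (I n)) (EFin \o g a c) (fun x => `|(g a c x)%:E|%E).
  - move=> n; have mI : measurable (I n) by exact: measurable_itv.
    by apply: (measurable_restrictT (EFin \o g a c) mI).1; apply: measurable_funTS; exact: (measurable_int mu (int_g a c)).
  - exact: (measurable_int mu (int_g a c)).
  - apply: aeW => x _; apply: cvg_near_cst; near=> n; rewrite patchE ifT// inE /I/= in_itv/= -ler_norml.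
    by near: n; exact: nbhs_infty_ger.
  - exact: (integrable_abse (int_g a c)).
  - by apply: aeW => x n _; rewrite patchE; case: ifP => //; rewrite abse0.
  - by move=> _ _; apply. }
have lim2 : (\int[mu]_(x in I n) (g a c x)%:E)%E @[n --> \oo] --> (0 : \bar R)%E.
  have c0 : ((h a c n%:R) - (h a c (- n%:R))) @[n --> \oo] --> (0 : R).
    apply/cvgr0Pnorm_le => e e0; near=> n.
    have n0 : (0 < n)%N by near: n; exists 1%N.
    have np : (0 : R) < n%:R by rewrite ltr0n.
    apply: le_trans (ler_normB _ _) _.
    have hb x : x ^+ 2 = n%:R ^+ 2 -> `|h a c x| <= C / n%:R.
      move=> xn; apply: le_trans (p_decay n0 xn).
      by rewrite /h normrM (ger0_norm (p_ge0 x)) ler_piMl.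
    apply: le_trans (lerD (hb _ _) (hb _ _)) _; rewrite ?sqrrN//.
    rewrite -mulrDl ler_pdivrMr// mulrC -ler_pdivrMr//.
    by near: n; exact: nbhs_infty_ger.
  have : (h a c n%:R - h a c (- n%:R))%:E @[n --> \oo] --> (0 : R)%:E.
    by apply/fine_cvgP; split => //; exact: nearW.
  apply: cvg_trans; apply: near_eq_cvg; near=> n; rewrite FTC//=.
  by near: n; exists 1%N.
have := cvg_unique _ lim1 lim2 => e0.
by rewrite /Rintegral e0.
Unshelve. all: by end_near.
Qed.

Let ibp a c : \int[mu]_x (x * p x * sin (a * x + c)) = a * s ^+ 2 * \int[mu]_x (cos (a * x + c) * p x).
Proof.
have := int_g0 a c; rewrite /g RintegralB//; last 2 first.
  by rewrite (_ : EFin \o _ = fun x => a%:E * (cos (a * x + c) * p x)%:E)%E; [apply: integrableZl => //; exact: int_cos|apply/funext => x /=; rewrite EFinM].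
  by rewrite (_ : EFin \o _ = fun x => ((s ^+ 2)^-1)%:E * (x * p x * sin (a * x + c))%:E)%E; [apply: integrableZl => //; exact: int_xsin|apply/funext => x /=; rewrite EFinM].
rewrite (@RintegralZl _ _ _ mu setT _ a measurableT (int_cos a c)).
rewrite (@RintegralZl _ _ _ mu setT _ _ measurableT (int_xsin a c)).
move/eqP; rewrite subr_eq0 => /eqP e0.
by rewrite [RHS]mulrAC e0; field.
Qed.

(** Differentiation under the integral and integration by parts give F' = - a s^2 F, hence exp(a^2
    s^2 / 2) F is constant. *)
Lemma normal_cos (a c : R) :
  Ex N (fun x => cos (a * x + c)) = expR (- (a ^+ 2 * s ^+ 2 / 2)) * cos c.
Proof.
pose F (a : R) := \int[mu]_x (cos (a * x + c) * p x).
have bc a' : bmf (fun x : R => cos (a' * x + c)) by apply: bmf_cos; exact: m_lin.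
have FE a' : Ex N (fun x => cos (a' * x + c)) = F a' by rewrite Ex_normal_prob.
have dF (a' : R) : is_derive a' (1 : R) F (- (a' * s ^+ 2 * F a')).
  have aI : `](a' - 1), (a' + 1)[%classic a' by rewrite /= in_itv/=; apply/andP; split; lra.
  have df (x y : R) : is_derive x (1 : R) (fun x => cos (x * y + c) * p y) (- (y * p y * sin (x * y + c))).
    have dl : is_derive x (1 : R) (fun x => x * y + c) y.
      by apply: is_derive_eq; rewrite /GRing.scale /=; ring.
    have ds := @is_derive1_comp R cos (fun x => x * y + c) x _ _ (is_derive_cos (x * y + c)) dl.
    by apply: is_derive_eq; rewrite /GRing.scale /=; ring.
  have d1 (x y : R) : partial1of2 (fun x y => cos (x * y + c) * p y) x y = - (y * p y * sin (x * y + c)).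
    by rewrite /partial1of2 derive1E; exact: derive_val.
  have i1 x : `](a' - 1), (a' + 1)[%classic x -> mu.-integrable setT (EFin \o (fun y => cos (x * y + c) * p y)).
    by move=> _; exact: int_cos.
  have i2 (x y : R) : `](a' - 1), (a' + 1)[%classic x -> [set: R] y -> derivable (fun z : R => cos (z * y + c) * p y) x (1 : R).
    by move=> _ _; case: (df x y).
  have i3 (x y : R) : `](a' - 1), (a' + 1)[%classic x -> [set: R] y ->
      `|partial1of2 (fun x y => cos (x * y + c) * p y) x y| <= `|y * p y|.
    by move=> _ _; rewrite d1 normrN normrM ler_piMr.
  have D := @differentiation_under_integral R _ _ mu (fun x y => cos (x * y + c) * p y) setT measurableT
    a' (a' - 1) (a' + 1) aI i1 i2 (fun y => `|y * p y|) (fun y => normr_ge0 _) int_xp i3.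
  have D2 := @derivable_under_integral R _ _ mu (fun x y => cos (x * y + c) * p y) setT measurableT
    a' (a' - 1) (a' + 1) aI i1 i2 (fun y => `|y * p y|) (fun y => normr_ge0 _) int_xp i3.
  have -> : - (a' * s ^+ 2 * F a') = 'D_1 F a'.
    rewrite -derive1E D -ibp -[LHS]mulN1r -(@RintegralZl _ _ _ mu setT _ _ measurableT (int_xsin a' c)).
    by congr Rintegral; apply/funext => y; rewrite d1 mulN1r.
  exact/derivableP.
have dK (a' : R) : is_derive a' (1 : R) (fun x => expR (x ^+ 2 * s ^+ 2 / 2) * F x) 0.
  have dq : is_derive a' (1 : R) (fun x => x ^+ 2 * s ^+ 2 / 2) (a' * s ^+ 2).
    by apply: is_derive_eq; rewrite /GRing.scale /=; field.
  have de := @is_derive1_comp R expR (fun x => x ^+ 2 * s ^+ 2 / 2) a' _ _ (is_derive_expR (a' ^+ 2 * s ^+ 2 / 2)) dq.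
  by apply: is_derive_eq; rewrite /GRing.scale /=; ring.
have := @is_derive_0_is_cst R _ a 0 dK; rewrite expr0n !mul0r expR0 mul1r -(FE 0).
rewrite (_ : Ex N _ = cos c); last first.
  by rewrite -[RHS](Ex_cst N); apply: eq_Ex => x; rewrite mul0r add0r.
by move=> <-; rewrite FE mulrA -expRD addNr expR0 mul1r.
Qed.

End NormalCos.

(** * Laws on the line are determined by rays and by cosines *)

Section LawUniqueness.
Context {R : realType}.
Context d1 (T1 : measurableType d1) (P1 : probability T1 R).
Context d2 (T2 : measurableType d2) (P2 : probability T2 R).
Variables (X : T1 -> R) (Y : T2 -> R).
Hypotheses (mX : measurable_fun setT X) (mY : measurable_fun setT Y).

Lemma ray_law_unique :
  (forall t, P1 [set w | X w <= t] = P2 [set w | Y w <= t]) ->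
  forall B : set R, measurable B -> P1 (X @^-1` B) = P2 (Y @^-1` B).
Proof.
move=> rays.
have m1 B : measurable B -> measurable (X @^-1` B).
  by move=> mB; rewrite -[X in measurable X]setTI; exact: mX.
have m2 B : measurable B -> measurable (Y @^-1` B).
  by move=> mB; rewrite -[X in measurable X]setTI; exact: mY.
move=> B mB.
apply: (@dynkin_induction _ (measurableTypeR R) (@RGenOInfty.G R)
  (fun S => P1 (X @^-1` S) = P2 (Y @^-1` S))).
- exact: RGenOInfty.measurableE.
- move=> _ _ [a ->] [b ->]; exists (Num.max a b).
  by apply/seteqP; split => x /=; rewrite !in_itv/= !andbT gt_max => /andP.
- by rewrite !preimage_setT [LHS]probability_setT; apply/esym; exact: probability_setT.
- move=> _ [t ->].
  have E1 : (P1 (~` (X @^-1` `]-oo, t])) = 1 - P1 (X @^-1` `]-oo, t]))%E.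
    by apply: probability_setC; exact: m1.
  have E2 : (P2 (~` (Y @^-1` `]-oo, t])) = 1 - P2 (Y @^-1` `]-oo, t]))%E.
    by apply: probability_setC; exact: m2.
  have e1 : ~` (X @^-1` `]-oo, t]) = X @^-1` `]t, +oo[.
    by apply/seteqP; split => w /=; rewrite !in_itv/= andbT ltNge => /negP.
  have e2 : ~` (Y @^-1` `]-oo, t]) = Y @^-1` `]t, +oo[.
    by apply/seteqP; split => w /=; rewrite !in_itv/= andbT ltNge => /negP.
  rewrite -e1 -e2 [LHS]E1 [RHS]E2; congr (_ - _)%E.
  have -> : X @^-1` `]-oo, t] = [set w | X w <= t] by apply/seteqP; split => w /=; rewrite in_itv.
  have -> : Y @^-1` `]-oo, t] = [set w | Y w <= t] by apply/seteqP; split => w /=; rewrite in_itv.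
  exact: rays.
- move=> S mS eqS.
  have E1 : (P1 (~` (X @^-1` S)) = 1 - P1 (X @^-1` S))%E by apply: probability_setC; exact: m1.
  have E2 : (P2 (~` (Y @^-1` S)) = 1 - P2 (Y @^-1` S))%E by apply: probability_setC; exact: m2.
  by transitivity (1 - P1 (X @^-1` S))%E => //; rewrite eqS.
- move=> F mF tF eqF; rewrite !preimage_bigcup.
  have tr (U : Type) (Z : U -> R) : trivIset setT (fun i => Z @^-1` F i).
    by apply/trivIsetP => i j _ _ ij; rewrite -preimage_setI (_ : F i `&` F j = set0)//; move/trivIsetP : tF => ->.
  have E1 : (P1 (\bigcup_i (X @^-1` F i)) = \sum_(0 <= i <oo | i \in setT) P1 (X @^-1` F i))%E.
    by apply: measure_bigcup => // i _; exact: (m1 _ (mF i)).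
  have E2 : (P2 (\bigcup_i (Y @^-1` F i)) = \sum_(0 <= i <oo | i \in setT) P2 (Y @^-1` F i))%E.
    by apply: measure_bigcup => // i _; exact: (m2 _ (mF i)).
  by rewrite [LHS]E1 [RHS]E2; apply: eq_eseriesr => i _; exact: eqF.
- have e : measurable B = (<<s @RGenOInfty.G R >> B) := congr1 (fun S : set (set R) => S B) (RGenOInfty.measurableE R).
  by move: (mB); rewrite e.
Qed.

End LawUniqueness.

Lemma measurable_ray {R : realType} d (T : measurableType d) (X : T -> R) (t : R) :
  measurable_fun setT X -> measurable [set w | X w <= t].
Proof.
move=> mX; rewrite (_ : [set w | _] = [set: T] `&` X @^-1` `]-oo, t]); first exact: mX.
by apply/seteqP; split => w /=; rewrite in_itv/=; [move=> ?; split|case].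
Qed.

Lemma measurable_tail {R : realType} d (T : measurableType d) (X : T -> R) (t : R) :
  measurable_fun setT X -> measurable [set w | t < `|X w|].
Proof.
move=> mX; rewrite (_ : [set w | _] = [set: T] `&` (fun w => `|X w|) @^-1` `]t, +oo[).
  by apply: measurableT_comp.
by apply/seteqP; split => w /=; rewrite in_itv/= andbT; [move=> ?; split|case].
Qed.

Lemma tight_single {R : realType} d (T : measurableType d) (P : probability T R)
    (X : T -> R) : measurable_fun setT X ->
  forall e, 0 < e -> exists2 A : R, 0 < A & forall B, A <= B -> fine (P [set w | B < `|X w|]) <= e.
Proof.
move=> mX e e0.
have : Ex P (\1_[set w | n%:R < `|X w|] : T -> R) @[n --> \oo] --> Ex P (fun=> 0 : R).
  { apply: (@cvg_Ex _ _ _ _ _ _ 1).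
  - by move=> n; apply: bmf_meas; apply: bmf_indic; exact: measurable_tail.
  - exact: measurable_cst.
  - by move=> n x; rewrite indicE; case: (_ \in _); rewrite ?normr1 ?normr0.
  - apply: aeW => x; apply: cvg_near_cst; near=> n.
    rewrite indicE memNset//= => /lt_geF/negP; apply.
    by near: n; exact: nbhs_infty_ger. }
rewrite Ex_cst => /cvgr0Pnorm_le/(_ e e0) [n _ hn].
exists n.+1%:R; first by rewrite ltr0n.
move=> B nB; have := hn n.+1 (leqnSn n); rewrite Ex_indic; last exact: measurable_tail.
apply: le_trans; apply: le_trans (ler_norm _); apply: fine_le.
- by apply: fin_num_measure; exact: measurable_tail.
- by apply: fin_num_measure; exact: measurable_tail.
- apply: le_measure; rewrite ?inE; [exact: measurable_tail|exact: measurable_tail|].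
  by move=> w /=; exact: le_lt_trans.
Unshelve. all: by end_near. Qed.

Section CosLawUnique.
Context {R : realType}.
Context d1 (T1 : measurableType d1) (P1 : probability T1 R).
Context d2 (T2 : measurableType d2) (P2 : probability T2 R).
Variables (X : T1 -> R) (Y : T2 -> R).
Hypotheses (mX : measurable_fun setT X) (mY : measurable_fun setT Y).
Hypothesis cosXY : forall a c,
  Ex P1 (fun w => cos (a * X w + c)) = Ex P2 (fun w => cos (a * Y w + c)).

(** Lipschitz functions decreasing to the indicator of the ray up to t as m grows. *)
Let ramp (m : nat) (t x : R) : R := Num.min 1 (Num.max 0 (1 - m%:R * (x - t))).

Let ramp_lip m t x y : `|ramp m t x - ramp m t y| <= m%:R * `|x - y|.
Proof.
have minmax (a b : R) : `|Num.min 1 (Num.max 0 a) - Num.min 1 (Num.max 0 b)| <= `|a - b|.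
  have h1 := ler_norm (a - b); have := ler_norm (b - a); rewrite distrC => h2.
  by have [?|?] := lerP 0 a; have [?|?] := lerP 0 b; rewrite ?minEle; do ?case: ifPn => /= *; rewrite ler_norml; apply/andP; split; lra.
apply: le_trans (minmax _ _) _.
rewrite (_ : _ - _ = m%:R * (y - x)); last by ring.
by rewrite normrM ger0_norm// distrC.
Qed.

Let ramp_bound m t x : `|ramp m t x| <= 1.
Proof.
by rewrite /ramp ler_norml; have [?|?] := lerP 0 (1 - m%:R * (x - t)); rewrite minEle; case: ifPn => /= *; apply/andP; split; lra.
Qed.

Let measurable_ramp m t d (U : measurableType d) (Z : U -> R) : measurable_fun setT Z ->
  measurable_fun setT (fun w => ramp m t (Z w)).
Proof.
move=> mZ; apply: measurable_minr => //; apply: measurable_maxr => //.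
by apply: measurable_funB => //; apply: measurable_funM => //; apply: measurable_funB.
Qed.

(** The continuity theorem applied to a constant sequence turns equality on cosines into equality on
    Lipschitz functions. *)
Let Ex_ramp m t : Ex P1 (fun w => ramp m t (X w)) = Ex P2 (fun w => ramp m t (Y w)).
Proof.
have := @levy_continuity R 1 _ T1 P1 _ T2 P2 (fun _ w _ => X w) (fun w _ => Y w)
  (fun _ _ => mX) (fun _ => mY) _ _ (fun x => ramp m t (x ord0)) 1 m%:R.
move=> H; have : Ex P1 (fun w => ramp m t (X w)) @[n --> \oo] --> Ex P2 (fun w => ramp m t (Y w)).
  { apply: H => //.
  - move=> a c; rewrite (_ : Ex P2 _ = Ex P1 (fun w => cos (\sum_(k < 1) a k * X w + c))); first exact: cvg_cst.
    transitivity (Ex P2 (fun w => cos (a ord0 * Y w + c))); first by apply: eq_Ex => w; rewrite big_ord1.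
    by rewrite -cosXY; apply: eq_Ex => w; rewrite big_ord1.
  - move=> e e0; have [A A0 hA] := tight_single P1 mX e0; have [B B0 hB] := tight_single P2 mY e0.
    exists (Num.max A B); first by rewrite lt_max A0.
    by split => [n k|k]; [apply: hA|apply: hB]; rewrite le_max lexx ?orbT.
  - move=> x y e xy; apply: le_trans (ramp_lip _ _ _ _) _.
    by rewrite ler_wpM2l.
  - by move=> _; exact: measurable_ramp.
  - exact: measurable_ramp. }
by move=> h; have := cvg_unique _ h (cvg_cst (Ex P1 (fun w => ramp m t (X w)))) => ->.
Qed.

Lemma cos_law_unique (B : set R) : measurable B -> P1 (X @^-1` B) = P2 (Y @^-1` B).
Proof.
apply: ray_law_unique => // t.
have lim d (U : measurableType d) (Q : probability U R) (Z : U -> R) : measurable_fun setT Z ->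
    Ex Q (fun w => ramp m t (Z w)) @[m --> \oo] --> fine (Q [set w | Z w <= t]).
  move=> mZ; rewrite -Ex_indic; last exact: measurable_ray.
  { apply: (@cvg_Ex _ _ _ _ _ _ 1).
  - by move=> m; exact: measurable_ramp.
  - by apply: bmf_meas; apply: bmf_indic; exact: measurable_ray.
  - by move=> m w; exact: ramp_bound.
  - apply: aeW => w; apply: cvg_near_cst; near=> m; rewrite indicE /ramp.
    have [Zt|tZ] := leP (Z w) t.
      rewrite mem_set//; have : 0 <= m%:R * (t - Z w) by rewrite mulr_ge0// subr_ge0.
      by move=> h; have [?|?] := lerP 0 (1 - m%:R * (Z w - t)); rewrite minEle; case: ifPn => /= *; lra.
    rewrite memNset; last by move=> /=; rewrite leNgt tZ.
    have : 1 <= m%:R * (Z w - t).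
      rewrite -ler_pdivrMr ?subr_gt0// mul1r; near: m; exact: nbhs_infty_ger.
    by move=> h; have [?|?] := lerP 0 (1 - m%:R * (Z w - t)); rewrite minEle; case: ifPn => /= *; lra. }
have := lim _ _ P1 X mX; under eq_fun do rewrite Ex_ramp.
move=> /cvg_unique/(_ (lim _ _ P2 Y mY)) e.
rewrite -[LHS]fineK; last by apply: fin_num_measure; exact: measurable_ray.
rewrite -[RHS]fineK; last by apply: fin_num_measure; exact: measurable_ray.
by rewrite e.
Unshelve. all: by end_near. Qed.

End CosLawUnique.

Lemma centered_gaussianP {R : realType} d (T : measurableType d) (Q : probability T R)
    (Y : T -> R) (v : R) : measurable_fun setT Y -> 0 <= v ->
  (forall a c, Ex Q (fun w => cos (a * Y w + c)) = expR (- (a ^+ 2 * v / 2)) * cos c) ->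
  centered_gaussian Q Y.
Proof.
move=> mY v0 H; split => //; exists (Num.sqrt v); split; first exact: sqrtr_ge0.
move=> B mB; have mid : measurable_fun setT (fun x : R => x) by exact: measurable_id.
have [s0|s0] := eqVneq (Num.sqrt v) 0.
  have v00 : v = 0 by apply/eqP; rewrite eq_le v0 andbT -sqrtr_eq0 s0.
  rewrite (@cos_law_unique R _ T Q _ T Q Y (fun=> 0))//.
    rewrite diracE; have [B0|B0] := boolP (0 \in B).
      rewrite (_ : _ @^-1` _ = setT); first exact: probability_setT.
      by apply/seteqP; split => // w _ /=; exact: set_mem.
    rewrite (_ : _ @^-1` _ = set0) ?measure0//.
    by apply/seteqP; split => // w /= Bw; move: B0; rewrite mem_set.
  move=> a c; rewrite H v00 mulr0 mul0r oppr0 expR0 mul1r mulr0 add0r.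
  by rewrite Ex_cst.
rewrite (@cos_law_unique R _ T Q _ (measurableTypeR R) (normal_prob 0 (Num.sqrt v)) Y (fun x => x))//.
by move=> a c; rewrite H [RHS](normal_cos s0) sqr_sqrtr.
Qed.

Lemma Ex_iid_split {R : realType} {V : completeNormedModType R} d (T : measurableType d)
    (P : probability T R) (I J : eqType) (Z : I + J -> T -> V) (a : paths V I -> R)
    (b : paths V J -> R) : iid P Z -> bmf a -> bmf b ->
  Ex P (fun w => a (fun i => Z (inl i) w) * b (fun j => Z (inr j) w)) =
  Ex P (fun w => a (fun i => Z (inl i) w)) * Ex P (fun w => b (fun j => Z (inr j) w)).
Proof.
move=> iidZ ba bb; have [mZ [eqZ _]] := iidZ.
have iidl : iid P (fun i => Z (inl i)) by apply: iid_reindex iidZ => i i' [].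
have iidr : iid P (fun j => Z (inr j)) by apply: iid_reindex iidZ => i i' [].
have iid1 := iid_prod iidl iidr (fun i j B mB => eqZ _ _ B mB).
pose phi (x : paths V (I + J)%type) := a (fun k => x (inl k)) * b (fun j => x (inr j)).
have bphi : bmf phi.
  apply: bmfM.
    case: ba => ma [M aM]; split; last by exists M => w.
    by apply: (measurableT_comp ma); exact: measurable_reindex.
  case: bb => mb [M bM]; split; last by exists M => w.
  by apply: (measurableT_comp mb); exact: measurable_reindex.
have := @Ex_transfer _ _ _ _ _ _ (paths V (I + J)%type) P (P \x P)%E
  (fun w k => Z k w)
  (fun w k => match k with inl i => Z (inl i) w.1 | inr j => Z (inr j) w.2 end) phi.
rewrite (_ : phi \o _ = (fun w => a (fun i => Z (inl i) w) * b (fun j => Z (inr j) w)))//.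
move=> ->//.
- rewrite Ex_prod; last first.
    case: bphi => mphi [M pM]; split; last by exists M => w /=.
    apply: (measurableT_comp mphi); apply: measurable_paths => k; case: iid1 => mk _; exact: mk.
  rewrite -ExZr; last first.
    case: ba => ma [M aM]; split; last by exists M => w.
    by apply: (measurableT_comp ma); exact: measurable_paths.
  apply: eq_Ex => x; rewrite /phi /= -ExZ//.
  case: bb => mb [M bM]; split; last by exists M => w.
  by apply: (measurableT_comp mb); exact: measurable_paths.
- exact: measurable_paths.
- by apply: measurable_paths => k; case: iid1 => mk _; exact: mk.
- apply: iid_same_law => // k B mB.
  have PT : P setT = 1%E by exact: probability_setT.
  case: k => k.
    transitivity ((P \x P)%E ((Z (inl k) @^-1` B) `*` setT)).
      by rewrite [RHS]product_measure1E//; [rewrite [X in (_ * X)%E]PT mule1|exact: mZ].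
    by congr ((P \x P)%E _); apply/seteqP; split => -[x y] //= [].
  transitivity ((P \x P)%E (setT `*` (Z (inr k) @^-1` B))).
    by rewrite [RHS]product_measure1E//; [rewrite [X in (X * _)%E]PT mul1e|exact: mZ].
  by congr ((P \x P)%E _); apply/seteqP; split => -[x y] //= [].
Qed.

(** * Binary digits of a uniform variable *)

Section Digits.
Context {R : realType}.

Local Notation U := (uniform_prob (@ltr01 R)).
Local Notation T := (measurableTypeR R).

(** The default 0 outside [0, 1[ keeps the value below 2^n everywhere, and those points are null for
    the uniform law. *)
Definition dyadic_floor (n : nat) (x : R) : nat :=
  if 0 <= x < 1 then Num.truncn (2 ^+ n * x) else 0%N.

Lemma dyadic_floor_half n x : (dyadic_floor n.+1 x)./2 = dyadic_floor n x.
Proof.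
rewrite /dyadic_floor; case: ifPn => // /andP[x0 x1].
have p0 m : 0 <= 2 ^+ m * x by rewrite mulr_ge0// exprn_ge0.
have /andP[] := truncn_itv (p0 n.+1); set k := Num.truncn _ => k1 k2.
apply/esym/truncn_def.
have ke : (k = odd k + k./2.*2)%N by rewrite odd_double_half.
have : k%:R = (odd k)%:R + 2 * (k./2)%:R :> R by rewrite {1}ke natrD -mul2n natrM.
move: k1 k2; rewrite exprS -mulrA -!natr1.
by case: (odd k) => /=; rewrite ?mulr1n ?mulr0n => ? ? ?; apply/andP; split; lra.
Qed.

Lemma dyadic_floor_lt n x : (dyadic_floor n x < 2 ^ n)%N.
Proof.
rewrite /dyadic_floor; case: ifPn => [/andP[x0 x1]|_]; last by rewrite expn_gt0.
rewrite truncn_lt_nat ?mulr_ge0 ?exprn_ge0// natrX.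
by rewrite gtr_pMr// exprn_gt0.
Qed.

Lemma dyadic_floor_ge n j : (0 < j)%N ->
  [set x | (j <= dyadic_floor n x)%N] = `[(j%:R / 2 ^+ n : R), 1[%classic.
Proof.
move=> j0; have p2 : (0 : R) < 2 ^+ n by rewrite exprn_gt0.
apply/seteqP; split => x /=; rewrite in_itv/= /dyadic_floor.
  case: ifPn => [/andP[x0 x1]|_]; last by rewrite leqNgt j0.
  by rewrite truncn_ge_nat; [rewrite ler_pdivrMr// mulrC => ->|rewrite mulr_ge0// ltW].
move=> /andP[jx x1]; have x0 : 0 <= x by rewrite (le_trans _ jx)// divr_ge0 ?ltW.
by rewrite x0 x1/= truncn_ge_nat; [rewrite mulrC -ler_pdivrMr|rewrite mulr_ge0// ltW].
Qed.

Lemma uniform_itv (a : R) : 0 <= a <= 1 -> U `[a, 1[%classic = (1 - a)%:E.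
Proof.
move=> /andP[a0 a1].
have := @integral_uniform R 0 1 ltr01 (fun x => (\1_(`[a, 1[%classic : set T) x)%:E).
rewrite integral_indic// setIT => ->//; last first.
  exact/measurable_EFinP/measurable_indic.
rewrite subr0 invr1 mul1e integral_indic//.
rewrite setIidl; last first.
  by move=> x /=; rewrite !in_itv/= => /andP[ax /ltW->]; rewrite (le_trans a0).
have [->|aN1] := eqVneq a 1; first by rewrite set_itvco0 measure0 subrr.
have := @lebesgue_measure_itv R `[a, 1[; rewrite /= lte_fin lt_neqAle aN1 a1.
by apply.
Qed.

Lemma measurable_dyadic_ge n j : measurable ([set x | (j <= dyadic_floor n x)%N] : set T).
Proof.
case: j => [|j]; last by rewrite dyadic_floor_ge//; exact: measurable_itv.
by rewrite (_ : [set x | _] = setT)//; apply/seteqP; split.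
Qed.

Let ge n j := [set x : T | (j <= dyadic_floor n x)%N].

Let indic_ge n j x : \1_(ge n j) x = (j <= dyadic_floor n x)%N%:R :> R.
Proof.
rewrite indicE (_ : (x \in ge n j) = (j <= dyadic_floor n x)%N)//.
by apply/idP/idP => [/set_mem|/mem_set].
Qed.

Lemma Ex_dyadic_floor n (psi : nat -> R) :
  bmf (fun x : T => psi (dyadic_floor n x)) /\
  Ex U (fun x => psi (dyadic_floor n x)) = 2 ^- n * \sum_(k < 2 ^ n) psi k.
Proof.
have p2 : (0 : R) < 2 ^+ n by rewrite exprn_gt0.
have bi j : bmf (\1_(ge n j) : T -> R) by apply: bmf_indic; exact: measurable_dyadic_ge.
have E x : psi (dyadic_floor n x) = \sum_(k < 2 ^ n) psi k * ((\1_(ge n k) x) - (\1_(ge n k.+1) x)).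
  rewrite (bigD1 (Ordinal (dyadic_floor_lt n x)))//= big1 => [|i].
    by rewrite addr0 !indic_ge leqnn ltnn subr0 mulr1.
  rewrite -val_eqE/= => iN; rewrite !indic_ge.
  by case: (ltngtP i (dyadic_floor n x)) iN => //; rewrite ?subrr ?mulr0.
have bt k : bmf (fun x => psi k * ((\1_(ge n k) x) - (\1_(ge n k.+1) x))).
  by apply: bmfM; [exact: bmf_cst|exact: bmfB].
split; first by rewrite (funext E); apply: bmf_sum => k; exact: (bt k).
rewrite (_ : Ex U _ = Ex U (fun x => \sum_(k < 2 ^ n) psi k * ((\1_(ge n k) x) - (\1_(ge n k.+1) x)))); last exact: eq_Ex.
rewrite Ex_sum; last by move=> k; exact: bt.
rewrite mulr_sumr; apply: eq_bigr => k _.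
rewrite ExZ; last exact: bmfB.
rewrite ExB// mulrC; congr (_ * _).
have Eg j : (j <= 2 ^ n)%N -> Ex U (\1_(ge n j)) = 1 - j%:R / 2 ^+ n.
  move=> jn; rewrite Ex_indic; last exact: measurable_dyadic_ge.
  case: j jn => [|j] jn.
    by rewrite /ge (_ : [set x | _] = setT) ?mul0r ?subr0 -?[LHS]/(fine (U setT)) ?probability_setT//; apply/seteqP; split.
  rewrite /ge dyadic_floor_ge// [X in fine X]uniform_itv//.
  by rewrite divr_ge0 ?(ltW p2)//= ler_pdivrMr// mul1r -natrX ler_nat.
rewrite !Eg//; last exact: ltnW.
by rewrite -[in X in _ - X]natr1; field; rewrite gt_eqF.
Qed.

Definition digit (i : nat) (x : R) : R := (odd (dyadic_floor i.+1 x))%:R.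

Lemma Ex_digits n (phi : nat -> R -> R) :
  bmf (fun x : T => \prod_(i < n) phi i (digit i x)) /\
  Ex U (fun x => \prod_(i < n) phi i (digit i x)) = \prod_(i < n) ((phi i 0 + phi i 1) / 2).
Proof.
(* Evaluates the product on the integer dyadic floor: the lowest bit of [k] is the last digit, and
   halving [k] drops it. *)
pose psi := fix psi m k : R := if m is m'.+1 then psi m' k./2 * phi m' (odd k)%:R else 1.
have E x : \prod_(i < n) phi i (digit i x) = psi n (dyadic_floor n x).
  elim: n => [|n IH]; first by rewrite big_ord0.
  by rewrite big_ord_recr IH /= dyadic_floor_half.
have [b e] := Ex_dyadic_floor n (psi n).
split; first by rewrite (funext E).
rewrite (_ : Ex U _ = Ex U (fun x => psi n (dyadic_floor n x))); last exact: eq_Ex.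
rewrite e; elim: n {E b e} => [|n IH].
  by rewrite expr0 invr1 mul1r expn0 big_ord_recl !big_ord0 addr0.
rewrite big_ord_recr -IH /= -!(big_mkord xpredT (fun k => psi _ k)).
rewrite -(big_mkord xpredT (fun k => psi n k./2 * phi n (odd k)%:R)).
have -> m : \sum_(0 <= k < 2 ^ m.+1) psi n k./2 * phi n (odd k)%:R =
    (\sum_(0 <= k < 2 ^ m) psi n k) * (phi n 0 + phi n 1).
  rewrite expnS mul2n; elim: (2 ^ m)%N => [|N IHN]; first by rewrite !big_geq// mul0r.
  rewrite doubleS !big_nat_recr//= IHN mulrDl -addrA; congr (_ + _).
  by rewrite doubleK uphalf_double odd_double /= -mulrDr.
by rewrite exprS; field; rewrite ?gt_eqF// exprn_gt0.
Qed.

Let digit_event i (B : set R) : measurable (digit i @^-1` B : set T) /\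
  U (digit i @^-1` B) = (((\1_B 0 + \1_B 1) / 2 : R))%:E.
Proof.
have [b e] := Ex_digits i.+1 (fun j y => if j == i then \1_B y else 1).
have E : (fun x => \prod_(j < i.+1) (if j == i :> nat then (\1_B (digit j x) : R) else 1)) = \1_(digit i @^-1` B).
  apply/funext => x; rewrite (bigD1 ord_max)//= eqxx big1 ?mulr1// => j.
  by rewrite -val_eqE /= => /negbTE->.
move: b e; rewrite E => b e.
have mB : measurable (digit i @^-1` B : set T).
  by apply/measurable_indicP; exact: bmf_meas b.
split => //; rewrite -[LHS]fineK; last exact: fin_num_measure.
congr (_%:E); rewrite -Ex_indic//.
rewrite (_ : Ex U _ = Ex U (fun x => \prod_(j < i.+1) (if j == i :> nat then (\1_B (digit j x) : R) else 1))); last by rewrite E.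
have [_ ->] := Ex_digits i.+1 (fun j y => if j == i then \1_B y else 1).
rewrite (bigD1 ord_max)//= eqxx big1 ?mulr1// => j.
by rewrite -val_eqE /= => /negbTE->; lra.
Qed.

(** Taken with values in the normed space [R^o], so that the results on [iid] families and their
    regroupings apply to digits. *)
Lemma iid_digits : @iid R R^o _ T U nat digit.
Proof.
split; first by move=> j B _; exact: (digit_event j B).1.
split; first by move=> i j B _; rewrite [LHS](digit_event i B).2 [RHS](digit_event j B).2.
move=> J B uJ mB; pose n := (\max_(j <- J) j).+1.
pose phi j y : R := if j \in J then \1_(B j) y else 1.
have Jn j : j \in J -> (j < n)%N by move=> jJ; rewrite /n ltnS; exact: leq_bigmax_seq.
have [b e] := Ex_digits n phi.
have E : (fun x => \prod_(j < n) phi j (digit j x)) =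
    \1_(\bigcap_(j in [set j | j \in J]) (digit j @^-1` B j)).
  apply/funext => x; rewrite indicE; have [xB|xB] := pselect ((\bigcap_(j in [set j | j \in J]) (digit j @^-1` B j)) x).
    rewrite mem_set// big1// => j _; rewrite /phi; case: ifP => // jJ.
    by rewrite indicE mem_set//; exact: xB.
  rewrite memNset//.
  have [j jJ jB] : exists2 j, j \in J & ~ B j (digit j x).
    apply: contrapT => H; apply: xB => j /= jJ; apply: contrapT => jB; apply: H.
    by exists j.
  rewrite (bigD1 (Ordinal (Jn j jJ)))//= /phi jJ indicE memNset//.
  by rewrite mul0r.
rewrite E in b.
have mI : measurable (\bigcap_(j in [set j | j \in J]) (digit j @^-1` B j) : set T).
  by apply/measurable_indicP; exact: bmf_meas b.
rewrite -[LHS]fineK; last exact: fin_num_measure.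
rewrite -Ex_indic// -E e.
transitivity (\prod_(j <- J) ((\1_(B j) 0 + \1_(B j) 1) / 2 : R)%:E)%E; last first.
  by apply: eq_bigr => j _; apply/esym; exact: (digit_event _ _).2.
rewrite prodEFin; congr (_%:E).
rewrite -(big_mkord xpredT (fun i => (phi i 0 + phi i 1) / 2)).
have -> : \prod_(0 <= i < n) ((phi i 0 + phi i 1) / 2) =
  \prod_(0 <= i < n | i \in J) ((\1_(B i) 0 + \1_(B i) 1) / 2).
  by rewrite [RHS]big_mkcond; apply: eq_bigr => i _; rewrite /phi; case: ifP => // _; lra.
rewrite -big_filter; apply: perm_big; apply: uniq_perm => //.
  by rewrite filter_uniq// iota_uniq.
move=> j; rewrite mem_filter mem_index_iota /=; case: (boolP (j \in J)) => // jJ.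
by rewrite Jn.
Qed.

End Digits.

Lemma measurable_fun_rays {R : realType} d (T : measurableType d) (f : T -> R) :
  (forall t, measurable [set x | f x <= t]) -> measurable_fun setT f.
Proof.
move=> mf; apply: (measurability (@RGenOInfty.G R)); first exact: RGenOInfty.measurableE.
move=> _ [_ [t ->] <-]; rewrite setTI.
rewrite (_ : _ @^-1` _ = ~` [set x | f x <= t]); first exact: measurableC.
by apply/seteqP; split => x /=; rewrite in_itv/= andbT ltNge => /negP.
Qed.

Lemma eq_measure_off {R : realType} d (T : measurableType d)
    (mu : {measure set T -> \bar R}) (A B N : set T) :
  measurable A -> measurable B -> measurable N -> mu N = 0%E ->
  (forall x, ~ N x -> A x <-> B x) -> mu A = mu B.
Proof.
move=> mA mB mN N0 AB; rewrite -(measureU0 mA mN N0) -(measureU0 mB mN N0).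
congr (mu _); apply/seteqP; split => x; have [Nx|Nx] := pselect (N x); try by right.
- by case=> // Ax; left; apply/AB.
- by case=> // Ax; left; apply/AB.
Qed.

Lemma uniform_set1 {R : realType} (a : R) : uniform_prob (@ltr01 R) [set a] = 0%E.
Proof.
have /null_content_dominatesP := @dominates_uniform_prob R 0 1 ltr01.
by apply => //; exact: lebesgue_measure_set1.
Qed.

Section Binary.
Context {R : realType}.

(** Thresholding at the value 1 makes the binary series converge on every real sequence, so [binary]
    is measurable on the whole path space. *)
Let bit (y : R) : R := \1_[set 1] y.

Let bit01 y : 0 <= bit y <= 1.
Proof. by rewrite /bit indicE; case: (_ \in _); rewrite ?lexx ler01. Qed.

Let partial (x : nat -> R) (n : nat) : R := \sum_(j < n) 2 ^- j.+1 * bit (x j).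

Let nd_partial x : nondecreasing_seq (partial x).
Proof.
apply/nondecreasing_seqP => n; rewrite /partial big_ord_recr /= lerDl mulr_ge0//.
Qed.

Let cvg_partial x : cvgn (partial x).
Proof.
apply: nondecreasing_is_cvgn; first exact: nd_partial.
exists 1 => _ [n _ <-].
suff : partial x n <= 1 - 2 ^- n by move/le_trans; apply; rewrite gerBl.
elim: n => [|n IH]; first by rewrite /partial big_ord0 expr0 invr1 subrr.
rewrite /partial big_ord_recr /= (_ : 1 - 2 ^- n.+1 = (1 - 2 ^- n) + 2 ^- n.+1); last first.
  by rewrite exprS; field.
by rewrite lerD// ler_piMr//; have /andP[] := bit01 (x n).
Qed.

Definition binary (x : paths R^o nat) : R := limn (partial x).

Lemma measurable_binary : measurable_fun setT binary.
Proof.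
apply: (@measurable_fun_cvg _ (paths R^o nat) R setT (fun n x => partial x n)) => [n|x _]; last exact: cvg_partial.
apply: measurable_sum => j; apply: measurable_funM => //.
rewrite (_ : (fun x => _) = \1_[set x : paths R^o nat | x j = 1 :> R]) //.
apply: measurable_indic; apply: sub_sigma_algebra; exists (j : nat), [set (1 : R^o)]; split => //.
rewrite -[X in borelV X]setCK.
apply: (@measurableC _ (g_sigma_algebraType [set A : set R^o | open A])).
by apply: sub_sigma_algebra; apply: closed_openC; exact: closed_eq.
Qed.

Lemma binary_digits (x : R) : binary (fun j => digit j x) = if 0 <= x < 1 then x else 0.
Proof.
have p2 n : (0 : R) < 2 ^+ n by rewrite exprn_gt0.
have E n : partial (fun j => digit j x) n = (dyadic_floor n x)%:R / 2 ^+ n.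
  elim: n => [|n IH].
    rewrite /partial big_ord0; have := dyadic_floor_lt 0 x; rewrite expn0.
    by case: dyadic_floor => //; rewrite mul0r.
  rewrite /partial big_ord_recr /= -[X in X + _]/(partial (fun j => digit j x) n) IH.
  have -> : bit (digit n x) = (odd (dyadic_floor n.+1 x))%:R.
    rewrite /bit /digit indicE; case: odd; first by rewrite mem_set.
    by rewrite memNset//= => /esym/eqP; rewrite oner_eq0.
  rewrite -(dyadic_floor_half n) -[in RHS](odd_double_half (dyadic_floor n.+1 x)).
  rewrite natrD -mul2n natrM exprS; field.
  by rewrite gt_eqF.
apply/cvg_lim => //; rewrite (funext E); case: ifPn => [/andP[x0 x1]|xN]; last first.
  by apply: cvg_near_cst; apply: nearW => n; rewrite /dyadic_floor (negbTE xN) mul0r.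
apply/cvgrPdist_le => e e0; near=> n.
have := truncn_itv (mulr_ge0 (ltW (p2 n)) x0) => /andP[h1 h2].
rewrite /dyadic_floor x0 x1 /= ler_norml.
have : 2 ^- n <= e.
  rewrite invf_ple ?posrE ?exprn_gt0//; apply: le_trans (_ : n%:R <= _).
    by near: n; exact: nbhs_infty_ger.
  by rewrite -natrX ler_nat ltnW// ltn_expl.
move: h1 h2; set k := Num.truncn _; rewrite -[k.+1%:R]natr1 => h1 h2 he.
have k1 : k%:R / 2 ^+ n <= x by rewrite ler_pdivrMr// mulrC.
have k2 : x <= k%:R / 2 ^+ n + 2 ^- n.
  by rewrite -[X in _ + X]mul1r -mulrDl ler_pdivlMr// mulrC (ltW h2).
by apply/andP; split; lra.
Unshelve. all: by end_near. Qed.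

End Binary.

(** * Quantile transform *)

Section Quantile.
Context {R : realType} (N : probability (measurableTypeR R) R).
Local Notation U := (uniform_prob (@ltr01 R)).
Local Notation T := (measurableTypeR R).

Let F (t : R) : R := fine (N [set x | x <= t]).

Let mray t : measurable ([set x | x <= t] : set T).
Proof. exact: (@measurable_ray R _ T (fun x => x)). Qed.

Let ExF t : Ex N (\1_[set x | x <= t] : T -> R) = F t.
Proof. by rewrite Ex_indic. Qed.

Let F_nd s t : s <= t -> F s <= F t.
Proof.
move=> st; rewrite /F fine_le//; [exact: fin_num_measure|exact: fin_num_measure|].
by rewrite le_measure ?inE// => x /=; move/le_trans; exact.
Qed.

Let F_cvg (u : nat -> R) (A : set T) : measurable A ->
  (forall x, \forall n \near \oo, (x <= u n) <-> A x) -> F (u n) @[n --> \oo] --> fine (N A).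
Proof.
move=> mA uA; under eq_fun do rewrite -ExF.
rewrite -Ex_indic//; apply: (@cvg_Ex _ _ _ _ _ _ 1).
- by move=> n; apply: bmf_meas; exact: bmf_indic.
- by apply: bmf_meas; exact: bmf_indic.
- by move=> n x; rewrite indicE; case: (_ \in _); rewrite ?normr1 ?normr0.
- apply: aeW => x; apply: cvg_near_cst; near=> n; rewrite !indicE.
  rewrite (_ : (x \in [set x | x <= u n]) = (x \in A))//.
  have : (x <= u n) <-> A x by near: n; exact: uA.
  by move=> [h1 h2]; apply/idP/idP => /set_mem h; apply/mem_set; [exact: h1|exact: h2].
Unshelve. all: by end_near. Qed.

Let F_low (u : R) : 0 < u -> exists t, F t < u.
Proof.
move=> u0; have : F (- n%:R) @[n --> \oo] --> fine (N set0).
  apply: F_cvg => // x; near=> n; split => //.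
  apply/negP; rewrite -ltNge ltrNl; near: n; exact: nbhs_infty_gtr.
rewrite measure0 => /cvgr0Pnorm_lt/(_ u u0) [n _ /(_ n (leqnn n))].
by move=> h; exists (- n%:R); apply: le_lt_trans h; exact: ler_norm.
Unshelve. all: by end_near. Qed.

Let F_high (u : R) : u < 1 -> exists t, u <= F t.
Proof.
move=> u1; have : F n%:R @[n --> \oo] --> fine (N setT).
  apply: F_cvg => // x; near=> n; split => // _.
  near: n; exact: nbhs_infty_ger.
rewrite [X in fine X]probability_setT /= => /cvgrPdist_lt/(_ (1 - u)).
rewrite subr_gt0 => /(_ u1) [n _ /(_ n (leqnn n))].
by move=> h; exists n%:R; have := ler_norm (1 - F n%:R); lra.
Unshelve. all: by end_near. Qed.

Let F_right (t u : R) : (forall e, 0 < e -> u <= F (t + e)) -> u <= F t.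
Proof.
move=> H; have : F (t + n.+1%:R^-1) @[n --> \oo] --> F t.
  apply: F_cvg => // x; have [xt|tx] := leP x t.
    by apply: nearW => n; split => // _; rewrite (le_trans xt)// lerDl.
  near=> n; split => [xn|]; last by rewrite /= leNgt tx.
  exfalso; move: xn; rewrite leNgt => /negP[]; rewrite -ltrBrDl.
  rewrite invf_plt ?posrE ?subr_gt0//; near: n.
  have := nbhs_infty_gtr (x - t)^-1; apply: filterS => n /lt_le_trans; apply.
  by rewrite ler_nat.
by move=> h; apply: (cvgr_to_ge h); apply: nearW => n; exact: H.
Unshelve. all: by end_near. Qed.

(** Outside ]0, 1[ the infimum may be taken over an empty or unbounded set, hence the default. *)
Definition quantile (u : R) : R := if 0 < u < 1 then inf [set t | u <= F t] else 0.

Lemma quantile_le (u t : R) : 0 < u < 1 -> (quantile u <= t) = (u <= F t).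
Proof.
move=> u01; rewrite /quantile u01; have /andP[u0 u1] := u01.
have [t0 t0u] := F_low u0; have [t1 t1u] := F_high u1.
have lb : has_lbound [set t | u <= F t].
  exists t0 => s /= us; rewrite leNgt; apply/negP => st.
  by have := F_nd (ltW st); lra.
apply/idP/idP => [qt|ut]; last exact: ge_inf.
apply: F_right => e e0.
have [s /= us se] : exists2 s, u <= F s & s < inf [set t | u <= F t] + e.
  by have [s] := @inf_adherent _ [set t | u <= F t] _ e0 (conj (ex_intro _ t1 t1u) lb); exists s.
by apply: le_trans us _; apply: F_nd; lra.
Qed.

Let measurable_le_F t : measurable ([set u | u <= F t] : set T).
Proof. exact: mray. Qed.

Let m01 : measurable ([set u : R | 0 < u < 1] : set T).
Proof.
rewrite (_ : [set u | _] = `]0, 1[%classic); first exact: measurable_itv.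
by apply/seteqP; split => u /=; rewrite in_itv.
Qed.

Lemma measurable_quantile : measurable_fun setT (quantile : T -> R).
Proof.
apply: measurable_fun_rays => t.
rewrite (_ : [set u | _] = ([set u | 0 < u < 1] `&` [set u | u <= F t]) `|`
  (~` [set u | 0 < u < 1] `&` [set _ | 0 <= t])).
  apply: measurableU; apply: measurableI => //; first exact: measurableC.
  case: (0 <= t); first by rewrite (_ : [set _ | _] = setT)//; apply/seteqP; split.
  by rewrite (_ : [set _ | _] = set0)//; apply/seteqP; split.
apply/seteqP; split => u /=; have [u01|u01] := pselect (0 < u < 1).
- by rewrite quantile_le// => ut; left.
- by rewrite /quantile (negbTE (introN idP u01)) => t0; right.
- by rewrite quantile_le// => -[[]|[]].
- by rewrite /quantile (negbTE (introN idP u01)) => -[[]|[]].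
Qed.

Let clip (x : R) : R := if 0 <= x < 1 then x else 0.

Let clip_itv x : 0 < x < 1 -> clip x = x.
Proof. by move=> /andP[x0 x1]; rewrite /clip x1 (ltW x0). Qed.

Let measurable_clip : measurable_fun setT (clip : T -> T).
Proof.
apply: measurable_fun_ifT => //; apply: measurable_and => //=; first exact: measurable_fun_ler.
exact: measurable_fun_ltr.
Qed.

Lemma measurable_quantile_clip :
  measurable_fun setT (fun x : T => quantile (if 0 <= x < 1 then x else 0)).
Proof. exact: measurableT_comp measurable_quantile measurable_clip. Qed.

Lemma law_quantile (B : set R) : measurable B ->
  U [set x | B (quantile (clip x))] = N B.
Proof.
have mq := measurable_quantile_clip.
apply: (@ray_law_unique R _ T U _ T N (fun x => quantile (clip x)) (fun x => x)) => // t.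
have F01 : 0 <= F t <= 1.
  rewrite fine_ge0//= -[leRHS]/(fine 1%:E) fine_le ?fin_num_measure//.
  exact: probability_le1.
pose I (a : R) : set T := `[a, 1[%classic.
have mI a : measurable (I a) by exact: measurable_itv.
have UI a : 0 <= a <= 1 -> U (~` (I a)) = a%:E.
  move=> a01; have -> : U (~` (I a)) = (1%E - U (I a))%E by exact: probability_setC.
  by rewrite [X in (_ - X)%E](uniform_itv a01) -EFinB opprB addrC subrK.
have -> : N [set w | w <= t] = (F t)%:E by rewrite fineK//; exact: fin_num_measure.
rewrite -(UI _ F01).
have n0 : U (~` (I 0)) = 0%E by apply: UI; rewrite lexx ler01.
(* The two events agree inside ]0, 1[ except at the single point F t, which is excluded from the
   complement of [F t, 1[. *)
{ apply: (@eq_measure_off _ _ _ _ _ _ ((~` (I 0) `|` [set 0]) `|` [set F t])).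
- exact: measurable_ray.
- exact: measurableC.
- by apply: measurableU => //; apply: measurableU => //; exact: measurableC.
- rewrite measureU0//; last exact: uniform_set1; last by apply: measurableU => //; exact: measurableC.
  by rewrite measureU0//; [exact: measurableC|exact: uniform_set1].
- move=> x /= H; have [x01|x01] := pselect (0 < x < 1); last first.
    exfalso; apply: H; left; have [x1|x1] := pselect (0 <= x < 1).
      right; move: x1 => /andP[x0 x1]; apply/eqP; rewrite eq_le x0 andbT leNgt; apply/negP => x2.
      by apply: x01; rewrite x2 x1.
    by left; rewrite /I /= in_itv.
  rewrite clip_itv// quantile_le//; have /andP[x0 x1] := x01.
  rewrite /I /= in_itv /= x1 andbT; split => [xF Fx|/negP].
    by apply: H; right; apply: le_anti; rewrite xF.
  by rewrite -ltNge; exact: ltW. }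
Qed.

End Quantile.

Section NormalSequence.
Context {R : realType}.
Local Notation U := (uniform_prob (@ltr01 R)).
Local Notation T := (measurableTypeR R).
Local Notation N01 := (normal_prob (0 : R) (1 : R)).

Let dig (k : nat * nat) (x : R) : R := digit (pickle k) x.

Let iid_dig : @iid R R^o _ T U (nat * nat)%type dig.
Proof.
apply: (@iid_reindex R R^o _ T U _ _ (@pickle (nat * nat)%type) (fun i => digit i)) iid_digits.
exact: (pcan_inj pickleK).
Qed.

Let q (x : paths R^o nat) : R := quantile N01 (binary x).

Let mq : measurable_fun setT q.
Proof. exact: measurableT_comp (measurable_quantile N01) (@measurable_binary R). Qed.

(* The binary digits of one uniform variable are split into infinitely many infinite
   sequences, each giving a uniform variable and, by quantiles, a normal one. *)
Definition std_normal (i : nat) (x : R) : R := q (fun j => dig (i, j) x).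

Lemma measurable_std_normal i : measurable_fun setT (std_normal i : T -> R).
Proof.
apply: (measurableT_comp mq); apply: (@measurable_paths R R^o _ _ T (fun j => dig (i, j))) => j.
by case: iid_dig => m _; exact: m.
Qed.

Let std_normal_cos i a c :
  Ex U (fun x => cos (a * std_normal i x + c)) = expR (- (a ^+ 2 / 2)) * cos c.
Proof.
have mc : measurable_fun setT (fun y : R => cos (a * y + c)).
  by apply: bmf_meas; apply: bmf_cos; apply: measurable_funD => //; apply: measurable_funM.
pose b (x : paths R^o nat) := cos (a * q x + c).
have bb : bmf b by split; [exact: measurableT_comp mc mq|exists 1 => x; exact: cos_max].
have iid1 : @iid R R^o _ T U nat (fun j => dig (i, j)).
  by apply: (iid_reindex _ iid_dig) => j j' [].
transitivity (Ex U (fun x => b (fun j => digit j x))).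
  { apply: (@Ex_transfer _ _ _ _ _ _ (paths R^o nat) U U (fun x j => dig (i, j) x) (fun x j => digit j x) b) => //.
  - by apply: (@measurable_paths R R^o _ _ T (fun j => dig (i, j))) => j; case: iid1 => m _; exact: m.
  - by apply: (@measurable_paths R R^o _ _ T digit) => j; case: (@iid_digits R) => m _; exact: m.
  - apply: (@iid_same_law R R^o) => //; first exact: iid_digits.
    move=> j B mB; case: (@iid_digits R) => _ [e _]; exact: e. }
transitivity (Ex N01 (fun x => cos (a * x + c))); last first.
  by rewrite normal_cos ?oner_neq0// expr1n mulr1.
transitivity (Ex U (fun x => cos (a * quantile N01 (if 0 <= x < 1 then x else 0) + c))).
  by apply: eq_Ex => x; rewrite /b /q binary_digits.
apply: (@Ex_transfer _ _ _ _ _ _ T U N01 (fun x => quantile N01 (if 0 <= x < 1 then x else 0)) (fun x => x) (fun y => cos (a * y + c))) => //.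
- exact: measurable_quantile_clip.
- by move=> B mB; exact: (law_quantile N01 mB).
- by split => //; exists 1 => x; exact: cos_max.
Qed.

Let std_normal_sin i a c :
  Ex U (fun x => sin (a * std_normal i x + c)) = expR (- (a ^+ 2 / 2)) * sin c.
Proof.
have E y : sin y = - cos (y + pi / 2) :> R by rewrite cosDpihalf opprK.
under eq_Ex do rewrite E -addrA.
rewrite ExN ?std_normal_cos; last first.
  apply: bmf_cos; apply: measurable_funD => //; apply: measurable_funM => //.
  exact: measurable_std_normal.
by rewrite cosDpihalf mulrN opprK.
Qed.

(** Induction with an arbitrary phase: the sine that the addition formula produces is a cosine
    shifted by pi/2, so the induction hypothesis covers it too. *)
Lemma std_normals_cos n (a : nat -> R) c :
  Ex U (fun x => cos (\sum_(i < n) a i * std_normal i x + c)) =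
  expR (- (\sum_(i < n) a i ^+ 2 / 2)) * cos c.
Proof.
elim: n c => [|n IH] c.
  rewrite big_ord0 oppr0 expR0 mul1r.
  by under eq_Ex do rewrite big_ord0 add0r; rewrite Ex_cst.
have IHs : Ex U (fun x => sin (\sum_(i < n) a i * std_normal i x + c)) =
    expR (- (\sum_(i < n) a i ^+ 2 / 2)) * sin c.
  have E y : sin y = - cos (y + pi / 2) :> R by rewrite cosDpihalf opprK.
  under eq_Ex do rewrite E -addrA.
  rewrite ExN ?IH ?cosDpihalf ?mulrN ?opprK//.
  apply: bmf_cos; apply: measurable_funD => //; apply: measurable_sum => i.
  by apply: measurable_funM => //; exact: measurable_std_normal.
(* Row n of the digit array against the rows below it: disjoint digits, hence independent
   normals. *)
pose h (k : nat + 'I_n * nat) : nat * nat := match k with inl k => (n, k) | inr (i, k) => (nat_of_ord i, k) end.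
have injh : injective h.
  { move=> [k|[i k]] [k'|[i' k']] /= [].
  - by move=> ->.
  - by move=> e; have := ltn_ord i'; rewrite -e ltnn.
  - by move=> e; have := ltn_ord i; rewrite e ltnn.
  - by move=> /val_inj -> ->. }
have iidh := iid_reindex injh iid_dig.
pose S (y : paths R^o ('I_n * nat)) := \sum_(i < n) a i * q (fun k => y (i, k)).
have mS : measurable_fun setT S.
  apply: measurable_sum => i; apply: measurable_funM => //; apply: (measurableT_comp mq).
  exact: (@measurable_reindex R R^o nat ('I_n * nat)%type (fun k => (i, k))).
have mA : measurable_fun setT (fun x => a n * q x) by apply: measurable_funM.
have mSc : measurable_fun setT (fun y => S y + c) by apply: measurable_funD.
have C := Ex_iid_split iidh (bmf_cos mA) (bmf_cos mSc).
have D := Ex_iid_split iidh (bmf_sin mA) (bmf_sin mSc).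
have mZ : measurable_fun setT (fun x : T => a n * std_normal n x).
  by apply: measurable_funM => //; exact: measurable_std_normal.
have mZs : measurable_fun setT (fun x : T => \sum_(i < n) a i * std_normal i x + c).
  apply: measurable_funD => //; apply: measurable_sum => i.
  by apply: measurable_funM => //; exact: measurable_std_normal.
transitivity (Ex U (fun x => cos (a n * std_normal n x) * cos (\sum_(i < n) a i * std_normal i x + c) -
  sin (a n * std_normal n x) * sin (\sum_(i < n) a i * std_normal i x + c))).
  by apply: eq_Ex => x; rewrite -cosD big_ord_recr /= [_ + a n * _]addrC -addrA.
rewrite ExB; [|by apply: bmfM; apply: bmf_cos|by apply: bmfM; apply: bmf_sin].
have c1 := std_normal_cos n (a n) 0; have s1 := std_normal_sin n (a n) 0.
rewrite (_ : Ex U _ = expR (- (a n ^+ 2 / 2)) * (expR (- (\sum_(i < n) a i ^+ 2 / 2)) * cos c)); last first.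
  rewrite -IH; have -> : expR (- (a n ^+ 2 / 2)) = Ex U (fun x => cos (a n * std_normal n x)).
    by rewrite cos0 mulr1 in c1; rewrite -c1; apply: eq_Ex => x; rewrite addr0.
  exact: C.
rewrite (_ : Ex U _ = 0); last first.
  transitivity (Ex U (fun x => sin (a n * std_normal n x)) * Ex U (fun x => sin (\sum_(i < n) a i * std_normal i x + c))).
    exact: D.
  rewrite (_ : Ex U _ = 0) ?mul0r//.
  by rewrite sin0 mulr0 in s1; rewrite -[RHS]s1; apply: eq_Ex => x; rewrite addr0.
by rewrite subr0 big_ord_recr /= opprD expRD mulrA; congr (_ * _); rewrite mulrC.
Qed.

End NormalSequence.

(** * Gaussian sequence with a prescribed covariance *)

Section GaussianSequence.
Context {R : realType}.
Local Notation U := (uniform_prob (@ltr01 R)).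
Local Notation T := (measurableTypeR R).
Variable Gam : nat -> nat -> R.
Hypothesis symG : forall i j, Gam i j = Gam j i.
Hypothesis psdG : forall n (a : nat -> R), 0 <= \sum_(i < n) \sum_(j < n) a i * a j * Gam i j.

Let quadE n (a : nat -> R) :
  \sum_(i < n.+1) \sum_(j < n.+1) a i * a j * Gam i j =
  \sum_(i < n) \sum_(j < n) a i * a j * Gam i j + 2 * a n * (\sum_(i < n) a i * Gam n i)
    + a n ^+ 2 * Gam n n.
Proof.
rewrite big_ord_recr /= big_ord_recr /=.
under eq_bigr do rewrite big_ord_recr /=.
rewrite big_split /= -!addrA; congr (_ + _); rewrite !addrA; congr (_ + _).
rewrite (_ : 2 * a n * _ = a n * (\sum_(i < n) a i * Gam n i) + a n * (\sum_(i < n) a i * Gam n i)); last by ring.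
by rewrite !mulr_sumr; congr (_ + _); apply: eq_bigr => i _; rewrite 1?(symG i n); ring.
Qed.

(* The best linear prediction of the n-th variable from the earlier ones:
   positive semidefiniteness puts the covariance row in the row space of the
   possibly singular covariance matrix. *)
Let normal_equations n : exists c : nat -> R,
  forall j, (j < n)%N -> \sum_(i < n) c i * Gam i j = Gam n j.
Proof.
pose A : 'M[R]_n := \matrix_(i, j) Gam i j.
pose g : 'rV[R]_n := \row_j Gam n j.
have gA : (g <= A)%MS.
  rewrite submxE; apply/eqP/rowP => k; rewrite [RHS]mxE.
  pose v (i : nat) : R := if insub i is Some j then cokermx A j k else 0.
  have vE (i : 'I_n) : v i = cokermx A i k by rewrite /v valK.
  have Av (i : 'I_n) : \sum_(j < n) Gam i j * v j = 0.
    have := congr1 (fun M : 'M[R]_n => M i k) (mulmx_coker A); rewrite [RHS]mxE mxE => e.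
    by rewrite -[RHS]e; apply: eq_bigr => j _; rewrite [A i j]mxE vE.
  have -> : (g *m cokermx A) 0 k = \sum_(j < n) Gam n j * v j.
    by rewrite mxE; apply: eq_bigr => j _; rewrite [g 0 j]mxE vE.
  set b := \sum_(j < n) _.
  (* Moving along a kernel vector [v] leaves only an affine function of t in the quadratic form; it
     stays nonnegative for all t only if its slope vanishes. *)
  have H t : 0 <= 2 * t * b + Gam n n.
    pose w i := if (i < n)%N then t * v i else 1.
    have wE (i : 'I_n) : w i = t * v i by rewrite /w ltn_ord.
    have wn : w n = 1 by rewrite /w ltnn.
    have := psdG n.+1 w; rewrite quadE wn.
    have -> : \sum_(i < n) \sum_(j < n) w i * w j * Gam i j = 0.
      rewrite big1// => i _.
      transitivity (t * v i * t * \sum_(j < n) Gam i j * v j); last by rewrite Av mulr0.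
      by rewrite mulr_sumr; apply: eq_bigr => j _; rewrite !wE; ring.
    have -> : \sum_(i < n) w i * Gam n i = t * b.
      by rewrite mulr_sumr; apply: eq_bigr => j _; rewrite wE; ring.
    by move=> h; lra.
  apply: contrapT => /eqP b0.
  have := H (- (Gam n n + 1) / (2 * b)).
  rewrite (_ : 2 * _ * b = - (Gam n n + 1)); last by field.
  by move=> h; lra.
have [D gE] := submxP gA.
exists (fun i => if insub i is Some j then D 0 j else 0) => j jn.
have := congr1 (fun M : 'rV[R]_n => M 0 (Ordinal jn)) gE; rewrite !mxE /= => ->.
by apply: eq_bigr => i _; rewrite valK mxE.
Qed.

Let coef n : nat -> R := projT1 (cid (normal_equations n)).

Let coefE n j : (j < n)%N -> \sum_(i < n) coef n i * Gam i j = Gam n j.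
Proof. by rewrite /coef; case: cid => c /= h; exact: h. Qed.

Let resid n : R := Gam n n - \sum_(i < n) coef n i * Gam n i.

Let sum_coef n : \sum_(i < n) \sum_(j < n) coef n i * coef n j * Gam i j = \sum_(i < n) coef n i * Gam n i.
Proof.
rewrite exchange_big /=; apply: eq_bigr => j _.
rewrite -coefE// mulr_sumr; apply: eq_bigr => i _; ring.
Qed.

Let resid_ge0 n : 0 <= resid n.
Proof.
pose b i := if (i < n)%N then coef n i else -1.
have bE (i : 'I_n) : b i = coef n i by rewrite /b ltn_ord.
have bn : b n = -1 by rewrite /b ltnn.
have := psdG n.+1 b; rewrite quadE bn.
have -> : \sum_(i < n) \sum_(j < n) b i * b j * Gam i j = \sum_(i < n) coef n i * Gam n i.
  by rewrite -sum_coef; apply: eq_bigr => i _; apply: eq_bigr => j _; rewrite !bE.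
have -> : \sum_(i < n) b i * Gam n i = \sum_(i < n) coef n i * Gam n i.
  by apply: eq_bigr => i _; rewrite bE.
by rewrite /resid => h; lra.
Qed.

(** Cholesky construction: the prediction from earlier values plus a fresh normal of variance
    [resid]. Carrying the whole prefix makes the course-of-values recursion structural. *)
Fixpoint gauss_prefix (n : nat) (x : R) (i : nat) : R :=
  if n is m.+1 then
    if i == m then \sum_(j < m) coef m j * gauss_prefix m x j + Num.sqrt (resid m) * std_normal m x
    else gauss_prefix m x i
  else 0.

Definition gauss_seq (n : nat) (x : R) : R := gauss_prefix n.+1 x n.

Let gauss_prefixE n x i : (i < n)%N -> gauss_prefix n x i = gauss_seq i x.
Proof.
elim: n => // n IH; rewrite ltnS leq_eqVlt => /orP[/eqP->//|iN].
by rewrite /= ltn_eqF// IH.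
Qed.

Let gauss_seqE n x : gauss_seq n x =
  \sum_(j < n) coef n j * gauss_seq j x + Num.sqrt (resid n) * std_normal n x.
Proof.
rewrite /gauss_seq /= eqxx; congr (_ + _); apply: eq_bigr => j _.
by rewrite gauss_prefixE.
Qed.

Lemma measurable_gauss_seq n : measurable_fun setT (gauss_seq n : T -> R).
Proof.
elim/ltn_ind: n => n IH; rewrite (funext (gauss_seqE n)).
apply: measurable_funD; last by apply: measurable_funM => //; exact: measurable_std_normal.
rewrite (_ : (fun x => _) = fun x => \sum_(j <- enum 'I_n) coef n j * gauss_seq j x); last first.
  by apply/funext => x; rewrite big_enum.
apply: measurable_sum => j; apply: measurable_funM => //; exact: IH.
Qed.

(** The last Gaussian value is rewritten through earlier ones and its own normal, whose coefficient
    is moved into [e]; so [e] may be nonzero only from index [n] on, and positive residual variances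
    accumulate in its sum of squares. *)
Let gauss_mix n N (a e : nat -> R) c : (n <= N)%N -> (forall j, (j < n)%N -> e j = 0) ->
  Ex U (fun x => cos (\sum_(i < n) a i * gauss_seq i x + \sum_(j < N) e j * std_normal j x + c)) =
  expR (- ((\sum_(i < n) \sum_(j < n) a i * a j * Gam i j + \sum_(j < N) e j ^+ 2) / 2)) * cos c.
Proof.
elim: n a e => [|n IH] a e nN en.
  under eq_Ex do rewrite big_ord0 add0r.
  by rewrite std_normals_cos big_ord0 add0r mulr_suml.
pose a' i := a i + a n * coef n i.
pose s := Num.sqrt (resid n).
pose e' j := if j == n then a n * s else e j.
rewrite (_ : Ex U _ = Ex U (fun x => cos (\sum_(i < n) a' i * gauss_seq i x + \sum_(j < N) e' j * std_normal j x + c))); last first.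
  apply: eq_Ex => x; congr (cos (_ + c)).
  rewrite big_ord_recr /= gauss_seqE (bigD1 (Ordinal nN))//= en// mul0r add0r.
  rewrite [in RHS](bigD1 (Ordinal nN))//= [in RHS]/e' eqxx.
  rewrite [\sum_(i < N | _) (if _ then _ else _) * _](eq_bigr (fun j : 'I_N => e j * std_normal j x)); last first.
    by move=> j; rewrite -val_eqE /= => /negbTE->.
  rewrite !addrA; congr (_ + _).
  rewrite -/s mulrDr addrA [a n * (s * _)]mulrA; congr (_ + _).
  by rewrite mulr_sumr -big_split; apply: eq_bigr => i _ /=; rewrite /a'; ring.
rewrite IH; [|exact: ltnW|by move=> j jn; rewrite /e' ltn_eqF// en// ltnW].
congr (expR (- (_ / 2)) * _).
rewrite (bigD1 (Ordinal nN))//= [RHS]addrC [in RHS](bigD1 (Ordinal nN))//= en// expr0n add0r [e' n]/e' eqxx.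
rewrite [\sum_(i < N | _) e' i ^+ 2](eq_bigr (fun j : 'I_N => e j ^+ 2)); last first.
  by move=> j; rewrite -val_eqE /= /e' => /negbTE->.
rewrite exprMn sqr_sqrtr// addrA [RHS]addrC; congr (_ + _).
rewrite quadE /resid.
have -> : \sum_(i < n) \sum_(j < n) a' i * a' j * Gam i j =
  \sum_(i < n) \sum_(j < n) a i * a j * Gam i j + 2 * a n * (\sum_(i < n) a i * Gam n i)
   + a n ^+ 2 * (\sum_(i < n) coef n i * Gam n i).
  transitivity (\sum_(i < n) \sum_(j < n) (a i * a j * Gam i j + a i * a n * (coef n j * Gam j i)
    + (a j * a n * (coef n i * Gam i j)) + a n ^+ 2 * (coef n i * coef n j * Gam i j))).
    by apply: eq_bigr => i _; apply: eq_bigr => j _; rewrite /a' (symG j i); ring.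
  under eq_bigr do rewrite !big_split /=.
  rewrite !big_split /=; congr (_ + _); last first.
    by rewrite -sum_coef mulr_sumr; apply: eq_bigr => i _; rewrite mulr_sumr.
  rewrite -!addrA; congr (_ + _).
  have -> : 2 * a n * (\sum_(i < n) a i * Gam n i) = \sum_(i < n) a i * a n * Gam n i + \sum_(i < n) a i * a n * Gam n i.
    rewrite -big_split mulr_sumr; apply: eq_bigr => i _ /=; ring.
  congr (_ + _).
    by apply: eq_bigr => i _; rewrite -mulr_sumr coefE.
  by rewrite exchange_big; apply: eq_bigr => i _ /=; rewrite -mulr_sumr coefE.
by ring.
Qed.

Lemma gauss_seq_cos n (a : nat -> R) c :
  Ex U (fun x => cos (\sum_(i < n) a i * gauss_seq i x + c)) =
  expR (- ((\sum_(i < n) \sum_(j < n) a i * a j * Gam i j) / 2)) * cos c.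
Proof.
have := @gauss_mix n n a (fun=> 0) c (leqnn n) (fun _ _ => erefl).
rewrite [X in _ + X](big1 _ _) => [|i _]; last by rewrite expr0n.
rewrite addr0 => <-; apply: eq_Ex => x.
by rewrite [X in _ + X + c](big1 _ _) ?addr0// => i _; rewrite mul0r.
Qed.

End GaussianSequence.

(** * Orthant indicators *)

Section Orthants.
Context (R : realType) (V : completeNormedModType R) (d : nat).
Context dT (T : measurableType dT) (P : probability T R).
Context d2 (T2 : measurableType d2) (P2 : probability T2 R).
Context (xi : int -> T -> V) (zeta zeta' : int -> T2 -> V).
Hypothesis iid_xi : iid P xi.
Hypothesis iid_zeta : iid P2 (fun j : int + int =>
  match j with inl j => zeta j | inr j => zeta' j end).
Hypothesis law_zeta : forall B, borelV B -> P2 (zeta 0 @^-1` B) = P (xi 0 @^-1` B).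
Variable G : (nat -> V) -> ('I_d -> R).
Hypothesis mG : measurable_G G.

Let mxi j : rv_V (xi j). Proof. by case: iid_xi. Qed.
Let mzeta j : rv_V (zeta j). Proof. by case: iid_zeta => m _; exact: (m (inl j)). Qed.
Let mzeta' j : rv_V (zeta' j). Proof. by case: iid_zeta => m _; exact: (m (inr j)). Qed.

Definition orthant (t : 'I_d -> \bar R) (x : paths V nat) : R :=
  [forall k, ((G x k)%:E <= t k)%E]%:R.

Definition pt_le (s t : 'I_d -> \bar R) := forall k, (s k <= t k)%E.

Let mGk k : measurable_fun setT (fun x : paths V nat => G x k).
Proof. by move=> _ B mB; rewrite setTI; exact: mG. Qed.

Lemma bmf_orthant t : bmf (orthant t).
Proof.
have -> : orthant t = fun x => \prod_(k <- enum 'I_d) ((G x k)%:E <= t k)%E%:R.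
  apply/funext => x; rewrite /orthant big_enum /=.
  case: (boolP [forall k, _]) => [/forallP h|/forallPn[k /negbTE h]].
    by rewrite big1// => k _; rewrite h.
  by rewrite (bigD1 k)//= h mul0r.
apply: bmf_prod => k; split; last first.
  by exists 1 => x; case: (_ <= _)%E; rewrite ?normr1 ?normr0.
case: (t k) => [r| |] /=.
- rewrite (_ : (fun x => _) = \1_[set x : paths V nat | G x k <= r]).
    by apply/measurable_indicP; exact: measurable_ray.
  by apply/funext => x; rewrite lee_fin indicE; congr ((nat_of_bool _)%:R); apply/idP/idP => [/mem_set|/set_mem].
- rewrite (_ : (fun x => _) = fun=> 1%:R); first exact: measurable_cst.
  by apply/funext => x; rewrite leey.
- exact: measurable_cst.
Qed.

Lemma orthant01 t x : 0 <= orthant t x <= 1.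
Proof. by rewrite /orthant; case: [forall _, _]; rewrite ?lexx ler01. Qed.

Lemma orthant_mono s t x : pt_le s t -> orthant s x <= orthant t x.
Proof.
move=> st; rewrite /orthant ler_nat.
case: (boolP [forall k, ((G x k)%:E <= s k)%E]) => // /forallP h.
by rewrite (_ : [forall k, _])//; apply/forallP => k; exact: le_trans (h k) (st k).
Qed.

Definition dist_fun (t : 'I_d -> \bar R) : R := Ex P (fun w => orthant t (past xi 0 w)).

Lemma dist_funE t : Fdist P (causal G xi) t = dist_fun t.
Proof.
rewrite /Fdist /dist_fun -Ex_indic.
  apply: eq_Ex => w; rewrite indicE /orthant; congr ((nat_of_bool _)%:R).
  by apply/idP/forallP => [/set_mem|] h; [|apply/mem_set].
suff : measurable_fun setT (\1_[set w | (forall k, ((causal G xi 0 w k)%:E <= t k)%E)] : T -> R) by move/measurable_indicP.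
rewrite [X in measurable_fun _ X](_ : _ = fun w => orthant t (past xi 0 w)).
  by apply: bmf_meas; apply: bmf_past => //; exact: bmf_orthant.
apply/funext => w; rewrite indicE /orthant; congr ((nat_of_bool _)%:R).
by apply/idP/forallP => [/set_mem|] h; [|apply/mem_set].
Qed.

Let bpast t i : bmf (fun w => orthant t (past xi i w)).
Proof. by apply: bmf_past => //; exact: bmf_orthant. Qed.

Lemma dist_fun_mono s t : pt_le s t -> dist_fun s <= dist_fun t.
Proof. by move=> st; apply: le_Ex => // w; exact: orthant_mono. Qed.

Lemma dist_fun01 t : 0 <= dist_fun t <= 1.
Proof.
apply/andP; split; first by apply: Ex_ge0 => w; case/andP: (orthant01 t (past xi 0 w)).
by apply: le_Ex_cst => // w; case/andP: (orthant01 t (past xi 0 w)).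
Qed.

Lemma Ex_coupled (b : paths V nat -> R) i : bmf b ->
  Ex P2 (fun w => b (coupled_past zeta zeta' i w)) = Ex P (fun w => b (past xi 0 w)).
Proof.
move=> bb.
pose h (k : nat) : int + int := if 0 < i - k%:Z then inl (i - k%:Z) else inr (i - k%:Z).
have injh : injective h.
  by move=> k k'; rewrite /h; case: ifP => _; case: ifP => _ // [] /addrI /oppr_inj[].
have iid1 := iid_reindex injh iid_zeta.
have iid2 : iid P (fun k : nat => xi (0 - k%:Z)).
  by apply: iid_reindex iid_xi => k k' /addrI/oppr_inj[].
have E : (fun w => coupled_past zeta zeta' i w) =
    (fun w k => match h k with inl j => zeta j | inr j => zeta' j end w).
  by apply/funext => w; apply/funext => k; rewrite /coupled_past /h; case: ifP.
have := @Ex_transfer _ _ _ _ _ _ (paths V nat) P2 P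
  (fun w k => match h k with inl j => zeta j | inr j => zeta' j end w)
  (fun w k => xi (0 - k%:Z) w) b; rewrite -E; apply => //.
- by rewrite E; apply: measurable_paths => k; case: iid1 => m _; exact: m.
- exact: measurable_paths.
- rewrite E; apply: iid_same_law => // k B mB.
  case: iid_zeta => _ [eqz _]; case: iid_xi => _ [eqx _].
  by rewrite (eqz (h k) (inl 0))// law_zeta// (eqx _ 0).
Qed.

Lemma Ex_zeta_past (b : paths V nat -> R) i : bmf b ->
  Ex P2 (fun w => b (past zeta i w)) = Ex P (fun w => b (past xi 0 w)).
Proof.
move=> bb.
have iid1 : iid P2 (fun k : nat => zeta (i - k%:Z)).
  by apply: (iid_reindex (h := fun k : nat => inl (i - k%:Z)) _ iid_zeta) => k k' [] /addrI/oppr_inj[].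
have iid2 : iid P (fun k : nat => xi (0 - k%:Z)).
  by apply: iid_reindex iid_xi => k k' /addrI/oppr_inj[].
apply: (@Ex_transfer _ _ _ _ _ _ (paths V nat) P2 P
  (fun w k => zeta (i - k%:Z) w) (fun w k => xi (0 - k%:Z) w) b) => //.
- exact: measurable_paths.
- exact: measurable_paths.
- apply: iid_same_law => // k B mB.
  case: iid_zeta => _ [eqz _]; case: iid_xi => _ [eqx _].
  by rewrite (eqz (inl (i - k%:Z)) (inl 0))// law_zeta// (eqx _ 0).
Qed.

Definition coupling_gap (i : nat) (w : T2) : R :=
  enorm (fun k => G (past zeta i.+1 w) k - G (coupled_past zeta zeta' i.+1 w) k).

Lemma le_enorm (x : 'I_d -> R) k : `|x k| <= enorm x.
Proof.
rewrite /enorm -sqrtr_sqr ler_wsqrtr// (bigD1 k)//= lerDl.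
by apply: sumr_ge0 => i _; exact: sqr_ge0.
Qed.

Lemma measurable_coupling_gap i : measurable_fun setT (coupling_gap i).
Proof.
have mp : measurable_fun setT (fun w => past zeta i.+1 w) by exact: measurable_paths.
have mc : measurable_fun setT (fun w => coupled_past zeta zeta' i.+1 w).
  by apply: measurable_paths => k; case: (0 < _).
apply: (@measurableT_comp _ _ _ _ _ _ (@Num.sqrt R)).
  by apply: continuous_measurable_fun; exact: sqrt_continuous.
rewrite (_ : (fun w => _) = fun w => \sum_(k <- enum 'I_d)
  (G (past zeta i.+1 w) k - G (coupled_past zeta zeta' i.+1 w) k) ^+ 2); last first.
  by apply/funext => w; rewrite big_enum.
apply: measurable_sum => k; apply: measurable_funX; apply: measurable_funB.
- exact: (measurableT_comp (mGk k) mp).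
- exact: (measurableT_comp (mGk k) mc).
Qed.

Definition margin (k : 'I_d) (x : \bar R) : 'I_d -> \bar R :=
  fun i => if i == k then x else +oo%E.

Lemma orthant_margin k x p : orthant (margin k x) p = ((G p k)%:E <= x)%E%:R.
Proof.
rewrite /orthant /margin; congr ((nat_of_bool _)%:R); apply/forallP/idP => [/(_ k)|h i].
  by rewrite eqxx.
by case: eqP => [->//|_]; exact: leey.
Qed.

(** If x and y are e-close, their indicators differ only when some coordinate of x lies within e of
    the threshold, an event seen by one margin. *)
Lemma orthant_diff_le t (e : R) (x y : paths V nat) : 0 <= e ->
  `|orthant t x - orthant t y| <=
  \sum_k (orthant (margin k (t k + e%:E)%E) x - orthant (margin k (t k - e%:E)%E) x)
  + (e < enorm (fun k => G x k - G y k))%R%:R.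
Proof.
move=> e0.
have m0 k : 0 <= orthant (margin k (t k + e%:E)%E) x - orthant (margin k (t k - e%:E)%E) x.
  rewrite subr_ge0; apply: orthant_mono => i; rewrite /margin; case: eqP => // _.
  by rewrite leeD2l// lee_fin; lra.
have s0 : 0 <= \sum_k (orthant (margin k (t k + e%:E)%E) x - orthant (margin k (t k - e%:E)%E) x).
  exact: sumr_ge0.
have [he|he] := boolP (e < _).
  have /andP[? ?] := orthant01 t x; have /andP[? ?] := orthant01 t y.
  by rewrite ler_norml /=; apply/andP; split; lra.
rewrite -leNgt in he; rewrite addr0.
have gap k : `|G x k - G y k| <= e.
  by apply: le_trans he; exact: (@le_enorm (fun k => G x k - G y k)).
have key k : ((G x k)%:E <= t k)%E != ((G y k)%:E <= t k)%E ->
    1 <= \sum_k (orthant (margin k (t k + e%:E)%E) x - orthant (margin k (t k - e%:E)%E) x).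
  { move=> hk; rewrite (bigD1 k)//= -[leLHS]addr0; apply: lerD; last exact: sumr_ge0.
  rewrite !orthant_margin; have := gap k; rewrite ler_norml => /andP[g1 g2].
  case: (t k) hk => [r| |] /=; rewrite ?leey ?leeNy_eq ?eqxx// !lee_fin.
  have [xr|xr] := leP (G x k) r; have [yr|yr] := leP (G y k) r => // _.
  - by rewrite (_ : G x k <= r + e); [rewrite (_ : (G x k <= r - e) = false) ?subr0//; apply/negbTE; rewrite -ltNge|]; lra.
  - by rewrite (_ : G x k <= r + e); [rewrite (_ : (G x k <= r - e) = false) ?subr0//; apply/negbTE; rewrite -ltNge|]; lra. }
have [e1|ne] := eqVneq [forall k, ((G x k)%:E <= t k)%E] [forall k, ((G y k)%:E <= t k)%E].
  by rewrite /orthant e1 subrr normr0.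
 apply: (@le_trans _ _ 1).
  have /andP[? ?] := orthant01 t x; have /andP[? ?] := orthant01 t y.
  by rewrite ler_norml; apply/andP; split; lra.
have [k hk] : exists k, ((G x k)%:E <= t k)%E != ((G y k)%:E <= t k)%E.
  apply/existsP; apply: contraNT ne => /existsPn h.
  by apply/eqP/eq_forallb => k; apply/eqP; have := h k; rewrite negbK.
exact: key hk.
Qed.

Variables (c theta : R).
Hypothesis c0 : 0 <= c.
Hypothesis holder : forall u v : 'I_d -> R,
  `|dist_fun (fun k => (u k)%:E) - dist_fun (fun k => (v k)%:E)|
    <= c * enorm (fun k => u k - v k) `^ theta.

(** The Hoelder condition concerns finite points only; margins are reached by sending the other
    coordinates to infinity. *)
Lemma dist_fun_margin k (x : R) :
  dist_fun (fun i => (if i == k then x else n%:R)%:E) @[n --> \oo] --> dist_fun (margin k x%:E).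
Proof.
apply: (@cvg_Ex _ _ _ _ _ _ 1).
- by move=> n; exact: bmf_meas (bpast _ 0).
- exact: bmf_meas (bpast _ 0).
- by move=> n w; have /andP[h1 h2] := orthant01 (fun i => (if i == k then x else n%:R)%:E) (past xi 0 w); rewrite ger0_norm.
- apply: aeW => w; apply: cvg_near_cst.
  have : \forall n \near \oo, forall i, G (past xi 0 w) i <= n%:R.
    near=> n => i; apply: (@le_trans _ _ (\sum_i `|G (past xi 0 w) i|)).
      by rewrite (bigD1 i)//= (le_trans (ler_norm _))// lerDl sumr_ge0.
    near: n; exact: nbhs_infty_ger.
  apply: filterS => n h; rewrite orthant_margin /orthant; congr ((nat_of_bool _)%:R).
  apply/forallP/idP => [/(_ k)|hk i]; first by rewrite eqxx.
  by case: eqP => [->//|_]; rewrite lee_fin.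
Unshelve. all: by end_near. Qed.

Lemma margin_holder k (x : \bar R) e : 0 <= e ->
  dist_fun (margin k (x + e%:E)%E) - dist_fun (margin k (x - e%:E)%E) <= c * (2 * e) `^ theta.
Proof.
move=> e0; have r0 : 0 <= c * (2 * e) `^ theta by rewrite mulr_ge0// powR_ge0.
case: x => [x| |]; [|by rewrite /= subrr|by rewrite /= subrr].
rewrite -EFinD -EFinB.
apply: (cvgr_to_le (cvgB (@dist_fun_margin k (x + e)) (@dist_fun_margin k (x - e)))).
apply: nearW => n.
apply: le_trans (ler_norm _) _.
have := holder (fun i => if i == k then x + e else n%:R) (fun i => if i == k then x - e else n%:R).
move/le_trans; apply; rewrite ler_wpM2l//.
rewrite (_ : enorm _ = 2 * e)// /enorm (bigD1 k)//= eqxx big1 => [|i /negbTE->]; last by rewrite subrr expr0n.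
rewrite addr0 (_ : x + e - (x - e) = 2 * e); last by ring.
by rewrite sqrtr_sqr ger0_norm// mulr_ge0.
Qed.

Let tail i e := fine (P2 [set w | e < coupling_gap i w]).

Let mtail i e : measurable [set w | e < coupling_gap i w].
Proof.
rewrite (_ : [set w | _] = ~` [set w | coupling_gap i w <= e]).
  by apply: measurableC; apply: measurable_ray; exact: measurable_coupling_gap.
by apply/seteqP; split => w /=; rewrite ltNge => /negP.
Qed.

Lemma orthant_coupling i t e : 0 <= e ->
  Ex P2 (fun w => `|orthant t (past zeta i.+1 w) - orthant t (coupled_past zeta zeta' i.+1 w)|)
  <= d%:R * (c * (2 * e) `^ theta) + tail i e.
Proof.
move=> e0.
have bp s : bmf (fun w => orthant s (past zeta i.+1 w)) by apply: bmf_past => //; exact: bmf_orthant.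
have bc : bmf (fun w => orthant t (coupled_past zeta zeta' i.+1 w)).
  by apply: (bmf_coupled_past iid_zeta); exact: bmf_orthant.
pose f k w := orthant (margin k (t k + e%:E)%E) (past zeta i.+1 w) - orthant (margin k (t k - e%:E)%E) (past zeta i.+1 w).
have bf k : bmf (f k) by exact: bmfB.
have bi : bmf (\1_[set w | e < coupling_gap i w] : T2 -> R) by exact: bmf_indic.
have bs : bmf (fun w => \sum_(k <- enum 'I_d) f k w) by exact: bmf_sum.
apply: (@le_trans _ _ (Ex P2 (fun w => \sum_(k <- enum 'I_d) f k w + \1_[set w | e < coupling_gap i w] w))).
  apply: le_Ex; [by apply: bmf_norm; exact: bmfB|exact: bmfD|] => w.
  rewrite big_enum indicE /=.
  rewrite (_ : (w \in _) = (e < coupling_gap i w)); last by apply/idP/idP => [/set_mem|/mem_set].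
  exact: orthant_diff_le.
rewrite ExD// Ex_indic// lerD2r Ex_sum//.
apply: (@le_trans _ _ (\sum_(k <- enum 'I_d) c * (2 * e) `^ theta)).
  apply: ler_sum => k _; rewrite /f ExB// !(@Ex_zeta_past (orthant _))//; try exact: bmf_orthant.
  exact: margin_holder.
by rewrite big_enum sumr_const card_ord [leRHS]mulrC mulr_natr.
Qed.

End Orthants.

Lemma Lnorm_tail {R : realType} d (T : measurableType d) (P : probability T R)
    (h : T -> R) (s e eta : R) : measurable_fun setT h -> (forall x, 0 <= h x) ->
  0 < s -> 0 < e -> 0 <= eta ->
  (Lnorm P s%:E (EFin \o h) <= eta%:E)%E ->
  fine (P [set x | e < h x]) <= (eta / e) `^ s.
Proof.
move=> mh h0 s0 e0 eta0 hN.
pose A := [set x | e < h x]; rewrite -/A.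
have mA : measurable A.
  rewrite (_ : A = [set x | e < `|h x|]); first exact: measurable_tail.
  by apply/seteqP; split => x; rewrite /A /= ger0_norm.
have es : 0 < e `^ s by exact: powR_gt0.
have : ((e `^ s)%:E * P A <= (eta `^ s)%:E)%E.
  apply: (@le_trans _ _ (Lnorm P s%:E (EFin \o h) `^ s)%E); last first.
    rewrite -poweR_EFin; apply: gt0_ler_poweR; rewrite ?in_itv/= ?leey ?andbT//; first exact: ltW.
    exact: Lnorm_ge0.
  rewrite poweR_Lnorm ?gt_eqF//.
  have mE : measurable_fun setT (EFin \o h) by exact/measurable_EFinP.
  have := @le_integral_comp_abse _ T R P setT measurableT (EFin \o h) e (fun x => x `^ s)%E
    (measurable_poweR s) (fun r _ => poweR_ge0 r s) _ mE e0.
  move=> H; apply: (le_trans _ (H _)); last first.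
    move=> x y; rewrite !inE/= !in_itv/= !andbT => x0' y0' xy.
    by apply: gt0_ler_poweR; rewrite ?in_itv/= ?leey ?andbT//; exact: ltW.
  rewrite -poweR_EFin lee_wpmul2l ?poweR_ge0// le_measure ?inE//.
    by apply: emeasurable_fun_c_infty => //; exact: measurableT_comp.
  by move=> x ex; split => //=; rewrite lee_fin ger0_norm// ltW.
rewrite -[P A]fineK; last exact: fin_num_measure.
rewrite -EFinM lee_fin powRM ?invr_ge0 ?(ltW e0)// -powR_inv1 ?(ltW e0)// -powRrM mulN1r powRN mulrC => h1.
by rewrite ler_pdivlMr.
Qed.

Lemma Lnorm_tail_oo {R : realType} d (T : measurableType d) (P : probability T R)
    (h : T -> R) (eta : R) : measurable_fun setT h -> (forall x, 0 <= h x) ->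
  (Lnorm P +oo (EFin \o h) <= eta%:E)%E -> fine (P [set x | eta < h x]) = 0.
Proof.
move=> mh h0; rewrite unlock /= (_ : P setT = 1%E) ?lte01; last exact: probability_setT.
move=> /ess_sup_inf.ess_supP [A [mA A0 hA]].
pose B := [set x | eta < h x]; rewrite -/B.
have mB : measurable B.
  rewrite (_ : B = [set x | eta < `|h x|]); first exact: measurable_tail.
  by apply/seteqP; split => x; rewrite /B /= ger0_norm.
rewrite (_ : P B = 0%E)//; apply/eqP; rewrite eq_le measure_ge0 andbT -A0.
apply: le_measure; rewrite ?inE// => x ex; apply: hA => /=.
by rewrite lee_fin ger0_norm// leNgt ex.
Qed.

Lemma le0_of_powR_small {R : realType} (x K a : R) : 0 < a -> 0 <= K ->
  (forall eta, 0 < eta -> x <= K * eta `^ a) -> x <= 0.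
Proof.
move=> a0 K0 H; rewrite leNgt; apply/negP => x0.
have y0 : 0 < x / (2 * (K + 1)) by rewrite divr_gt0// mulr_gt0// ltr_wpDl.
have := H ((x / (2 * (K + 1))) `^ a^-1) (powR_gt0 _ y0).
rewrite -powRrM mulVf ?gt_eqF// powRr1 ?(ltW y0)//.
rewrite mulrA ler_pdivlMr; last by rewrite mulr_gt0// ltr_wpDl.
by have := mulr_ge0 K0 (ltW x0); lra.
Qed.

(** * Coupling bound for orthant differences *)

Section Dependence.
Context (R : realType) (V : completeNormedModType R) (d : nat).
Context dT (T : measurableType dT) (P : probability T R).
Context d2 (T2 : measurableType d2) (P2 : probability T2 R).
Context (xi : int -> T -> V) (zeta zeta' : int -> T2 -> V).
Hypothesis iid_xi : iid P xi.
Hypothesis iid_zeta : iid P2 (fun j : int + int =>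
  match j with inl j => zeta j | inr j => zeta' j end).
Hypothesis law_zeta : forall B, borelV B -> P2 (zeta 0 @^-1` B) = P (xi 0 @^-1` B).
Variable G : (nat -> V) -> ('I_d -> R).
Hypothesis mG : measurable_G G.
Variables (c theta : R).
Hypothesis c0 : 0 <= c.
Hypothesis theta0 : 0 < theta.
Hypothesis holder : forall u v : 'I_d -> R,
  `|dist_fun P xi G (fun k => (u k)%:E) - dist_fun P xi G (fun k => (v k)%:E)|
    <= c * enorm (fun k => u k - v k) `^ theta.

Variables (s : \bar R) (rate : R).
Hypothesis rateP : (s = +oo%E /\ rate = theta) \/
  exists s', [/\ s = s'%:E, 0 < s' & rate = theta * s' / (s' + theta)].

Let F := dist_fun P xi G.
Let gap i := coupling_gap zeta zeta' G i.
Definition gap_norm (i : nat) : R := fine (Lnorm P2 s (fun w => (gap i w)%:E)).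

Hypothesis gap_fin : forall i, (Lnorm P2 s (fun w => (gap i w)%:E) < +oo)%E.

Let mgap i : measurable_fun setT (gap i).
Proof. exact: (measurable_coupling_gap iid_zeta mG). Qed.

Let gap0 i w : 0 <= gap i w. Proof. exact: sqrtr_ge0. Qed.

Let rate0 : 0 < rate.
Proof.
case: rateP => [[_ ->]//|[s' [_ s0 ->]]].
by rewrite divr_gt0// ?mulr_gt0// addr_gt0.
Qed.

Let Lnorm_le i eta : gap_norm i <= eta ->
  (Lnorm P2 s (fun w => (gap i w)%:E) <= eta%:E)%E.
Proof.
move=> h; rewrite -[leLHS]fineK ?lee_fin// ge0_fin_numE//; exact: Lnorm_ge0.
Qed.

Lemma gap_norm_ge0 i : 0 <= gap_norm i.
Proof. by apply: fine_ge0; exact: Lnorm_ge0. Qed.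

(* The radius balances the Hoelder modulus against the tail of the coupling gap. *)
Lemma orthant_coupling_rate i t eta : 0 < eta -> gap_norm i <= eta ->
  Ex P2 (fun w => `|orthant G t (past zeta i.+1 w) - orthant G t (coupled_past zeta zeta' i.+1 w)|)
  <= (d%:R * (c * 2 `^ theta) + 1) * eta `^ rate.
Proof.
move=> eta0 eta1; have Le := Lnorm_le eta1.
have [e [e0 et tl]] : exists e, [/\ 0 < e, e `^ theta = eta `^ rate &
    fine (P2 [set w | e < gap i w]) <= eta `^ rate].
  case: rateP => [[soo ->]|[s' [sE s0 rE]]].
    exists eta; split => //; rewrite soo in Le.
    by rewrite (Lnorm_tail_oo (mgap i) (gap0 i) Le) powR_ge0.
  have st : 0 < s' + theta by rewrite addr_gt0.
  exists (eta `^ (s' / (s' + theta))); split; first exact: powR_gt0.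
    by rewrite -powRrM rE; congr (_ `^ _); rewrite mulrC mulrA.
  rewrite sE in Le.
  apply: le_trans (Lnorm_tail (mgap i) (gap0 i) s0 (powR_gt0 _ eta0) (ltW eta0) Le) _.
  rewrite -powRN -{1}(powRr1 (ltW eta0)) -powRD; last by rewrite (gt_eqF eta0) implybT.
  rewrite -powRrM rE le_eqVlt; apply/orP; left; apply/eqP; congr (_ `^ _).
  by field; rewrite gt_eqF.
apply: le_trans (orthant_coupling iid_xi iid_zeta law_zeta mG c0 holder i t (ltW e0)) _.
rewrite [leRHS]mulrDl mul1r; apply: lerD; last exact: tl.
by rewrite powRM// ?(ltW e0)// et !mulrA.
Qed.

Variable alpha : R.
Hypothesis alpha0 : 0 < alpha.
Hypothesis alpha_rate : alpha < rate.

(** With g = 1 - alpha/rate, write x = x^g x^(1-g) and bound the first factor through x <= 2m, the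
    second through x <= C delta^rate: the coupling norm then enters with exactly the power alpha of
    the summability hypothesis. *)
Lemma dependence_bound : exists2 C : R, 1 <= C & forall u t i, pt_le u t ->
  Ex P2 (coupling_dist zeta zeta' (fun x => orthant G t x - orthant G u x) i) <=
  C * (F t - F u) `^ (1 - alpha / rate) * gap_norm i `^ alpha.
Proof.
pose g := 1 - alpha / rate.
have ar : 0 < alpha / rate by rewrite divr_gt0.
have ar1 : alpha / rate < 1 by rewrite ltr_pdivrMr// mul1r.
have g0 : 0 < g by rewrite subr_gt0.
pose C1 := d%:R * (c * 2 `^ theta) + 1.
have C10 : 0 <= C1 by rewrite addr_ge0// mulr_ge0// mulr_ge0// powR_ge0.
pose C := 2 `^ g * (2 * C1) `^ (1 - g) + 1.
have C0 : 1 <= C by rewrite lerDr mulr_ge0// powR_ge0.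
exists C => // u t i ut.
set x := Ex P2 _; set m := F t - F u.
have m0 : 0 <= m by rewrite subr_ge0; apply: dist_fun_mono.
have bz v : bmf (fun w => orthant G v (past zeta i.+1 w)).
  by apply: bmf_past; [case: iid_zeta => h _ j; exact: (h (inl j))|exact: bmf_orthant].
have bc v : bmf (fun w => orthant G v (coupled_past zeta zeta' i.+1 w)).
  by apply: (bmf_coupled_past iid_zeta); exact: bmf_orthant.
have x0 : 0 <= x by apply: Ex_ge0 => w; exact: normr_ge0.
have bx : bmf (coupling_dist zeta zeta' (fun x => orthant G t x - orthant G u x) i).
  by apply: bmf_norm; apply: bmfB; apply: bmfB.
have xm : x <= 2 * m.
  apply: (@le_trans _ _ (Ex P2 (fun w => (orthant G t (past zeta i.+1 w) - orthant G u (past zeta i.+1 w)) +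
     (orthant G t (coupled_past zeta zeta' i.+1 w) - orthant G u (coupled_past zeta zeta' i.+1 w))))).
    apply: le_Ex => //; first by apply: bmfD; exact: bmfB.
    move=> w; rewrite /coupling_dist.
    have h1 := orthant_mono G (past zeta i.+1 w) ut.
    have h2 := orthant_mono G (coupled_past zeta zeta' i.+1 w) ut.
    by rewrite ler_norml; apply/andP; split; lra.
  rewrite ExD; [|exact: bmfB|exact: bmfB]; rewrite !ExB//.
  rewrite !(Ex_zeta_past iid_xi iid_zeta law_zeta); try exact: bmf_orthant.
  rewrite !(Ex_coupled iid_xi iid_zeta law_zeta); try exact: bmf_orthant.
  by rewrite -/(dist_fun P xi G t) -/(dist_fun P xi G u) -/(F t) -/(F u) /m; lra.
have xe eta : 0 < eta -> gap_norm i <= eta -> x <= (2 * C1) * eta `^ rate.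
  move=> e0 e1.
  apply: (@le_trans _ _ (Ex P2 (fun w => `|orthant G t (past zeta i.+1 w) - orthant G t (coupled_past zeta zeta' i.+1 w)|
     + `|orthant G u (past zeta i.+1 w) - orthant G u (coupled_past zeta zeta' i.+1 w)|))).
    apply: le_Ex => //; first by apply: bmfD; apply: bmf_norm; exact: bmfB.
    move=> w; rewrite /coupling_dist.
    rewrite [X in `|X|](_ : _ = (orthant G t (past zeta i.+1 w) - orthant G t (coupled_past zeta zeta' i.+1 w)) -
      (orthant G u (past zeta i.+1 w) - orthant G u (coupled_past zeta zeta' i.+1 w))); last by ring.
    exact: ler_normB.
  rewrite ExD; [|by apply: bmf_norm; exact: bmfB|by apply: bmf_norm; exact: bmfB].
  have := orthant_coupling_rate t e0 e1; have := orthant_coupling_rate u e0 e1.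
  by rewrite -/C1; lra.
have key eta : 0 < eta -> gap_norm i <= eta -> x <= (C * m `^ g) * eta `^ alpha.
  move=> e0 e1; have h := xe _ e0 e1.
  have er : 0 <= eta `^ rate by exact: powR_ge0.
  rewrite -[x](powRr1 x0) (_ : 1 = g + (1 - g)); last by ring.
  rewrite powRD; last by rewrite addrC subrK oner_eq0.
  have p1 : x `^ g <= 2 `^ g * m `^ g.
    rewrite -powRM//; apply: ge0_ler_powR; rewrite ?nnegrE ?(ltW g0)//.
    by rewrite mulr_ge0.
  have p2 : x `^ (1 - g) <= (2 * C1) `^ (1 - g) * eta `^ alpha.
    rewrite (_ : eta `^ alpha = (eta `^ rate) `^ (1 - g)); last first.
      rewrite -powRrM; congr (_ `^ _); rewrite /g.
      by field; rewrite gt_eqF.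
    rewrite -powRM//; last by rewrite mulr_ge0.
    apply: ge0_ler_powR; rewrite ?nnegrE// ?mulr_ge0//.
    by rewrite /g opprB addrC subrK ltW.
  apply: (@le_trans _ _ ((2 `^ g * m `^ g) * ((2 * C1) `^ (1 - g) * eta `^ alpha))).
    by apply: ler_pM; rewrite ?powR_ge0.
  rewrite (_ : _ * _ = (C - 1) * (m `^ g * eta `^ alpha)); last by rewrite /C; ring.
  rewrite -[leRHS]mulrA ler_wpM2r//; first by rewrite mulr_ge0// powR_ge0.
  by lra.
(* The bound requires a positive radius; a vanishing norm is reached by letting eta tend to 0. *)
have [gi0|giN] := eqVneq (gap_norm i) 0.
  rewrite gi0 powR0 ?gt_eqF// mulr0.
  apply: (@le0_of_powR_small _ _ (C * m `^ g) alpha) => //.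
    by rewrite mulr_ge0 ?powR_ge0// (le_trans ler01).
  by move=> eta e0; apply: key => //; rewrite gi0 ltW.
by apply: key => //; rewrite lt_def giN gap_norm_ge0.
Qed.

End Dependence.

Lemma cvg_sum_seq {R : realType} I (s : seq I) (u : I -> nat -> R) (l : I -> R) :
  (forall i, u i n @[n --> \oo] --> l i) ->
  \sum_(i <- s) u i n @[n --> \oo] --> \sum_(i <- s) l i.
Proof.
move=> ul; elim: s => [|i s IH].
  by rewrite big_nil; under eq_fun do rewrite big_nil; exact: cvg_cst.
rewrite big_cons; under eq_fun do rewrite big_cons.
by apply: cvgD => //; exact: ul.
Qed.

(** * Moments and finite-dimensional limits of the empirical process *)

Section EmpiricalProcess.
Context (R : realType) (V : completeNormedModType R) (d : nat).
Context dT (T : measurableType dT) (P : probability T R).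
Context d2 (T2 : measurableType d2) (P2 : probability T2 R).
Context (xi : int -> T -> V) (zeta zeta' : int -> T2 -> V).
Hypothesis iid_xi : iid P xi.
Hypothesis iid_zeta : iid P2 (fun j : int + int =>
  match j with inl j => zeta j | inr j => zeta' j end).
Hypothesis law_zeta : forall B, borelV B -> P2 (zeta 0 @^-1` B) = P (xi 0 @^-1` B).

Let mxi j : rv_V (xi j). Proof. by case: iid_xi. Qed.

Section ShortRange.
Variables (q : nat) (K : R) (beta : nat -> R).
Hypothesis beta0 : forall i, 0 <= beta i.
Hypothesis sum_beta : forall n, \sum_(i < n) i.+1%:R ^+ (2 * q).+2 * beta i <= K.

(** The variance constant 1 + 2 K is the lag-zero term plus twice the sum of the autocovariances. *)
Lemma psum_short_range (a : paths V nat -> R) (kappa : R) : 0 <= kappa -> bmf a ->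
  (forall x, `|a x| <= 1) -> Ex P (fun w => a (past xi 0 w)) = 0 ->
  Ex P (fun w => a (past xi 0 w) ^+ 2) <= kappa ->
  (forall i, Ex P2 (coupling_dist zeta zeta' a i) <= kappa * beta i) ->
  short_range P P2 q (1 + 2 * K) K (psum xi a) (coupling_dist zeta zeta' a) kappa beta.
Proof.
move=> k0 ba a1 a0 ak dep.
have sb n : \sum_(i < n) beta i <= K.
  apply: le_trans (sum_beta n); apply: ler_sum => i _.
  by rewrite ler_peMl// exprn_ege1// ler1n.
split.
- exact: psum_splits.
- move=> n; split; first exact: (bmf_psum iid_xi ba).
  by move=> i; exact: (bmf_coupling_dist iid_zeta).
- move=> n w; apply: le_trans (ler_norm_sum _ _ _) _.
  apply: (@le_trans _ _ (\sum_(i < n) 1)); first by apply: ler_sum => i _.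
  by rewrite sumr_const card_ord.
- move=> i w; rewrite /coupling_dist normr_ge0/=; apply: le_trans (ler_normB _ _) _.
  have := a1 (past zeta i.+1 w); have := a1 (coupled_past zeta zeta' i.+1 w).
  by lra.
- split => //; first exact: (Ex_psum iid_xi iid_zeta law_zeta).
  by move=> n; exact: (variance_bound iid_xi iid_zeta law_zeta ba a0 a1 k0 dep sb n ak).
Qed.

End ShortRange.

Variable G : (nat -> V) -> ('I_d -> R).
Hypothesis mG : measurable_G G.
Variables (g C0 : R) (q : nat) (K : R) (beta : nat -> R).
Hypotheses (g01 : 0 < g <= 1) (C01 : 1 <= C0).
Hypothesis beta0 : forall i, 0 <= beta i.
Hypothesis sum_beta : forall n, \sum_(i < n) i.+1%:R ^+ (2 * q).+2 * beta i <= K.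

Let F := dist_fun P xi G.
Hypothesis dep : forall u t i, pt_le u t ->
  Ex P2 (coupling_dist zeta zeta' (fun x => orthant G t x - orthant G u x) i) <=
  C0 * (F t - F u) `^ g * beta i.

Definition centered_orthant (t : 'I_d -> \bar R) (x : paths V nat) : R := orthant G t x - F t.

Definition emp (n : nat) (w : T) (t : 'I_d -> \bar R) : R :=
  (Num.sqrt n%:R)^-1 * psum xi (centered_orthant t) n w.

Let borth t : bmf (orthant G t). Proof. exact: bmf_orthant. Qed.
Let bpast t i : bmf (fun w => orthant G t (past xi i w)).
Proof. exact: bmf_past. Qed.

Lemma bmf_centered_orthant t : bmf (centered_orthant t).
Proof. by apply: bmfB => //; exact: bmf_cst. Qed.

Lemma bmf_emp n t : bmf (fun w => emp n w t).
Proof.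
apply: bmfM; first exact: bmf_cst.
by apply: (bmf_psum iid_xi); exact: bmf_centered_orthant.
Qed.

Lemma empE n w t : emp n w t = Un P (causal G xi) n w t.
Proof.
rewrite /emp /Un /psum big_add1 /= big_mkord; congr (_ * _); apply: eq_bigr => i _.
rewrite /centered_orthant dist_funE//; congr (_ - _).
rewrite indicE /orthant; congr ((nat_of_bool _)%:R).
by apply/forallP/idP => [h|/set_mem h]; [apply/mem_set|].
Qed.

Let K0 : 0 <= K.
Proof. by have := sum_beta 0; rewrite big_ord0. Qed.

Let gp : 0 < g. Proof. by case/andP: g01. Qed.

(** Variance and dependence are put under the single size kappa = C0 m^g, using m <= 1, g <= 1 and
    C0 >= 1. As n is comparable to 2^k, dividing by n^p turns 3^k into (3/2^p)^k up to a
    constant. *)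
Lemma emp_incr_moment : exists2 C : R, 0 <= C &
  forall u t n k, pt_le u t -> (0 < n)%N -> (n <= 2 ^ k)%N -> (2 ^ k <= 2 * n)%N ->
  Ex P (fun w => (emp n w t - emp n w u) ^+ (2 * q.+2)) <=
  C * (((F t - F u) `^ g) ^+ q.+2 + (3 / 2 ^+ q.+2) ^+ k * (F t - F u) `^ g).
Proof.
have Cv0 : 0 <= 1 + 2 * K by rewrite addr_ge0// mulr_ge0.
have [C1 C10 H] := moment_bound P P2 q Cv0 K0.
have C00 : 0 <= C0 by exact: le_trans C01.
have C0p : 1 <= C0 ^+ q.+2 by exact: exprn_ege1.
have C0n : 0 <= C0 ^+ q.+2 by exact: exprn_ge0.
have C0l : C0 <= C0 ^+ q.+2 by rewrite exprS ler_peMr// exprn_ege1.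
exists (C1 * 2 ^+ q.+2 * C0 ^+ q.+2); first by rewrite mulr_ge0 ?exprn_ge0// mulr_ge0// exprn_ge0.
move=> u t n k ut n0 nk kn.
set m := F t - F u.
have m0 : 0 <= m by rewrite subr_ge0; apply: dist_fun_mono.
have m1 : m <= 1.
  have /andP[_ h1] := dist_fun01 iid_xi mG t; have /andP[h2 _] := dist_fun01 iid_xi mG u.
  by rewrite /m /F; lra.
have mg : m <= m `^ g.
  have [->|mN] := eqVneq m 0; first exact: powR_ge0.
  by rewrite -{1}(powRr1 m0); apply: ger_powR; [rewrite lt_def mN m0|case/andP: g01].
pose a x := centered_orthant t x - centered_orthant u x.
have ba : bmf a by apply: bmfB; exact: bmf_centered_orthant.
pose kappa := C0 * m `^ g.
have kappa0 : 0 <= kappa by rewrite mulr_ge0// powR_ge0.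
have aE x : a x = (orthant G t x - orthant G u x) - m by rewrite /a /centered_orthant /m; ring.
have o01 x : 0 <= orthant G t x - orthant G u x <= 1.
  have := orthant_mono G x ut; have /andP[_] := orthant01 G t x; have /andP[+ _] := orthant01 G u x.
  by move=> *; apply/andP; split; lra.
have a1 x : `|a x| <= 1.
  by rewrite aE ler_norml; have := o01 x => /andP[h1 h2]; apply/andP; split; lra.
have Eo : Ex P (fun w => orthant G t (past xi 0 w) - orthant G u (past xi 0 w)) = m.
  by rewrite ExB.
have a0 : Ex P (fun w => a (past xi 0 w)) = 0.
  transitivity (Ex P (fun w => (orthant G t (past xi 0 w) - orthant G u (past xi 0 w)) - m)).
    by apply: eq_Ex => w; exact: aE.
  by rewrite ExB ?Ex_cst ?Eo ?subrr//; [exact: bmfB|exact: bmf_cst].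
have ak : Ex P (fun w => a (past xi 0 w) ^+ 2) <= kappa.
  apply: (@le_trans _ _ m); last first.
    by apply: le_trans mg _; rewrite /kappa ler_peMl// powR_ge0.
  apply: (@le_trans _ _ (Ex P (fun w => (1 - 2 * m) * (orthant G t (past xi 0 w) - orthant G u (past xi 0 w)) + m ^+ 2))).
    rewrite le_eqVlt; apply/orP; left; apply/eqP; apply: eq_Ex => w; rewrite aE.
    set o := orthant G t _ - _; have oo : o ^+ 2 = o.
      rewrite /o /orthant; have := o01 (past xi 0 w); rewrite /orthant.
      by case: [forall _, _]; case: [forall _, _]; rewrite /= ?subrr ?subr0 ?expr0n ?expr1n// => /andP[]; lra.
    by rewrite sqrrB oo; ring.
  rewrite ExD ?Ex_cst ?ExZ ?Eo; [|exact: bmfB|by apply: bmfM; [exact: bmf_cst|exact: bmfB]|exact: bmf_cst].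
  by rewrite -subr_ge0 (_ : _ - _ = m ^+ 2); [exact: sqr_ge0|ring].
have adep i : Ex P2 (coupling_dist zeta zeta' a i) <= kappa * beta i.
  apply: le_trans (dep i ut); rewrite le_eqVlt; apply/orP; left; apply/eqP.
  by apply: eq_Ex => w; rewrite /coupling_dist !aE; congr `|_|; ring.
have SR := psum_short_range beta0 sum_beta kappa0 ba a1 a0 ak adep.
have M := H _ _ _ _ kappa0 SR k n nk.
have np : (0 : R) < n%:R by rewrite ltr0n.
have -> : Ex P (fun w => (emp n w t - emp n w u) ^+ (2 * q.+2)) =
   n%:R ^- q.+2 * Ex P (fun w => psum xi a n w ^+ (2 * q.+2)).
  rewrite -ExZ; last by apply: bmfX; exact: (bmf_psum iid_xi ba).
  apply: eq_Ex => w; rewrite /emp -mulrBr exprMn; congr (_ * _).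
    by rewrite exprM exprVn sqr_sqrtr ?exprVn// ltW.
  congr (_ ^+ _); rewrite /psum -sumrB; by apply: eq_bigr.
rewrite ler_pdivrMl ?exprn_gt0//; apply: le_trans M _.
have k2 : ((2 ^ k)%:R : R) <= 2 * n%:R by rewrite -natrM ler_nat.
have k2p : ((2 ^ k)%:R : R) ^+ q.+2 <= 2 ^+ q.+2 * n%:R ^+ q.+2.
  by rewrite -exprMn; apply: lerXn2r; rewrite ?nnegrE// mulr_ge0// ltW.
pose x := m `^ g; have x0 : 0 <= x by exact: powR_ge0.
have y0 : 0 <= (3 / 2 ^+ q.+2) ^+ k :> R by apply: exprn_ge0; rewrite divr_ge0// exprn_ge0.
have E3 : (3 : R) ^+ k = (2 ^ k)%:R ^+ q.+2 * (3 / 2 ^+ q.+2) ^+ k.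
  rewrite natrX expr_div_n -!exprM mulnC mulrCA divff ?mulr1// gt_eqF// exprn_gt0//.
rewrite E3 exprMn (_ : n%:R ^+ q.+2 * _ = C1 * ((2 ^+ q.+2 * n%:R ^+ q.+2) * (C0 ^+ q.+2 * (x ^+ q.+2 + (3 / 2 ^+ q.+2) ^+ k * x)))); last by rewrite -/x; ring.
rewrite ler_wpM2l// -/kappa (_ : _ + _ = (2 ^ k)%:R ^+ q.+2 * (kappa ^+ q.+2 + (3 / 2 ^+ q.+2) ^+ k * kappa)); last by ring.
apply: ler_pM; [exact: exprn_ge0|by rewrite addr_ge0 ?exprn_ge0// mulr_ge0|exact: k2p|].
rewrite (_ : kappa = C0 * x)// exprMn [leRHS]mulrDr lerD2l [leRHS]mulrCA.
by rewrite ler_wpM2l// ler_wpM2r.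
Qed.

(** The counting part of the increment is monotone in the endpoint; only the centering, sqrt n times
    the mass, is lost. *)
Lemma emp_sandwich n w u t v : pt_le u t -> pt_le t v ->
  `|emp n w t - emp n w u| <= `|emp n w v - emp n w u| + Num.sqrt n%:R * (F v - F u).
Proof.
move=> ut tv.
have mono s s' : pt_le s s' -> F s <= F s' by exact: dist_fun_mono.
have E s s' : emp n w s - emp n w s' =
  (Num.sqrt n%:R)^-1 * (\sum_(i < n) (orthant G s (past xi i.+1 w) - orthant G s' (past xi i.+1 w)))
  - Num.sqrt n%:R * (F s - F s').
  rewrite /emp -mulrBr /psum -sumrB.
  rewrite (eq_bigr (fun i : 'I_n => (orthant G s (past xi i.+1 w) - orthant G s' (past xi i.+1 w)) - (F s - F s'))); last first.
    by move=> i _; rewrite /centered_orthant; ring.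
  rewrite sumrB sumr_const card_ord [LHS]mulrBr -[(F s - F s') *+ n]mulr_natl [X in _ - X = _]mulrA; congr (_ - _ * _).
  have [->|n0] := eqVneq n 0%N; first by rewrite sqrtr0 mulr0.
  have s0 : Num.sqrt n%:R != 0 :> R by rewrite gt_eqF// sqrtr_gt0 ltr0n lt0n.
  by apply: (mulfI s0); rewrite mulrA divff// mul1r -expr2 sqr_sqrtr.
have Fut := mono _ _ ut; have Ftv := mono _ _ tv.
have sn : 0 <= Num.sqrt n%:R :> R by exact: sqrtr_ge0.
have [h1 h2] : 0 <= (Num.sqrt n%:R)^-1 * (\sum_(i < n) (orthant G t (past xi i.+1 w) - orthant G u (past xi i.+1 w))) /\
   (Num.sqrt n%:R)^-1 * (\sum_(i < n) (orthant G t (past xi i.+1 w) - orthant G u (past xi i.+1 w))) <=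
   (Num.sqrt n%:R)^-1 * (\sum_(i < n) (orthant G v (past xi i.+1 w) - orthant G u (past xi i.+1 w))).
  split.
    rewrite mulr_ge0 ?invr_ge0//; apply: sumr_ge0 => i _; rewrite subr_ge0; exact: orthant_mono.
  rewrite ler_wpM2l ?invr_ge0//; apply: ler_sum => i _; rewrite lerD2r; exact: orthant_mono.
have h3 : Num.sqrt n%:R * (F t - F u) <= Num.sqrt n%:R * (F v - F u).
  by rewrite ler_wpM2l// lerD2r.
have h4 : 0 <= Num.sqrt n%:R * (F t - F u) by rewrite mulr_ge0// subr_ge0.
have := ler_norm (emp n w v - emp n w u); rewrite (E t u) (E v u) => h5.
have h6 := normr_ge0 (emp n w v - emp n w u); rewrite (E v u) in h6.
by rewrite ler_norml; apply/andP; split; lra.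
Qed.

Hypothesis d0 : (0 < d)%N.

(** A single orthant is its difference with the orthant at -oo, which is empty because d > 0. *)
Let dep1 t i : Ex P2 (fun w => `|orthant G t (past zeta i.+1 w) - orthant G t (coupled_past zeta zeta' i.+1 w)|)
  <= C0 * beta i.
Proof.
pose u : 'I_d -> \bar R := fun=> -oo%E.
have o0 x : orthant G u x = 0.
  rewrite /orthant (_ : [forall k, _] = false)//; apply/negbTE/forallPn.
  by exists (Ordinal d0); rewrite leeNy_eq.
have ut : pt_le u t by move=> k; exact: leNye.
have F0 : F u = 0 by rewrite -[RHS](Ex_cst P 0); apply: eq_Ex => w; exact: o0.
have := dep i ut; rewrite F0 subr0.
rewrite (_ : Ex P2 _ = Ex P2 (fun w => `|orthant G t (past zeta i.+1 w) - orthant G t (coupled_past zeta zeta' i.+1 w)|)); last first.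
  by apply: eq_Ex => w; rewrite /coupling_dist !o0 !subr0.
move/le_trans; apply; rewrite ler_wpM2r// ler_piMr//; first exact: le_trans C01.
have /andP[h1 h2] := dist_fun01 iid_xi mG t.
apply: (@le_trans _ _ (1 `^ g)); last by rewrite powR1.
by apply: ge0_ler_powR; rewrite ?nnegrE// ltW.
Qed.

Let bcenter t i : bmf (fun w => centered_orthant t (past xi i w)).
Proof. by apply: bmf_past => //; exact: bmf_centered_orthant. Qed.

Lemma emp_clt N (t : 'I_N -> 'I_d -> \bar R) (c : 'I_N -> R) : exists2 s2 : R,
  Ex P (fun w => (\sum_(j < N) c j * emp n w (t j)) ^+ 2) @[n --> \oo] --> s2 &
  forall b, Ex P (fun w => cos (\sum_(j < N) c j * emp n w (t j) + b)) @[n --> \oo] -->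
    expR (- (s2 / 2)) * cos b.
Proof.
(* Scales the linear combination so that the summands are bounded by 1, as [short_range] asks. *)
pose L := 1 + \sum_(j < N) `|c j|.
have sc0 : 0 <= \sum_(j < N) `|c j| by apply: sumr_ge0.
have L1 : 1 <= L by rewrite lerDl.
have L0 : 0 < L by exact: lt_le_trans L1.
pose a x := L^-1 * \sum_(j <- enum 'I_N) c j * centered_orthant (t j) x.
have ba : bmf a.
  apply: bmfM; first exact: bmf_cst.
  by apply: bmf_sum => j; apply: bmfM; [exact: bmf_cst|exact: bmf_centered_orthant].
have aE x : a x = L^-1 * \sum_(j < N) c j * centered_orthant (t j) x by rewrite /a big_enum.
have a1 x : `|a x| <= 1.
  rewrite aE normrM ger0_norm ?invr_ge0 ?(ltW L0)// ler_pdivrMl// mulr1.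
  apply: le_trans (ler_norm_sum _ _ _) _; apply: (@le_trans _ _ (\sum_(j < N) `|c j|)); last by rewrite lerDr.
  apply: ler_sum => j _; rewrite normrM ler_piMr// /centered_orthant.
  have /andP[? ?] := orthant01 G (t j) x; have /andP[? ?] := dist_fun01 iid_xi mG (t j).
  by rewrite ler_norml /F; apply/andP; split; lra.
have a0 : Ex P (fun w => a (past xi 0 w)) = 0.
  rewrite ExZ; last by apply: bmf_sum => j; apply: bmfM; [exact: bmf_cst|exact: bcenter].
  rewrite Ex_sum; last by move=> j; apply: bmfM; [exact: bmf_cst|exact: bcenter].
  rewrite big1 ?mulr0// => j _; rewrite ExZ// /centered_orthant ExB//; last exact: bmf_cst.
  by rewrite Ex_cst subrr mulr0.
have C00 : 0 <= C0 by exact: le_trans C01.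
have ak : Ex P (fun w => a (past xi 0 w) ^+ 2) <= C0.
  apply: le_trans C01; apply: le_Ex_cst; first by apply: bmfX; exact: bmf_past.
  by move=> w; rewrite -real_normK ?num_real// -(expr1n _ 2); apply: lerXn2r; rewrite ?nnegrE.
have adep i : Ex P2 (coupling_dist zeta zeta' a i) <= C0 * beta i.
  pose f j w := `|orthant G (t j) (past zeta i.+1 w) - orthant G (t j) (coupled_past zeta zeta' i.+1 w)|.
  have bf j : bmf (f j).
    apply: bmf_norm; apply: bmfB; last by apply: (bmf_coupled_past iid_zeta).
    by apply: bmf_past => // k; case: iid_zeta => h _; exact: (h (inl k)).
  have bcf j : bmf (fun w => `|c j| * f j w) by apply: bmfM => //; exact: bmf_cst.
  apply: (@le_trans _ _ (Ex P2 (fun w => L^-1 * \sum_(j <- enum 'I_N) `|c j| * f j w))).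
    { apply: le_Ex.
    - exact: (bmf_coupling_dist iid_zeta).
    - by apply: bmfM; [exact: bmf_cst|exact: bmf_sum].
    - move=> w; rewrite /coupling_dist !aE -mulrBr normrM ger0_norm ?invr_ge0 ?(ltW L0)//.
      rewrite ler_wpM2l ?invr_ge0 ?(ltW L0)// -sumrB big_enum; apply: le_trans (ler_norm_sum _ _ _) _.
      apply: ler_sum => j _; rewrite -mulrBr normrM /f /centered_orthant ler_wpM2l//.
      by rewrite le_eqVlt; apply/orP; left; apply/eqP; congr `|_|; ring. }
  rewrite ExZ; last exact: bmf_sum.
  rewrite Ex_sum// ler_pdivrMl// big_enum /=.
  apply: (@le_trans _ _ (\sum_(j < N) `|c j| * (C0 * beta i))).
    by apply: ler_sum => j _; rewrite ExZ// ler_wpM2l//; exact: dep1.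
  by rewrite -mulr_suml ler_wpM2r// ?mulr_ge0// lerDr.
have sb n : \sum_(i < n) beta i <= K.
  apply: le_trans (sum_beta n); apply: ler_sum => i _.
  by rewrite ler_peMl// exprn_ege1// ler1n.
have sb0 n : \sum_(i < n) i.+1%:R ^+ (2 * 0).+2 * beta i <= K.
  apply: le_trans (sum_beta n); apply: ler_sum => i _.
  by rewrite ler_wpM2r// ler_weXn2l// ler1n.
have SR := psum_short_range beta0 sb0 C00 ba a1 a0 ak adep.
have [s2 s20 vs] := variance_cvg iid_xi iid_zeta law_zeta ba a0 a1 C00 adep sb.
have Cv0 : 0 <= 1 + 2 * K by rewrite addr_ge0// mulr_ge0.
have E n w : \sum_(j < N) c j * emp n w (t j) = L / Num.sqrt n%:R * psum xi a n w.
  rewrite /psum (eq_bigr (fun i : 'I_n => L^-1 * \sum_(j < N) c j * centered_orthant (t j) (past xi i.+1 w))); last by move=> i _; exact: aE.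
  rewrite -mulr_sumr exchange_big /= mulrA (_ : L / _ / L = (Num.sqrt n%:R)^-1); last first.
    by rewrite mulrAC divff ?mul1r// gt_eqF.
  rewrite mulr_sumr; apply: eq_bigr => j _; rewrite /emp /psum -mulr_sumr; ring.
exists (L ^+ 2 * s2).
  apply: cvg_trans (cvgM (cvg_cst (L ^+ 2)) vs); apply: near_eq_cvg; near=> n => /=.
  have n0 : (0 < n)%N by near: n; exists 1%N.
  rewrite mulrA mulrAC -ExZ; last by apply: bmfX; exact: (bmf_psum iid_xi ba).
  by apply: eq_Ex => w; rewrite E exprMn expr_div_n sqr_sqrtr.
move=> b; under eq_fun do under eq_Ex do rewrite E.
exact: (cos_clt (c := b) Cv0 K0 C00 SR s20 vs (ltW L0)).
Unshelve. all: by end_near. Qed.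

(** Polarization of the limit variances gives the covariances; positive semidefiniteness passes to
    the limit from second moments, and uniqueness of limits identifies the variance in the central
    limit theorem. *)
Lemma emp_fdd : exists Gam : ('I_d -> \bar R) -> ('I_d -> \bar R) -> R,
  [/\ forall s t, Gam s t = Gam t s,
   forall N (t : 'I_N -> 'I_d -> \bar R) (c : 'I_N -> R),
     0 <= \sum_(i < N) \sum_(j < N) c i * c j * Gam (t i) (t j) &
   forall N (t : 'I_N -> 'I_d -> \bar R) (c : 'I_N -> R) b,
    Ex P (fun w => cos (\sum_(j < N) c j * emp n w (t j) + b)) @[n --> \oo] -->
    expR (- ((\sum_(i < N) \sum_(j < N) c i * c j * Gam (t i) (t j)) / 2)) * cos b].
Proof.
have be := bmf_emp.
have bee n s t : bmf (fun w => emp n w s * emp n w t) by exact: bmfM.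
have ex s t : exists l : R, Ex P (fun w => emp n w s * emp n w t) @[n --> \oo] --> l.
  pose T2' (i : 'I_2) := if i == ord0 then s else t.
  have [l1 c1 _] := @emp_clt 2 T2' (fun=> 1).
  have [l2 c2 _] := @emp_clt 1 (fun=> s) (fun=> 1).
  have [l3 c3 _] := @emp_clt 1 (fun=> t) (fun=> 1).
  exists ((l1 - l2 - l3) * 2^-1).
  pose E2 n := Ex P (fun w => (\sum_(j < 2) 1 * emp n w (T2' j)) ^+ 2).
  pose E1 u n := Ex P (fun w => (\sum_(j < 1) 1 * emp n w u) ^+ 2).
  have h n : Ex P (fun w => emp n w s * emp n w t) = (E2 n - E1 s n - E1 t n) * 2^-1.
    have -> : E2 n = Ex P (fun w => (emp n w s ^+ 2 + 2 * (emp n w s * emp n w t)) + emp n w t ^+ 2).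
      by apply: eq_Ex => w; rewrite big_ord_recl big_ord1 /T2' /= !mul1r; ring.
    have e1 u : E1 u n = Ex P (fun w => emp n w u ^+ 2).
      by apply: eq_Ex => w; rewrite big_ord1 mul1r.
    have b2 : bmf (fun w => 2 * (emp n w s * emp n w t)) by apply: bmfM => //; exact: bmf_cst.
    rewrite !e1 ExD; [|by apply: bmfD => //; exact: bmfX|exact: bmfX].
    rewrite ExD//; [|exact: bmfX]; rewrite ExZ//.
    by set x := Ex P _; set y := Ex P _; set z := Ex P _; field.
  rewrite (funext h); exact: cvgM (cvgB (cvgB c1 c2) c3) (cvg_cst _).
pose Gam s t : R := projT1 (cid (ex s t)).
have cG s t : Ex P (fun w => emp n w s * emp n w t) @[n --> \oo] --> Gam s t.
  by rewrite /Gam; case: cid.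
have cQ N (t : 'I_N -> 'I_d -> \bar R) (c : 'I_N -> R) :
    Ex P (fun w => (\sum_(j < N) c j * emp n w (t j)) ^+ 2) @[n --> \oo] -->
    \sum_(i < N) \sum_(j < N) c i * c j * Gam (t i) (t j).
  have -> : (fun n => Ex P (fun w => (\sum_(j < N) c j * emp n w (t j)) ^+ 2)) =
    (fun n => \sum_(i < N) \sum_(j < N) c i * c j * Ex P (fun w => emp n w (t i) * emp n w (t j))).
    apply/funext => n.
    have bcee i j : bmf (fun w => c i * c j * (emp n w (t i) * emp n w (t j))).
      by apply: bmfM => //; exact: bmf_cst.
    transitivity (Ex P (fun w => \sum_(i <- enum 'I_N) \sum_(j <- enum 'I_N) c i * c j * (emp n w (t i) * emp n w (t j)))).
      apply: eq_Ex => w; rewrite expr2 big_enum mulr_suml; apply: eq_bigr => i _.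
      by rewrite big_enum mulr_sumr; apply: eq_bigr => j _; ring.
    rewrite Ex_sum; last by move=> i; exact: bmf_sum.
    rewrite big_enum; apply: eq_bigr => i _; rewrite Ex_sum// big_enum.
    by apply: eq_bigr => j _; rewrite ExZ.
  by apply: cvg_sum_seq => i; apply: cvg_sum_seq => j; exact: cvgMr.
exists Gam; split.
- move=> s t; apply: (cvg_unique _ (cG s t)) => //.
  rewrite (_ : (fun n => _) = (fun n => Ex P (fun w => emp n w t * emp n w s))); first exact: cG.
  by apply/funext => n; apply: eq_Ex => w; rewrite mulrC.
- move=> N t c; apply: (cvgr_to_ge (cQ N t c)); apply: nearW => n.
  by apply: Ex_ge0 => w; exact: sqr_ge0.
- move=> N t c b; have [s2 h1 h2] := emp_clt t c.
  by have <- : s2 = \sum_(i < N) \sum_(j < N) c i * c j * Gam (t i) (t j) by exact: (cvg_unique _ h1 (cQ N t c)).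
Qed.

End EmpiricalProcess.

(** * Quantile grids and chaining *)

Section ErealQuantile.
Context {R : realType}.
Variable F : \bar R -> R.
Hypothesis F_mono : forall x y, (x <= y)%E -> F x <= F y.
Hypothesis F_Ny : F -oo%E = 0.
Hypothesis F_y : F +oo%E = 1.
Hypothesis F_cont : forall (x : R) e, 0 < e ->
  exists2 h, 0 < h & F (x + h)%:E - F (x - h)%:E <= e.
Hypothesis F_high : forall e, 0 < e -> exists x : R, 1 - e <= F x%:E.
Hypothesis F_low : forall e, 0 < e -> exists x : R, F x%:E <= e.

Definition equantile (u : R) : \bar R := ereal_inf [set x | u <= F x].

Lemma equantile_le u x : u <= F x -> (equantile u <= x)%E.
Proof. by move=> ux; exact: ereal_inf_lbound. Qed.

Lemma equantile_ge u x : F x < u -> (x <= equantile u)%E.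
Proof.
move=> xu; apply: le_ereal_inf_tmp => y /= uy; rewrite leNgt; apply/negP => yx.
by have := F_mono (ltW yx); lra.
Qed.

Lemma equantile_gt1 u : 1 < u -> equantile u = +oo%E.
Proof.
move=> u1; apply/eqP; rewrite -leye_eq; apply: le_ereal_inf_tmp => x /= ux.
by have := lt_le_trans u1 (le_trans ux (F_mono (leey x))); rewrite F_y ltxx.
Qed.

(** Continuity, including at both infinities, makes the quantile an exact right inverse, so grid
    cells have marginal mass exactly 2^-j. *)
Lemma equantileK u : 0 <= u <= 1 -> F (equantile u) = u.
Proof.
move=> /andP[u0 u1]; have inf_lt y : (equantile u < y)%E -> u <= F y.
  move=> /ereal_inf_lt[z /= uz zy]; apply: le_trans uz _; exact: F_mono (ltW zy).
have inf_gt y : (y < equantile u)%E -> F y <= u.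
  move=> yi; rewrite leNgt; apply/negP => uy.
  by have := equantile_le (ltW uy); rewrite leNgt yi.
apply/eqP; rewrite eq_le; apply/andP; split.
- case E : (equantile u) => [x| |]; last by rewrite F_Ny.
    apply/ler_addgt0Pr => e e0; have [h h0 Fh] := F_cont x e0.
    have : F (x - h)%:E <= u by apply: inf_gt; rewrite E lte_fin; lra.
    have : F x%:E <= F (x + h)%:E by apply: F_mono; rewrite lee_fin; lra.
    by lra.
  rewrite F_y; apply/ler_addgt0Pr => e e0; have [x Fx] := F_high e0.
  by have := inf_gt x%:E; rewrite E ltry => /(_ isT); lra.
- case E : (equantile u) => [x| |]; last 1 first.
    rewrite F_Ny; apply/ler_addgt0Pr => e e0; have [x Fx] := F_low e0.
    by have := inf_lt x%:E; rewrite E ltNyr => /(_ isT); lra.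
  + apply/ler_addgt0Pr => e e0; have [h h0 Fh] := F_cont x e0.
    have : u <= F (x + h)%:E by apply: inf_lt; rewrite E lte_fin; lra.
    have : F (x - h)%:E <= F x%:E by apply: F_mono; rewrite lee_fin; lra.
    by lra.
  + by rewrite F_y.
Qed.

Lemma ecdf_cvg (t : \bar R) (u : nat -> \bar R) : u n @[n --> \oo] --> t ->
  F (u n) @[n --> \oo] --> F t.
Proof.
move=> ut; apply/cvgrPdist_le => e e0.
have near_gt y : (y < t)%E -> \forall n \near \oo, (y < u n)%E.
  by move=> yt; apply: (ut [set z | (y < z)%E]); exact: open_ereal_gt'.
have near_lt y : (t < y)%E -> \forall n \near \oo, (u n < y)%E.
  by move=> yt; apply: (ut [set z | (z < y)%E]); exact: open_ereal_lt'.
case: t ut near_gt near_lt => [x| |] ut near_gt near_lt.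
- have [h h0 Fh] := F_cont x e0.
  have lo : \forall n \near \oo, ((x - h)%:E < u n)%E by apply: near_gt; rewrite lte_fin; lra.
  have hi : \forall n \near \oo, (u n < (x + h)%:E)%E by apply: near_lt; rewrite lte_fin; lra.
  apply: filterS2 lo hi => n h1 h2; have := F_mono (ltW h1); have := F_mono (ltW h2).
  have : F (x - h)%:E <= F x%:E by apply: F_mono; rewrite lee_fin; lra.
  have : F x%:E <= F (x + h)%:E by apply: F_mono; rewrite lee_fin; lra.
  by rewrite ler_norml => *; apply/andP; split; lra.
- have [x Fx] := F_high e0.
  apply: filterS (near_gt x%:E (ltry x)) => n /ltW/F_mono h; have := F_mono (leey (u n)); rewrite F_y => h2.
  by rewrite ler_norml; apply/andP; split; lra.
- have [x Fx] := F_low e0.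
  apply: filterS (near_lt x%:E (ltNyr x)) => n /ltW/F_mono h; have := F_mono (leNye (u n)); rewrite F_Ny => h2.
  by rewrite ler_norml; apply/andP; split; lra.
Qed.

End ErealQuantile.

Section Grid.
Context {R : realType} (d : nat).
Variable Fk : 'I_d -> \bar R -> R.
Hypothesis F_mono : forall k x y, (x <= y)%E -> Fk k x <= Fk k y.
Hypothesis F_Ny : forall k, Fk k -oo%E = 0.
Hypothesis F_y : forall k, Fk k +oo%E = 1.
Hypothesis F_cont : forall k (x : R) e, 0 < e ->
  exists2 h, 0 < h & Fk k (x + h)%:E - Fk k (x - h)%:E <= e.
Hypothesis F_high : forall k e, 0 < e -> exists x : R, 1 - e <= Fk k x%:E.
Hypothesis F_low : forall k e, 0 < e -> exists x : R, Fk k x%:E <= e.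

Definition grid_point (u : 'I_d -> R) : 'I_d -> \bar R := fun k => equantile (Fk k) (u k).

(* Consecutive levels are 2^-j apart in each margin, whatever the law. Levels above 1 are
   allowed: their quantile is +oo. *)
Definition node (j : nat) (c : 'I_d -> nat) : 'I_d -> \bar R :=
  grid_point (fun k => (c k)%:R / 2 ^+ j).

Definition cell (j : nat) (t : 'I_d -> \bar R) (k : 'I_d) : nat :=
  Num.truncn (2 ^+ j * Fk k (t k)).

Definition grid_proj j t := node j (cell j t).

Let p2 j : (0 : R) < 2 ^+ j. Proof. exact: exprn_gt0. Qed.

Lemma Fk01 k x : 0 <= Fk k x <= 1.
Proof. by rewrite -(F_Ny k) -(F_y k) !F_mono ?leey ?leNye. Qed.

Let pF j t k : 0 <= 2 ^+ j * Fk k (t k).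
Proof. by rewrite mulr_ge0 ?(ltW (p2 j))//; case/andP: (Fk01 k (t k)). Qed.

Lemma Fk_node j c k : Fk k (node j c k) = Num.min ((c k)%:R / 2 ^+ j) 1.
Proof.
have x0 : 0 <= (c k)%:R / 2 ^+ j :> R by rewrite divr_ge0// ltW.
rewrite /node /grid_point; have [x1|x1] := leP ((c k)%:R / 2 ^+ j) 1.
  by rewrite (equantileK (@F_mono k) (F_Ny k) (F_y k) (@F_cont k) (@F_high k) (@F_low k))// x0.
by rewrite (equantile_gt1 (@F_mono k) (F_y k)).
Qed.

Lemma node_double j c : node j.+1 (fun k => (c k).*2) = node j c.
Proof.
apply/funext => k; rewrite /node /grid_point; congr (equantile _ _).
by rewrite -mul2n natrM exprS -mulf_div divff// mul1r.
Qed.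

Lemma node_mono j c c' : (forall k, (c k <= c' k)%N) -> pt_le (node j c) (node j c').
Proof.
move=> cc k; rewrite /node /grid_point; apply: le_ereal_inf => x /= h.
by apply: le_trans h; rewrite ler_wpM2r ?invr_ge0 ?(ltW (p2 j))// ler_nat.
Qed.

Lemma cell_le j t k : (cell j t k <= 2 ^ j)%N.
Proof.
rewrite /cell truncn_le_nat -[(2 ^ j).+1%:R]natr1 natrX ltr_pwDr//.
by rewrite ler_piMr ?(ltW (p2 j))//; case/andP: (Fk01 k (t k)).
Qed.

(** The grids are nested: passing to level j + 1 raises each coordinate by at most one fine step,
    which is the link used in chaining. *)
Lemma cell_half j t k : (cell j.+1 t k)./2 = cell j t k.
Proof.
have /andP[k1 k2] := truncn_itv (pF j.+1 t k); move: k1 k2.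
rewrite -/(cell j.+1 t k); set m := cell j.+1 t k => k1 k2.
apply/esym/truncn_def.
have : m%:R = (odd m)%:R + 2 * (m./2)%:R :> R.
  by rewrite -{1}(odd_double_half m) natrD -mul2n natrM.
move: k1 k2; rewrite exprS -mulrA -[m.+1%:R]natr1 -[m./2.+1%:R]natr1.
by case: (odd m) => /=; rewrite ?mulr1n ?mulr0n => ? ? ?; apply/andP; split; lra.
Qed.

Lemma grid_proj_le j t : pt_le (grid_proj j t) t.
Proof.
move=> k; apply: equantile_le; rewrite ler_pdivrMr// mulrC.
by have /andP[] := truncn_itv (pF j t k).
Qed.

Lemma le_grid_next j t : pt_le t (node j (fun k => (cell j t k).+1)).
Proof.
move=> k; apply: (equantile_ge (@F_mono k)); rewrite ltr_pdivlMr// mulrC.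
by have /andP[] := truncn_itv (pF j t k).
Qed.

Definition bump_at (c : 'I_d -> nat) (k : 'I_d) : 'I_d -> nat := fun i => (c i + (i == k))%N.

(** Coordinates run up to 2^j + 1, since a path of unit steps from a cell may already have left the
    cube by one step. *)
Definition grid_idx (j : nat) := ({ffun 'I_d -> 'I_(2 ^ j).+2} * 'I_d)%type.

Definition grid_incr (u : ('I_d -> \bar R) -> R) j (x : grid_idx j) : R :=
  u (node j (bump_at (fun i => x.1 i : nat) x.2)) - u (node j (fun i => x.1 i : nat)).

Definition good_level (u : ('I_d -> \bar R) -> R) (j : nat) (e : R) :=
  forall x : grid_idx j, `|grid_incr u x| <= e.

(** The coordinates are raised one after the other, each raise being one grid increment. *)
Lemma good_level_step u j e (c : 'I_d -> nat) (b : 'I_d -> bool) :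
  0 <= e -> good_level u j e -> (forall k, (c k <= 2 ^ j)%N) ->
  `|u (node j (fun k => c k + b k)%N) - u (node j c)| <= d%:R * e.
Proof.
move=> e0 gu cj.
pose path m : 'I_d -> nat := fun i => (c i + (b i && (i < m)))%N.
have step (m : 'I_d) : `|u (node j (path m.+1)) - u (node j (path m))| <= e.
  have [bm|bm] := boolP (b m); last first.
    rewrite (_ : path m.+1 = path m) ?subrr ?normr0//; apply/funext => i; rewrite /path.
    have [->|im] := eqVneq i m; first by rewrite (negbTE bm).
    by rewrite ltnS leq_eqVlt val_eqE (negbTE im).
  pose x : grid_idx j := ([ffun i => inord (path m i)], m).
  have := gu x; rewrite /grid_incr /=.
  have pm i : nat_of_ord ([ffun i => inord (path m i)] i : 'I_(2 ^ j).+2) = path m i.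
    by rewrite ffunE inordK//; apply: leq_ltn_trans (leq_add (cj i) (leq_b1 _)) _; rewrite addn1.
  have -> : (fun i => ([ffun i => inord (path m i)] i : 'I_(2 ^ j).+2) : nat) = path m by apply/funext.
  rewrite (_ : bump_at (path m) m = path m.+1)//; apply/funext => i; rewrite /bump_at /path.
  have [->|im] := eqVneq i m; first by rewrite bm ltnn ltnSn addn0.
  by rewrite addn0 ltnS [(i <= m)%N]leq_eqVlt val_eqE (negbTE im).
have -> : (fun k => c k + b k)%N = path d by apply/funext => i; rewrite /path ltn_ord andbT.
have -> : c = path 0%N :> ('I_d -> nat) by apply/funext => i; rewrite /path ltn0 andbF addn0.
have -> : u (node j (path d)) - u (node j (path 0%N)) = \sum_(m < d) (u (node j (path m.+1)) - u (node j (path m))).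
  by rewrite -(big_mkord xpredT (fun m => u (node j (path m.+1)) - u (node j (path m)))) telescope_sumr.
apply: le_trans (ler_norm_sum _ _ _) _; apply: (@le_trans _ _ (\sum_(m < d) e)); first by apply: ler_sum => m _.
by rewrite sumr_const card_ord mulr_natl.
Qed.

Lemma chaining u (e : nat -> R) J K t : (forall j, 0 <= e j) -> (J <= K)%N ->
  (forall j, (J <= j <= K)%N -> good_level u j (e j)) ->
  `|u (grid_proj K t) - u (grid_proj J t)| <= d%:R * \sum_(J.+1 <= j < K.+1) e j.
Proof.
move=> e0; elim: K => [|K IH].
  by rewrite leqn0 => /eqP -> _; rewrite subrr normr0 big_geq// mulr0.
rewrite leq_eqVlt => /orP[/eqP <- _|JK gd].
  by rewrite subrr normr0 big_geq// mulr0.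
rewrite big_nat_recr//= mulrDr.
rewrite (_ : _ - _ = (u (grid_proj K t) - u (grid_proj J t)) + (u (grid_proj K.+1 t) - u (grid_proj K t))); last by ring.
apply: le_trans (ler_normD _ _) _; apply: lerD.
  by apply: IH => // j /andP[h1 h2]; apply: gd; rewrite h1 ltnW.
have gK := gd K.+1; rewrite leqnn (ltnW JK) in gK.
have := @good_level_step u K.+1 (e K.+1) (fun k => (cell K t k).*2) (fun k => odd (cell K.+1 t k)) (e0 _) (gK isT).
rewrite node_double (_ : (fun k => _) = cell K.+1 t); last first.
  by apply/funext => k; rewrite -cell_half addnC odd_double_half.
by apply => k; rewrite expnS mul2n leq_double cell_le.
Qed.

Lemma good_level_next u j e t : 0 <= e -> good_level u j e ->
  `|u (node j (fun k => (cell j t k).+1)) - u (grid_proj j t)| <= d%:R * e.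
Proof.
move=> e0 gu; have := @good_level_step u j e (cell j t) (fun=> true) e0 gu (cell_le j t).
by rewrite (_ : (fun k => _) = fun k => (cell j t k).+1)//; apply/funext => k; rewrite addn1.
Qed.

End Grid.

Lemma powR2_expn {R : realType} (g : R) (j : nat) : (2 ^- j) `^ g = (2 `^ (- g)) ^+ j :> R.
Proof.
have -> : 2 ^- j = 2 `^ (- j%:R) :> R by rewrite powRN powR_mulrn.
by rewrite -powRrM -[RHS]powR_mulrn ?powR_ge0// -powRrM mulrC mulrN mulNr.
Qed.

(** Normalized by rho^j, the 2p-th moments of the roughly 2^(jd) increments of level j sum to
    multiples of A^j (main term) and B^j (lower-order term). From g p > d one can take rho below 1
    with A < 1; the bound on B makes the lower-order term vanish at the stopping level. *)
Lemma chaining_rates {R : realType} (d q : nat) (g : R) : (0 < d)%N -> (d < q.+2)%N ->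
  0 < g -> d%:R / q.+2%:R < g ->
  exists rho A B : R, [/\ 0 < rho < 1, 0 < A < 1, 1 < B, 9 * B < 4 ^+ q.+2 &
   2 ^+ d * (2 `^ (- g)) ^+ q.+2 <= A * rho ^+ (2 * q.+2) /\
   2 ^+ d * 2 `^ (- g) <= B * rho ^+ (2 * q.+2)].
Proof.
move=> d0 dq g0 dg; set x := 2 `^ (- g).
have x0 : 0 < x by exact: powR_gt0.
have x1 : x <= 1.
  rewrite /x powRN invf_le1 ?powR_gt0// -[leLHS](powRr0 2).
  by apply: ler_powR; rewrite ?ler1n// ltW.
have xp : 2 ^+ d * x ^+ q.+2 < 1.
  rewrite -[2 ^+ d]powR_mulrn// -[x ^+ _]powR_mulrn ?(ltW x0)// /x -powRrM.
  rewrite -powRD; last by rewrite pnatr_eq0 implybT.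
  rewrite /powR pnatr_eq0 /= -[ltRHS]expR0 ltr_expR.
  rewrite pmulr_llt0 ?ln_gt0 ?ltr1n//.
  by move: dg; rewrite ltr_pdivrMr ?ltr0n//; lra.
have x9 : 9 * (2 ^+ d * x) < 4 ^+ q.+2.
  (* For p = 2 only d = 1 occurs, and 2 x^2 < 1 forces x < 8/9; for p >= 3 the crude bound 2^d <=
     2^(p-1) is enough. *)
  case: q dq dg xp => [|q] dq dg xp.
    have d1 : d = 1%N by apply/eqP; rewrite eqn_leq d0 -ltnS dq.
    move: xp; rewrite d1 !expr1 => xp.
    rewrite ltNge; apply/negP => h.
    have h1 : 8 / 9 <= x by move: h; rewrite (_ : 4 ^+ 2 = 16 :> R); [lra|ring].
    have h2 : (8 / 9) ^+ 2 <= x ^+ 2 by apply: lerXn2r; rewrite ?nnegrE// ltW.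
    by move: h2; rewrite (_ : (8 / 9) ^+ 2 = 64 / 81 :> R); [lra|field].
  have e2 : (2 : R) ^+ d <= 2 ^+ q.+2 by rewrite ler_weXn2l// ?ler1n// -ltnS.
  have h1 : 2 ^+ d * x <= 2 ^+ q.+2 by apply: le_trans e2; rewrite ler_piMr// exprn_ge0.
  have h2 : (4 : R) ^+ q.+3 = 4 * (2 ^+ q.+2 * 2 ^+ q.+2).
    by rewrite exprS -exprMn; congr (4 * _ ^+ _); ring.
  have h3 : (4 : R) <= 2 ^+ q.+2.
    by rewrite !exprS; have : 1 <= 2 ^+ q :> R by [rewrite exprn_ege1// ler1n]; lra.
  have h4 : 4 * 2 ^+ q.+2 <= 2 ^+ q.+2 * 2 ^+ q.+2 :> R by rewrite ler_wpM2r// exprn_ge0.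
  rewrite h2; move: h1 h3 h4; set y := 2 ^+ q.+2; set z := 2 ^+ d * x => h1 h3 h4; lra.
pose m := Num.max (2 ^+ d * x ^+ q.+2) (9 * (2 ^+ d * x) / 4 ^+ q.+2).
have p4 : (0 : R) < 4 ^+ q.+2 by rewrite exprn_gt0.
have m1 : m < 1 by rewrite gt_max xp/= ltr_pdivrMr// mul1r.
have ma : 2 ^+ d * x ^+ q.+2 <= m by rewrite le_max lexx.
have mb : 9 * (2 ^+ d * x) / 4 ^+ q.+2 <= m by rewrite le_max lexx orbT.
have a0 : 0 < 2 ^+ d * x ^+ q.+2 by rewrite mulr_gt0// exprn_gt0.
(* rho is defined by rho^(2p) = y, with y strictly between the larger of the two constraints and
   1. *)
pose y := (1 + m) / 2.
have y0 : 0 < y by rewrite /y; lra.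
have y1 : y < 1 by rewrite /y; lra.
have my : m < y by rewrite /y; lra.
have rE : (y `^ ((2 * q.+2)%:R^-1)) ^+ (2 * q.+2) = y.
  by rewrite -powR_mulrn ?powR_ge0// -powRrM mulVf ?powRr1 ?(ltW y0)// pnatr_eq0.
(* The alternative 3/2 keeps B above 1, so that a geometric sum in B is governed by its last
   term. *)
exists (y `^ ((2 * q.+2)%:R^-1)), (2 ^+ d * x ^+ q.+2 / y), (Num.max (2 ^+ d * x / y) (3 / 2)).
rewrite rE; split.
- rewrite powR_gt0//= /powR gt_eqF//= -expR0 ltr_expR pmulr_rlt0 ?invr_gt0 ?ltr0n//.
  by rewrite ln_lt0// y0.
- by rewrite divr_gt0//= ltr_pdivrMr// mul1r; exact: le_lt_trans my.
- by rewrite lt_max; apply/orP; right; lra.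
- rewrite maxr_pMr//; rewrite gt_max; apply/andP; split.
    rewrite mulrA ltr_pdivrMr// [ltRHS]mulrC -ltr_pdivrMr//; exact: le_lt_trans my.
  have : 1 <= 4 ^+ q :> R by rewrite exprn_ege1// ler1n.
  by rewrite !exprS; lra.
- split; first by rewrite divfK// gt_eqF.
  by rewrite -ler_pdivrMr// le_max lexx.
Qed.

(** * Expected oscillation along the grids *)

Section Oscillation.
Context {R : realType} (d : nat).
Context dT (T : measurableType dT) (P : probability T R).
Variable Fk : 'I_d -> \bar R -> R.
Hypothesis F_mono : forall k x y, (x <= y)%E -> Fk k x <= Fk k y.
Hypothesis F_Ny : forall k, Fk k -oo%E = 0.
Hypothesis F_y : forall k, Fk k +oo%E = 1.
Hypothesis F_cont : forall k (x : R) e, 0 < e ->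
  exists2 h, 0 < h & Fk k (x + h)%:E - Fk k (x - h)%:E <= e.
Hypothesis F_high : forall k e, 0 < e -> exists x : R, 1 - e <= Fk k x%:E.
Hypothesis F_low : forall k e, 0 < e -> exists x : R, Fk k x%:E <= e.
Variable F : ('I_d -> \bar R) -> R.
Hypothesis F_pt : forall u v, pt_le u v -> 0 <= F v - F u <= \sum_k (Fk k (v k) - Fk k (u k)).

Let p2 j : (0 : R) < 2 ^+ j. Proof. exact: exprn_gt0. Qed.

Let Fk_nodeE := Fk_node F_mono F_Ny F_y F_cont F_high F_low.

Lemma Fk_node_succ j c c' k : (c k <= c' k <= (c k).+1)%N ->
  Fk k (node Fk j c' k) - Fk k (node Fk j c k) <= 2 ^- j *+ (c k < c' k)%N.
Proof.
move=> /andP[h1 h2]; rewrite !Fk_nodeE.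
have [e|ne] := eqVneq (c k) (c' k); first by rewrite e subrr ltnn.
have e : c' k = (c k).+1 by apply/eqP; rewrite eqn_leq h2 ltn_neqAle ne h1.
rewrite e ltnSn mulr1n -[(c k).+1%:R]natr1 mulrDl mul1r.
have := invr_gt0 (2 ^+ j : R); rewrite p2 => i0.
set y := (c k)%:R / 2 ^+ j.
have [?|?] := leP y 1; have [?|?] := leP (y + 2 ^- j) 1; lra.
Qed.

Lemma dist_bump j c k : 0 <= F (node Fk j (bump_at c k)) - F (node Fk j c) <= 2 ^- j.
Proof.
have cb i : (c i <= bump_at c k i <= (c i).+1)%N by rewrite /bump_at; case: eqP => _; lia.
have le1 : pt_le (node Fk j c) (node Fk j (bump_at c k)).
  by apply: node_mono => i; case/andP: (cb i).
have /andP[h1 h2] := F_pt le1; rewrite h1 /=; apply: le_trans h2 _.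
rewrite (bigD1 k)//= -[leRHS]addr0; apply: lerD.
  by apply: le_trans (Fk_node_succ j (cb k)) _; rewrite /bump_at eqxx addn1 ltnSn.
rewrite big1// => i /negbTE ik.
have -> : node Fk j (bump_at c k) i = node Fk j c i by rewrite /node /grid_point /bump_at ik addn0.
by rewrite subrr.
Qed.

Lemma dist_next j c : F (node Fk j (fun k => (c k).+1)) - F (node Fk j c) <= d%:R * 2 ^- j.
Proof.
have le1 : pt_le (node Fk j c) (node Fk j (fun k => (c k).+1)) by apply: node_mono => k.
have /andP[_ h2] := F_pt le1; apply: le_trans h2 _.
apply: (@le_trans _ _ (\sum_(k < d) 2 ^- j)); last by rewrite sumr_const card_ord mulr_natl.
apply: ler_sum => k _; apply: le_trans (@Fk_node_succ j c (fun k => (c k).+1) k _) _.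
  by rewrite leqnSn leqnn.
by rewrite ltnSn.
Qed.

Variables (q : nat).

(** A Markov majorant for all increments of one level at once: a single measurable quantity whose
    being below 1 makes the level good. *)
Definition level_sum (u : ('I_d -> \bar R) -> R) (j : nat) (e : R) : R :=
  \sum_(x : grid_idx d j) (grid_incr Fk u x / e) ^+ (2 * q.+2).

Lemma level_sum_ge0 u j e : 0 <= level_sum u j e.
Proof. by apply: sumr_ge0 => x _; rewrite exprM exprn_ge0// sqr_ge0. Qed.

Lemma level_sum_good u j e : 0 < e -> level_sum u j e < 1 -> good_level Fk u j e.
Proof.
move=> e0 h x; rewrite leNgt; apply/negP => ex.
suff : 1 <= level_sum u j e by rewrite leNgt h.
rewrite /level_sum (bigD1 x)//= -[leLHS]addr0; apply: lerD.
  rewrite exprM -real_normK ?num_real// -exprM exprn_ege1// normrM normfV (gtr0_norm e0).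
  by rewrite ler_pdivlMr// mul1r ltW.
by apply: sumr_ge0 => y _; rewrite exprM exprn_ge0// sqr_ge0.
Qed.

Lemma card_grid_idx j : (#|{: grid_idx d j}|%:R : R) <= (d * 3 ^ d)%:R * 2 ^+ (j * d).
Proof.
rewrite card_prod card_ffun !card_ord -natrX -natrM ler_nat mulnC -mulnA leq_mul2l.
apply/orP; right; rewrite expnM -expnMn.
have h : ((2 ^ j).+2 <= 3 * 2 ^ j)%N by have := expn_gt0 2 j; lia.
by case: (d) => // d'; rewrite leq_exp2r.
Qed.

Variables (g C rho A B : R).
Hypotheses (g0 : 0 < g) (C0 : 0 <= C).
Hypotheses (rho01 : 0 < rho < 1) (A01 : 0 < A < 1) (B1 : 1 < B).
Hypothesis rateA : 2 ^+ d * (2 `^ (- g)) ^+ q.+2 <= A * rho ^+ (2 * q.+2).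
Hypothesis rateB : 2 ^+ d * 2 `^ (- g) <= B * rho ^+ (2 * q.+2).

Let C2 : R := C * (d * 3 ^ d)%:R.

Lemma Ex_level_sum (U : T -> ('I_d -> \bar R) -> R) (eps : R) j :
  (forall t, bmf (fun w => U w t)) -> 0 <= eps ->
  (forall u t, pt_le u t -> Ex P (fun w => (U w t - U w u) ^+ (2 * q.+2)) <=
     C * (((F t - F u) `^ g) ^+ q.+2 + eps * (F t - F u) `^ g)) ->
  Ex P (fun w => level_sum (U w) j (rho ^+ j)) <= C2 * (A ^+ j + eps * B ^+ j).
Proof.
move=> bU eps0 mom; have /andP[r0 r1] := rho01.
pose x := 2 `^ (- g).
have rA : 2 ^+ d * x ^+ q.+2 <= A * rho ^+ (2 * q.+2) := rateA.
have rB : 2 ^+ d * x <= B * rho ^+ (2 * q.+2) := rateB.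
have x0 : 0 <= x by exact: powR_ge0.
have rp : 0 < rho ^+ (2 * q.+2) by exact: exprn_gt0.
have bi (y : grid_idx d j) : bmf (fun w => grid_incr Fk (U w) y) by apply: bmfB.
have b1 (y : grid_idx d j) : bmf (fun w => (grid_incr Fk (U w) y / rho ^+ j) ^+ (2 * q.+2)).
  by apply: bmfX; apply: bmfM => //; exact: bmf_cst.
rewrite (_ : Ex P _ = Ex P (fun w => \sum_(y <- enum {: grid_idx d j}) (grid_incr Fk (U w) y / rho ^+ j) ^+ (2 * q.+2))); last first.
  by apply: eq_Ex => w; rewrite big_enum.
rewrite Ex_sum// big_enum /=.
pose D := C * ((x ^+ j) ^+ q.+2 + eps * x ^+ j) / (rho ^+ j) ^+ (2 * q.+2).
have rj : 0 < (rho ^+ j) ^+ (2 * q.+2) by rewrite exprn_gt0// exprn_gt0.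
apply: (@le_trans _ _ (\sum_(y : grid_idx d j) D)).
  apply: ler_sum => y _.
  rewrite (_ : Ex P _ = Ex P (fun w => (grid_incr Fk (U w) y) ^+ (2 * q.+2)) / (rho ^+ j) ^+ (2 * q.+2)); last first.
    rewrite -ExZr; last exact: bmfX.
    by apply: eq_Ex => w; rewrite expr_div_n.
  rewrite ler_wpM2r ?invr_ge0 ?(ltW rj)//.
  have /andP[h1 h2] := dist_bump j (fun i => y.1 i : nat) y.2.
  have le1 : pt_le (node Fk j (fun i => y.1 i : nat)) (node Fk j (bump_at (fun i => y.1 i : nat) y.2)).
    by apply: node_mono => i; exact: leq_addr.
  apply: le_trans (mom _ _ le1) _; rewrite ler_wpM2l//.
  have h3 : (F (node Fk j (bump_at (fun i => y.1 i : nat) y.2)) - F (node Fk j (fun i => y.1 i : nat))) `^ g <= x ^+ j.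
    rewrite -powR2_expn; apply: ge0_ler_powR; rewrite ?nnegrE ?(ltW g0)//.
  apply: lerD; last by rewrite ler_wpM2l.
  by apply: lerXn2r; rewrite ?nnegrE ?powR_ge0// exprn_ge0.
rewrite sumr_const -[leLHS]mulr_natl.
have D0 : 0 <= D.
  by rewrite /D divr_ge0 ?(ltW rj)// mulr_ge0// addr_ge0 ?exprn_ge0// ?mulr_ge0// exprn_ge0.
apply: le_trans (ler_wpM2r D0 (card_grid_idx j)) _.
rewrite [leLHS](_ : _ = C2 * ((2 ^+ d * x ^+ q.+2 / rho ^+ (2 * q.+2)) ^+ j + eps * (2 ^+ d * x / rho ^+ (2 * q.+2)) ^+ j)); last first.
  have e1 : (2 ^+ d * x ^+ q.+2 / rho ^+ (2 * q.+2)) ^+ j = 2 ^+ (j * d) * (x ^+ j) ^+ q.+2 / (rho ^+ j) ^+ (2 * q.+2).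
    by rewrite expr_div_n exprMn -!exprM ![(_ * j)%N]mulnC.
  have e2 : (2 ^+ d * x / rho ^+ (2 * q.+2)) ^+ j = 2 ^+ (j * d) * x ^+ j / (rho ^+ j) ^+ (2 * q.+2).
    by rewrite expr_div_n exprMn -!exprM ![(_ * j)%N]mulnC.
  rewrite e1 e2 /D /C2; set y := (rho ^+ j) ^+ _; set z := 2 ^+ (j * d); set v := (x ^+ j) ^+ _.
  by ring.
rewrite ler_wpM2l//; first exact: mulr_ge0.
have [A0 _] := andP A01.
apply: lerD.
  apply: lerXn2r; rewrite ?nnegrE ?(ltW A0)//; last by rewrite ler_pdivrMr.
  by rewrite divr_ge0 ?(ltW rp)// mulr_ge0// exprn_ge0.
rewrite ler_wpM2l//; apply: lerXn2r; rewrite ?nnegrE; last by rewrite ler_pdivrMr.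
  by rewrite divr_ge0 ?(ltW rp)// mulr_ge0// exprn_ge0.
by apply: le_trans (ltW B1).
Qed.

Definition osc_sum (u : ('I_d -> \bar R) -> R) (J K : nat) : R :=
  \sum_(J <= j < K.+1) level_sum u j (rho ^+ j).

Lemma osc_sum_good u J K j : osc_sum u J K < 1 -> (J <= j <= K)%N -> good_level Fk u j (rho ^+ j).
Proof.
have /andP[r0 r1] := rho01.
move=> h jJK; apply: level_sum_good; first exact: exprn_gt0.
apply: le_lt_trans h; rewrite /osc_sum (bigD1_seq j)//=; last exact: iota_uniq.
  by rewrite lerDl; apply: sumr_ge0 => i _; exact: level_sum_ge0.
by rewrite mem_index_iota ltnS.
Qed.

Lemma Ex_osc_sum (U : T -> ('I_d -> \bar R) -> R) (eps : R) J K :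
  (forall t, bmf (fun w => U w t)) -> 0 <= eps ->
  (forall u t, pt_le u t -> Ex P (fun w => (U w t - U w u) ^+ (2 * q.+2)) <=
     C * (((F t - F u) `^ g) ^+ q.+2 + eps * (F t - F u) `^ g)) ->
  Ex P (fun w => osc_sum (U w) J K) <= C2 * (A ^+ J / (1 - A) + eps * (B ^+ K.+1 / (B - 1))).
Proof.
move=> bU eps0 mom; have [A0 A1] := andP A01.
have bl j : bmf (fun w => level_sum (U w) j (rho ^+ j)).
  rewrite /level_sum; rewrite (_ : (fun w => _) = fun w => \sum_(y <- enum {: grid_idx d j}) (grid_incr Fk (U w) y / rho ^+ j) ^+ (2 * q.+2)).
    apply: bmf_sum => y; apply: bmfX; apply: bmfM; last exact: bmf_cst.
    exact: bmfB.
  by apply/funext => w; rewrite big_enum.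
rewrite /osc_sum Ex_sum//.
apply: (@le_trans _ _ (\sum_(J <= j < K.+1) C2 * (A ^+ j + eps * B ^+ j))).
  by apply: ler_sum => j _; exact: Ex_level_sum.
rewrite -mulr_sumr big_split /= -mulr_sumr ler_wpM2l ?mulr_ge0//; apply: lerD.
  have [JK|KJ] := leqP J K; last by rewrite big_geq// divr_ge0 ?exprn_ge0 ?(ltW A0)// subr_ge0 ltW.
  have s n : \sum_(J <= j < J + n) A ^+ j = (A ^+ J - A ^+ (J + n)) / (1 - A).
    elim: n => [|n IH]; first by rewrite addn0 big_geq// subrr mul0r.
    rewrite addnS big_nat_recr ?leq_addr//= IH exprS; field.
    by rewrite subr_eq0 eq_sym lt_eqF.
  rewrite -(subnKC (leqW JK)) s ler_wpM2r ?invr_ge0 ?subr_ge0 ?(ltW A1)//.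
  by rewrite gerBl exprn_ge0// ltW.
rewrite ler_wpM2l//.
have B0 : 0 < B := lt_trans ltr01 B1.
apply: (@le_trans _ _ (\sum_(0 <= j < K.+1) B ^+ j)).
  have [JK|KJ] := leqP J K.+1; last by rewrite big_geq ?(ltnW KJ)//; apply: sumr_ge0 => i _; rewrite exprn_ge0// ltW.
  rewrite [leRHS](@big_cat_nat _ _ _ J)//= lerDr; apply: sumr_ge0 => i _; rewrite exprn_ge0// ltW//.
have s n : \sum_(0 <= j < n) B ^+ j = (B ^+ n - 1) / (B - 1).
  elim: n => [|n IH]; first by rewrite big_geq// expr0 subrr mul0r.
  by rewrite big_nat_recr//= IH exprS; field; rewrite subr_eq0 gt_eqF.
by rewrite s ler_wpM2r ?invr_ge0 ?subr_ge0 ?(ltW B1)// gerBl.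
Qed.

End Oscillation.

(** * Margins of the distribution function *)

Section Margins.
Context (R : realType) (V : completeNormedModType R) (d : nat).
Context dT (T : measurableType dT) (P : probability T R) (xi : int -> T -> V).
Hypothesis iid_xi : iid P xi.
Variable G : (nat -> V) -> ('I_d -> R).
Hypothesis mG : measurable_G G.

Let F := dist_fun P xi G.

Definition margin_fun (k : 'I_d) (x : \bar R) : R := F (margin k x).

Let mxi j : rv_V (xi j). Proof. by case: iid_xi. Qed.

Let bpast t i : bmf (fun w => orthant G t (past xi i w)).
Proof. by apply: bmf_past => //; exact: bmf_orthant. Qed.

Lemma margin_fun_mono k x y : (x <= y)%E -> margin_fun k x <= margin_fun k y.
Proof. by move=> xy; apply: dist_fun_mono => // i; rewrite /margin; case: eqP. Qed.

Lemma margin_fun_Ny k : margin_fun k -oo%E = 0.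
Proof.
rewrite -[RHS](Ex_cst P 0); apply: eq_Ex => w.
by rewrite orthant_margin leeNy_eq.
Qed.

Lemma margin_fun_y k : margin_fun k +oo%E = 1.
Proof.
rewrite -[RHS](Ex_cst P 1); apply: eq_Ex => w.
by rewrite orthant_margin leey.
Qed.

Let margin_cvg k (u : nat -> R) (b : bool) :
  (forall x : R, \forall n \near \oo, (x <= u n) = b) ->
  margin_fun k (u n)%:E @[n --> \oo] --> (b%:R : R).
Proof.
move=> ub; rewrite -(Ex_cst P b%:R); apply: (@cvg_Ex _ _ _ _ _ _ 1).
- by move=> n; exact: bmf_meas (bpast _ 0).
- exact: measurable_cst.
- by move=> n w; have /andP[h1 h2] := orthant01 G (margin k (u n)%:E) (past xi 0 w); rewrite ger0_norm.
- apply: aeW => w; apply: cvg_near_cst.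
  apply: filterS (ub (G (past xi 0 w) k)) => n h.
  by rewrite orthant_margin lee_fin h.
Qed.

Lemma margin_fun_high k e : 0 < e -> exists x : R, 1 - e <= margin_fun k x%:E.
Proof.
move=> e0; have : margin_fun k n%:R%:E @[n --> \oo] --> (true%:R : R).
  apply: margin_cvg => x; near=> n; apply/idP; near: n; exact: nbhs_infty_ger.
move=> /cvgrPdist_le/(_ e e0) [n _ /(_ n (leqnn n))] /=.
by move=> h; exists n%:R; have := ler_norm (1 - margin_fun k n%:R%:E); lra.
Unshelve. all: by end_near. Qed.

Lemma margin_fun_low k e : 0 < e -> exists x : R, margin_fun k x%:E <= e.
Proof.
move=> e0; have : margin_fun k (- n%:R)%:E @[n --> \oo] --> (false%:R : R).
  apply: margin_cvg => x; near=> n; apply/negP; rewrite leNgt => /negP; apply.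
  rewrite ltrNl; near: n; exact: nbhs_infty_gtr.
move=> /cvgr0Pnorm_le/(_ e e0) [n _ /(_ n (leqnn n))] /=.
by move=> h; exists (- n%:R); apply: le_trans h; exact: ler_norm.
Unshelve. all: by end_near. Qed.

Lemma margin_fun_cont (c theta : R) : 0 <= c -> 0 < theta ->
  (forall u v : 'I_d -> R, `|F (fun k => (u k)%:E) - F (fun k => (v k)%:E)|
    <= c * enorm (fun k => u k - v k) `^ theta) ->
  forall k (x : R) e, 0 < e ->
  exists2 h, 0 < h & margin_fun k (x + h)%:E - margin_fun k (x - h)%:E <= e.
Proof.
move=> c0 t0 hold k x e e0.
have c1 : 0 < c + 1 by rewrite ltr_wpDl.
have y0 : 0 < e / (c + 1) by rewrite divr_gt0.
exists ((e / (c + 1)) `^ theta^-1 / 2); first by rewrite divr_gt0// powR_gt0.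
have h0 : 0 <= (e / (c + 1)) `^ theta^-1 / 2 by rewrite divr_ge0// powR_ge0.
have := margin_holder iid_xi mG c0 hold k x%:E h0.
rewrite [2 * _]mulrC divfK ?pnatr_eq0// -powRrM mulVf ?gt_eqF// powRr1 ?(ltW y0)//.
rewrite -EFinD -EFinB => /le_trans; apply.
rewrite mulrA ler_pdivrMr// mulrDr mulr1 mulrC lerDl; exact: ltW.
Qed.

(** A sample point counted at v but not at u exceeds u in some coordinate, and that margin counts
    it. *)
Lemma dist_fun_pt u v : pt_le u v ->
  0 <= F v - F u <= \sum_k (margin_fun k (v k) - margin_fun k (u k)).
Proof.
move=> uv; rewrite subr_ge0 dist_fun_mono//=.
have bd k : bmf (fun w => orthant G (margin k (v k)) (past xi 0 w) - orthant G (margin k (u k)) (past xi 0 w)).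
  exact: bmfB.
rewrite /F /dist_fun -ExB//.
rewrite (_ : \sum_k _ = Ex P (fun w => \sum_(k <- enum 'I_d) (orthant G (margin k (v k)) (past xi 0 w) - orthant G (margin k (u k)) (past xi 0 w)))); last first.
  by rewrite Ex_sum// big_enum; apply: eq_bigr => k _; rewrite ExB.
apply: le_Ex; [exact: bmfB|exact: bmf_sum|] => w; rewrite big_enum /=.
set x := past xi 0 w.
have t0 k : 0 <= orthant G (margin k (v k)) x - orthant G (margin k (u k)) x.
  by rewrite subr_ge0; apply: orthant_mono => i; rewrite /margin; case: eqP => // ->.
have [hu|hu] := boolP [forall k, ((G x k)%:E <= u k)%E].
  have o1 : orthant G u x = 1 by rewrite /orthant hu.
  have /andP[_ h] := orthant01 G v x.
  by apply: (@le_trans _ _ 0); [rewrite o1 subr_le0|exact: sumr_ge0].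
have ou : orthant G u x = 0 by rewrite /orthant (negbTE hu).
have [hv|hv] := boolP [forall k, ((G x k)%:E <= v k)%E]; last first.
  by rewrite ou /orthant (negbTE hv) subrr; apply: sumr_ge0 => k _; exact: t0.
have ov : orthant G v x = 1 by rewrite /orthant hv.
have /forallPn[k hk] := hu.
rewrite ou ov subr0 (bigD1 k)//= -[leLHS]addr0; apply: lerD; last by apply: sumr_ge0 => i _; exact: t0.
by rewrite !orthant_margin (negbTE hk) (forallP hv k) subr0.
Qed.

End Margins.

(** * Asymptotic equicontinuity of the empirical process *)

Section Equicontinuity.
Context (R : realType) (d : nat).
Context dT (T : measurableType dT) (P : probability T R).
Variable Fk : 'I_d -> \bar R -> R.
Hypothesis F_mono : forall k x y, (x <= y)%E -> Fk k x <= Fk k y.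
Hypothesis F_Ny : forall k, Fk k -oo%E = 0.
Hypothesis F_y : forall k, Fk k +oo%E = 1.
Hypothesis F_cont : forall k (x : R) e, 0 < e ->
  exists2 h, 0 < h & Fk k (x + h)%:E - Fk k (x - h)%:E <= e.
Hypothesis F_high : forall k e, 0 < e -> exists x : R, 1 - e <= Fk k x%:E.
Hypothesis F_low : forall k e, 0 < e -> exists x : R, Fk k x%:E <= e.
Variable F : ('I_d -> \bar R) -> R.
Hypothesis F_pt : forall u v, pt_le u v -> 0 <= F v - F u <= \sum_k (Fk k (v k) - Fk k (u k)).
Variables (q : nat) (g C rho A B : R).
Hypotheses (g0 : 0 < g) (C0 : 0 <= C).
Hypotheses (rho01 : 0 < rho < 1) (A01 : 0 < A < 1) (B1 : 1 < B).
Hypothesis B9 : 9 * B < 4 ^+ q.+2.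
Hypothesis rateA : 2 ^+ d * (2 `^ (- g)) ^+ q.+2 <= A * rho ^+ (2 * q.+2).
Hypothesis rateB : 2 ^+ d * 2 `^ (- g) <= B * rho ^+ (2 * q.+2).

Variable U : nat -> T -> ('I_d -> \bar R) -> R.
Hypothesis bU : forall n t, bmf (fun w => U n w t).
Hypothesis U_moment : forall u t n k, pt_le u t -> (0 < n)%N -> (n <= 2 ^ k)%N ->
  (2 ^ k <= 2 * n)%N -> Ex P (fun w => (U n w t - U n w u) ^+ (2 * q.+2)) <=
  C * (((F t - F u) `^ g) ^+ q.+2 + (3 / 2 ^+ q.+2) ^+ k * (F t - F u) `^ g).
Hypothesis U_sandwich : forall n w u t v, pt_le u t -> pt_le t v ->
  `|U n w t - U n w u| <= `|U n w v - U n w u| + Num.sqrt n%:R * (F v - F u).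

Let rho0 : 0 < rho. Proof. by case/andP: rho01. Qed.
Let rho1 : rho < 1. Proof. by case/andP: rho01. Qed.

Lemma geometric_sum_le J K : \sum_(J.+1 <= j < K.+1) rho ^+ j <= rho ^+ J / (1 - rho).
Proof.
have r1 : 0 < 1 - rho by rewrite subr_gt0.
have [JK|KJ] := leqP J K; last first.
  by rewrite big_geq ?ltnS ?(ltnW KJ)// divr_ge0 ?exprn_ge0// ltW.
rewrite -(subnKC JK); elim: (K - J)%N => [|n IH].
  by rewrite addn0 big_geq// divr_ge0 ?exprn_ge0// ltW.
suff s : \sum_(J.+1 <= j < (J + n.+1).+1) rho ^+ j = (rho ^+ J.+1 - rho ^+ (J + n.+1).+1) / (1 - rho).
  rewrite s ler_wpM2r ?invr_ge0 ?(ltW r1)// exprS.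
  have : 0 <= rho ^+ (J + n.+1).+1 by rewrite exprn_ge0// ltW.
  have : rho * rho ^+ J <= rho ^+ J by rewrite ler_piMl ?exprn_ge0// ltW.
  lra.
elim: n.+1 => [|m IHm]; first by rewrite addn0 big_geq// subrr mul0r.
rewrite addnS big_nat_recr ?ltnS ?leq_addr//= IHm !exprS; field.
by rewrite subr_eq0 eq_sym lt_eqF.
Qed.

(* At the finest level the step 2^-K of the grid is of order n^(-1/2) 2^-m. *)
Definition top_level (n m : nat) : nat := ((up_log 2 n)./2 + m)%N.

Lemma up_log2_bounds n : (0 < n)%N -> (n <= 2 ^ up_log 2 n <= 2 * n)%N.
Proof.
move=> n0; rewrite up_logP//=; case: n n0 => // -[|n] _; first by rewrite up_log1.
have := @up_log_bounds 2 n.+2 isT isT => /andP[h _].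
have k0 : (0 < up_log 2 n.+2)%N by rewrite up_log_gt0.
by rewrite -(prednK k0) expnS leq_mul2l/= ltnW.
Qed.

Lemma sqrt_top_level n m : (0 < n)%N ->
  Num.sqrt n%:R * 2 ^- top_level n m <= 2 * 2 ^- m :> R.
Proof.
move=> n0; have /andP[nk _] := up_log2_bounds n0; set k := up_log 2 n in nk.
have h : Num.sqrt n%:R <= 2 ^+ (k./2).+1 :> R.
  rewrite -[leRHS]ger0_norm ?exprn_ge0// -sqrtr_sqr ler_wsqrtr// -exprM.
  apply: (@le_trans _ _ ((2 ^ k)%:R)); first by rewrite ler_nat.
  rewrite natrX ler_weXn2l ?ler1n// muln2 doubleS -{1}(odd_double_half k).
  by case: (odd k); rewrite ?add0n ?add1n ?leqnSn// ltnW.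
rewrite /top_level -/k exprD invfM mulrA -[X in _ <= X * _]mulr1 ler_wpM2r ?invr_ge0 ?exprn_ge0//.
by rewrite ler_pdivrMr ?exprn_gt0// mulr1 -exprS.
Qed.

(** Chaining covers the levels from J to K; the last gap, from the level-K projection to t, is
    bridged by monotonicity at the price of one grid step and a centering of order sqrt n 2^-K. *)
Lemma sup_grid_dist n w J K m : (0 < n)%N -> K = top_level n m -> (J <= K)%N ->
  osc_sum Fk q rho (U n w) J K < 1 -> forall t,
  `|U n w t - U n w (grid_proj Fk J t)| <= d%:R * (2 * (rho ^+ J / (1 - rho)) + 2 * 2 ^- m).
Proof.
move=> n0 KE JK osc t.
have r1 : 0 < 1 - rho by rewrite subr_gt0.
have gd j : (J <= j <= K)%N -> good_level Fk (U n w) j (rho ^+ j).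
  by move=> jJK; exact: (osc_sum_good rho01 osc jJK).
have rK0 : 0 <= rho ^+ K by rewrite exprn_ge0// ltW.
have e0 j : 0 <= rho ^+ j by rewrite exprn_ge0// ltW.
have h1 := chaining F_mono F_Ny F_y t e0 JK gd.
have h2 := U_sandwich n w (grid_proj_le F_mono F_Ny F_y K t) (le_grid_next F_mono F_Ny F_y K t).
have gK : good_level Fk (U n w) K (rho ^+ K) by apply: gd; rewrite JK leqnn.
have h3 := good_level_next F_mono F_Ny F_y t rK0 gK.
have h4 := dist_next F_mono F_Ny F_y F_cont F_high F_low F_pt K (cell Fk K t).
have h5 : Num.sqrt n%:R * (F (node Fk K (fun k => (cell Fk K t k).+1)) - F (grid_proj Fk K t)) <= d%:R * (2 * 2 ^- m).
  apply: (@le_trans _ _ (Num.sqrt n%:R * (d%:R * 2 ^- K))).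
    by rewrite ler_wpM2l ?sqrtr_ge0.
  by rewrite mulrCA ler_wpM2l// KE sqrt_top_level.
have h6 : \sum_(J.+1 <= j < K.+1) rho ^+ j <= rho ^+ J / (1 - rho) by exact: geometric_sum_le.
have h7 : rho ^+ K <= rho ^+ J / (1 - rho).
  apply: (@le_trans _ _ (rho ^+ J)).
    rewrite -(subnKC JK) exprD ler_piMr ?exprn_ge0// ?(ltW rho0)//.
    by rewrite exprn_ile1// ltW.
  by rewrite ler_peMr ?exprn_ge0 ?(ltW rho0)// invf_ge1 ?subr_gt0// gerBl ltW.
have h6' := ler_wpM2l (ler0n R d) h6; have h7' := ler_wpM2l (ler0n R d) h7.
rewrite (_ : _ - _ = (U n w t - U n w (grid_proj Fk K t)) + (U n w (grid_proj Fk K t) - U n w (grid_proj Fk J t))); last by ring.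
apply: le_trans (ler_normD _ _) _.
move: h1 h2 h3 h5 h6' h7'; set a := \sum_(_ <= j < _) _; set b := rho ^+ J / _.
by rewrite !mulrDr; lra.
Qed.

(** Since K is half the binary logarithm of n up to the constant m, the product is geometric with
    ratio 9 B / 4^p < 1. *)
Lemma top_level_small m : (3 / 2 ^+ q.+2) ^+ up_log 2 n * B ^+ (top_level n m).+1 @[n --> \oo] --> (0 : R).
Proof.
have B0 : 0 < B := lt_trans ltr01 B1.
pose r := 3 / 2 ^+ q.+2 : R; have r0 : 0 <= r by rewrite divr_ge0// exprn_ge0.
have r2 : r ^+ 2 * B < 1.
  rewrite /r expr_div_n -exprM mulnC exprM mulrAC ltr_pdivrMr ?exprn_gt0// mul1r.
  by rewrite (_ : 3 ^+ 2 = 9 :> R); [rewrite (_ : 2 ^+ 2 = 4 :> R); [exact: B9|ring]|ring].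
have rb0 : 0 <= r ^+ 2 * B by rewrite mulr_ge0 ?sqr_ge0// ltW.
pose D := (1 + r) * B ^+ m.+1.
have D0 : 0 <= D by rewrite mulr_ge0 ?exprn_ge0 ?(ltW B0)// addr_ge0.
have ul : (up_log 2 n)./2 @[n --> \oo] --> \oo.
  apply/cvgnyPge => a; near=> n.
  have n2 : (2 ^ (a.*2).+1 <= n)%N by near: n; exists (2 ^ (a.*2).+1)%N.
  have n0 : (0 < n)%N by apply: leq_trans n2; rewrite expn_gt0.
  have /andP[h _] := up_log2_bounds n0.
  have := leq_trans n2 h; rewrite leq_exp2l// => h2.
  by rewrite -[leqLHS](doubleK a) half_leq// ltnW.
have geo : D * (r ^+ 2 * B) ^+ (up_log 2 n)./2 @[n --> \oo] --> (0 : R).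
  have := @cvg_geometric R D (r ^+ 2 * B); rewrite ger0_norm// => /(_ r2) h.
  exact: (cvg_comp _ _ ul h).
{ apply: (@squeeze_cvgr _ _ _ _ (fun=> 0) (fun n => D * (r ^+ 2 * B) ^+ (up_log 2 n)./2)); last 2 first.
- exact: cvg_cst.
- exact: geo.
- apply: nearW => n; apply/andP; split; first by rewrite mulr_ge0 ?exprn_ge0// ltW.
  rewrite -/r /top_level; set k := up_log 2 n.
  have rk : r ^+ k <= (1 + r) * (r ^+ 2) ^+ k./2.
    rewrite -{1}(odd_double_half k) exprD -mul2n exprM ler_wpM2r ?exprn_ge0//.
    by case: (odd k); rewrite ?expr1 ?expr0; lra.
  rewrite -addnS exprD [in leRHS]exprMn mulrA.
  rewrite (_ : D * _ = (1 + r) * (r ^+ 2) ^+ k./2 * B ^+ k./2 * B ^+ m.+1); last by rewrite /D; ring.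
  by rewrite ler_wpM2r ?exprn_ge0 ?(ltW B0)// ler_wpM2r ?exprn_ge0 ?(ltW B0). }
Unshelve. all: by end_near. Qed.

(** Phrased with a measurable control [H] of small mean, so that the supremum over uncountably many
    t never has to be an event. *)
Lemma asymptotic_equicontinuity e : 0 < e -> exists J0, forall J, (J0 <= J)%N ->
  \forall n \near \oo, exists H : T -> R, [/\ bmf H, forall w, 0 <= H w, Ex P H <= e &
    forall w, H w < 1 -> forall t, `|U n w t - U n w (grid_proj Fk J t)| <= e].
Proof.
move=> e0; have [A0 A1] := andP A01.
have r1 : 0 < 1 - rho by rewrite subr_gt0.
pose C2 : R := C * (d * 3 ^ d)%:R.
have C20 : 0 <= C2 by rewrite mulr_ge0.
have small (a x : R) h : 0 <= a -> 0 <= x < 1 -> 0 < h -> \forall J \near \oo, a * x ^+ J <= h.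
  move=> a0 /andP[x0 x1] h0.
  have : a * x ^+ J @[J --> \oo] --> (0 : R).
    by have := @cvg_geometric R a x; rewrite ger0_norm// => /(_ x1).
  move=> /cvgr0Pnorm_le/(_ h h0); apply: filterS => J; apply: le_trans; exact: ler_norm.
have e4 : 0 < e / 4 by rewrite divr_gt0.
(* Order of choices: m fixes the error of the monotonicity step uniformly in n, then J makes the
   main chaining terms small, and finally n is large enough for the lower-order term. *)
have [m hm] : exists m, d%:R * 2 * 2^-1 ^+ m <= e / 4 :> R.
  have [m _ /(_ m (leqnn m)) h] := @small (d%:R * 2) 2^-1 (e / 4) (mulr_ge0 (ler0n _ _) (ler0n _ _)) ltac:(apply/andP; split; lra) e4.
  by exists m.
have [J1 _ hJ1] := @small (d%:R * 2 / (1 - rho)) rho (e / 4)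
  ltac:(by rewrite divr_ge0 ?mulr_ge0// ltW) ltac:(by rewrite (ltW rho0) rho1) e4.
have [J2 _ hJ2] := @small (C2 / (1 - A)) A (e / 4)
  ltac:(by rewrite divr_ge0// subr_ge0 ltW) ltac:(by rewrite (ltW A0) A1) e4.
exists (maxn J1 J2) => J; rewrite geq_max => /andP[J1J J2J].
have hA := hJ2 J J2J; have hR := hJ1 J J1J.
have tl := top_level_small m.
have B0 : 0 < B - 1 by rewrite subr_gt0.
have hB : \forall n \near \oo, C2 / (B - 1) * ((3 / 2 ^+ q.+2) ^+ up_log 2 n * B ^+ (top_level n m).+1) <= e / 4.
  have : C2 / (B - 1) * ((3 / 2 ^+ q.+2) ^+ up_log 2 n * B ^+ (top_level n m).+1) @[n --> \oo] --> (0 : R).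
    by rewrite -(mulr0 (C2 / (B - 1))); exact: cvgMr.
  by move=> /cvgr0Pnorm_le/(_ _ e4); apply: filterS => n; apply: le_trans; exact: ler_norm.
near=> n.
have n0 : (0 < n)%N by near: n; exists 1%N.
have hBn : C2 / (B - 1) * ((3 / 2 ^+ q.+2) ^+ up_log 2 n * B ^+ (top_level n m).+1) <= e / 4 by near: n.
have JK : (J <= top_level n m)%N.
  rewrite /top_level; apply: leq_trans (leq_addr _ _).
  have n2 : (2 ^ (J.*2).+1 <= n)%N by near: n; exists (2 ^ (J.*2).+1)%N.
  have /andP[h _] := up_log2_bounds n0.
  have := leq_trans n2 h; rewrite leq_exp2l// => h2.
  by rewrite -[leqLHS](doubleK J) half_leq// ltnW.
pose K := top_level n m.
exists (fun w => osc_sum Fk q rho (U n w) J K); split.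
- rewrite /osc_sum; apply: bmf_sum => j; rewrite /level_sum.
  rewrite (_ : (fun w => _) = fun w => \sum_(y <- enum {: grid_idx d j}) (grid_incr Fk (U n w) y / rho ^+ j) ^+ (2 * q.+2)).
    apply: bmf_sum => y; apply: bmfX; apply: bmfM; last exact: bmf_cst.
    exact: bmfB.
  by apply/funext => w; rewrite big_enum.
- by move=> w; apply: sumr_ge0 => j _; exact: level_sum_ge0.
- have /andP[nk kn] := up_log2_bounds n0.
  have r0 : 0 <= (3 / 2 ^+ q.+2) ^+ up_log 2 n :> R by rewrite exprn_ge0// divr_ge0// exprn_ge0.
  apply: le_trans (Ex_osc_sum F_mono F_Ny F_y F_cont F_high F_low F_pt g0 C0 rho01 A01 B1 rateA rateB J K (bU n) r0 _) _.
    by move=> u t ut; exact: (U_moment ut n0 nk kn).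
  rewrite -/C2 -/K in hBn *.
  rewrite (_ : C2 * _ = C2 / (1 - A) * A ^+ J + C2 / (B - 1) * ((3 / 2 ^+ q.+2) ^+ up_log 2 n * B ^+ K.+1)); last by ring.
  by lra.
- move=> w Hw t; apply: le_trans (sup_grid_dist n0 (erefl K) JK Hw t) _.
  rewrite exprVn in hm.
  rewrite (_ : d%:R * _ = d%:R * 2 / (1 - rho) * rho ^+ J + d%:R * 2 * 2 ^- m); last by ring.
  by lra.
Unshelve. all: by end_near. Qed.

End Equicontinuity.

(** The vector is replaced by its dyadic floor, which has countably many values, and the Lipschitz
    bound passes to the limit; no sigma-algebra on R^N enters. *)
Lemma measurable_lipschitz {R : realType} d (T : measurableType d) N
    (H : ('I_N -> R) -> R) (L : R) (X : T -> 'I_N -> R) : 0 <= L ->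
  (forall x y e, (forall k, `|x k - y k| <= e) -> `|H x - H y| <= L * e) ->
  (forall i, measurable_fun setT (fun w => X w i)) ->
  measurable_fun setT (fun w => H (X w)).
Proof.
move=> L0 HL mX; have p2 n : (0 : R) < 2 ^+ n by exact: exprn_gt0.
pose z n w : {ffun 'I_N -> int} := [ffun i => Num.floor (2 ^+ n * X w i)].
pose phi n (v : {ffun 'I_N -> int}) := H (fun i => (v i)%:~R / 2 ^+ n).
have mz n v : measurable [set w | z n w = v].
  rewrite (_ : [set w | _] = \bigcap_(i in [set: 'I_N]) ([set w | X w i <= ((v i) + 1)%:~R / 2 ^+ n] `&`
     ~` [set w | X w i = ((v i) + 1)%:~R / 2 ^+ n] `&` ~` [set w | X w i <= (v i)%:~R / 2 ^+ n] `|`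
     [set w | X w i = (v i)%:~R / 2 ^+ n])).
    apply: fin_bigcap_measurable; first exact: finite_finset.
    have me (i : 'I_N) (c : R) : measurable [set w | X w i = c].
      by rewrite (_ : [set w | _] = [set: T] `&` (fun w => X w i) @^-1` [set c]); [exact: mX|rewrite setTI].
    move=> i _; apply: measurableU => //; apply: measurableI; last by apply: measurableC; exact: measurable_ray.
    by apply: measurableI; [exact: measurable_ray|apply: measurableC].
  have key w i : (Num.floor (2 ^+ n * X w i) = v i) <-> (v i)%:~R / 2 ^+ n <= X w i < ((v i) + 1)%:~R / 2 ^+ n.
    rewrite ler_pdivrMr// ltr_pdivlMr// ![X w i * _]mulrC; split => [<-|]; first exact: floor_itv.
    by move=> h; exact: floor_def.
  apply/seteqP; split => w /=.
    move=> zw i _; have /key : Num.floor (2 ^+ n * X w i) = v i by rewrite -zw ffunE.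
    rewrite le_eqVlt => /andP[/orP[/eqP->|h1] h2]; first by right.
    left; split; first split; first exact: ltW.
      by move=> /= e; rewrite e ltxx in h2.
    by apply/negP; rewrite -ltNge.
  move=> h; apply/ffunP => i; rewrite ffunE; apply/key.
  have := h i I; case=> [[[h1 h2] /negP]|/= ->].
    by rewrite -ltNge => h3; rewrite (ltW h3) lt_neqAle h1 andbT; apply/eqP.
  by rewrite lexx /= ltr_pM2r ?invr_gt0// intrD ltrDl.
apply: (@measurable_fun_cvg _ _ _ _ (fun n w => phi n (z n w))) => [n|w _].
  move=> _ B mB; rewrite setTI.
  rewrite (_ : _ @^-1` B = \bigcup_m (if unpickle m is Some v then [set w | z n w = v /\ B (phi n v)] else set0)).
    apply: bigcupT_measurable => m; case: unpickle => // v.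
    have [Bv|Bv] := pselect (B (phi n v)).
      by rewrite (_ : [set w | _] = [set w | z n w = v])//; apply/seteqP; split => w /= => [[]|].
    by rewrite (_ : [set w | _] = set0)//; apply/seteqP; split => w //= [].
  apply/seteqP; split => w /=.
    by move=> Bw; exists (pickle (z n w)) => //; rewrite pickleK.
  by move=> [m _]; case: unpickle => // v [-> ].
apply/cvgrPdist_le => e e0; near=> n.
apply: le_trans (HL _ _ (2 ^- n) _) _.
  move=> k; rewrite ffunE; have /andP[h1 h2] := floor_itv (2 ^+ n * X w k).
  have h3 : (Num.floor (2 ^+ n * X w k))%:~R / 2 ^+ n <= X w k by rewrite ler_pdivrMr// [_ * 2 ^+ n]mulrC.
  have h4 : X w k <= (Num.floor (2 ^+ n * X w k))%:~R / 2 ^+ n + 2 ^- n.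
    rewrite -[X in _ + X]mul1r -mulrDl ler_pdivlMr// mulrC.
    by move: h2; rewrite intrD => /ltW.
  by rewrite ler_norml; apply/andP; split; have := invr_gt0 (2 ^+ n : R); rewrite p2 => ?; lra.
have n2 : n%:R <= 2 ^+ n :> R by rewrite -natrX ler_nat ltnW// ltn_expl.
have nL : L / e <= n%:R by near: n; exact: nbhs_infty_ger.
by rewrite ler_pdivrMr// mulrC -ler_pdivrMr//; exact: le_trans n2.
Unshelve. all: by end_near. Qed.


Section Hcomp.
Context {R : realType}.

Lemma hcomp_lt (a b : \bar R) : (a < b)%E -> hcomp a < hcomp b.
Proof.
have b1 (r : R) : r < 1 + `|r| by have := ler_norm r; lra.
have b2 (r : R) : - (1 + `|r|) < r by have := ler_norm (- r); rewrite normrN; lra.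
have p (r : R) : 0 < 1 + `|r| by have := normr_ge0 r; lra.
case: a => [a| |]; case: b => [b| |] //=.
- rewrite lte_fin => ab; rewrite ltr_pdivrMr// mulrAC ltr_pdivlMr//.
  have [a0|a0] := leP 0 a; have [c0|c0] := leP 0 b;
    rewrite ?(ger0_norm a0) ?(ltr0_norm a0) ?(ger0_norm c0) ?(ltr0_norm c0); try lra.
  have : a * b <= 0 by rewrite mulr_le0_ge0// ltW.
  by lra.
- by move=> _; rewrite ltr_pdivrMr// mul1r.
- by move=> _; rewrite ltr_pdivlMr// mulN1r.
Qed.

Lemma lt_hcomp (a b : \bar R) : hcomp a < hcomp b -> (a < b)%E.
Proof.
move=> h; rewrite ltNge; apply/negP; rewrite le_eqVlt => /orP[/eqP e|/hcomp_lt].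
  by move: h; rewrite e ltxx.
by move/(lt_trans h); rewrite ltxx.
Qed.

Variable F : \bar R -> R.
Hypothesis F_mono : forall x y, (x <= y)%E -> F x <= F y.
Hypothesis F_Ny : F -oo%E = 0.
Hypothesis F_y : F +oo%E = 1.
Hypothesis F_cont : forall (x : R) e, 0 < e ->
  exists2 h, 0 < h & F (x + h)%:E - F (x - h)%:E <= e.
Hypothesis F_high : forall e, 0 < e -> exists x : R, 1 - e <= F x%:E.
Hypothesis F_low : forall e, 0 < e -> exists x : R, F x%:E <= e.

Lemma ecdf_hcomp (t : \bar R) (e : R) : 0 < e -> exists2 eta, 0 < eta &
  forall s, `|hcomp s - hcomp t| < eta -> `|F s - F t| <= e.
Proof.
move=> e0; case: t => [x| |].
- have [h h0 Fh] := F_cont x e0.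
  have h1 : hcomp (x - h)%:E < hcomp x%:E by apply: hcomp_lt; rewrite lte_fin; lra.
  have h2 : hcomp x%:E < hcomp (x + h)%:E by apply: hcomp_lt; rewrite lte_fin; lra.
  exists (Num.min (hcomp x%:E - hcomp (x - h)%:E) (hcomp (x + h)%:E - hcomp x%:E)).
    by rewrite lt_min !subr_gt0 h1 h2.
  move=> s; rewrite lt_min !ltr_norml => /andP[/andP[l1 l2] /andP[l3 l4]].
  have s1 : ((x - h)%:E < s)%E by apply: lt_hcomp; lra.
  have s2 : (s < (x + h)%:E)%E by apply: lt_hcomp; lra.
  have := F_mono (ltW s1); have := F_mono (ltW s2).
  have : F (x - h)%:E <= F x%:E by apply: F_mono; rewrite lee_fin; lra.
  have : F x%:E <= F (x + h)%:E by apply: F_mono; rewrite lee_fin; lra.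
  by rewrite ler_norml => *; apply/andP; split; lra.
- have [x Fx] := F_high e0; have h := hcomp_lt (ltry x).
  exists (hcomp (+oo%E : \bar R) - hcomp x%:E); first by rewrite subr_gt0.
  move=> s; rewrite ltr_norml => /andP[l1 l2].
  have s1 : (x%:E < s)%E by apply: lt_hcomp; lra.
  have := F_mono (ltW s1); have := F_mono (leey s); rewrite F_y.
  by rewrite ler_norml => *; apply/andP; split; lra.
- have [x Fx] := F_low e0; have h := hcomp_lt (ltNyr x).
  exists (hcomp x%:E - hcomp (-oo%E : \bar R)); first by rewrite subr_gt0.
  move=> s; rewrite ltr_norml => /andP[l1 l2].
  have s1 : (s < x%:E)%E by apply: lt_hcomp; lra.
  have := F_mono (ltW s1); have := F_mono (leNye s); rewrite F_Ny.
  by rewrite ler_norml => *; apply/andP; split; lra.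
Qed.

End Hcomp.

(** * Uniform continuity in the metric of the margins *)

Section MarginUniform.
Context (R : realType) (d : nat).
Variable Fk : 'I_d -> \bar R -> R.
Hypothesis F_mono : forall k x y, (x <= y)%E -> Fk k x <= Fk k y.
Hypothesis F_Ny : forall k, Fk k -oo%E = 0.
Hypothesis F_y : forall k, Fk k +oo%E = 1.
Hypothesis F_cont : forall k (x : R) e, 0 < e ->
  exists2 h, 0 < h & Fk k (x + h)%:E - Fk k (x - h)%:E <= e.
Hypothesis F_high : forall k e, 0 < e -> exists x : R, 1 - e <= Fk k x%:E.
Hypothesis F_low : forall k e, 0 < e -> exists x : R, Fk k x%:E <= e.

(** Uniform continuity for the pseudometric given by the differences of the margins; as the margins
    are continuous on [-oo,oo], it implies continuity in the product topology. *)
Definition margin_uniform (x : ('I_d -> \bar R) -> R) := forall e, 0 < e ->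
  exists2 h, 0 < h & forall s t,
    (forall k, `|Fk k (s k) - Fk k (t k)| <= h) -> `|x s - x t| <= e.

Lemma margin_uniform_cst c : margin_uniform (fun=> c).
Proof. by move=> e e0; exists 1 => // s t _; rewrite subrr normr0 ltW. Qed.

Lemma margin_uniform_continuous x : margin_uniform x -> continuous_ext x.
Proof.
move=> ux t u ut; apply/cvgrPdist_le => e e0; have [h h0 xh] := ux e e0.
have : \forall n \near \oo, forall k, `|Fk k (t k) - Fk k (u n k)| <= h.
  apply: filter_forall => k.
  have := ecdf_cvg (@F_mono k) (F_Ny k) (F_y k) (@F_cont k) (@F_high k) (@F_low k) (ut k).
  by move/cvgrPdist_le => /(_ _ h0).
by apply: filterS => n; exact: xh.
Qed.

Lemma margin_uniform_Dspace x : margin_uniform x -> Dspace x.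
Proof.
move=> ux t b; exists (x t) => e e0; have e2 : 0 < e / 2 by rewrite divr_gt0.
have [h h0 xh] := ux _ e2.
have : \forall eta \near (0 : R)^'+, 0 < eta /\ forall k s, `|hcomp s - hcomp (t k)| < eta ->
    `|Fk k s - Fk k (t k)| <= h.
  apply: filterI; first exact: nbhs_right_gt.
  have fa k : \forall eta \near (0 : R)^'+, forall s, `|hcomp s - hcomp (t k)| < eta ->
      `|Fk k s - Fk k (t k)| <= h; last exact: filter_forall fa.
  have [eta eta0 etah] := ecdf_hcomp (@F_mono k) (F_Ny k) (F_y k) (@F_cont k) (@F_high k) (@F_low k) (t k) h0.
  near=> eta' => s se; apply: etah; apply: lt_trans se _.
  by near: eta'; exact: nbhs_right_lt.
move=> /filter_ex[eta [eta0 etah]]; exists eta; split => // s _ se.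
by apply: le_lt_trans (xh s t _) _; [move=> k; exact: etah|lra].
Unshelve. all: by end_near. Qed.

Lemma Fk_grid_proj j t k : 0 <= Fk k (t k) - Fk k (grid_proj Fk j t k) <= 2 ^- j.
Proof.
have p2 : (0 : R) < 2 ^+ j by exact: exprn_gt0.
have h := @F_mono k _ _ (grid_proj_le F_mono F_Ny F_y j t k); rewrite subr_ge0 h /=.
rewrite /grid_proj (Fk_node F_mono F_Ny F_y F_cont F_high F_low).
have /andP[F0 F1] := Fk01 F_mono F_Ny F_y k (t k).
have x0 : 0 <= 2 ^+ j * Fk k (t k) by rewrite mulr_ge0// ltW.
have /andP[h1] := truncn_itv x0; rewrite -/(cell Fk j t k) -[(cell Fk j t k).+1%:R]natr1 => /ltW h2.
have -> : Num.min ((cell Fk j t k)%:R / 2 ^+ j) 1 = (cell Fk j t k)%:R / 2 ^+ j :> R.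
  by apply/min_idPl; rewrite ler_pdivrMr// mul1r; apply: le_trans h1 _; rewrite ler_piMr// ltW.
rewrite lerBlDl -[X in _ + X]mul1r -mulrDl ler_pdivlMr// mulrC; exact: h2.
Qed.

Lemma expn2V_le (e : R) : 0 < e -> \forall j \near \oo, 2 ^- j <= e.
Proof.
move=> e0; near=> j; have n2 : j%:R <= 2 ^+ j :> R by rewrite -natrX ler_nat ltnW// ltn_expl.
have nL : e^-1 <= j%:R by near: j; exact: nbhs_infty_ger.
rewrite -[leRHS]invrK lef_pV2 ?posrE ?invr_gt0 ?exprn_gt0//; exact: le_trans n2.
Unshelve. all: by end_near. Qed.

Lemma margin_uniform_proj x e : margin_uniform x -> 0 < e ->
  \forall j \near \oo, forall t, `|x t - x (grid_proj Fk j t)| <= e.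
Proof.
move=> ux e0; have [h h0 xh] := ux e e0.
apply: filterS (expn2V_le h0) => j jh t; apply: xh => k.
by have /andP[h1 h2] := Fk_grid_proj j t k; rewrite ger0_norm//; exact: le_trans jh.
Qed.

Lemma margin_uniform_proj_cvg x t : margin_uniform x -> x (grid_proj Fk j t) @[j --> \oo] --> x t.
Proof.
move=> ux; apply/cvgrPdist_le => e e0.
by apply: filterS (margin_uniform_proj ux e0) => j; exact.
Qed.

Variables (x : ('I_d -> \bar R) -> R) (C rho : R) (J0 : nat).
Hypotheses (rho01 : 0 < rho < 1) (C0 : 0 <= C).
Hypothesis x_good : forall j, (J0 <= j)%N -> good_level Fk x j (C * rho ^+ j).

Let r0 : 0 < rho. Proof. by case/andP: rho01. Qed.
Let r1 : 0 < 1 - rho. Proof. by rewrite subr_gt0; case/andP: rho01. Qed.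
Let e0 j : 0 <= C * rho ^+ j. Proof. by rewrite mulr_ge0// exprn_ge0// ltW. Qed.

Let D : R := d%:R * C / (1 - rho).
Let D0 : 0 <= D. Proof. by rewrite divr_ge0 ?mulr_ge0// ltW. Qed.

Let chain J K t : (J0 <= J <= K)%N ->
  `|x (grid_proj Fk K t) - x (grid_proj Fk J t)| <= D * rho ^+ J.
Proof.
move=> /andP[J0J JK].
have := @chaining R d Fk F_mono F_Ny F_y x (fun j => C * rho ^+ j) J K t e0 JK.
move=> /(_ _)/le_trans; apply; first by move=> j /andP[Jj _]; apply: x_good; exact: leq_trans Jj.
rewrite -mulr_sumr mulrA; have := geometric_sum_le rho01 J K.
move=> /(ler_wpM2l (mulr_ge0 (ler0n R d) C0))/le_trans; apply.
by rewrite /D mulrA mulrAC.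
Qed.

Let rho_small e : 0 < e -> \forall J \near \oo, rho ^+ J <= e.
Proof.
move=> e00; have : rho ^+ J @[J --> \oo] --> (0 : R).
  by apply: cvg_expr; rewrite ger0_norm ?(ltW r0)//; case/andP: rho01.
by move=> /cvgr0Pnorm_le/(_ e e00); apply: filterS => J; apply: le_trans; exact: ler_norm.
Qed.

Lemma good_levels_cvg t : cvgn (fun K => x (grid_proj Fk K t)).
Proof.
apply: cauchy_cvg; apply: cauchy_exP => e ep.
have D1 : 0 < D + 1 by rewrite ltr_wpDl.
have [J [J0J eJ]] : exists J, (J0 <= J)%N /\ rho ^+ J <= e / 2 / (D + 1).
  have : \forall J \near \oo, (J0 <= J)%N /\ rho ^+ J <= e / 2 / (D + 1).
    by apply: filterI; [exists J0|apply: rho_small; rewrite !divr_gt0].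
  by move=> /filter_ex[J [h1 h2]]; exists J.
exists (x (grid_proj Fk J t)); exists J => // K /= JK; rewrite /ball /= distrC.
apply: le_lt_trans (chain t _) _; first by rewrite J0J.
apply: (@le_lt_trans _ _ ((D + 1) * rho ^+ J)).
  by rewrite ler_wpM2r ?exprn_ge0 ?(ltW r0)// lerDl.
by rewrite mulrC; move: eJ; rewrite ler_pdivlMr//; lra.
Qed.

Hypothesis x_lim : forall t, x (grid_proj Fk K t) @[K --> \oo] --> x t.

(** Points whose margins differ by at most 2^-J have neighbouring cells, so both cells are reached
    from their coordinatewise minimum by at most one step per coordinate. *)
Lemma good_levels_uniform : margin_uniform x.
Proof.
move=> e ep; pose B : R := 2 * D + 2 * (d%:R * C).
have B0 : 0 <= B by apply: addr_ge0; apply: mulr_ge0 => //; exact: mulr_ge0.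
have B1 : 0 < B + 1 by rewrite ltr_wpDl.
have [J [J0J eJ]] : exists J, (J0 <= J)%N /\ rho ^+ J <= e / (B + 1).
  have : \forall J \near \oo, (J0 <= J)%N /\ rho ^+ J <= e / (B + 1).
    by apply: filterI; [exists J0|apply: rho_small; exact: divr_gt0].
  by move=> /filter_ex[J [h1 h2]]; exists J.
have rJ : 0 <= rho ^+ J by rewrite exprn_ge0// ltW.
have tail t : `|x t - x (grid_proj Fk J t)| <= D * rho ^+ J.
  have h : `|x (grid_proj Fk K t) - x (grid_proj Fk J t)| @[K --> \oo] --> `|x t - x (grid_proj Fk J t)|.
    by apply: cvg_norm; apply: cvgB; [exact: x_lim|exact: cvg_cst].
  apply: cvgr_to_le h _; exists J => // K JK; apply: chain; exact/andP.
have p2 : (0 : R) < 2 ^+ J by exact: exprn_gt0.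
exists (2 ^- J) => [|s t st]; first by rewrite invr_gt0.
have half (a b : 'I_d -> \bar R) k : `|Fk k (a k) - Fk k (b k)| <= 2 ^- J -> (cell Fk J a k <= (cell Fk J b k).+1)%N.
  rewrite ler_norml => /andP[_ h].
  have /andP[a0 _] := Fk01 F_mono F_Ny F_y k (a k); have /andP[b0 _] := Fk01 F_mono F_Ny F_y k (b k).
  have a1 : 0 <= 2 ^+ J * Fk k (a k) by rewrite mulr_ge0// ltW.
  have b1 : 0 <= 2 ^+ J * Fk k (b k) by rewrite mulr_ge0// ltW.
  have /andP[ca _] := truncn_itv a1; have /andP[_ cb] := truncn_itv b1.
  rewrite -ltnS -(ltr_nat R) -[(cell Fk J b k).+2%:R]natr1 -[(cell Fk J b k).+1%:R]natr1; apply: le_lt_trans ca _.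
  have : 2 ^+ J * (Fk k (a k) - Fk k (b k)) <= 1 by rewrite mulrC -ler_pdivlMr// mul1r.
  by rewrite mulrBr; move: cb; rewrite -/(cell Fk J b k) -[(cell Fk J b k).+1%:R]natr1; lra.
have min_id a b : (a <= b.+1 -> minn a b + (b < a) = a)%N.
  move=> ab; case: (leqP a b) => ba; first by rewrite addn0.
  by apply/eqP; rewrite addn1 eqn_leq ba ab.
pose c k := minn (cell Fk J s k) (cell Fk J t k).
have cJ k : (c k <= 2 ^ J)%N by rewrite geq_min (cell_le F_mono F_Ny F_y).
have gs := good_level_step (fun k => (cell Fk J t k < cell Fk J s k)%N) (e0 J) (x_good J0J) cJ.
have gt := good_level_step (fun k => (cell Fk J s k < cell Fk J t k)%N) (e0 J) (x_good J0J) cJ.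
have es : (fun k => c k + (cell Fk J t k < cell Fk J s k))%N = cell Fk J s.
  apply/funext => k; by rewrite /c min_id//; exact: half.
have et : (fun k => c k + (cell Fk J s k < cell Fk J t k))%N = cell Fk J t.
  apply/funext => k; by rewrite /c minnC min_id//; apply: half; rewrite distrC.
rewrite es in gs; rewrite et in gt.
have ts := tail s; have tt := tail t.
have eB : B * rho ^+ J <= e.
  apply: (@le_trans _ _ ((B + 1) * rho ^+ J)); first by rewrite ler_wpM2r// lerDl.
  by rewrite mulrC -ler_pdivlMr.
apply: le_trans eB.
rewrite (_ : x s - x t = (x s - x (grid_proj Fk J s)) - (x t - x (grid_proj Fk J t))
  + (x (grid_proj Fk J s) - x (node Fk J c)) - (x (grid_proj Fk J t) - x (node Fk J c))); last by ring.
apply: le_trans (ler_normB _ _) _; apply: (@le_trans _ _ (2 * D * rho ^+ J + d%:R * (C * rho ^+ J) + d%:R * (C * rho ^+ J))).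
  apply: lerD => //; apply: le_trans (ler_normD _ _) _; apply: lerD => //.
  apply: le_trans (ler_normB _ _) _; move: ts tt; lra.
by rewrite /B; lra.
Qed.

End MarginUniform.

(** * The limit process *)

Section Clamp.
Context {R : realType}.

Definition clamp01 (x : R) : R := Num.min 1 (Num.max 0 x).

Lemma clamp01_itv x : 0 <= clamp01 x <= 1.
Proof.
rewrite /clamp01; have [?|?] := lerP 0 x; rewrite minEle; case: ifPn => /= *; apply/andP; split; lra.
Qed.

Lemma clamp01_lip x y : `|clamp01 x - clamp01 y| <= `|x - y|.
Proof.
have h1 := ler_norm (x - y); have := ler_norm (y - x); rewrite distrC => h2; rewrite /clamp01.
by have [?|?] := lerP 0 x; have [?|?] := lerP 0 y; rewrite ?minEle; do ?case: ifPn => /= *; rewrite ler_norml; apply/andP; split; lra.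
Qed.

Lemma clamp01_le x y : x <= y -> 0 <= y -> clamp01 x <= y.
Proof.
by move=> xy y0; rewrite /clamp01; have [?|?] := lerP 0 x; rewrite minEle; case: ifPn => /= *; lra.
Qed.

Lemma clamp01_eq1 x : 1 <= x -> clamp01 x = 1.
Proof.
by move=> x1; rewrite /clamp01; have [?|?] := lerP 0 x; rewrite minEle; case: ifPn => /= *; lra.
Qed.

Lemma measurable_clamp01 d (T : measurableType d) (f : T -> R) :
  measurable_fun setT f -> measurable_fun setT (fun x => clamp01 (f x)).
Proof. by move=> mf; apply: measurable_minr => //; exact: measurable_maxr. Qed.

End Clamp.

(** * Construction of the Gaussian limit field *)

Section LimitFields.
Context (R : realType) (d : nat).
Context dT (T : measurableType dT) (P : probability T R).
Variable Fk : 'I_d -> \bar R -> R.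
Hypothesis F_mono : forall k x y, (x <= y)%E -> Fk k x <= Fk k y.
Hypothesis F_Ny : forall k, Fk k -oo%E = 0.
Hypothesis F_y : forall k, Fk k +oo%E = 1.
Hypothesis F_cont : forall k (x : R) e, 0 < e ->
  exists2 h, 0 < h & Fk k (x + h)%:E - Fk k (x - h)%:E <= e.
Hypothesis F_high : forall k e, 0 < e -> exists x : R, 1 - e <= Fk k x%:E.
Hypothesis F_low : forall k e, 0 < e -> exists x : R, Fk k x%:E <= e.
Variable F : ('I_d -> \bar R) -> R.
Hypothesis F_pt : forall u v, pt_le u v -> 0 <= F v - F u <= \sum_k (Fk k (v k) - Fk k (u k)).
Hypothesis F01 : forall t, 0 <= F t <= 1.
Variables (q : nat) (g C rho A B : R).
Hypotheses (g0 : 0 < g) (C0 : 0 <= C).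
Hypotheses (rho01 : 0 < rho < 1) (A01 : 0 < A < 1) (B1 : 1 < B).
Hypothesis rateA : 2 ^+ d * (2 `^ (- g)) ^+ q.+2 <= A * rho ^+ (2 * q.+2).
Hypothesis rateB : 2 ^+ d * 2 `^ (- g) <= B * rho ^+ (2 * q.+2).

Variable U : nat -> T -> ('I_d -> \bar R) -> R.
Hypothesis bU : forall n t, bmf (fun w => U n w t).
Hypothesis U_moment : forall u t n k, pt_le u t -> (0 < n)%N -> (n <= 2 ^ k)%N ->
  (2 ^ k <= 2 * n)%N -> Ex P (fun w => (U n w t - U n w u) ^+ (2 * q.+2)) <=
  C * (((F t - F u) `^ g) ^+ q.+2 + (3 / 2 ^+ q.+2) ^+ k * (F t - F u) `^ g).
Hypothesis U_bottom : forall n w, U n w (fun=> -oo%E) = 0.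

Variable Gam : ('I_d -> \bar R) -> ('I_d -> \bar R) -> R.
Hypothesis Gam_sym : forall s t, Gam s t = Gam t s.
Hypothesis Gam_psd : forall N (t : 'I_N -> 'I_d -> \bar R) (c : 'I_N -> R),
  0 <= \sum_(i < N) \sum_(j < N) c i * c j * Gam (t i) (t j).
Hypothesis U_fdd : forall N (t : 'I_N -> 'I_d -> \bar R) (c : 'I_N -> R) b,
  Ex P (fun w => cos (\sum_(j < N) c j * U n w (t j) + b)) @[n --> \oo] -->
  expR (- ((\sum_(i < N) \sum_(j < N) c i * c j * Gam (t i) (t j)) / 2)) * cos b.

Local Notation Q := (uniform_prob (@ltr01 R)).
Local Notation T3 := (measurableTypeR R).

(** Indexing by rational levels gives a node the same index as its copies on all finer grids, so the
    Gaussian sequence is consistent across grids. *)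
Definition rat_point (a : {ffun 'I_d -> rat}) : 'I_d -> \bar R :=
  grid_point Fk (fun k => ratr (a k)).

Let dec (i : nat) : {ffun 'I_d -> rat} := odflt [ffun=> 0] (unpickle i).

Let Gn i j : R := Gam (rat_point (dec i)) (rat_point (dec j)).

Let Gn_sym i j : Gn i j = Gn j i. Proof. exact: Gam_sym. Qed.

Let Gn_psd n (a : nat -> R) : 0 <= \sum_(i < n) \sum_(j < n) a i * a j * Gn i j.
Proof. exact: (@Gam_psd n (fun i => rat_point (dec i)) (fun i => a i)). Qed.

Definition rat_field (a : {ffun 'I_d -> rat}) : R -> R := gauss_seq Gn_sym Gn_psd (pickle a).

Lemma measurable_rat_field a : measurable_fun setT (rat_field a : T3 -> R).
Proof. exact: measurable_gauss_seq. Qed.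

Lemma rat_field_cos N (a : 'I_N -> {ffun 'I_d -> rat}) (c : 'I_N -> R) b :
  Ex Q (fun w => cos (\sum_(i < N) c i * rat_field (a i) w + b)) =
  expR (- ((\sum_(i < N) \sum_(j < N) c i * c j * Gam (rat_point (a i)) (rat_point (a j))) / 2)) * cos b.
Proof.
pose M := (\max_(i < N) pickle (a i)).+1.
have aM i : (pickle (a i) < M)%N by rewrite /M ltnS; exact: (leq_bigmax i).
(* Repetitions among the indices [a i] are merged by adding their coefficients. *)
pose e m : R := \sum_(i < N) c i * (m == pickle (a i))%:R.
have sel (f : nat -> R) : \sum_(m < M) e m * f m = \sum_(i < N) c i * f (pickle (a i)).
  under eq_bigr do rewrite mulr_suml.
  rewrite exchange_big /=; apply: eq_bigr => i _.
  rewrite (bigD1 (Ordinal (aM i)))//= eqxx mulr1 big1 ?addr0// => m.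
  by rewrite -val_eqE /= => /negbTE->; rewrite mulr0 mul0r.
have := gauss_seq_cos Gn_sym Gn_psd M e b.
rewrite (_ : \sum_(i < M) \sum_(j < M) e i * e j * Gn i j =
    \sum_(i < N) \sum_(j < N) c i * c j * Gam (rat_point (a i)) (rat_point (a j))); last first.
  transitivity (\sum_(i < M) e i * \sum_(j < M) e j * Gn i j).
    by apply: eq_bigr => i _; rewrite mulr_sumr; apply: eq_bigr => j _; rewrite mulrA.
  rewrite (sel (fun i => \sum_(j < M) e j * Gn i j)); apply: eq_bigr => i _.
  rewrite (sel (fun j => Gn (pickle (a i)) j)) mulr_sumr; apply: eq_bigr => j _.
  by rewrite /Gn /dec !pickleK /= mulrA.
move=> <-; apply: eq_Ex => w; congr (cos (_ + _)).
by rewrite (sel (fun m => gauss_seq Gn_sym Gn_psd m w)).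
Qed.

Definition dyadic_idx (j : nat) (c : 'I_d -> nat) : {ffun 'I_d -> rat} :=
  [ffun k => (c k)%:R / 2 ^+ j].

Lemma rat_point_dyadic j c : rat_point (dyadic_idx j c) = node Fk j c.
Proof.
apply/funext => k; rewrite /rat_point /node /grid_point; congr (equantile _ _).
by rewrite ffunE fmorph_div /= rmorphXn /= !ratr_nat.
Qed.

(* A junk value unless the limit exists, see good_path. *)
Definition raw_field (w : R) (t : 'I_d -> \bar R) : R :=
  limn (fun K => rat_field (dyadic_idx K (cell Fk K t)) w).

(** A node above level 1 is +oo, and the cell index of +oo is 2^j. *)
Definition truncate (j : nat) (c : 'I_d -> nat) : 'I_d -> nat := fun k => minn (c k) (2 ^ j).

Lemma truncate_id j c : (forall k, (c k <= 2 ^ j)%N) -> truncate j c = c.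
Proof. by move=> cj; apply/funext => k; rewrite /truncate (minn_idPl (cj k)). Qed.

Let cell_node j c n k : cell Fk (j + n) (node Fk j c) k = (truncate j c k * 2 ^ n)%N.
Proof.
have p j' : (0 : R) < 2 ^+ j' by exact: exprn_gt0.
rewrite /cell (Fk_node F_mono F_Ny F_y F_cont F_high F_low).
have -> : Num.min ((c k)%:R / 2 ^+ j) 1 = (truncate j c k)%:R / 2 ^+ j :> R.
  rewrite /truncate; have [h|h] := leqP (c k) (2 ^ j).
    by apply/min_idPl; rewrite ler_pdivrMr// mul1r -natrX ler_nat.
  rewrite natrX divff ?gt_eqF//; apply/min_idPr.
  by rewrite ler_pdivlMr// mul1r -natrX ler_nat ltnW.
rewrite exprD (_ : _ * _ = (truncate j c k * 2 ^ n)%:R :> R) ?natrK//.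
by rewrite natrM natrX; field; rewrite gt_eqF.
Qed.

Lemma raw_field_node w j c : raw_field w (node Fk j c) = rat_field (dyadic_idx j (truncate j c)) w.
Proof.
have p j' : (0 : rat) < 2 ^+ j' by exact: exprn_gt0.
apply/cvg_lim => //; apply: cvg_near_cst; near=> K.
have jK : (j <= K)%N by near: K; exists j.
congr (rat_field _ w); apply/ffunP => k; rewrite !ffunE -(subnKC jK) cell_node.
by rewrite exprD natrM natrX -mulf_div divff ?mulr1// gt_eqF.
Unshelve. all: by end_near. Qed.

Lemma measurable_raw_node j c : measurable_fun setT (fun w : T3 => raw_field w (node Fk j c)).
Proof. by rewrite (funext (fun w => raw_field_node w j c)); exact: measurable_rat_field. Qed.

(** The increment from -oo, where the process vanishes; sample sizes start at 1, as in the moment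
    hypothesis. *)
Let U_bounded n t : Ex P (fun w => U n.+1 w t ^+ (2 * q.+2)) <= 2 * C.
Proof.
have /andP[nk kn] := up_log2_bounds (ltn0Sn n).
have bt : pt_le (fun=> -oo%E) t by move=> k; exact: leNye.
have := U_moment bt (ltn0Sn n) nk kn.
rewrite (_ : Ex P _ = Ex P (fun w => U n.+1 w t ^+ (2 * q.+2))); last first.
  by apply: eq_Ex => w; rewrite U_bottom subr0.
move/le_trans; apply.
set m := F t - _.
have m0 : 0 <= m by have /andP[] := F_pt bt.
have m1 : m <= 1.
  by have /andP[_ h1] := F01 t; have /andP[h2 _] := F01 (fun=> -oo%E); rewrite /m; lra.
have mg : m `^ g <= 1.
  apply: (@le_trans _ _ (1 `^ g)); last by rewrite powR1.
  by apply: ge0_ler_powR; rewrite ?nnegrE// ltW.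
have mg0 : 0 <= m `^ g by exact: powR_ge0.
have r1 : 3 / 2 ^+ q.+2 <= 1 :> R.
  rewrite ler_pdivrMr ?exprn_gt0// mul1r !exprS.
  by have : 1 <= 2 ^+ q :> R by [rewrite exprn_ege1// ler1n]; lra.
have r0 : 0 <= 3 / 2 ^+ q.+2 :> R by rewrite divr_ge0// exprn_ge0.
rewrite [leRHS]mulrC ler_wpM2l// (_ : 2 = 1 + 1 :> R)//; apply: lerD.
  exact: exprn_ile1.
by rewrite mulr_ile1 ?exprn_ge0// exprn_ile1.
Qed.

Let U_tail n t a : 1 <= a -> fine (P [set w | a < `|U n.+1 w t|]) <= 2 * C / a.
Proof.
move=> a1; have a0 : 0 < a by exact: lt_le_trans a1.
have bX : bmf (fun w => U n.+1 w t ^+ (2 * q.+2)) by exact: bmfX.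
have X0 w : 0 <= U n.+1 w t ^+ (2 * q.+2) by rewrite exprM exprn_ge0// sqr_ge0.
have mt := measurable_tail a (bmf_meas (bU n.+1 t)).
apply: (@le_trans _ _ (Ex P (fun w => U n.+1 w t ^+ (2 * q.+2) * a^-1))).
  rewrite -Ex_indic//; apply: le_Ex; [exact: bmf_indic|by apply: bmfM => //; exact: bmf_cst|] => w.
  rewrite indicE ler_pdivlMr//; have [h|h] := boolP (w \in _); last by rewrite mul0r.
  rewrite mul1r; move/set_mem : h => /= h.
  have h1 : a <= `|U n.+1 w t| by exact: ltW.
  rewrite exprM -real_normK ?num_real// -exprM mulnC.
  rewrite mulnS mulnC exprS; apply: le_trans h1 _; rewrite ler_peMr// exprn_ege1//.
  exact: le_trans a1 (ltW h).
by rewrite ExZr// ler_wpM2r// ?invr_ge0 ?(ltW a0)//; exact: U_bounded.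
Qed.

Lemma raw_field_fdd N (j : 'I_N -> nat) (c : 'I_N -> 'I_d -> nat) (H : ('I_N -> R) -> R) (M L : R) :
  (forall i k, (c i k <= 2 ^ j i)%N) ->
  (forall x, `|H x| <= M) -> 0 <= L ->
  (forall x y e, (forall k, `|x k - y k| <= e) -> `|H x - H y| <= L * e) ->
  Ex P (fun w => H (fun i => U n.+1 w (node Fk (j i) (c i)))) @[n --> \oo] -->
  Ex Q (fun w => H (fun i => raw_field w (node Fk (j i) (c i)))).
Proof.
move=> cj HM L0 HL.
have mlip d0 (T0 : measurableType d0) (X : T0 -> 'I_N -> R) :
    (forall i, measurable_fun setT (fun w => X w i)) -> measurable_fun setT (fun w => H (X w)).
  exact: measurable_lipschitz L0 HL.
apply: (@levy_continuity R N _ T P _ T3 Q (fun n w i => U n.+1 w (node Fk (j i) (c i)))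
  (fun w i => raw_field w (node Fk (j i) (c i))) _ _ _ _ H M L) => //.
- by move=> n i; exact: bmf_meas (bU _ _).
- by move=> i; exact: measurable_raw_node.
- move=> a b.
  rewrite (_ : Ex Q _ = Ex Q (fun w => cos (\sum_(i < N) a i * rat_field (dyadic_idx (j i) (c i)) w + b))); last first.
    apply: eq_Ex => w; congr (cos (_ + _)); apply: eq_bigr => i _.
    by rewrite raw_field_node truncate_id// => k; exact: cj.
  rewrite rat_field_cos; under eq_bigr do under eq_bigr do rewrite !rat_point_dyadic.
  pose u n := Ex P (fun w => cos (\sum_(k < N) a k * U n w (node Fk (j k) (c k)) + b)).
  have h : u @ \oo --> expR (- ((\sum_(i < N) \sum_(l < N) a i * a l *
      Gam (node Fk (j i) (c i)) (node Fk (j l) (c l))) / 2)) * cos b by exact: U_fdd.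
  by rewrite -cvg_shiftS in h; exact: h.
(* The moment bound serves all n at once; the limit has finitely many coordinates, each tight by
   itself. *)
- move=> e e0.
  have tA i : {A0 : R | 0 < A0 /\ forall B, A0 <= B ->
      fine (Q [set w : T3 | B < `|raw_field w (node Fk (j i) (c i))|]) <= e}.
    apply: cid; have [A0 A00 h] := tight_single Q (measurable_raw_node (j i) (c i)) e0.
    by exists A0.
  pose A0 i := sval (tA i).
  have A0p i : 0 < A0 i by rewrite /A0; case: (tA i) => ? [].
  have C1 : 0 <= 2 * C / e by rewrite divr_ge0 ?mulr_ge0// ltW.
  have S0 : 0 <= \sum_i A0 i by apply: sumr_ge0 => i _; exact: ltW.
  exists (1 + 2 * C / e + \sum_i A0 i); first by lra.
  split => [n k|k].
    apply: le_trans (U_tail _ _ _) _; first by lra.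
    rewrite ler_pdivrMr; last by lra.
    rewrite mulrC [leLHS](_ : _ = (2 * C / e) * e); last by rewrite divfK ?gt_eqF// mulrC.
    by rewrite [leRHS]mulrC ler_wpM2r ?(ltW e0)//; lra.
  have [_] := svalP (tA k); apply; rewrite -/(A0 k).
  have : A0 k <= \sum_i A0 i.
    by rewrite (bigD1 k)//= lerDl; apply: sumr_ge0 => i _; exact: ltW.
  by move: S0 C1; lra.
- by move=> n; apply: mlip => i; exact: bmf_meas (bU _ _).
- by apply: mlip => i; exact: measurable_raw_node.
Qed.

(* The limit field lives on levels at most 1; capping a point there does not change F. *)
Definition cap (t : 'I_d -> \bar R) : 'I_d -> \bar R :=
  fun k => Order.min (t k) (equantile (Fk k) 1).

Let cap_node j c : cap (node Fk j c) = node Fk j (truncate j c).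
Proof.
have p j' : (0 : R) < 2 ^+ j' by exact: exprn_gt0.
apply/funext => k; rewrite /cap /node /grid_point /truncate.
have [h|h] := leqP (c k) (2 ^ j).
  apply/min_idPl; apply: le_ereal_inf => x /= hx; apply: le_trans hx.
  by rewrite ler_pdivrMr// mul1r -natrX ler_nat.
rewrite (@equantile_gt1 _ _ (@F_mono k) (F_y k) ((c k)%:R / 2 ^+ j)).
  by rewrite natrX divff ?gt_eqF//; apply/min_idPr; exact: leey.
by rewrite ltr_pdivlMr// mul1r -natrX ltr_nat.
Qed.

Let cap_mono u t : pt_le u t -> pt_le (cap u) (cap t).
Proof. by move=> ut k; rewrite /cap le_min !ge_min ut/= lexx orbT. Qed.

Let F_cap t : F (cap t) = F t.
Proof.
have ct : pt_le (cap t) t by move=> k; rewrite /cap ge_min lexx.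
have /andP[h1 h2] := F_pt ct.
suff h3 : \sum_k (Fk k (t k) - Fk k (cap t k)) <= 0 by apply/eqP; rewrite eq_le; apply/andP; split; lra.
apply: sumr_le0 => k _; rewrite subr_le0 /cap minEle; case: ifPn => // _.
rewrite (@equantileK _ _ (@F_mono k) (F_Ny k) (F_y k) (@F_cont k) (@F_high k) (@F_low k)) ?ler01 ?lexx//.
by have /andP[] := Fk01 F_mono F_Ny F_y k (t k).
Qed.

(** Finite-dimensional convergence tests bounded Lipschitz functions only. This surrogate for
    [level_sum] is one, lies below it, and still detects good levels at the cost of a factor 2. *)
Definition level_clamp (u : ('I_d -> \bar R) -> R) (j : nat) : R :=
  \sum_(x <- enum {: grid_idx d j}) clamp01 (`|grid_incr Fk u x / rho ^+ j| - 1).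

Let rho0 : 0 < rho. Proof. by case/andP: rho01. Qed.

Lemma level_clamp_le u j : level_clamp u j <= level_sum Fk q u j (rho ^+ j).
Proof.
rewrite /level_clamp /level_sum big_enum /=; apply: ler_sum => x _.
set y := _ / _; rewrite exprM -real_normK ?num_real// -exprM.
have y0 := normr_ge0 y; apply: clamp01_le; last exact: exprn_ge0.
have [y1|y1] := leP `|y| 1; first by have := exprn_ge0 (2 * q.+2) y0; lra.
apply: (@le_trans _ _ `|y|); first by lra.
by rewrite mulnS exprS ler_peMr// exprn_ege1// ltW.
Qed.

Lemma level_clamp_ge0 u j : 0 <= level_clamp u j.
Proof. by apply: sumr_ge0 => x _; case/andP: (clamp01_itv (`|grid_incr Fk u x / rho ^+ j| - 1)). Qed.

Lemma level_clamp_good u j : level_clamp u j < 1 -> good_level Fk u j (2 * rho ^+ j).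
Proof.
move=> h x; rewrite leNgt; apply/negP => ex; have rj : 0 < rho ^+ j by exact: exprn_gt0.
suff : 1 <= level_clamp u j by rewrite leNgt h.
rewrite /level_clamp big_enum /= (bigD1 x)//= clamp01_eq1.
  by rewrite lerDl; apply: sumr_ge0 => y _; case/andP: (clamp01_itv (`|grid_incr Fk u y / rho ^+ j| - 1)).
by rewrite normrM normfV (gtr0_norm rj) lerBrDl ler_pdivlMr//; exact: ltW.
Qed.

Let raw_cap w j c : raw_field w (node Fk j c) = raw_field w (node Fk j (truncate j c)).
Proof. by rewrite !raw_field_node (@truncate_id j (truncate j c))// => k; exact: geq_minr. Qed.

Let level_clamp_fdd j : Ex P (fun w => level_clamp (fun t => U n.+1 w (cap t)) j) @[n --> \oo] -->
  Ex Q (fun w => level_clamp (raw_field w) j).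
Proof.
have rj : 0 < rho ^+ j by exact: exprn_gt0.
pose H (v : 'I_2 -> R) := clamp01 (`|(v ord0 - v ord_max) / rho ^+ j| - 1).
pose c (x : grid_idx d j) (i : 'I_2) : 'I_d -> nat :=
  truncate j (if i == ord0 then bump_at (fun i => x.1 i : nat) x.2 else (fun i => x.1 i : nat)).
have HL v v' e : (forall k, `|v k - v' k| <= e) -> `|H v - H v'| <= 2 / rho ^+ j * e.
  move=> vv; apply: le_trans (clamp01_lip _ _) _.
  rewrite opprB addrA subrK; apply: le_trans (ler_dist_dist _ _) _.
  rewrite -mulrBl normrM normfV (gtr0_norm rj) mulrAC ler_wpM2r ?invr_ge0 ?(ltW rj)//.
  have := vv ord0; have := vv ord_max; rewrite !ler_norml => /andP[? ?] /andP[? ?]; apply/andP; split; lra.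
have H1 v : `|H v| <= 1 by have /andP[? ?] := clamp01_itv (`|(v ord0 - v ord_max) / rho ^+ j| - 1); rewrite ger0_norm.
have L0 : 0 <= 2 / rho ^+ j by rewrite divr_ge0// ltW.
have bH d0 (T0 : measurableType d0) (X : T0 -> 'I_2 -> R) : (forall i, measurable_fun setT (fun w => X w i)) ->
    bmf (fun w => H (X w)).
  by move=> mX; split; [exact: measurable_lipschitz L0 HL mX|exists 1 => w; exact: H1].
have term x : Ex P (fun w => H (fun i => U n.+1 w (node Fk j (c x i)))) @[n --> \oo] -->
    Ex Q (fun w => H (fun i => raw_field w (node Fk j (c x i)))).
  by apply: (@raw_field_fdd 2 (fun=> j) (c x) H 1 (2 / rho ^+ j)) => // i k; exact: geq_minr.
have eU n : Ex P (fun w => level_clamp (fun t => U n.+1 w (cap t)) j) =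
    \sum_(x <- enum {: grid_idx d j}) Ex P (fun w => H (fun i => U n.+1 w (node Fk j (c x i)))).
  rewrite -Ex_sum => [|x]; last by apply: bH => i; exact: bmf_meas (bU _ _).
  by apply: eq_Ex => w; apply: eq_bigr => x _; rewrite /grid_incr !cap_node.
have eW : Ex Q (fun w => level_clamp (raw_field w) j) =
    \sum_(x <- enum {: grid_idx d j}) Ex Q (fun w => H (fun i => raw_field w (node Fk j (c x i)))).
  rewrite -Ex_sum => [|x]; last by apply: bH => i; exact: measurable_raw_node.
  apply: eq_Ex => w; apply: eq_bigr => x _; rewrite /grid_incr.
  by rewrite /H /c eqxx -!raw_cap.
rewrite eW (_ : (fun n => _) = fun n => \sum_(x <- enum {: grid_idx d j}) Ex P (fun w => H (fun i => U n.+1 w (node Fk j (c x i))))); last by apply/funext.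
exact: cvg_sum_seq term.
Qed.

Let Ex_level_clamp_U n j : Ex P (fun w => level_clamp (fun t => U n.+1 w (cap t)) j) <=
  C * (d * 3 ^ d)%:R * (A ^+ j + (3 / 2 ^+ q.+2) ^+ up_log 2 n.+1 * B ^+ j).
Proof.
have /andP[nk kn] := up_log2_bounds (ltn0Sn n).
have eps0 : 0 <= (3 / 2 ^+ q.+2) ^+ up_log 2 n.+1 :> R by rewrite exprn_ge0// divr_ge0// exprn_ge0.
have bc t : bmf (fun w => U n.+1 w (cap t)) by exact: bU.
apply: le_trans (Ex_level_sum (P := P) F_mono F_Ny F_y F_cont F_high F_low F_pt g0 C0 rho01 A01 B1 rateA rateB j bc eps0 _); last first.
  by move=> u t ut; have := U_moment (cap_mono ut) (ltn0Sn n) nk kn; rewrite !F_cap.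
have bi (x : grid_idx d j) : bmf (fun w => grid_incr Fk (fun t => U n.+1 w (cap t)) x / rho ^+ j).
  by apply: bmfM; [exact: bmfB|exact: bmf_cst].
apply: le_Ex.
- rewrite /level_clamp; apply: bmf_sum => x; split; last first.
    exists 1 => w; set y := _ - 1.
    by have /andP[? ?] := clamp01_itv y; rewrite ger0_norm.
  apply: measurable_clamp01; apply: bmf_meas; apply: bmfB; last exact: bmf_cst.
  exact: bmf_norm.
- rewrite /level_sum (_ : (fun w => _) = fun w => \sum_(y <- enum {: grid_idx d j}) (grid_incr Fk (fun t => U n.+1 w (cap t)) y / rho ^+ j) ^+ (2 * q.+2)).
    by apply: bmf_sum => y; exact: bmfX.
  by apply/funext => w; rewrite big_enum.
- by move=> w; exact: level_clamp_le.
Qed.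

(** At a fixed level the lower-order term tends to 0 with n, so the limit field obeys the main term
    alone and can be chained through all levels. *)
Lemma Ex_level_clamp j : Ex Q (fun w => level_clamp (raw_field w) j) <= C * (d * 3 ^ d)%:R * A ^+ j.
Proof.
have ul : up_log 2 n.+1 @[n --> \oo] --> \oo.
  apply/cvgnyPge => a; near=> n.
  have n2 : (2 ^ a <= n)%N by near: n; exists (2 ^ a)%N.
  have /andP[h _] := up_log2_bounds (ltn0Sn n).
  by have := leq_trans (leqW n2) h; rewrite leq_exp2l.
have r0 : 0 <= 3 / 2 ^+ q.+2 :> R by rewrite divr_ge0// exprn_ge0.
have r1 : 3 / 2 ^+ q.+2 < 1 :> R.
  rewrite ltr_pdivrMr ?exprn_gt0// mul1r !exprS.
  by have : 1 <= 2 ^+ q :> R by [rewrite exprn_ege1// ler1n]; lra.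
have geo : (3 / 2 ^+ q.+2) ^+ up_log 2 n.+1 @[n --> \oo] --> (0 : R).
  have h : (3 / 2 ^+ q.+2) ^+ n @[n --> \oo] --> (0 : R) by apply: cvg_expr; rewrite ger0_norm.
  exact: (cvg_comp _ _ ul h).
have lim : C * (d * 3 ^ d)%:R * (A ^+ j + (3 / 2 ^+ q.+2) ^+ up_log 2 n.+1 * B ^+ j) @[n --> \oo] -->
    C * (d * 3 ^ d)%:R * (A ^+ j + 0 * B ^+ j).
  by apply: cvgMr; apply: cvgD; [exact: cvg_cst|exact: cvgMl].
rewrite mul0r addr0 in lim.
have h := @ler_cvg_to _ _ _ _ (fun n => Ex P (fun w => level_clamp (fun t => U n.+1 w (cap t)) j))
  (fun n => C * (d * 3 ^ d)%:R * (A ^+ j + (3 / 2 ^+ q.+2) ^+ up_log 2 n.+1 * B ^+ j)) _ _ (@level_clamp_fdd j) lim.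
by apply: h; apply: nearW => n; exact: Ex_level_clamp_U.
Unshelve. all: by end_near. Qed.

Definition good_path (w : R) := exists J, forall j, (J <= j)%N -> level_clamp (raw_field w) j < 1.

Let bmf_clamp j : bmf (fun w : T3 => level_clamp (raw_field w) j).
Proof.
rewrite /level_clamp; apply: bmf_sum => x; split; last first.
  exists 1 => w; set y := _ - 1.
  by have /andP[? ?] := clamp01_itv y; rewrite ger0_norm.
apply: measurable_clamp01; apply: measurable_funB; last exact: measurable_cst.
apply: measurableT_comp => //; apply: measurable_funM; last exact: measurable_cst.
by apply: measurable_funB; exact: measurable_raw_node.
Qed.

Let m_bad j : measurable [set w : T3 | 1 <= level_clamp (raw_field w) j].
Proof.
rewrite (_ : [set w | _] = [set w : T3 | - level_clamp (raw_field w) j <= -1]).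
  by apply: measurable_ray; apply: measurable_funN; exact: bmf_meas (bmf_clamp j).
by apply/seteqP; split => w /=; rewrite lerN2.
Qed.

(** Borel-Cantelli: the probability of a bad level j is at most a constant times A^j. *)
Lemma good_path_ae : {ae Q, forall w, good_path w}.
Proof.
pose E j := [set w : T3 | 1 <= level_clamp (raw_field w) j].
exists (lim_sup_set E); split; last 1 first.
- move=> w /= nw n _; apply: contrapT => h; apply: nw; exists n => j nj.
  by rewrite ltNge; apply/negP => hj; apply: h; exists j.
- apply: bigcapT_measurable => n; apply: bigcup_measurable => k _; exact: m_bad.
- apply: lim_sup_set_cvg0 => [k|]; first exact: m_bad.
  have /andP[A0 A1] := A01; have A1' : 0 < 1 - A by rewrite subr_gt0.
  pose C2 := C * (d * 3 ^ d)%:R; have C20 : 0 <= C2 by rewrite mulr_ge0.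
  apply: (@le_lt_trans _ _ (C2 * (1 + A ^+ 0 / (1 - A)))%:E); last exact: ltry.
  apply: lime_le; first by apply: is_cvg_nneseries => n _ _; exact: measure_ge0.
  apply: nearW => n; apply: (@le_trans _ _ (\sum_(0 <= j < n) (C2 * A ^+ j)%:E)%E).
    apply: lee_sum => j _; have mE : measurable (E j) by exact: m_bad.
    rewrite -[leLHS]fineK; last first.
      by rewrite ge0_fin_numE// (le_lt_trans (probability_le1 _ mE))// ltry.
    rewrite lee_fin; apply: le_trans (Ex_level_clamp j).
    rewrite -[leRHS]divr1; exact: (markov_Ex Q ltr01 (bmf_clamp j) (fun w => level_clamp_ge0 _ _)).
  rewrite sumEFin lee_fin -mulr_sumr ler_wpM2l//.
  apply: (@le_trans _ _ (\sum_(0 <= j < n.+1) A ^+ j)).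
    by rewrite big_nat_recr//= lerDl exprn_ge0// ltW.
  by rewrite big_ltn// expr0 lerD2l; exact: geometric_sum_le.
Qed.

(** Setting the exceptional paths to 0 makes every path continuous, while node values change only on
    a null set. *)
Definition field (w : R) (t : 'I_d -> \bar R) : R :=
  if pselect (good_path w) then raw_field w t else 0.

Lemma field_uniform w : margin_uniform Fk (field w).
Proof.
have [gw|ng] := pselect (good_path w); last first.
  rewrite (_ : field w = fun=> 0); first exact: margin_uniform_cst.
  by apply/funext => t; rewrite /field; case: pselect.
rewrite (_ : field w = raw_field w); last by apply/funext => t; rewrite /field; case: pselect.
case: gw => J gw.
have gl j : (J <= j)%N -> good_level Fk (raw_field w) j (2 * rho ^+ j).
  by move=> /gw; exact: level_clamp_good.
have e2 : (0 : R) <= 2 by [].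
have raw_cell K t : raw_field w (grid_proj Fk K t) = rat_field (dyadic_idx K (cell Fk K t)) w.
  by rewrite raw_field_node truncate_id// => k; exact: cell_le F_mono F_Ny F_y _ _ _.
apply: (good_levels_uniform F_mono F_Ny F_y rho01 e2 gl) => t.
have := @good_levels_cvg _ _ _ F_mono F_Ny F_y _ _ _ _ rho01 e2 gl t.
by rewrite (_ : (fun K => _) = (fun K => rat_field (dyadic_idx K (cell Fk K t)) w))//; apply/funext => K.
Qed.

Let m_good : measurable ([set w | good_path w] : set T3).
Proof.
rewrite (_ : [set w | _] = ~` lim_sup_set (fun j => [set w : T3 | 1 <= level_clamp (raw_field w) j])).
  apply: measurableC; apply: bigcapT_measurable => n; apply: bigcup_measurable => k _; exact: m_bad.
apply/seteqP; split => w /=.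
  move=> [J gw] /(_ J I)[j /= Jj]; rewrite leNgt => /negP; apply; exact: gw.
move=> h; apply: contrapT => nw; apply: h => n _; apply: contrapT => h; apply: nw; exists n => j nj.
by rewrite ltNge; apply/negP => hj; apply: h; exists j.
Qed.

Let measurable_field_node j c : measurable_fun setT (fun w : T3 => field w (node Fk j c)).
Proof.
rewrite (_ : (fun w => _) = fun w : T3 => \1_([set w | good_path w]) w * raw_field w (node Fk j c)).
  apply: measurable_funM; last exact: measurable_raw_node.
  exact: measurable_indic.
apply/funext => w; rewrite /field indicE; case: pselect => gw.
  by rewrite mem_set// mul1r.
by rewrite memNset// mul0r.
Qed.

Lemma measurable_field t : measurable_fun setT (fun w : T3 => field w t).
Proof.
apply: (@measurable_fun_cvg _ _ _ _ (fun j w => field w (grid_proj Fk j t))) => [j|w _].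
  exact: measurable_field_node.
exact: margin_uniform_proj_cvg (field_uniform w).
Qed.

Let Ex_field_node N (j : 'I_N -> nat) (c : 'I_N -> 'I_d -> nat) (H : ('I_N -> R) -> R) :
  (forall X : 'I_N -> T3 -> R, (forall i, measurable_fun setT (X i)) -> bmf (fun w => H (fun i => X i w))) ->
  Ex Q (fun w => H (fun i => field w (node Fk (j i) (c i)))) =
  Ex Q (fun w => H (fun i => raw_field w (node Fk (j i) (c i)))).
Proof.
move=> bH.
have b1 := bH (fun i w => field w (node Fk (j i) (c i))) (fun i => @measurable_field_node _ _).
have b2 := bH (fun i w => raw_field w (node Fk (j i) (c i))) (fun i => measurable_raw_node _ _).
have E : (\int[Q]_w (H (fun i => field w (node Fk (j i) (c i))))%:E =
    \int[Q]_w (H (fun i => raw_field w (node Fk (j i) (c i))))%:E)%E.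
  apply: ae_eq_integral => //; try by apply/measurable_EFinP; apply: bmf_meas.
  have [N0 [mN0 QN0 sub]] := good_path_ae.
  exists N0; split => // w /= h; apply: sub => /= gw; apply: h => _; congr (H _)%:E.
  by apply/funext => i; rewrite /field; case: pselect.
by move: E; rewrite !Ex_EFin// => -[].
Qed.

Lemma field_fdd N (j : 'I_N -> nat) (c : 'I_N -> 'I_d -> nat) (H : ('I_N -> R) -> R) (M L : R) :
  (forall i k, (c i k <= 2 ^ j i)%N) ->
  (forall x, `|H x| <= M) -> 0 <= L ->
  (forall x y e, (forall k, `|x k - y k| <= e) -> `|H x - H y| <= L * e) ->
  Ex P (fun w => H (fun i => U n.+1 w (node Fk (j i) (c i)))) @[n --> \oo] -->
  Ex Q (fun w => H (fun i => field w (node Fk (j i) (c i)))).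
Proof.
move=> cj HM L0 HL; rewrite Ex_field_node; first exact: raw_field_fdd HM L0 HL.
move=> X mX; split; last by exists M => w.
exact: (measurable_lipschitz (X := fun w i => X i w) L0 HL mX).
Qed.

(** At arbitrary points a linear combination is the limit of its values at nodes. The node variances
    are shown to converge by taking logarithms of their cosine transforms, whose limit is positive
    for small b. *)
Lemma field_gaussian : centered_gaussian_process Q (field : T3 -> _).
Proof.
move=> m t a.
pose Y w := \sum_(k < m) a k * field w (t k).
pose YK K w := \sum_(k < m) a k * field w (grid_proj Fk K (t k)).
pose v K := \sum_(k < m) \sum_(l < m) a k * a l * Gam (grid_proj Fk K (t k)) (grid_proj Fk K (t l)).
have mY : measurable_fun setT (Y : T3 -> R).
  apply: measurable_sum => k; apply: measurable_funM; [exact: measurable_cst|exact: measurable_field].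
have mYK K : measurable_fun setT (YK K : T3 -> R).
  apply: measurable_sum => k; apply: measurable_funM; [exact: measurable_cst|exact: measurable_field].
have cosYK K b c : Ex Q (fun w => cos (b * YK K w + c)) = expR (- (b ^+ 2 * v K / 2)) * cos c.
  pose H (y : 'I_m -> R) := cos (b * (\sum_k a k * y k) + c).
  rewrite [LHS](_ : _ = Ex Q (fun w => H (fun k => field w (node Fk K (cell Fk K (t k))))))//.
  rewrite (@Ex_field_node _ (fun=> K)); last first.
    move=> X mX; apply: bmf_cos; apply: measurable_funD; last exact: measurable_cst.
    apply: measurable_funM; first exact: measurable_cst.
    by apply: measurable_sum => k; apply: measurable_funM; [exact: measurable_cst|exact: mX].
  rewrite (_ : Ex Q _ = Ex Q (fun w => cos (\sum_(k < m) (b * a k) * rat_field (dyadic_idx K (cell Fk K (t k))) w + c))); last first.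
    apply: eq_Ex => w; rewrite /H mulr_sumr; congr (cos (_ + _)); apply: eq_bigr => k _.
    by rewrite raw_field_node truncate_id ?mulrA// => i; exact: cell_le F_mono F_Ny F_y _ _ _.
  rewrite rat_field_cos; congr (expR (- (_ / 2)) * _).
  rewrite /v mulr_sumr; apply: eq_bigr => k _; rewrite mulr_sumr; apply: eq_bigr => l _.
  by rewrite !rat_point_dyadic /grid_proj; ring.
have YKY w : YK K w @[K --> \oo] --> Y w.
  apply: (@cvg_sum_seq _ _ _ (fun k K => a k * field w (grid_proj Fk K (t k))) (fun k => a k * field w (t k))) => k; apply: cvgMr; exact: margin_uniform_proj_cvg (field_uniform w).
have bcos b c (X : T3 -> R) : measurable_fun setT X -> bmf (fun w => cos (b * X w + c)).
  move=> mX; apply: bmf_cos; apply: measurable_funD; last exact: measurable_cst.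
  by apply: measurable_funM => //; exact: measurable_cst.
have cos_lim b c : Ex Q (fun w => cos (b * YK K w + c)) @[K --> \oo] --> Ex Q (fun w => cos (b * Y w + c)).
  { apply: (@cvg_Ex _ _ _ _ _ _ 1).
  - by move=> K; exact: bmf_meas (bcos _ _ _ (mYK K)).
  - exact: bmf_meas (bcos _ _ _ mY).
  - by move=> K w; rewrite ler_norml cos_geN1 cos_le1.
  - apply: aeW => w; apply: continuous_cvg; first exact: continuous_cos.
    by apply: cvgD; [exact: cvgMr|exact: cvg_cst]. }
(* E cos(b Y) -> 1 as b -> 0, which excludes v K -> oo *)
have [b b0 hb] : exists2 b, b != 0 & 0 < Ex Q (fun w => cos (b * Y w + 0)).
  have : Ex Q (fun w => cos (n.+1%:R^-1 * Y w + 0)) @[n --> \oo] --> Ex Q (fun w : T3 => cos 0 : R).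
    { apply: (@cvg_Ex _ _ _ _ _ _ 1).
    - by move=> n; exact: bmf_meas (bcos _ _ _ mY).
    - exact: measurable_cst.
    - by move=> n w; rewrite ler_norml cos_geN1 cos_le1.
    - apply: aeW => w; apply: continuous_cvg; first exact: continuous_cos.
      rewrite -[X in _ --> X]addr0 -[X in _ --> X + _](mul0r (Y w)).
      by apply: cvgD; [apply: cvgMl; exact: cvg_harmonic|exact: cvg_cst]. }
  rewrite Ex_cst cos0 => /cvgr_gt/(_ _ ltr01)/filter_ex[n hn].
  by exists n.+1%:R^-1.
(* The solution of exp(-b^2 v0 / 2) = E cos(b Y). *)
pose v0 := - 2 / b ^+ 2 * ln (Ex Q (fun w => cos (b * Y w + 0))).
have b2 : 0 < b ^+ 2 by rewrite exprn_even_gt0.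
have vv0 : v K @[K --> \oo] --> v0.
  rewrite (_ : v = fun K => - 2 / b ^+ 2 * ln (Ex Q (fun w => cos (b * YK K w + 0)))).
    by apply: cvgMr; apply: continuous_cvg; [exact: continuous_ln|exact: cos_lim].
  apply/funext => K; rewrite cosYK cos0 mulr1 expRK; field; exact: b0.
have v0_ge0 : 0 <= v0.
  apply: cvgr_to_ge vv0 _; apply: nearW => K; exact: Gam_psd.
apply: (centered_gaussianP mY v0_ge0) => b' c.
apply: (cvg_unique _ (cos_lim b' c)) => //.
rewrite (_ : (fun K => _) = fun K => expR (- (b' ^+ 2 * v K / 2)) * cos c); last by apply/funext.
apply: cvgMl; apply: continuous_cvg; first exact: continuous_expR.
by apply: cvgN; apply: cvgMl; exact: cvgMr.
Qed.

End LimitFields.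

(** * Weak convergence *)

(* The integral of an arbitrary function is a difference of suprema over simple functions, so it is monotone without measurability. *)
Lemma le_integral_any {R : realType} d (T : measurableType d) (P : probability T R)
    (f g : T -> R) : (forall w, f w <= g w) ->
  (\int[P]_w (f w)%:E <= \int[P]_w (g w)%:E)%E.
Proof.
move=> fg; rewrite /integral !patch_setT; apply: leeB.
  apply: le_ereal_sup => _ [h hf <-]; exists h => // w.
  apply: le_trans (hf w) _; rewrite !funeposE -!EFin_max lee_fin.
  by have := fg w; case: (leP (f w) 0); case: (leP (g w) 0); lra.
apply: le_ereal_sup => _ [h hf <-]; exists h => // w.
apply: le_trans (hf w) _; rewrite !funenegE -!EFinN -!EFin_max lee_fin.
by have := fg w; case: (leP (- f w) 0); case: (leP (- g w) 0); lra.
Qed.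

Section SupConvolution.
Context (R : realType) (d : nat).
Implicit Types x y : ('I_d -> \bar R) -> R.
Variables (f : (('I_d -> \bar R) -> R) -> R) (M : R).
Hypothesis fM : forall x, `|f x| <= M.

(* f (U n) need not be measurable; its Lipschitz majorant at a path projected on a grid is a
   Lipschitz function of finitely many coordinates. *)
Definition sup_values (m : R) x := [set v | v = - M \/
  exists y c, [/\ Dspace y, 0 <= c, forall t, `|x t - y t| <= c & v = f y - m * c]].

Definition sup_conv (m : R) x := sup (sup_values m x).

Variable m : R.
Hypothesis m0 : 0 <= m.

Let fM2 x : - M <= f x <= M. Proof. by rewrite -ler_norml. Qed.

Let M0 : 0 <= M. Proof. exact: le_trans (fM (fun=> 0)). Qed.

Let ub x : ubound (sup_values m x) M.
Proof.
move=> v [->|[y [c [_ c0 _ ->]]]]; first by move: M0; lra.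
by have := fM2 y; have := mulr_ge0 m0 c0; lra.
Qed.

Let ne x : sup_values m x !=set0. Proof. by exists (- M); left. Qed.

Let le_sup x v : sup_values m x v -> v <= sup_conv m x.
Proof. by apply: ub_le_sup; exists M; exact: ub. Qed.

Lemma sup_conv_le x b : - M <= b ->
  (forall y c, Dspace y -> 0 <= c -> (forall t, `|x t - y t| <= c) -> f y - m * c <= b) ->
  sup_conv m x <= b.
Proof.
move=> Mb h; apply: ge_sup => // v [->//|[y [c [Dy c0 xy ->]]]]; exact: h.
Qed.

Lemma sup_conv_norm x : `|sup_conv m x| <= M.
Proof.
by rewrite ler_norml; apply/andP; split; [apply: le_sup; left|apply: ge_sup; [exact: ne|exact: ub]].
Qed.

Lemma sup_conv_ge x : Dspace x -> f x <= sup_conv m x.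
Proof.
move=> Dx; apply: le_sup; right; exists x, 0; split => //; last by rewrite mulr0 subr0.
by move=> t; rewrite subrr normr0.
Qed.

Let sup_conv_lip1 x x' e : (forall t, `|x t - x' t| <= e) -> sup_conv m x <= sup_conv m x' + m * e.
Proof.
move=> xx; have e0 : 0 <= e := le_trans (normr_ge0 _) (xx (fun=> +oo%E)).
have me := mulr_ge0 m0 e0.
apply: sup_conv_le => [|y c Dy c0 xy].
  by have := sup_conv_norm x'; rewrite ler_norml => /andP[? _]; lra.
suff : f y - m * (c + e) <= sup_conv m x' by rewrite mulrDr; lra.
apply: le_sup; right; exists y, (c + e); split => //; first by lra.
move=> t; rewrite (_ : x' t - y t = (x t - y t) - (x t - x' t)); last by ring.
by apply: le_trans (ler_normB _ _) _; exact: lerD.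
Qed.

Lemma sup_conv_lip x x' e : (forall t, `|x t - x' t| <= e) -> `|sup_conv m x - sup_conv m x'| <= m * e.
Proof.
move=> xx; have h1 := sup_conv_lip1 xx.
have h2 := @sup_conv_lip1 x' x e (fun t => ltac:(rewrite distrC; exact: xx)).
by rewrite ler_norml; apply/andP; split; lra.
Qed.

End SupConvolution.

(** A competitor at uniform distance c >= eta pays n c, eventually more than 2M; a closer one is
    also close for the Skorokhod distance, with the identity as time change, and continuity of f at
    x applies. *)
Lemma sup_conv_cvg {R : realType} (d : nat) (f : (('I_d -> \bar R) -> R) -> R) (M : R) x :
  bcont_skor f -> (forall x, `|f x| <= M) -> Dspace x ->
  sup_conv f M n%:R x @[n --> \oo] --> f x.
Proof.
move=> [_ fc] fM Dx; apply/cvgrPdist_le => e e0.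
have [eta eta0 fe] := fc x Dx e e0.
have fM2 y : - M <= f y <= M by rewrite -ler_norml.
have M0 : 0 <= M by exact: le_trans (fM (fun=> 0)).
near=> n; have n0 : (0 : R) <= n%:R by [].
rewrite distrC ler_norml; apply/andP; split.
  by have := sup_conv_ge fM n0 Dx; lra.
rewrite lerBlDl; apply: sup_conv_le => [|y c Dy c0 xy]; first by have := fM2 x; lra.
have nc := mulr_ge0 n0 c0.
have [ce|ec] := ltP c eta.
  have : `|f x - f y| < e.
    apply: fe => //; exists (fun k => id).
      by move=> k; split => //; exists id.
    exists c => //; split => [k a|//]; by rewrite subrr normr0.
  by rewrite ltr_norml => /andP[? ?]; lra.
have : 2 * M <= n%:R * c.
  apply: (@le_trans _ _ (n%:R * eta)); last by rewrite ler_wpM2l.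
  rewrite -ler_pdivrMr//; near: n; exact: nbhs_infty_ger.
by have := fM2 x; have := fM2 y; lra.
Unshelve. all: by end_near. Qed.

(** * Weak convergence for possibly non-measurable functionals *)

Section WeakConvergence.
Context (R : realType) (d : nat).
Context dT (T : measurableType dT) (P : probability T R).
Context dQ (T3 : measurableType dQ) (Q : probability T3 R).
Variable Fk : 'I_d -> \bar R -> R.
Hypothesis F_mono : forall k x y, (x <= y)%E -> Fk k x <= Fk k y.
Hypothesis F_Ny : forall k, Fk k -oo%E = 0.
Hypothesis F_y : forall k, Fk k +oo%E = 1.
Hypothesis F_cont : forall k (x : R) e, 0 < e ->
  exists2 h, 0 < h & Fk k (x + h)%:E - Fk k (x - h)%:E <= e.
Hypothesis F_high : forall k e, 0 < e -> exists x : R, 1 - e <= Fk k x%:E.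
Hypothesis F_low : forall k e, 0 < e -> exists x : R, Fk k x%:E <= e.
Variables (U : nat -> T -> ('I_d -> \bar R) -> R) (W : T3 -> ('I_d -> \bar R) -> R).
Hypothesis U_D : forall n w, Dspace (U n w).
Hypothesis mU : forall n t, measurable_fun setT (fun w => U n w t).
Hypothesis W_uniform : forall w, margin_uniform Fk (W w).
Hypothesis mW : forall t, measurable_fun setT (fun w => W w t).
Hypothesis fdd : forall N (j : 'I_N -> nat) (c : 'I_N -> 'I_d -> nat) (H : ('I_N -> R) -> R) (M L : R),
  (forall i k, (c i k <= 2 ^ j i)%N) ->
  (forall x, `|H x| <= M) -> 0 <= L ->
  (forall x y e, (forall k, `|x k - y k| <= e) -> `|H x - H y| <= L * e) ->
  Ex P (fun w => H (fun i => U n w (node Fk (j i) (c i)))) @[n --> \oo] -->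
  Ex Q (fun w => H (fun i => W w (node Fk (j i) (c i)))).
Hypothesis equicontinuous : forall e, 0 < e -> exists J0, forall J, (J0 <= J)%N ->
  \forall n \near \oo, exists H : T -> R, [/\ bmf H, forall w, 0 <= H w, Ex P H <= e &
    forall w, H w < 1 -> forall t, `|U n w t - U n w (grid_proj Fk J t)| <= e].

Let W_D w : Dspace (W w).
Proof. exact: margin_uniform_Dspace (W_uniform w). Qed.

Section Functional.
Variables (f : (('I_d -> \bar R) -> R) -> R) (M : R).
Hypothesis f_cont : bcont_skor f.
Hypothesis fM : forall x, `|f x| <= M.

Let fM2 x : - M <= f x <= M. Proof. by rewrite -ler_norml. Qed.
Let M0 : 0 <= M. Proof. exact: le_trans (fM (fun=> 0)). Qed.

Let h (m : R) x := sup_conv f M m x.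

Section Level.
Variable J : nat.

Let I := {ffun 'I_d -> 'I_(2 ^ J).+1}.
Let idx (t : 'I_d -> \bar R) : I := [ffun k => inord (cell Fk J t k)].
Let cnode (i : 'I_#|I|) : 'I_d -> nat := fun k => (enum_val i : I) k.
(** A projected path depends only on its values at the finitely many nodes, so its sup-convolution
    is a Lipschitz function on a finite-dimensional space. *)
Let Hm m (v : 'I_#|I| -> R) : R := h m (fun t => v (enum_rank (idx t))).

Let Hm_proj m x : Hm m (fun i => x (node Fk J (cnode i))) = h m (fun t => x (grid_proj Fk J t)).
Proof.
rewrite /Hm; congr (h m _); apply/funext => t; congr (x (node Fk J _)); apply/funext => k.
by rewrite /cnode enum_rankK ffunE inordK// ltnS (cell_le F_mono F_Ny F_y).
Qed.

Let cnode_le i k : (cnode i k <= 2 ^ J)%N. Proof. by rewrite -ltnS ltn_ord. Qed.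

Let Hm_lip m x y e : 0 <= m -> (forall k, `|x k - y k| <= e) -> `|Hm m x - Hm m y| <= m * e.
Proof. by move=> m0 xy; apply: sup_conv_lip. Qed.

Lemma bmf_sup_conv_proj d0 (T0 : measurableType d0) (X : T0 -> ('I_d -> \bar R) -> R) m : 0 <= m ->
  (forall t, measurable_fun setT (fun w => X w t)) ->
  bmf (fun w => h m (fun t => X w (grid_proj Fk J t))).
Proof.
move=> m0 mX; rewrite (_ : (fun w => _) = fun w => Hm m (fun i => X w (node Fk J (cnode i)))).
  split; last by exists M => w; exact: sup_conv_norm.
  apply: (@measurable_lipschitz _ _ _ _ (Hm m) m (fun w i => X w (node Fk J (cnode i)))) => //.
  by move=> x y e; exact: Hm_lip.
by apply/funext => w; rewrite Hm_proj.
Qed.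

Lemma sup_conv_proj_fdd m : 0 <= m ->
  Ex P (fun w => h m (fun t => U n w (grid_proj Fk J t))) @[n --> \oo] -->
  Ex Q (fun w => h m (fun t => W w (grid_proj Fk J t))).
Proof.
move=> m0.
have EP : (fun n => Ex P (fun w => h m (fun t => U n w (grid_proj Fk J t)))) =
    fun n => Ex P (fun w => Hm m (fun i => U n w (node Fk J (cnode i)))).
  by apply/funext => n; apply: eq_Ex => w; rewrite Hm_proj.
have EQ : Ex Q (fun w => h m (fun t => W w (grid_proj Fk J t))) =
    Ex Q (fun w => Hm m (fun i => W w (node Fk J (cnode i)))).
  by apply: eq_Ex => w; rewrite Hm_proj.
rewrite EP EQ; apply: (@fdd #|I| (fun=> J) cnode (Hm m) M m cnode_le _ m0) => [x|x y e].
  exact: sup_conv_norm.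
exact: Hm_lip.
Qed.

End Level.

Let h_W_cvg m : 0 <= m -> forall w, h m (fun t => W w (grid_proj Fk J t)) @[J --> \oo] --> h m (W w).
Proof.
move=> m0 w; apply/cvgrPdist_le => e e0.
have m1 : 0 < m + 1 by rewrite ltr_wpDl.
have em : 0 < e / (m + 1) by exact: divr_gt0.
apply: filterS (margin_uniform_proj F_mono F_Ny F_y F_cont F_high F_low (W_uniform w) em) => J hJ.
apply: le_trans (sup_conv_lip fM m0 hJ) _.
by rewrite mulrA ler_pdivrMr// mulrDr mulr1 mulrC lerDl ltW.
Qed.

Let bh m : 0 <= m -> bmf (fun w => h m (W w)).
Proof.
move=> m0; split; last by exists M => w; exact: sup_conv_norm.
apply: (@measurable_fun_cvg _ _ _ _ (fun J w => h m (fun t => W w (grid_proj Fk J t)))) => [J|w _].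
  exact: bmf_meas (bmf_sup_conv_proj J m0 mW).
exact: h_W_cvg.
Qed.

(** Along the limit paths f is a double limit of finite-dimensional Lipschitz functions, which is
    where its measurability comes from. *)
Lemma bmf_functional : bmf (fun w => f (W w)).
Proof.
split; last by exists M.
apply: (@measurable_fun_cvg _ _ _ _ (fun n w => h n%:R (W w))) => [n|w _].
  exact: bmf_meas (bh (ler0n R n)).
exact: sup_conv_cvg.
Qed.

(** The sharpness m of the sup-convolution is chosen under the limit law, then the grid level J,
    then n. Where the equicontinuity control [H] fails to be below 1, the added 2 M H exceeds the
    oscillation of f. *)
Lemma majorant eps : 0 < eps -> \forall n \near \oo,
  exists G : T -> R, [/\ bmf G, forall w, f (U n w) <= G w & Ex P G <= Ex Q (fun w => f (W w)) + eps].
Proof.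
move=> eps0; have e4 : 0 < eps / 4 by rewrite divr_gt0.
have [m hm] : exists m : nat, Ex Q (fun w => h m%:R (W w)) <= Ex Q (fun w => f (W w)) + eps / 4.
  have c : Ex Q (fun w => h n%:R (W w)) @[n --> \oo] --> Ex Q (fun w => f (W w)).
    { apply: (@cvg_Ex _ _ _ _ _ _ M).
    - by move=> n; exact: bmf_meas (bh (ler0n R n)).
    - exact: bmf_meas bmf_functional.
    - by move=> n w; exact: sup_conv_norm.
    - by apply: aeW => w; exact: sup_conv_cvg. }
  have lt4 : Ex Q (fun w => f (W w)) < Ex Q (fun w => f (W w)) + eps / 4 by rewrite ltrDl.
  have : \forall n \near \oo, Ex Q (fun w => h n%:R (W w)) < Ex Q (fun w => f (W w)) + eps / 4.
    exact: cvgr_lt c _ lt4.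
  by move=> /filter_ex[m /ltW hm]; exists m.
have m0 : (0 : R) <= m%:R by [].
have hJ : \forall J \near \oo, Ex Q (fun w => h m%:R (fun t => W w (grid_proj Fk J t))) <= Ex Q (fun w => h m%:R (W w)) + eps / 4.
  have c : Ex Q (fun w => h m%:R (fun t => W w (grid_proj Fk J t))) @[J --> \oo] --> Ex Q (fun w => h m%:R (W w)).
    { apply: (@cvg_Ex _ _ _ _ _ _ M).
    - by move=> J; exact: bmf_meas (bmf_sup_conv_proj J m0 mW).
    - exact: bmf_meas (bh m0).
    - by move=> J w; exact: sup_conv_norm.
    - by apply: aeW => w; exact: h_W_cvg. }
  have lt4 : Ex Q (fun w => h m%:R (W w)) < Ex Q (fun w => h m%:R (W w)) + eps / 4 by rewrite ltrDl.
  by apply: filterS (cvgr_lt _ c _ lt4) => J; exact: ltW.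
(* The equicontinuity error e is multiplied by m (Lipschitz constant) and by 2M (failure event);
   dividing by b keeps both together below eps/4. *)
pose b := m%:R + 2 * M + 1; have b0 : 0 < b by rewrite /b; move: M0; lra.
have e0 : 0 < eps / 4 / b by exact: divr_gt0.
have [J0 eqJ] := equicontinuous e0.
have [J [J0J hJJ]] : exists J, (J0 <= J)%N /\ Ex Q (fun w => h m%:R (fun t => W w (grid_proj Fk J t))) <= Ex Q (fun w => h m%:R (W w)) + eps / 4.
  have : \forall J \near \oo, (J0 <= J)%N /\ Ex Q (fun w => h m%:R (fun t => W w (grid_proj Fk J t))) <= Ex Q (fun w => h m%:R (W w)) + eps / 4.
    by apply: filterI hJ; exists J0.
  by move=> /filter_ex[J [? ?]]; exists J.
have lt4 : Ex Q (fun w => h m%:R (fun t => W w (grid_proj Fk J t))) < Ex Q (fun w => h m%:R (fun t => W w (grid_proj Fk J t))) + eps / 4 by rewrite ltrDl.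
have c := @sup_conv_proj_fdd J m%:R m0.
apply: filterS2 (eqJ J J0J) (cvgr_lt _ c _ lt4) => n [H [bH H0 EH HU]] /ltW hn.
set e := eps / 4 / b in e0 EH HU.
have be : (m%:R + 2 * M) * e <= eps / 4.
  apply: (@le_trans _ _ (b * e)); first by rewrite ler_wpM2r ?(ltW e0)// /b lerDl.
  by rewrite /e mulrC divfK// gt_eqF.
have bg := bmf_sup_conv_proj J m0 (mU n).
exists (fun w => h m%:R (fun t => U n w (grid_proj Fk J t)) + (m%:R * e + 2 * M * H w)); split.
- apply: bmfD => //; apply: bmfD; first exact: bmf_cst.
  by apply: bmfM => //; exact: bmf_cst.
- move=> w; rewrite /h; have MH := mulr_ge0 M0 (H0 w); have me := mulr_ge0 m0 (ltW e0).
  have := sup_conv_norm fM m0 (fun t => U n w (grid_proj Fk J t)); rewrite ler_norml => /andP[h1 h2].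
  have [H1|H1] := ltP (H w) 1.
    have := sup_conv_lip fM m0 (HU w H1); rewrite ler_norml => /andP[_ h3].
    by have := sup_conv_ge fM m0 (@U_D n w); lra.
  have : M <= M * H w by rewrite ler_peMr.
  by have := fM2 (U n w); lra.
- rewrite ExD//; last by apply: bmfD; [exact: bmf_cst|apply: bmfM => //; exact: bmf_cst].
  rewrite ExD//; [|exact: bmf_cst|by apply: bmfM => //; exact: bmf_cst].
  rewrite Ex_cst ExZ//.
  have : 2 * M * Ex P H <= 2 * M * e by rewrite ler_wpM2l// mulr_ge0.
  by move: be; rewrite mulrDl; lra.
Qed.

End Functional.

Theorem weak_convergence (f : (('I_d -> \bar R) -> R) -> R) : bcont_skor f ->
  (fun n => \int[P]_w (f (U n w))%:E)%E @ \oo --> (\int[Q]_w (f (W w))%:E)%E.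
Proof.
move=> fc; have [M fM] := fc.1.
have nfM x : `|- f x| <= M by rewrite normrN.
(* The lower bound is the majorant of -f, negated. *)
have nfc : bcont_skor (fun x => - f x).
  split; first by exists M.
  move=> x Dx e e0; have [eta eta0 h] := fc.2 x Dx e e0; exists eta => // y Dy xy.
  by rewrite -opprD normrN; exact: h.
have bfW := bmf_functional fc fM.
rewrite Ex_EFin//; apply/fine_cvgP.
have bounds eps : 0 < eps -> \forall n \near \oo,
    ((Ex Q (fun w => f (W w)) - eps)%:E <= \int[P]_w (f (U n w))%:E <= (Ex Q (fun w => f (W w)) + eps)%:E)%E.
  move=> e0; apply: filterS2 (majorant fc fM e0) (majorant nfc nfM e0) => n [G [bG fG EG]] [G' [bG' fG' EG']].
  apply/andP; split.
    apply: (@le_trans _ _ (\int[P]_w (- G' w)%:E)%E); last by apply: le_integral_any => w; have := fG' w; lra.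
    rewrite Ex_EFin; last exact: bmfN.
    by move: EG'; rewrite lee_fin !ExN//; lra.
  apply: (le_trans (le_integral_any P fG)); rewrite Ex_EFin// lee_fin//.
split.
  apply: filterS (bounds 1 ltr01) => n /andP[h1 h2].
  by rewrite fin_numE; apply/andP; split; apply/eqP => E; rewrite E in h1 h2.
apply/cvgrPdist_le => e e0; apply: filterS (bounds e e0) => n /= /andP[].
case: integral => [r| |]//=; rewrite !lee_fin => h1 h2.
by rewrite ler_norml; apply/andP; split; lra.
Qed.

End WeakConvergence.

(** * Empirical paths belong to the multiparameter Skorokhod space *)

Section DspaceTheory.
Context {R : realType} {d : nat}.
Implicit Types x y : ('I_d -> \bar R) -> R.

Lemma Dspace_cst c : Dspace (fun _ : 'I_d -> \bar R => c).
Proof. by move=> t b; exists c => e e0; exists 1; split => // s _ _; rewrite subrr normr0. Qed.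

Lemma DspaceD x y : Dspace x -> Dspace y -> Dspace (fun t => x t + y t).
Proof.
move=> Dx Dy t b; have [l hl] := Dx t b; have [l' hl'] := Dy t b.
exists (l + l') => e e0; have e2 : 0 < e / 2 by rewrite divr_gt0.
have [h [h0 xh]] := hl _ e2; have [h' [h'0 yh]] := hl' _ e2.
exists (Num.min h h'); split; first by rewrite lt_min h0.
move=> s sb st; have := xh s sb (fun k => ltac:(by move: (st k); rewrite lt_min => /andP[])).
have := yh s sb (fun k => ltac:(by move: (st k); rewrite lt_min => /andP[])).
by rewrite !ltr_norml => /andP[? ?] /andP[? ?]; apply/andP; split; lra.
Qed.

Lemma DspaceM c x : Dspace x -> Dspace (fun t => c * x t).
Proof.
move=> Dx t b; have [l hl] := Dx t b; exists (c * l) => e e0.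
have c1 : 0 < `|c| + 1 by rewrite ltr_wpDl.
have [h [h0 xh]] := hl _ (divr_gt0 e0 c1); exists h; split => // s sb st.
rewrite -mulrBr normrM; apply: (@le_lt_trans _ _ ((`|c| + 1) * `|x s - l|)).
  by rewrite ler_wpM2r// lerDl.
by rewrite mulrC -ltr_pdivlMr//; exact: xh.
Qed.

Lemma Dspace_sum (I : Type) (r : seq I) (f : I -> ('I_d -> \bar R) -> R) :
  (forall i, Dspace (f i)) -> Dspace (fun t => \sum_(i <- r) f i t).
Proof.
move=> Df; elim: r => [|i r IH].
  rewrite (_ : (fun t => _) = fun=> 0); first exact: Dspace_cst.
  by apply/funext => t; rewrite big_nil.
rewrite (_ : (fun t => _) = fun t => f i t + \sum_(j <- r) f j t); first exact: DspaceD.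
by apply/funext => t; rewrite big_cons.
Qed.

Lemma Dspace_orthant (z : 'I_d -> R) :
  Dspace (fun t : 'I_d -> \bar R => [forall k, ((z k)%:E <= t k)%E]%:R : R).
Proof.
move=> t b.
pose v k := if b k then ((z k)%:E <= t k)%E else ((z k)%:E < t k)%E.
have vk k : \forall eta \near (0 : R)^'+, forall s : \bar R, (if b k then (t k <= s)%E else (s < t k)%E) ->
    `|hcomp s - hcomp (t k)| < eta -> ((z k)%:E <= s)%E = v k.
  rewrite /v; case: (b k).
    have [zt|tz] := leP (z k)%:E (t k).
      by apply: nearW => eta s ts _; rewrite (le_trans zt ts).
    near=> eta => s _ st; apply/negbTE; rewrite -ltNge; apply: lt_hcomp.
    have : eta < hcomp (z k)%:E - hcomp (t k).
      by near: eta; apply: nbhs_right_lt; rewrite subr_gt0; exact: hcomp_lt.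
    by move: st; rewrite ltr_norml => /andP[? ?]; lra.
  have [zt|tz] := ltP (z k)%:E (t k).
    near=> eta => s _ st; apply: ltW; apply: lt_hcomp.
    have : eta < hcomp (t k) - hcomp (z k)%:E.
      by near: eta; apply: nbhs_right_lt; rewrite subr_gt0; exact: hcomp_lt.
    by move: st; rewrite ltr_norml => /andP[? ?]; lra.
  by apply: nearW => eta s st _; apply/negbTE; rewrite -ltNge; exact: lt_le_trans tz.
exists ([forall k, v k]%:R) => e e0.
have : \forall eta \near (0 : R)^'+, 0 < eta /\ forall k (s : \bar R),
    (if b k then (t k <= s)%E else (s < t k)%E) -> `|hcomp s - hcomp (t k)| < eta -> ((z k)%:E <= s)%E = v k.
  by apply: filterI; [exact: nbhs_right_gt|exact: filter_forall vk].
move=> /filter_ex[eta [eta0 h]].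
exists eta; split => // s sb st.
have -> : [forall k, ((z k)%:E <= s k)%E] = [forall k, v k].
  by apply: eq_forallb => k; exact: h (sb k) (st k).
by rewrite subrr normr0.
Unshelve. all: by end_near. Qed.

End DspaceTheory.

Lemma Dspace_emp {R : realType} {V : completeNormedModType R} d dT (T : measurableType dT)
    (P : probability T R) (xi : int -> T -> V) (iid_xi : iid P xi) (G : (nat -> V) -> 'I_d -> R)
    (mG : measurable_G G) (c theta : R) n w : 0 <= c -> 0 < theta ->
  (forall u v : 'I_d -> R, `|dist_fun P xi G (fun k => (u k)%:E) - dist_fun P xi G (fun k => (v k)%:E)|
    <= c * enorm (fun k => u k - v k) `^ theta) ->
  Dspace (emp P xi G n w).
Proof.
move=> c0 theta0 holder; apply: DspaceM; apply: Dspace_sum => i; apply: DspaceD; first exact: Dspace_orthant.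
pose Fk := margin_fun P xi G.
rewrite (_ : (fun t => _) = fun t => -1 * dist_fun P xi G t); last by apply/funext => t; rewrite mulN1r.
apply: DspaceM; apply: (margin_uniform_Dspace (Fk := Fk)).
  by move=> k x y; exact: margin_fun_mono.
  by move=> k; exact: margin_fun_Ny.
  by move=> k; exact: margin_fun_y.
  by move=> k x e; exact: margin_fun_cont holder k x e.
  by move=> k e; exact: margin_fun_high.
  by move=> k e; exact: margin_fun_low.
(* F is Lipschitz for the sum of the marginal distances: both points are compared with their
   componentwise minimum. *)
have F_le s t : dist_fun P xi G s - dist_fun P xi G t <= \sum_k `|Fk k (s k) - Fk k (t k)|.
  pose u k := Order.min (s k) (t k).
  have us : pt_le u s by move=> k; rewrite ge_min lexx.
  have ut : pt_le u t by move=> k; rewrite ge_min lexx orbT.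
  have /andP[_ h1] := dist_fun_pt iid_xi mG us; have /andP[h2 _] := dist_fun_pt iid_xi mG ut.
  apply: (@le_trans _ _ (\sum_k (Fk k (s k) - Fk k (u k)))); first by move: h1 h2; rewrite -/Fk; lra.
  apply: ler_sum => k _; rewrite /u minEle; case: ifPn => _; last exact: ler_norm.
  by rewrite subrr.
move=> e e0; have d1 : 0 < d%:R + 1 :> R by rewrite ltr_wpDl.
exists (e / (d%:R + 1)) => [|s t st]; first exact: divr_gt0.
have B s' t' : (forall k, `|Fk k (s' k) - Fk k (t' k)| <= e / (d%:R + 1)) ->
    dist_fun P xi G s' - dist_fun P xi G t' <= e.
  move=> h; apply: le_trans (F_le s' t') _.
  apply: (@le_trans _ _ (\sum_(k < d) e / (d%:R + 1))); first by apply: ler_sum => k _.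
  by rewrite sumr_const card_ord -[leLHS]mulr_natl mulrA ler_pdivrMr// mulrDr mulr1 mulrC lerDl ltW.
rewrite ler_norml lerNl opprB; apply/andP; split; apply: B => // k; by rewrite distrC.
Qed.

(* rate is the exponent of the coupling bound  P(1{X<=t} != 1{X'<=t}) <= C delta^rate. *)
Lemma coupling_rate {R : realType} (d p : nat) (theta r alpha : R) (s : \bar R) :
  0 < theta -> 1 <= r -> (1 < s)%E ->
  (s = +oo%E /\ r = 1) \/ (exists s', s = s'%:E /\ r^-1 + s'^-1 = 1) ->
  r * d%:R < p%:R -> 0 < alpha <= 1 -> r * p%:R / (p%:R - r * d%:R) < theta / alpha ->
  exists rate : R, [/\ (s = +oo%E /\ rate = theta) \/
    (exists s', [/\ s = s'%:E, 0 < s' & rate = theta * s' / (s' + theta)]),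
    0 < rate & d%:R / p%:R < 1 - alpha / rate].
Proof.
move=> th0 r1 s1 rs rdp /andP[a0 a1] hyp.
have r0 : 0 < r by exact: lt_le_trans r1.
have p0 : 0 < p%:R :> R by apply: le_lt_trans rdp; rewrite mulr_ge0// ltW.
have D0 : 0 < p%:R - r * d%:R by rewrite subr_gt0.
(* The exponent hypothesis in additive form. For finite s, alpha/rate = alpha/theta + alpha/s', and
   alpha <= 1 with 1/r + 1/s' = 1 concludes. *)
have key : alpha / theta < r^-1 - d%:R / p%:R.
  have h : r^-1 - d%:R / p%:R = (p%:R - r * d%:R) / (r * p%:R) by field; rewrite !gt_eqF.
  rewrite h -[alpha / theta]invf_div -[_ / (r * _)]invf_div.
  by rewrite ltf_pV2 ?posrE ?divr_gt0// mulr_gt0.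
case: rs => [[-> r_1]|[s' [se rs]]].
  exists theta; split => //; first by left.
  by rewrite r_1 invr1 in key; lra.
rewrite se lte_fin in s1; have s0 : 0 < s' by exact: lt_trans s1.
exists (theta * s' / (s' + theta)); split.
- by right; exists s'.
- by rewrite divr_gt0 ?mulr_gt0// addr_gt0.
- have -> : alpha / (theta * s' / (s' + theta)) = alpha / theta + alpha * s'^-1.
    by field; rewrite !gt_eqF// addr_gt0.
  have : alpha * s'^-1 <= s'^-1 by rewrite ler_piMl// invr_ge0 ltW.
  by lra.
Qed.

Theorem theorem4 (R : realType) (V : completeNormedModType R) (d : nat)
  (dT : measure_display) (T : measurableType dT) (P : probability T R)
  (xi : int -> T -> V) (G : (nat -> V) -> ('I_d -> R))
  (theta r alpha : R) (s : \bar R) (p : nat) :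
  (0 < d)%N ->
  iid P xi -> measurable_G G ->
  (* (i) F is theta-Hoelder *)
  0 < theta <= 1 ->
  (exists c : R, forall u v : 'I_d -> R,
     `|Fdist P (causal G xi) (fun k => (u k)%:E)
       - Fdist P (causal G xi) (fun k => (v k)%:E)|
     <= c * enorm (fun k => u k - v k) `^ theta) ->
  (* (ii) *)
  1 <= r -> (1 < s)%E ->
  ((s = +oo%E /\ r = 1) \/ (exists s' : R, s = s'%:E /\ r^-1 + s'^-1 = 1)) ->
  r * d%:R < p%:R ->
  0 < alpha <= 1 ->
  r * p%:R / (p%:R - r * d%:R) < theta / alpha ->
  (exists (d2 : measure_display) (T2 : measurableType d2)
          (P2 : probability T2 R) (zeta zeta' : int -> T2 -> V),
     iid P2 (fun j : int + int => match j with inl j => zeta j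
                                              | inr j => zeta' j end) /\
     (forall B, borelV B -> P2 (zeta 0 @^-1` B) = P (xi 0 @^-1` B)) /\
     let delta (i : nat) : \bar R :=
       Lnorm P2 s (fun w => (enorm (fun k => causal G zeta i%:Z w k
                                   - causal_coupled G zeta zeta' i%:Z w k))%:E) in
     (forall i : nat, (0 < i)%N -> (delta i < +oo)%E) /\
     (\sum_(1 <= i <oo) ((i%:R ^+ (2 * p - 2)) * fine (delta i) `^ alpha)%:E
        < +oo)%E) ->
  exists (d3 : measure_display) (T3 : measurableType d3)
         (Q : probability T3 R) (W : T3 -> ('I_d -> \bar R) -> R),
    centered_gaussian_process Q W /\
    {ae Q, forall w, continuous_ext (W w)} /\
    forall f : (('I_d -> \bar R) -> R) -> R, bcont_skor f ->
      (fun n => \int[P]_w (f (Un P (causal G xi) n w))%:E)%E @ \oo -->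
      (\int[Q]_w (f (W w))%:E)%E.
Proof.
move=> d0 iid_xi mG /andP[th0 th1] [c0 holder0] r1 s1 rs rdp alpha01 hyp.
move=> [d2 [T2 [P2 [zeta [zeta' [iid_zeta [law_zeta [gap_fin0 sum_fin]]]]]]]].
have [rate [rateP rate0 dg]] := coupling_rate th0 r1 s1 rs rdp alpha01 hyp.
have /andP[a0 a1] := alpha01.
have dp : (d < p)%N.
  rewrite -(ltr_nat R); apply: le_lt_trans rdp; by rewrite ler_peMl.
(* p > r d >= d >= 1 forces p >= 2, and the moment machinery is written for p = q + 2. *)
have p2 : p = p.-2.+2 by case: (p) dp d0 => [|[|?]] //; case: (d) => [|[]].
set q := p.-2 in p2; rewrite {}p2 in dp dg sum_fin.
(* The Hoelder constant comes without a sign; its absolute value works as well. *)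
pose c := `|c0|; have c_ge0 : 0 <= c by exact: normr_ge0.
have holder u v : `|dist_fun P xi G (fun k => (u k)%:E) - dist_fun P xi G (fun k => (v k)%:E)|
    <= c * enorm (fun k => u k - v k) `^ theta.
  rewrite -!dist_funE//; apply: le_trans (holder0 u v) _.
  by rewrite ler_wpM2r ?powR_ge0// ler_norm.
have gap_fin i : (Lnorm P2 s (fun w => (coupling_gap zeta zeta' G i w)%:E) < +oo)%E.
  exact: (gap_fin0 i.+1).
pose g := 1 - alpha / rate.
have dg' : d%:R / q.+2%:R < g := dg.
have g0 : 0 < g by apply: le_lt_trans dg'; rewrite divr_ge0.
have g1 : g <= 1 by rewrite gerBl divr_ge0// ltW.
have alpha_rate : alpha < rate by move: g0; rewrite subr_gt0 ltr_pdivrMr// mul1r.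
have [C0 C01 dep] := dependence_bound iid_xi iid_zeta law_zeta mG c_ge0 th0 holder rateP gap_fin a0 alpha_rate.
pose beta i := gap_norm P2 zeta zeta' G s i `^ alpha.
have beta0 i : 0 <= beta i by exact: powR_ge0.
have [K sum_beta] : exists K : R, forall n, \sum_(i < n) i.+1%:R ^+ (2 * q).+2 * beta i <= K.
  move: sum_fin; set S := (\big[_/_]_(_ <= _ <oo) _)%E => Sfin.
  have t0 i : (0 <= (i%:R ^+ (2 * q.+2 - 2) * fine (Lnorm P2 s (fun w => (enorm (fun k =>
      causal G zeta i%:Z w k - causal_coupled G zeta zeta' i%:Z w k))%:E)) `^ alpha)%:E)%E.
    by rewrite lee_fin mulr_ge0 ?powR_ge0// exprn_ge0.
  have S0 : (0 <= S)%E by apply: nneseries_ge0 => i _ _; exact: t0.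
  exists (fine S) => n; rewrite -lee_fin fineK ?ge0_fin_numE//.
  have := @nneseries_lim_ge R _ xpredT 1 n.+1 (fun i _ _ => t0 i).
  move/(le_trans _); apply; rewrite big_add1 /= big_mkord sumEFin lee_fin.
  have -> : (2 * q.+2 - 2 = (2 * q).+2)%N by rewrite mulnS addKn mulnS.
  exact: lexx.
have g01 : 0 < g <= 1 by rewrite g0.
have [C C_ge0 moment] := emp_incr_moment iid_xi iid_zeta law_zeta mG g01 C01 beta0 sum_beta dep.
have [Gam [Gsym Gpsd fdd]] := emp_fdd iid_xi iid_zeta law_zeta mG g01 C01 beta0 sum_beta dep d0.
have [rho [A [B [rho01 A01 B1 B9 [rateA rateB]]]]] := chaining_rates d0 dp g0 dg'.
pose Fk := margin_fun P xi G.
have F_mono k x y : (x <= y)%E -> Fk k x <= Fk k y by exact: margin_fun_mono.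
have F_Ny k : Fk k -oo%E = 0 by exact: margin_fun_Ny.
have F_y k : Fk k +oo%E = 1 by exact: margin_fun_y.
have F_cont k x e := @margin_fun_cont _ _ _ _ _ _ _ iid_xi _ mG _ _ c_ge0 th0 holder k x e.
have F_high k e := @margin_fun_high _ _ _ _ _ _ _ iid_xi _ mG k e.
have F_low k e := @margin_fun_low _ _ _ _ _ _ _ iid_xi _ mG k e.
have F_pt u v := @dist_fun_pt _ _ _ _ _ _ _ iid_xi _ mG u v.
have F01 t := dist_fun01 iid_xi mG t.
have bU n t : bmf (fun w => emp P xi G n w t) by exact: bmf_emp.
have U_bottom n w : emp P xi G n w (fun=> -oo%E) = 0.
  have z x : orthant G (fun=> -oo%E) x = 0.
    by rewrite /orthant; case: forallP => // /(_ (Ordinal d0)).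
  rewrite /emp /psum big1 ?mulr0// => i _; rewrite /centered_orthant z /dist_fun.
  have -> : Ex P (fun w => orthant G (fun=> -oo%E) (past xi 0 w)) = 0.
    by rewrite -[RHS](Ex_cst P); apply: eq_Ex => w'; exact: z.
  exact: subrr.
exists _, (measurableTypeR R), (uniform_prob (@ltr01 R)), (field Fk rho Gsym Gpsd).
split; first exact: (field_gaussian F_mono F_Ny F_y F_cont F_high F_low F_pt F01 g0 C_ge0 rho01
  A01 B1 rateA rateB bU moment U_bottom Gsym Gpsd fdd).
have unif w := field_uniform F_mono F_Ny F_y F_cont F_high F_low rho01 Gsym Gpsd w.
split.
  apply: aeW => w; exact: (margin_uniform_continuous F_mono F_Ny F_y F_cont F_high F_low (unif w)).
move=> f fc.
rewrite (_ : (fun n => _) = fun n => (\int[P]_w (f (emp P xi G n w))%:E)%E); last first.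
  apply/funext => n; apply: eq_integral => w _; congr (f _)%:E.
  by apply/funext => t; rewrite empE.
apply: (weak_convergence F_mono F_Ny F_y F_cont F_high F_low) fc => //.
- by move=> n w; exact: (Dspace_emp iid_xi mG n w c_ge0 th0 holder).
- by move=> n t; exact: bmf_meas (bU n t).
- exact: (measurable_field F_mono F_Ny F_y F_cont F_high F_low rho01).
- move=> N j c' H M L cj HM L0 HL.
  (* The convergence to the field is known along sample sizes n + 1, hence the shift. *)
  pose u n := Ex P (fun w => H (fun i => emp P xi G n w (node Fk (j i) (c' i)))).
  suff : [sequence u n.+1]_n @ \oo -->
      Ex (uniform_prob (@ltr01 R)) (fun w => H (fun i => field Fk rho Gsym Gpsd w (node Fk (j i) (c' i)))).
    by rewrite cvg_shiftS.
  exact: (field_fdd F_mono F_Ny F_y F_cont F_high F_low F_pt F01 g0 C_ge0 rho01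
    A01 B1 rateA rateB bU moment U_bottom fdd cj HM L0 HL).
- move=> e e0; exact: (asymptotic_equicontinuity F_mono F_Ny F_y F_cont F_high F_low F_pt g0 C_ge0
    rho01 A01 B1 B9 rateA rateB bU moment (emp_sandwich iid_xi mG) e0).
Qed.
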